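(* Let $H=\frac14x^4+\frac12y^2$ and consider the foliation $$\omega_\epsilon=dH+\epsilon\omega_1=0,\qquad 0<\epsilon\ll1,$$ $$\omega_1=(c_0+c_1x+c_2x^2+c_3y+c_4x^3+c_5xy)\,dx+(b_0+b_1x+b_2x^2+b_3y)\,dy,$$ with real coefficients $c_0,\dots,c_5,b_0,\dots,b_3$. The number of limit cycles bifurcating from the open period annulus $\mathbb R^2\setminus\{(0,0)\}$ of the Hamiltonian foliation $dH=0$ with respect to this one-parameter linear deformation is equal to one. More precisely, the following statements hold: 1. $M_1(h)$ has no positive zero if $M_1(h)\not\equiv0$. 2. $M_2(h)$ has a unique positive zero if $M_1(h)\equiv0$ and $M_2(h)\not\equiv0$. 3. $M_3(h)$ has a unique positive zero if $M_1(h)=M_2(h)\equiv0$ and $M_3(h)\not\equiv0$. 4. $M_k(h)\equiv0$ for all $k\ge4$ if $M_1(h)=M_2(h)=M_3(h)\equiv0$. Furthermore, if $M_1(h)=M_2(h)=M_3(h)\equiv0$, the foliation $\omega_\epsilon=0$ always possesses an open period annulus $\mathbb R^2\setminus U_{(0,0)}$, where $U_{(0,0)}$ is a small neighborhood of the origin. The algebraic set (in the space of coefficients) given by $M_1(h)=M_2(h)=M_3(h)\equiv0$ has three irreducible components: $(C_1)$ $c_3-b_1=c_5-2b_2=0$; $(C_2)$ $c_0=c_2=c_3=b_1=0$; $(C_3)$ $b_1-c_3=c_0=c_2=b_0=c_5+b_2=0$. The foliation $\omega_\epsilon=0$ is Hamiltonian on the component $(C_1)$, and it can be pulled back to a symmetric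 foliation on the components $(C_2)$ and $(C_3)$.
   Context: The closed orbits of $dH=0$ are parametrized by $h>0$: $\gamma_h=\{x^4+2y^2=h^4\}$, and $h=x$ on the positive $x$-half-axis. Melnikov functions are the coefficients in the expansion in $\epsilon$ of the first return map of $\omega_\epsilon=0$ on the positive $x$-half-axis, $\mathcal P(h,\epsilon)=h+\epsilon M_1(h)+\epsilon^2M_2(h)+\cdots$ ($h$ in compact subsets of $(0,\infty)$, $|\epsilon|$ small). $M_2$ is considered when $M_1\equiv0$, $M_3$ when $M_1\equiv M_2\equiv0$, and so on. The number of limit cycles bifurcating from the open period annulus is the supremum, over all compact subsets $K\subset\mathbb R^2\setminus\{(0,0)\}$ and all choices of the coefficients, of the maximal number of limit cycles of $\omega_\epsilon=0$ which tend to $K$ as $\epsilon\to0$. ''Hamiltonian'' means that the one-form $\omega_\epsilon$ is exact. ''Can be pulled back to a symmetric foliation'' means that, for small $\epsilon$, after a change of coordinates of the form $(x,y)\mapsto(x,z)$ (with $z=z(x,y)$ polynomial; possibly the identity) the foliation is invariant under the involution $(x,z)\mapsto(-x,z)$. A period annulus is an open annulus filled by closed leaves.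
   Formalization: In items 2 and 3, ''has a unique positive zero'' is proved as ''has at most one positive zero, and for some coefficients has one''; as worded it fails, e.g. c_0=c_5=1 and all other coefficients 0 give M_1≡0 and M_2>0 without zeros. *)

(* Defs.v *)
From Stdlib Require Import Reals List Lra.
From Coquelicot Require Import Coquelicot.

Open Scope R_scope.

(* Subsets of [E] are predicates; [set_eq] is extensional equality. *)
Definition set_eq {E : Type} (A B : E -> Prop) : Prop := forall p, A p <-> B p.
Definition subset {E : Type} (A B : E -> Prop) : Prop := forall p, A p -> B p.

(** * One-forms on the plane and their foliations *)

(* [w p] is the pair of the coefficients of dx and dy at [p]. *)
Definition one_form : Type := R * R -> R * R.

Definition is_differential (F : R -> R -> R) (w : one_form) : Prop :=
  forall p : R * R,
    differentiable_pt_lim F (fst p) (snd p) (fst (w p)) (snd (w p)).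

Definition exact (w : one_form) : Prop := exists F, is_differential F w.

(* The leaves of [a dx + b dy = 0] are the orbits of the vector field
   (b, -a), which vanishes exactly at the singular points of the form. *)
Definition integral_curve_at (w : one_form) (g : R -> R * R) (t : R) : Prop :=
  is_derive (fun s => fst (g s)) t (snd (w (g t))) /\
  is_derive (fun s => snd (g s)) t (- fst (w (g t))).

(* The condition at [g 0] excludes singular points. *)
Definition closed_leaf (w : one_form) (L : R * R -> Prop) : Prop :=
  exists (g : R -> R * R) (T : R),
    0 < T /\
    (forall t, integral_curve_at w g t) /\
    (forall t, g (t + T) = g t) /\
    w (g 0) <> (0, 0) /\
    (forall p, L p <-> exists t, g t = p).

Definition limit_cycle (w : one_form) (L : R * R -> Prop) : Prop :=
  closed_leaf w L /\
  exists V : R * R -> Prop,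
    open V /\ subset L V /\
    forall L', closed_leaf w L' -> subset L' V -> set_eq L' L.

Definition at_most_limit_cycles (w : one_form) (V : R * R -> Prop) (n : nat)
  : Prop :=
  forall L : nat -> R * R -> Prop,
    (forall i, (i <= n)%nat -> limit_cycle w (L i) /\ subset (L i) V) ->
    exists i j, (i < j <= n)%nat /\ set_eq (L i) (L j).

Definition open_annulus (A : R * R -> Prop) : Prop :=
  open A /\
  exists f g : R * R -> R * R,
    (forall p, p <> (0, 0) -> A (f p) /\ g (f p) = p /\ continuous f p) /\
    (forall p, A p -> g p <> (0, 0) /\ f (g p) = p /\ continuous g p).

Definition period_annulus (w : one_form) (A : R * R -> Prop) : Prop :=
  open_annulus A /\
  forall p, A p -> exists L, closed_leaf w L /\ L p /\ subset L A.

(* [h'] is the abscissa of the first return to the positive x-half-axis of the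
   leaf issued from [(h, 0)]. *)
Definition first_return (w : one_form) (h h' : R) : Prop :=
  0 < h /\ 0 < h' /\
  exists (g : R -> R * R) (T : R),
    0 < T /\
    (forall t, 0 <= t <= T -> integral_curve_at w g t) /\
    g 0 = (h, 0) /\ g T = (h', 0) /\
    (forall t, 0 < t < T -> ~ (0 < fst (g t) /\ snd (g t) = 0)).

(** * Polynomials and algebraic sets *)

(* Polynomial functions in the coordinate functions listed in [X]. *)
Inductive polynomial {E : Type} (X : list (E -> R)) : (E -> R) -> Prop :=
| poly_const : forall a : R, polynomial X (fun _ => a)
| poly_coord : forall f, In f X -> polynomial X f
| poly_add : forall f g, polynomial X f -> polynomial X g ->
    polynomial X (fun p => f p + g p)
| poly_mul : forall f g, polynomial X f -> polynomial X g ->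
    polynomial X (fun p => f p * g p).

Definition algebraic_set {E : Type} (X : list (E -> R)) (Z : E -> Prop) : Prop :=
  exists S : (E -> R) -> Prop,
    (forall f, S f -> polynomial X f) /\
    (forall p, Z p <-> forall f, S f -> f p = 0).

Definition irreducible {E : Type} (X : list (E -> R)) (Z : E -> Prop) : Prop :=
  algebraic_set X Z /\
  (exists p, Z p) /\
  forall Z1 Z2, algebraic_set X Z1 -> algebraic_set X Z2 ->
    set_eq Z (fun p => Z1 p \/ Z2 p) -> set_eq Z Z1 \/ set_eq Z Z2.

Definition irreducible_component {E : Type} (X : list (E -> R))
  (V Z : E -> Prop) : Prop :=
  irreducible X Z /\ subset Z V /\
  forall Z', irreducible X Z' -> subset Z Z' -> subset Z' V -> set_eq Z' Z.

(** * Pull-back of a symmetric foliation *)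

Definition pairing (a v : R * R) : R := fst a * fst v + snd a * snd v.

Definition reflection (p : R * R) : R * R := (- fst p, snd p).

Definition chart (z : R * R -> R) (p : R * R) : R * R := (fst p, z p).

Definition dz_dx (z : R * R -> R) (p : R * R) : R :=
  Derive (fun x => z (x, snd p)) (fst p).
Definition dz_dy (z : R * R -> R) (p : R * R) : R :=
  Derive (fun y => z (fst p, y)) (snd p).

Definition dchart (z : R * R -> R) (p v : R * R) : R * R :=
  (fst v, dz_dx z p * fst v + dz_dy z p * snd v).

(* For polynomial [z] this makes [chart z] a diffeomorphism of the plane. *)
Definition coordinate_change (z : R * R -> R) : Prop :=
  (forall q, exists p, chart z p = q /\ forall p', chart z p' = q -> p' = p) /\
  forall p, dz_dy z p <> 0.

(* If [q] and [u] are the images of the point [p] and of the tangent vector [v]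
   at [p] under the involution (x, z) |-> (-x, z), then [v] is tangent to the
   foliation if and only if [u] is; in particular the singular points are
   preserved. *)
Definition symmetric_in_chart (w : one_form) (z : R * R -> R) : Prop :=
  forall p q v u : R * R,
    chart z q = reflection (chart z p) ->
    dchart z q u = reflection (dchart z p v) ->
    (pairing (w p) v = 0 <-> pairing (w q) u = 0).

Definition pulled_back_to_symmetric (w : one_form) : Prop :=
  exists z : R * R -> R,
    polynomial (fst :: snd :: nil) z /\
    coordinate_change z /\
    symmetric_in_chart w z.

(** * The linear deformation *)

Record coeffs : Type := Coeffs {
  c0 : R; c1 : R; c2 : R; c3 : R; c4 : R; c5 : R;
  b0 : R; b1 : R; b2 : R; b3 : R }.

Definition coeff_coords : list (coeffs -> R) :=
  c0 :: c1 :: c2 :: c3 :: c4 :: c5 :: b0 :: b1 :: b2 :: b3 :: nil.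

Definition Ham (x y : R) : R := / 4 * x ^ 4 + / 2 * y ^ 2.

Definition dHam : one_form := fun p => (fst p ^ 3, snd p).

Lemma dHam_differential : is_differential Ham dHam.
Proof.
intros [x y].
cut (differentiable_pt_lim Ham x y (1 * x ^ 3 + 1 * 0) (1 * 0 + 1 * y)).
{ now rewrite Rmult_0_r, !Rmult_1_l, Rplus_0_r, Rplus_0_l. }
apply (differentiable_pt_lim_comp Rplus
         (fun u _ => / 4 * u ^ 4) (fun _ v => / 2 * v ^ 2)).
- intros eps; exists (mkposreal 1 Rlt_0_1); intros u v _ _.
  match goal with |- Rabs ?r <= _ => replace r with 0 by ring end.
  rewrite Rabs_R0; apply Rmult_le_pos.
  + apply Rlt_le, cond_pos.
  + apply Rle_trans with (2 := Rmax_l _ _); apply Rabs_pos.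
- apply differentiable_pt_lim_proj1_0, is_derive_Reals.
  auto_derive; [exact I | field].
- intros eps.
  assert (D : derivable_pt_lim (fun v => / 2 * v ^ 2) y y).
  { apply is_derive_Reals; auto_derive; [exact I | field]. }
  destruct (differentiable_pt_lim_proj1_0 _ y x _ D eps) as [d Hd].
  exists d; intros u v Hu Hv; specialize (Hd v u Hv Hu).
  now rewrite Rmax_comm, (Rplus_comm (0 * _)).
Qed.

Definition omega1 (k : coeffs) : one_form := fun p =>
  let x := fst p in
  let y := snd p in
  (c0 k + c1 k * x + c2 k * x ^ 2 + c3 k * y + c4 k * x ^ 3 + c5 k * x * y,
   b0 k + b1 k * x + b2 k * x ^ 2 + b3 k * y).

Definition omega (k : coeffs) (e : R) : one_form := fun p =>
  (fst (dHam p) + e * fst (omega1 k p), snd (dHam p) + e * snd (omega1 k p)).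

(* The convergent expansion of the first return map in powers of [e], uniformly
   for [h] in compact subsets of (0, oo); it determines [M i h] for [0 < h]. *)
Definition melnikov (k : coeffs) (M : nat -> R -> R) : Prop :=
  (forall h, 0 < h -> M O h = h) /\
  forall a b, 0 < a -> a <= b ->
    exists e0, 0 < e0 /\
      forall h e, a <= h <= b -> Rabs e < e0 ->
        exists h', first_return (omega k e) h h' /\
          is_pseries (fun i => M i h) e h'.

Definition vanishes (f : R -> R) : Prop := forall h, 0 < h -> f h = 0.

(** * Limit cycles bifurcating from the period annulus *)

Definition compact_set (K : R * R -> Prop) : Prop :=
  forall (I : Type) (U : I -> R * R -> Prop),
    (forall i, open (U i)) ->
    (forall p, K p -> exists i, U i p) ->
    exists l : list I, forall p, K p -> exists i, In i l /\ U i p.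

Definition cyclicity_le (k : coeffs) (K : R * R -> Prop) (n : nat) : Prop :=
  exists (V : R * R -> Prop) (e0 : R),
    open V /\ subset K V /\ 0 < e0 /\
    forall e, 0 < e < e0 -> at_most_limit_cycles (omega k e) V n.

(* The maximal number of limit cycles which tend to [K] as [e] tends to 0+. *)
Definition cyclicity (k : coeffs) (K : R * R -> Prop) (n : nat) : Prop :=
  cyclicity_le k K n /\ forall m, cyclicity_le k K m -> (n <= m)%nat.

(* [n] is the supremum (necessarily attained) over the coefficients and over the
   compact subsets of the punctured plane. *)
Definition bifurcating_limit_cycles (n : nat) : Prop :=
  (forall k K, compact_set K -> ~ K (0, 0) ->
     exists m, cyclicity k K m /\ (m <= n)%nat) /\
  (exists k K, compact_set K /\ ~ K (0, 0) /\ cyclicity k K n).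

Definition comp1 (k : coeffs) : Prop := c3 k - b1 k = 0 /\ c5 k - 2 * b2 k = 0.

Definition comp2 (k : coeffs) : Prop :=
  c0 k = 0 /\ c2 k = 0 /\ c3 k = 0 /\ b1 k = 0.

Definition comp3 (k : coeffs) : Prop :=
  b1 k - c3 k = 0 /\ c0 k = 0 /\ c2 k = 0 /\ b0 k = 0 /\ c5 k + b2 k = 0.

(* Main.v *)
(** The leaves are followed in quasi-homogeneous polar coordinates
    x = cs phi / u, y = sn phi / u^2, in which the unperturbed ovals are the
    circles u = constant. There the foliation becomes a scalar equation
    du/dphi = e * (polynomial in u) / (1 + e * polynomial in u), regular up to
    u = 0, that is, up to infinity. Its solution is a power series in [e] whose
    coefficients obey a recursion; a majorant argument in a submultiplicative
    Lipschitz norm gives the convergence, uniformly in the initial value, and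
    Lipschitz bounds on all the coefficients. Closed leaves correspond to
    2 PI-periodic solutions.

    The first Melnikov function is (b1 - c3) times a positive constant. If it
    vanishes, the foliation is a Lienard system x' = z,
    z' = - (g0 + g1 x + g2 x^2 + g3 x^3) - mu x z, and for g0 = g2 = 0 it is
    linear in (x^2, z), with an explicit logarithmic first integral. In general
    the variation of this integral along a turn is mu * (g0 P + g2 Q) with P and
    Q close to positive multiples of h and h^3. This makes the second and third
    Melnikov functions positive multiples of some c + d h^2, and shows that all
    of them vanish as soon as mu * g0 and mu * g2 do. Since c + d h^2 has at most
    one positive zero, which is simple, the Lipschitz bounds leave room for one
    limit cycle only. *)

(* The elementary functions [cs] and [sn] replace the elliptic functions of the quartic oval: their
   period is 2 PI for every oval, so the first return is read off at one fixed angle. With weights 1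
   for x and 2 for y, the coefficients of [omega1] have degree at most 3 and 2; this is why a
   multiplication by u^3 or u^2 makes them polynomial in u, with bounds that include u = 0.

   The quotient in the scalar equation would call for the inversion of a power series. Instead w =
   kap N / (1 + e Q) is carried as a third unknown next to u and 1 / u, and w (1 + e Q) = kap N is
   solved degree by degree.

   Two fixed points for the same e might merge as e tends to 0, so a small remainder does not
   exclude them: its variation between the two points has to be small as well. The Lipschitz part of
   the norm provides this, and no derivative with respect to the initial value is ever taken.

   The logarithmic integral contains the argument of (nu sigma, z). At e = 0 this point stays in the
   half-plane sigma >= 0, so a single branch of the argument serves a whole turn. The error is
   proportional to 1 - exp(- (mu / nu) arg), which vanishes with mu and so contributes one more
   factor e. *)
From Stdlib Require Import Reals Lra Lia Psatz Arith ZArith List Classical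
  ClassicalEpsilon FunctionalExtensionality.
From Coquelicot Require Import Coquelicot.
Require Import Defs.

Open Scope R_scope.

(** * Quasi-homogeneous polar coordinates *)

(* [quart phi ^ 4 = cos phi ^ 4 + 2 * sin phi ^ 2]; hence [cs] and [sn] below
   parametrize the oval x^4 + 2 y^2 = 1 clockwise. *)
Definition quart (phi : R) : R := sqrt (sqrt (1 + sin phi ^ 4)).
Definition cs (phi : R) : R := cos phi / quart phi.
Definition sn (phi : R) : R := - sin phi / quart phi ^ 2.
(** The change of clock between time and angle: on the unit oval, [cs] and [sn] follow x' = y, y' =
    - x^3 with the speed multiplied by [kap]. *)
Definition kap (phi : R) : R := (1 + sin phi ^ 2) / quart phi ^ 3.

Lemma sin2_cos2' (phi : R) : cos phi ^ 2 = 1 - sin phi ^ 2.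
Proof. generalize (sin2_cos2 phi); unfold Rsqr; nra. Qed.

Lemma quart_4 (phi : R) : quart phi ^ 4 = 1 + sin phi ^ 4.
Proof.
assert (H : 0 <= 1 + sin phi ^ 4) by nra.
unfold quart; replace (sqrt (sqrt (1 + sin phi ^ 4)) ^ 4) with
  ((sqrt (sqrt (1 + sin phi ^ 4)) ^ 2) ^ 2) by ring.
rewrite pow2_sqrt by apply sqrt_pos.
now rewrite pow2_sqrt.
Qed.

Lemma quart_ge_1 (phi : R) : 1 <= quart phi.
Proof.
assert (0 <= quart phi) by apply sqrt_pos.
apply Rnot_lt_le; intros Hlt.
assert (quart phi ^ 4 < 1) by (apply pow_lt_1_compat; [lra | lia]).
generalize (quart_4 phi) (pow2_ge_0 (sin phi ^ 2)); lra.
Qed.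

Lemma is_derive_quart (phi : R) :
  is_derive quart phi (sin phi ^ 3 * cos phi / quart phi ^ 3).
Proof.
assert (Hq := quart_ge_1 phi).
assert (H1 : 0 < 1 + sin phi ^ 4) by nra.
assert (H2 : 0 < sqrt (1 + sin phi ^ 4)) by now apply sqrt_lt_R0.
unfold quart at 1; auto_derive; [tauto | ].
assert (E : sqrt (1 + sin phi ^ 4) = quart phi ^ 2).
{ unfold quart; rewrite pow2_sqrt; lra. }
replace (sin phi * (sin phi * (sin phi * (sin phi * 1)))) with (sin phi ^ 4)
  by ring.
fold (quart phi); rewrite E; field; lra.
Qed.

Lemma is_derive_cs (phi : R) : is_derive cs phi (kap phi * sn phi).
Proof.
assert (Hq := quart_ge_1 phi).
evar_last.
{ apply (is_derive_div cos quart); [apply is_derive_cos | apply is_derive_quart |].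
  lra. }
unfold kap, sn; apply (Rmult_eq_reg_r (quart phi ^ 5)); [| apply pow_nonzero; lra].
transitivity (- sin phi * quart phi ^ 4 - sin phi ^ 3 * cos phi ^ 2);
  [field; lra |].
rewrite quart_4, sin2_cos2'; field; lra.
Qed.

Lemma cs4_sn2 (phi : R) : cs phi ^ 4 + 2 * sn phi ^ 2 = 1.
Proof.
assert (Hq := quart_ge_1 phi).
unfold cs, sn; apply (Rmult_eq_reg_r (quart phi ^ 4)); [| apply pow_nonzero; lra].
transitivity ((cos phi ^ 2) ^ 2 + 2 * sin phi ^ 2); [field; lra |].
rewrite quart_4, sin2_cos2'; ring.
Qed.

Lemma is_derive_sn (phi : R) : is_derive sn phi (- kap phi * cs phi ^ 3).
Proof.
assert (Hq := quart_ge_1 phi).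
evar_last.
{ apply (is_derive_div (fun x => - sin x) (fun x => quart x ^ 2)).
  - apply (is_derive_opp sin); apply is_derive_sin.
  - apply (is_derive_pow quart 2); apply is_derive_quart.
  - apply pow_nonzero; lra. }
unfold kap, cs; apply (Rmult_eq_reg_r (quart phi ^ 6)); [| apply pow_nonzero; lra].
transitivity (cos phi * (- quart phi ^ 4 + 2 * sin phi ^ 4)).
{ unfold opp; simpl; field; lra. }
rewrite quart_4.
transitivity (- (1 + sin phi ^ 2) * (cos phi * cos phi ^ 2));
  [rewrite sin2_cos2'; ring | field; lra].
Qed.

Lemma kap_pos (phi : R) : 0 < kap phi.
Proof.
assert (Hq := quart_ge_1 phi).
unfold kap; apply Rdiv_lt_0_compat; [nra | apply pow_lt; lra].
Qed.

Lemma cs_0 : cs 0 = 1.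
Proof.
unfold cs, quart; rewrite cos_0, sin_0.
replace (1 + 0 ^ 4) with 1 by ring; rewrite !sqrt_1; field.
Qed.

Lemma sn_0 : sn 0 = 0.
Proof. unfold sn; rewrite sin_0; unfold Rdiv; ring. Qed.

Lemma quart_shift (phi phi' : R) :
  sin phi ^ 2 = sin phi' ^ 2 -> quart phi = quart phi'.
Proof.
intros H; unfold quart; do 3 f_equal.
transitivity ((sin phi ^ 2) ^ 2); [ring | rewrite H; ring].
Qed.

Lemma quart_antiperiodic (phi : R) : quart (phi + PI) = quart phi.
Proof. apply quart_shift; rewrite neg_sin; ring. Qed.

Lemma cs_antiperiodic (phi : R) : cs (phi + PI) = - cs phi.
Proof. unfold cs; rewrite neg_cos, quart_antiperiodic; unfold Rdiv; ring. Qed.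

Lemma sn_antiperiodic (phi : R) : sn (phi + PI) = - sn phi.
Proof. unfold sn; rewrite neg_sin, quart_antiperiodic; unfold Rdiv; ring. Qed.

Lemma kap_antiperiodic (phi : R) : kap (phi + PI) = kap phi.
Proof. unfold kap; rewrite neg_sin, quart_antiperiodic; unfold Rdiv; ring. Qed.

Lemma cs_periodic (phi : R) : cs (phi + 2 * PI) = cs phi.
Proof.
replace (phi + 2 * PI) with (phi + PI + PI) by ring.
rewrite !cs_antiperiodic; ring.
Qed.

Lemma sn_periodic (phi : R) : sn (phi + 2 * PI) = sn phi.
Proof.
replace (phi + 2 * PI) with (phi + PI + PI) by ring.
rewrite !sn_antiperiodic; ring.
Qed.

Lemma kap_periodic (phi : R) : kap (phi + 2 * PI) = kap phi.
Proof.
replace (phi + 2 * PI) with (phi + PI + PI) by ring.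
now rewrite !kap_antiperiodic.
Qed.

Lemma cs_bound (phi : R) : Rabs (cs phi) <= 1.
Proof.
assert (H : cs phi ^ 2 <= 1).
{ generalize (cs4_sn2 phi) (pow2_ge_0 (sn phi)); nra. }
apply Rabs_le; split; nra.
Qed.

Lemma sn_bound (phi : R) : Rabs (sn phi) <= 1.
Proof. apply Rabs_le; generalize (cs4_sn2 phi) (pow2_ge_0 (cs phi ^ 2)); split; nra. Qed.

Lemma inv_quart_bound (phi : R) (n : nat) : 0 < / quart phi ^ n <= 1.
Proof.
assert (Hq := quart_ge_1 phi).
split; [apply Rinv_0_lt_compat, pow_lt; lra |].
rewrite <- Rinv_1; apply Rinv_le_contravar; [lra | now apply pow_R1_Rle].
Qed.

Lemma sin_le_1 (phi : R) : Rabs (sin phi) <= 1.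
Proof. apply Rabs_le, SIN_bound. Qed.

Lemma kap_bound (phi : R) : Rabs (kap phi) <= 2.
Proof.
assert (H := kap_pos phi); rewrite Rabs_pos_eq by lra.
unfold kap, Rdiv.
assert (Hq := inv_quart_bound phi 3).
generalize (SIN_bound phi); nra.
Qed.

Lemma is_derive_kap (phi : R) :
  is_derive kap phi (2 * sin phi * cos phi * / quart phi ^ 3 -
    3 * (1 + sin phi ^ 2) * sin phi ^ 3 * cos phi * / quart phi ^ 7).
Proof.
assert (Hq := quart_ge_1 phi).
evar_last.
{ apply (is_derive_div (fun x => 1 + sin x ^ 2) (fun x => quart x ^ 3)).
  - auto_derive; [exact I | reflexivity].
  - apply (is_derive_pow quart 3); apply is_derive_quart.
  - apply pow_nonzero; lra. }
simpl; field; lra.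
Qed.

Lemma lipschitz_of_derive (f df : R -> R) (K : R) :
  (forall x, is_derive f x (df x)) -> (forall x, Rabs (df x) <= K) ->
  forall x y, Rabs (f x - f y) <= K * Rabs (x - y).
Proof.
intros Hf Hb x y.
destruct (MVT_gen f y x df) as [c [_ Hc]].
- intros; apply Hf.
- intros z _; apply continuity_pt_filterlim.
  apply (ex_derive_continuous f); eexists; apply Hf.
- rewrite Hc, Rabs_mult; apply Rmult_le_compat_r; [apply Rabs_pos | apply Hb].
Qed.

Lemma Rabs_mult_le (x y a b : R) :
  Rabs x <= a -> Rabs y <= b -> Rabs (x * y) <= a * b.
Proof.
intros; rewrite Rabs_mult; apply Rmult_le_compat; auto using Rabs_pos.
Qed.

Lemma cs_lipschitz (x y : R) : Rabs (cs x - cs y) <= 2 * Rabs (x - y).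
Proof.
apply (lipschitz_of_derive _ _ _ is_derive_cs); intros z.
replace 2 with (2 * 1) by ring; apply Rabs_mult_le; [apply kap_bound | apply sn_bound].
Qed.

Lemma sn_lipschitz (x y : R) : Rabs (sn x - sn y) <= 2 * Rabs (x - y).
Proof.
apply (lipschitz_of_derive _ _ _ is_derive_sn); intros z.
replace 2 with (2 * 1 ^ 3) by ring; apply Rabs_mult_le.
- rewrite Rabs_Ropp; apply kap_bound.
- rewrite <- RPow_abs; apply pow_incr; split; [apply Rabs_pos | apply cs_bound].
Qed.

Lemma kap_lipschitz (x y : R) : Rabs (kap x - kap y) <= 8 * Rabs (x - y).
Proof.
apply (lipschitz_of_derive _ _ _ is_derive_kap); intros z.
assert (Hs := sin_le_1 z).
assert (Hc : Rabs (cos z) <= 1) by apply Rabs_le, COS_bound.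
assert (H3 : forall n, Rabs (/ quart z ^ n) <= 1).
{ intros n; generalize (inv_quart_bound z n); intros; rewrite Rabs_pos_eq; lra. }
assert (Hs3 : Rabs (sin z ^ 3) <= 1).
{ rewrite <- RPow_abs; rewrite <- (pow1 3); apply pow_incr; split; auto using Rabs_pos. }
assert (Hs2 : Rabs (1 + sin z ^ 2) <= 2).
{ rewrite Rabs_pos_eq by nra; generalize (SIN_bound z); nra. }
unfold Rminus; eapply Rle_trans; [apply Rabs_triang |].
rewrite Rabs_Ropp.
replace 8 with (2 * 1 * 1 * 1 + 3 * 2 * 1 * 1 * 1) by ring.
apply Rplus_le_compat; repeat apply Rabs_mult_le; auto;
  rewrite Rabs_pos_eq; lra.
Qed.

(** * A submultiplicative Lipschitz norm *)

(* The interval [-9, 9] contains a full turn, since PI <= 4. *)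
Definition in_dom (U phi a : R) : Prop := Rabs phi <= 9 /\ Rabs a <= U.

(* The sum of the sup norm and of the Lipschitz constant is submultiplicative. *)
Definition bnd (U : R) (f : R -> R -> R) (K : R) : Prop :=
  exists K1 K2, 0 <= K1 /\ 0 <= K2 /\ K1 + K2 <= K /\
    (forall phi a, in_dom U phi a -> Rabs (f phi a) <= K1) /\
    (forall phi a phi' a', in_dom U phi a -> in_dom U phi' a' ->
       Rabs (f phi a - f phi' a') <= K2 * (Rabs (phi - phi') + Rabs (a - a'))).

Lemma bnd_sup (U : R) (f : R -> R -> R) (K phi a : R) :
  bnd U f K -> in_dom U phi a -> Rabs (f phi a) <= K.
Proof. intros (K1 & K2 & ? & ? & ? & H & _) D; specialize (H _ _ D); lra. Qed.

Lemma bnd_lip (U : R) (f : R -> R -> R) (K phi a phi' a' : R) :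
  bnd U f K -> in_dom U phi a -> in_dom U phi' a' ->
  Rabs (f phi a - f phi' a') <= K * (Rabs (phi - phi') + Rabs (a - a')).
Proof.
intros (K1 & K2 & ? & ? & ? & _ & H) D D'; specialize (H _ _ _ _ D D').
eapply Rle_trans; [exact H |]; apply Rmult_le_compat_r; [| lra].
generalize (Rabs_pos (phi - phi')) (Rabs_pos (a - a')); lra.
Qed.

Lemma bnd_nonneg (U : R) (f : R -> R -> R) (K : R) : bnd U f K -> 0 <= K.
Proof. intros (K1 & K2 & ? & ? & ? & _); lra. Qed.

Lemma bnd_le (U : R) (f : R -> R -> R) (K K' : R) : bnd U f K -> K <= K' -> bnd U f K'.
Proof.
intros (K1 & K2 & ? & ? & ? & H1 & H2) HK; exists K1, K2; repeat split; auto; lra.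
Qed.

Lemma bnd_const (U c : R) : bnd U (fun _ _ => c) (Rabs c).
Proof.
exists (Rabs c), 0; repeat split; auto using Rabs_pos, Rle_refl; try lra.
intros; rewrite Rminus_diag, Rabs_R0; lra.
Qed.

Lemma bnd_plus (U : R) (f g : R -> R -> R) (K L : R) :
  bnd U f K -> bnd U g L -> bnd U (fun phi a => f phi a + g phi a) (K + L).
Proof.
intros (K1 & K2 & ? & ? & ? & H1 & H2) (L1 & L2 & ? & ? & ? & G1 & G2).
exists (K1 + L1), (K2 + L2); repeat split; try lra.
- intros phi a D; eapply Rle_trans; [apply Rabs_triang |].
  specialize (H1 _ _ D); specialize (G1 _ _ D); lra.
- intros phi a phi' a' D D'.
  replace (f phi a + g phi a - (f phi' a' + g phi' a')) with
    ((f phi a - f phi' a') + (g phi a - g phi' a')) by ring.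
  eapply Rle_trans; [apply Rabs_triang |].
  specialize (H2 _ _ _ _ D D'); specialize (G2 _ _ _ _ D D'); lra.
Qed.

Lemma bnd_mult (U : R) (f g : R -> R -> R) (K L : R) :
  bnd U f K -> bnd U g L -> bnd U (fun phi a => f phi a * g phi a) (K * L).
Proof.
intros (K1 & K2 & ? & ? & ? & H1 & H2) (L1 & L2 & ? & ? & ? & G1 & G2).
exists (K1 * L1), (K1 * L2 + K2 * L1); repeat split; try nra.
- intros; apply Rabs_mult_le; auto.
- intros phi a phi' a' D D'.
  replace (f phi a * g phi a - f phi' a' * g phi' a') with
    (f phi a * (g phi a - g phi' a') + (f phi a - f phi' a') * g phi' a') by ring.
  eapply Rle_trans; [apply Rabs_triang |].
  rewrite Rmult_plus_distr_r; apply Rplus_le_compat.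
  + rewrite Rmult_assoc; apply Rabs_mult_le; auto.
  + replace (K2 * L1 * (Rabs (phi - phi') + Rabs (a - a'))) with
      (K2 * (Rabs (phi - phi') + Rabs (a - a')) * L1) by ring.
    apply Rabs_mult_le; auto.
Qed.

Lemma bnd_opp (U : R) (f : R -> R -> R) (K : R) :
  bnd U f K -> bnd U (fun phi a => - f phi a) K.
Proof.
intros (K1 & K2 & ? & ? & ? & H1 & H2); exists K1, K2; repeat split; auto.
- intros; rewrite Rabs_Ropp; auto.
- intros; replace (- f phi a - - f phi' a') with (- (f phi a - f phi' a')) by ring.
  rewrite Rabs_Ropp; auto.
Qed.

Lemma bnd_minus (U : R) (f g : R -> R -> R) (K L : R) :
  bnd U f K -> bnd U g L -> bnd U (fun phi a => f phi a - g phi a) (K + L).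
Proof. intros Hf Hg; apply bnd_plus, bnd_opp; assumption. Qed.

Lemma bnd_sum (U : R) (f : nat -> R -> R -> R) (K : nat -> R) (n : nat) :
  (forall k, (k <= n)%nat -> bnd U (f k) (K k)) ->
  bnd U (fun phi a => sum_f_R0 (fun k => f k phi a) n) (sum_f_R0 K n).
Proof.
induction n as [| n IH]; intros H; simpl; [now apply H |].
apply bnd_plus; [apply IH; intros; apply H; lia | now apply H].
Qed.

Lemma bnd_angle (U : R) (f : R -> R) (K L : R) :
  (forall x, Rabs (f x) <= K) -> (forall x y, Rabs (f x - f y) <= L * Rabs (x - y)) ->
  0 <= L -> bnd U (fun phi _ => f phi) (K + L).
Proof.
intros H1 H2 HL; exists K, L; repeat split; auto; try lra.
- eapply Rle_trans; [apply Rabs_pos | apply (H1 0)].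
- intros phi a phi' a' _ _; eapply Rle_trans; [apply H2 |].
  apply Rmult_le_compat_l; [assumption |]; generalize (Rabs_pos (a - a')); lra.
Qed.

Lemma bnd_radius (U : R) : 0 <= U -> bnd U (fun _ a => a) (U + 1).
Proof.
intros HU; exists U, 1; repeat split; try lra.
- now intros phi a [_ ?].
- intros phi a phi' a' _ _; generalize (Rabs_pos (phi - phi')); lra.
Qed.

Lemma RInt_bound (f : R -> R) (x y K : R) :
  (forall z, continuous f z) ->
  (forall z, Rmin x y <= z <= Rmax x y -> Rabs (f z) <= K) ->
  Rabs (RInt f x y) <= K * Rabs (y - x).
Proof.
intros Hc HK.
assert (ex : forall u v, ex_RInt f u v) by (intros; apply (ex_RInt_continuous (V := R_CompleteNormedModule)); auto).
destruct (Rle_dec x y) as [H | H].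
- rewrite (Rabs_pos_eq (y - x)) by lra.
  rewrite (Rmult_comm K); apply abs_RInt_le_const; auto.
  intros t Ht; apply HK; rewrite Rmin_left, Rmax_right; lra.
- rewrite <- opp_RInt_swap by auto; unfold opp; simpl; rewrite Rabs_Ropp.
  rewrite (Rabs_minus_sym y x), (Rabs_pos_eq (x - y)) by lra.
  rewrite (Rmult_comm K); apply abs_RInt_le_const; [lra | auto |].
  intros t Ht; apply HK; rewrite Rmin_right, Rmax_left; lra.
Qed.

Lemma in_dom_between (U x y a z : R) :
  in_dom U x a -> in_dom U y a -> Rmin x y <= z <= Rmax x y -> in_dom U z a.
Proof.
intros [Hx Ha] [Hy _] Hz; split; [| assumption].
apply Rabs_le_between in Hx; apply Rabs_le_between in Hy; apply Rabs_le_between.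
revert Hz; unfold Rmin, Rmax; destruct (Rle_dec x y); lra.
Qed.

Lemma in_dom_0 (U phi a : R) : in_dom U phi a -> in_dom U 0 a.
Proof. intros [_ ?]; split; [rewrite Rabs_R0; lra | assumption]. Qed.

(** For angles up to 9 the integral is at most 9 K1, and its Lipschitz constant is at most 9 K2 +
    K1, where K1 comes from the moving end point. The sum is at most 10 K. *)
Lemma bnd_RInt (U : R) (f : R -> R -> R) (K : R) :
  (forall phi a, continuous (fun s => f s a) phi) -> bnd U f K ->
  bnd U (fun phi a => RInt (fun s => f s a) 0 phi) (10 * K).
Proof.
intros Hc (K1 & K2 & ? & ? & ? & H1 & H2).
assert (ex : forall a u v, ex_RInt (fun s => f s a) u v)
  by (intros; apply (ex_RInt_continuous (V := R_CompleteNormedModule)); auto).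
exists (9 * K1), (9 * K2 + K1); repeat split; try lra.
- intros phi a D; assert (D' := D); destruct D' as [D' _].
  apply Rle_trans with (K1 * Rabs (phi - 0)).
  + apply RInt_bound; auto; intros z Hz; apply H1.
    exact (in_dom_between _ _ _ _ _ (in_dom_0 _ _ _ D) D Hz).
  + rewrite Rminus_0_r; nra.
- intros phi a phi' a' D D'.
  assert (D'' : in_dom U phi a') by (split; [apply D | apply D']).
  replace (RInt (fun s => f s a) 0 phi - RInt (fun s => f s a') 0 phi') with
    (RInt (fun s => f s a - f s a') 0 phi + RInt (fun s => f s a') phi' phi).
  + eapply Rle_trans; [apply Rabs_triang |].
    apply Rle_trans with (K2 * Rabs (a - a') * 9 + K1 * Rabs (phi - phi')).
    * apply Rplus_le_compat.
      -- apply Rle_trans with (K2 * Rabs (a - a') * Rabs (phi - 0)).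
         ++ apply RInt_bound.
            { intros z; apply (continuous_minus (V := R_NormedModule)); auto. }
            intros z Hz; eapply Rle_trans.
            { apply H2.
              - exact (in_dom_between _ _ _ _ _ (in_dom_0 _ _ _ D) D Hz).
              - exact (in_dom_between _ _ _ _ _ (in_dom_0 _ _ _ D'') D'' Hz). }
            rewrite Rminus_diag, Rabs_R0; lra.
         ++ apply Rmult_le_compat_l; [generalize (Rabs_pos (a - a')); nra |].
            rewrite Rminus_0_r; apply D.
      -- apply RInt_bound; auto; intros z Hz; apply H1.
         exact (in_dom_between _ _ _ _ _ D' D'' Hz).
    * generalize (Rabs_pos (a - a')) (Rabs_pos (phi - phi')); nra.
  + rewrite (RInt_minus (fun s => f s a) (fun s => f s a')) by auto.
    rewrite <- (RInt_Chasles (fun s => f s a') 0 phi' phi) by auto.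
    unfold minus, plus, opp; simpl; ring.
Qed.

(** * Weighted power series *)

(** A purely geometric bound would lose a factor n + 1 in each Cauchy product. The factor 1 / (n +
    1)^2 is summable, which keeps the loss down to a constant. *)
Definition wt (r : R) (n : nat) : R := r ^ n / (INR n + 1) ^ 2.

Lemma wt_pos (r : R) (n : nat) : 0 < r -> 0 < wt r n.
Proof.
intros; apply Rdiv_lt_0_compat; apply pow_lt; [assumption |].
generalize (pos_INR n); lra.
Qed.

(** A shift of the degree gains 1 / r. With r large this is the small factor that closes the
    majorant induction; 4 bounds ((n + 2) / (n + 1))^2. *)
Lemma wt_shift (r : R) (n : nat) : 0 < r -> wt r n <= 4 / r * wt r (S n).
Proof.
intros Hr; unfold wt; rewrite S_INR; assert (Hn := pos_INR n).
apply (Rmult_le_reg_r ((INR n + 1) ^ 2 * (INR n + 1 + 1) ^ 2)).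
{ apply Rmult_lt_0_compat; apply pow_lt; lra. }
assert (Hrn : 0 < r ^ n) by now apply pow_lt.
change (r ^ S n) with (r * r ^ n).
replace (r ^ n / (INR n + 1) ^ 2 * ((INR n + 1) ^ 2 * (INR n + 1 + 1) ^ 2)) with
  (r ^ n * (INR n + 1 + 1) ^ 2) by (field; lra).
replace (4 / r * (r * r ^ n / (INR n + 1 + 1) ^ 2) *
   ((INR n + 1) ^ 2 * (INR n + 1 + 1) ^ 2)) with
  (r ^ n * (4 * (INR n + 1) ^ 2)) by (field; lra).
apply Rmult_le_compat_l; [lra |].
replace (4 * (INR n + 1) ^ 2) with ((2 * (INR n + 1)) ^ 2) by ring.
apply pow_incr; lra.
Qed.

Lemma sum_inv_squares (n : nat) :
  sum_f_R0 (fun k => / (INR k + 1) ^ 2) n <= 2 - / (INR n + 1).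
Proof.
induction n as [| n IH]; [simpl; lra |].
rewrite tech5, S_INR; assert (Hn := pos_INR n).
apply Rle_trans with (2 - / (INR n + 1) + / (INR n + 1 + 1) ^ 2); [lra |].
assert (/ (INR n + 1 + 1) ^ 2 <= / (INR n + 1) - / (INR n + 1 + 1)); [| lra].
replace (/ (INR n + 1) - / (INR n + 1 + 1)) with
  (/ ((INR n + 1) * (INR n + 1 + 1))) by (field; lra).
apply Rinv_le_contravar; nra.
Qed.

Lemma sum_rev (f : nat -> R) (n : nat) :
  sum_f_R0 (fun k => f (n - k)%nat) n = sum_f_R0 f n.
Proof.
rewrite <- !sum_n_Reals; unfold sum_n.
induction n as [| n IH] in f |- *; [reflexivity |].
rewrite sum_n_Sm by lia; rewrite Nat.sub_diag.
rewrite (sum_Sn_m f) by lia.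
rewrite <- (sum_n_m_S (fun k => f k)).
rewrite <- (IH (fun k => f (S k))), plus_comm; f_equal.
apply sum_n_m_ext_loc; intros k Hk; f_equal; lia.
Qed.

(* [(n+2)^2 / ((k+1)^2 (n-k+1)^2) = (1/(k+1) + 1/(n-k+1))^2]. *)
Lemma wt_conv (r : R) (n : nat) :
  0 < r -> sum_f_R0 (fun k => wt r k * wt r (n - k)) n <= 8 * wt r n.
Proof.
intros Hr.
assert (Hrn : 0 < r ^ n) by now apply pow_lt.
assert (Hn := pos_INR n).
apply Rle_trans with (sum_f_R0 (fun k => (/ (INR k + 1) ^ 2 +
  / (INR (n - k) + 1) ^ 2) * (2 * wt r n)) n).
- apply sum_Rle; intros k Hk; unfold wt.
  replace (r ^ n) with (r ^ k * r ^ (n - k)) by (rewrite <- pow_add; f_equal; lia).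
  assert (E : INR n = INR k + INR (n - k)) by (rewrite <- plus_INR; f_equal; lia).
  rewrite E.
  assert (Hk1 := pos_INR k); assert (Hk2 := pos_INR (n - k)).
  set (x := INR k) in *; set (y := INR (n - k)) in *.
  assert (0 < r ^ k) by now apply pow_lt.
  assert (0 < r ^ (n - k)) by now apply pow_lt.
  set (p := r ^ k) in *; set (s := r ^ (n - k)) in *.
  apply (Rmult_le_reg_r ((x + 1) ^ 2 * (y + 1) ^ 2 * (x + y + 1) ^ 2)).
  { repeat apply Rmult_lt_0_compat; try apply pow_lt; lra. }
  replace (p / (x + 1) ^ 2 * (s / (y + 1) ^ 2) *
    ((x + 1) ^ 2 * (y + 1) ^ 2 * (x + y + 1) ^ 2)) with
    (p * s * (x + y + 1) ^ 2) by (field; lra).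
  replace ((/ (x + 1) ^ 2 + / (y + 1) ^ 2) * (2 * (p * s / (x + y + 1) ^ 2)) *
    ((x + 1) ^ 2 * (y + 1) ^ 2 * (x + y + 1) ^ 2)) with
    (p * s * (2 * ((y + 1) ^ 2 + (x + 1) ^ 2))) by (field; lra).
  apply Rmult_le_compat_l; [nra |].
  generalize (pow2_ge_0 (x - y)); nra.
- rewrite <- (scal_sum (fun k => / (INR k + 1) ^ 2 + / (INR (n - k) + 1) ^ 2)).
  rewrite sum_plus, (sum_rev (fun k => / (INR k + 1) ^ 2)).
  assert (H := sum_inv_squares n).
  assert (0 < / (INR n + 1)) by (apply Rinv_0_lt_compat; lra).
  assert (W := wt_pos r n Hr); nra.
Qed.

(* [f n phi a] is the coefficient of degree [n] of a power series whose
   coefficients are functions of [phi] and [a]. *)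
Definition coefs : Type := nat -> R -> R -> R.

Definition conv (f g : coefs) : coefs := fun n phi a =>
  PS_mult (fun k => f k phi a) (fun k => g k phi a) n.

(** Only degrees below [N] are bounded, so that the estimate of the recursively defined coefficients
    can proceed by induction on [N]. *)
Definition maj (U r : R) (N : nat) (f : coefs) (K : R) : Prop :=
  forall n, (n < N)%nat -> bnd U (f n) (K * wt r n).

Lemma maj_conv (U r : R) (N : nat) (f g : coefs) (K L : R) :
  0 < r -> 0 <= K -> 0 <= L -> maj U r N f K -> maj U r N g L ->
  maj U r N (conv f g) (8 * K * L).
Proof.
intros Hr HK HL Hf Hg n Hn; unfold conv, PS_mult.
eapply bnd_le.
- apply (bnd_sum U (fun k phi a => f k phi a * g (n - k)%nat phi a)
    (fun k => wt r k * wt r (n - k) * (K * L))).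
  intros k Hk; eapply bnd_le; [apply bnd_mult; [apply Hf | apply Hg]; lia |].
  apply Req_le; ring.
- rewrite <- (scal_sum (fun k => wt r k * wt r (n - k))).
  generalize (wt_conv r n Hr); intros.
  assert (0 <= K * L) by nra; nra.
Qed.

Lemma maj_plus (U r : R) (N : nat) (f g : coefs) (K L : R) :
  maj U r N f K -> maj U r N g L ->
  maj U r N (fun n phi a => f n phi a + g n phi a) (K + L).
Proof.
intros Hf Hg n Hn; rewrite Rmult_plus_distr_r; apply bnd_plus; auto.
Qed.

Lemma maj_scal (U r : R) (N : nat) (f : coefs) (c : R -> R -> R) (K L : R) :
  bnd U c L -> maj U r N f K ->
  maj U r N (fun n phi a => c phi a * f n phi a) (L * K).
Proof.
intros Hc Hf n Hn; rewrite Rmult_assoc; apply bnd_mult; auto.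
Qed.

Definition monom0 (c : R -> R -> R) : coefs := fun n =>
  match n with O => c | S _ => fun _ _ => 0 end.

Lemma maj_monom0 (U r : R) (N : nat) (c : R -> R -> R) (K : R) :
  0 < r -> bnd U c K -> maj U r N (monom0 c) K.
Proof.
intros Hr Hc [| n] Hn; simpl.
- unfold wt; simpl; replace (K * (1 / ((0 + 1) * ((0 + 1) * 1)))) with K by field.
  assumption.
- eapply bnd_le; [apply bnd_const |]; rewrite Rabs_R0.
  apply Rmult_le_pos; [eapply bnd_nonneg; eassumption | apply Rlt_le, wt_pos; assumption].
Qed.

(** * The perturbation in polar coordinates *)

(* The coefficients of dx and dy in [omega1], multiplied by [u ^ 3] and [u ^ 2],
   at the point [(cs phi / u, sn phi / u ^ 2)]. *)
Definition A3 (k : coeffs) (phi u : R) : R :=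
  c0 k * u ^ 3 + c1 k * cs phi * u ^ 2 +
  (c2 k * cs phi ^ 2 + c3 k * sn phi) * u +
  (c4 k * cs phi ^ 3 + c5 k * cs phi * sn phi).
Definition B2 (k : coeffs) (phi u : R) : R :=
  b0 k * u ^ 2 + b1 k * cs phi * u + (b2 k * cs phi ^ 2 + b3 k * sn phi).

(* Along the leaves, [phi' = (1 + e Q) / (kap u)] and [u' = - e N]. *)
Definition Nf (k : coeffs) (phi u : R) : R :=
  cs phi ^ 3 * B2 k phi u - sn phi * A3 k phi u.
Definition Qf (k : coeffs) (phi u : R) : R :=
  cs phi * A3 k phi u + 2 * sn phi * B2 k phi u.

(** The series of u = a E. The operators [A3s], [B2s], [Ns] and [Qs] below evaluate [A3], [B2], [Nf]
    and [Qf] on it, with Cauchy products for products. *)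
Definition sc (f : coefs) : coefs := fun n phi a => a * f n phi a.
Definition A3s (k : coeffs) (e : coefs) : coefs := fun n phi a =>
  c0 k * conv (sc e) (conv (sc e) (sc e)) n phi a +
  c1 k * cs phi * conv (sc e) (sc e) n phi a +
  (c2 k * cs phi ^ 2 + c3 k * sn phi) * sc e n phi a +
  monom0 (fun phi _ => c4 k * cs phi ^ 3 + c5 k * cs phi * sn phi) n phi a.
Definition B2s (k : coeffs) (e : coefs) : coefs := fun n phi a =>
  b0 k * conv (sc e) (sc e) n phi a + b1 k * cs phi * sc e n phi a +
  monom0 (fun phi _ => b2 k * cs phi ^ 2 + b3 k * sn phi) n phi a.
Definition Ns (k : coeffs) (e : coefs) : coefs := fun n phi a =>
  cs phi ^ 3 * B2s k e n phi a - sn phi * A3s k e n phi a.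
Definition Qs (k : coeffs) (e : coefs) : coefs := fun n phi a =>
  cs phi * A3s k e n phi a + 2 * sn phi * B2s k e n phi a.

(** Integrated form of E' = sign * e * E * w with E = 1 at angle 0: the factor e lets degree n + 1
    depend on degree n of the product. *)
Definition next_exp (sign : R) (e w : coefs) : coefs := fun n =>
  match n with
  | O => fun _ _ => 1
  | S m => fun phi a => sign * RInt (fun s => conv e w m s a) 0 phi
  end.

(** The equation w (1 + e Q) = kap N, solved for the coefficient of degree n; the factor e in front
    of Q leaves only lower degrees of w on the right. *)
Definition next_w (k : coeffs) (e w : coefs) : coefs := fun n phi a =>
  kap phi * Ns k e n phi a -
  match n with O => 0 | S m => conv w (Qs k e) m phi a end.

Definition state : Type := nat -> (R -> R -> R) * (R -> R -> R) * (R -> R -> R).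
Definition st_e (s : state) : coefs := fun n => fst (fst (s n)).
Definition st_r (s : state) : coefs := fun n => snd (fst (s n)).
Definition st_w (s : state) : coefs := fun n => snd (s n).

(** The third component is computed from the updated exponential, because degree n of w involves
    degree n of E. As the latter is determined by lower degrees, [next] still looks only at degrees
    below n. *)
Definition next (k : coeffs) (s : state) : state := fun n =>
  (next_exp (-1) (st_e s) (st_w s) n, next_exp 1 (st_r s) (st_w s) n,
   next_w k (next_exp (-1) (st_e s) (st_w s)) (st_w s) n).

(** * Dependence of each degree on lower degrees only, and existence of the coefficients *)

Lemma conv_local (f g f' g' : coefs) (n : nat) :
  (forall i, (i <= n)%nat -> f i = f' i) -> (forall i, (i <= n)%nat -> g i = g' i) ->
  conv f g n = conv f' g' n.
Proof.
intros Hf Hg; extensionality phi; extensionality a; unfold conv, PS_mult.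
apply sum_eq; intros i Hi; rewrite Hf, Hg by lia; reflexivity.
Qed.

Lemma sc_local (f f' : coefs) (n : nat) : f n = f' n -> sc f n = sc f' n.
Proof. intros H; unfold sc; now rewrite H. Qed.

Lemma A3s_local (k : coeffs) (e e' : coefs) (n : nat) :
  (forall i, (i <= n)%nat -> e i = e' i) -> A3s k e n = A3s k e' n.
Proof.
intros H; unfold A3s.
assert (H2 : forall i, (i <= n)%nat -> conv (sc e) (sc e) i = conv (sc e') (sc e') i)
  by (intros; apply conv_local; intros; apply sc_local, H; lia).
rewrite H2, (sc_local e e') by auto.
rewrite (conv_local (sc e) _ (sc e') (conv (sc e') (sc e'))); auto.
intros; apply sc_local; auto.
Qed.

Lemma B2s_local (k : coeffs) (e e' : coefs) (n : nat) :
  (forall i, (i <= n)%nat -> e i = e' i) -> B2s k e n = B2s k e' n.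
Proof.
intros H; unfold B2s.
rewrite (conv_local (sc e) (sc e) (sc e') (sc e')), (sc_local e e'); auto;
  intros; apply sc_local; auto.
Qed.

Lemma Ns_local (k : coeffs) (e e' : coefs) (n : nat) :
  (forall i, (i <= n)%nat -> e i = e' i) -> Ns k e n = Ns k e' n.
Proof. intros H; unfold Ns; rewrite (A3s_local k e e'), (B2s_local k e e'); auto. Qed.

Lemma Qs_local (k : coeffs) (e e' : coefs) (n : nat) :
  (forall i, (i <= n)%nat -> e i = e' i) -> Qs k e n = Qs k e' n.
Proof. intros H; unfold Qs; rewrite (A3s_local k e e'), (B2s_local k e e'); auto. Qed.

Lemma next_exp_local (sign : R) (e w e' w' : coefs) (n : nat) :
  (forall i, (i < n)%nat -> e i = e' i) -> (forall i, (i < n)%nat -> w i = w' i) ->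
  next_exp sign e w n = next_exp sign e' w' n.
Proof.
destruct n as [| n]; intros He Hw; [reflexivity |]; simpl.
rewrite (conv_local e w e' w' n); auto; intros; [apply He | apply Hw]; lia.
Qed.

Lemma next_w_local (k : coeffs) (e w e' w' : coefs) (n : nat) :
  (forall i, (i <= n)%nat -> e i = e' i) -> (forall i, (i < n)%nat -> w i = w' i) ->
  next_w k e w n = next_w k e' w' n.
Proof.
intros He Hw; unfold next_w; rewrite (Ns_local k e e' n) by assumption.
destruct n as [| n]; [reflexivity |].
rewrite (conv_local w (Qs k e) w' (Qs k e') n); auto.
- intros; apply Hw; lia.
- intros; apply Qs_local; intros; apply He; lia.
Qed.

Lemma next_local (k : coeffs) (s s' : state) (n : nat) :
  (forall i, (i < n)%nat -> s i = s' i) -> next k s n = next k s' n.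
Proof.
intros H; unfold next.
assert (He : forall i, (i < n)%nat -> st_e s i = st_e s' i)
  by (intros; unfold st_e; now rewrite H).
assert (Hr : forall i, (i < n)%nat -> st_r s i = st_r s' i)
  by (intros; unfold st_r; now rewrite H).
assert (Hw : forall i, (i < n)%nat -> st_w s i = st_w s' i)
  by (intros; unfold st_w; now rewrite H).
rewrite (next_exp_local (-1) (st_e s) (st_w s) (st_e s') (st_w s')) by auto.
rewrite (next_exp_local 1 (st_r s) (st_w s) (st_r s') (st_w s')) by auto.
f_equal; apply next_w_local; auto.
intros; apply next_exp_local; intros; [apply He | apply Hw]; lia.
Qed.

Definition start : state := fun _ => (fun _ _ => 0, fun _ _ => 0, fun _ _ => 0).
(** The fixed point of [next], obtained by iteration in place of a course-of-values recursion: after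
    n + 1 passes the coefficients up to degree n no longer change, whatever the starting state. *)
Definition sol (k : coeffs) : state := fun n =>
  Nat.iter (S n) (next k) start n.

Lemma iter_sol (k : coeffs) (n m : nat) :
  (n < m)%nat -> Nat.iter m (next k) start n = sol k n.
Proof.
revert m; induction n as [n IH] using lt_wf_ind; intros [| m] Hm; [lia |].
unfold sol; simpl Nat.iter; apply next_local; intros i Hi.
rewrite !IH by lia; reflexivity.
Qed.

Lemma sol_fix (k : coeffs) (n : nat) : sol k n = next k (sol k) n.
Proof.
unfold sol at 1; simpl Nat.iter; apply next_local; intros; now apply iter_sol.
Qed.

(* The solution with [u = a * E] and [1 / u = R / a], where [E = R = 1] at
   [phi = 0], satisfies [E' = - e E w] and [R' = e R w]. *)
Definition ce (k : coeffs) : coefs := st_e (sol k).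
Definition cr (k : coeffs) : coefs := st_r (sol k).
Definition cw (k : coeffs) : coefs := st_w (sol k).

Lemma ce_fix (k : coeffs) (n : nat) : ce k n = next_exp (-1) (ce k) (cw k) n.
Proof. unfold ce at 1, st_e; now rewrite sol_fix. Qed.

Lemma cr_fix (k : coeffs) (n : nat) : cr k n = next_exp 1 (cr k) (cw k) n.
Proof. unfold cr at 1, st_r; now rewrite sol_fix. Qed.

Lemma cw_fix (k : coeffs) (n : nat) : cw k n = next_w k (ce k) (cw k) n.
Proof.
unfold cw at 1, st_w; rewrite sol_fix; simpl.
apply next_w_local; auto; intros; now rewrite ce_fix.
Qed.

(** Continuity in the angle guarantees that the integrals in [next_exp] exist; it is proved along
    the same recursion, hence the bound on the degree. *)
Definition cont (f : coefs) (n : nat) : Prop :=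
  forall i, (i < n)%nat -> forall a phi, continuous (fun s => f i s a) phi.

Lemma cont_conv (f g : coefs) (n : nat) : cont f n -> cont g n -> cont (conv f g) n.
Proof.
intros Hf Hg i Hi a phi; unfold conv, PS_mult.
assert (H : forall m, (m <= i)%nat -> continuous
  (fun s => sum_f_R0 (fun j => f j s a * g (i - j)%nat s a) m) phi).
{ induction m as [| m IH]; intros Hm; simpl.
  - apply (continuous_mult (K := R_AbsRing)); [apply Hf | apply Hg]; lia.
  - apply (continuous_plus (V := R_NormedModule)); [apply IH; lia |].
    apply (continuous_mult (K := R_AbsRing)); [apply Hf | apply Hg]; lia. }
now apply H.
Qed.

Lemma continuous_of_derive (f df : R -> R) (x : R) :
  (forall x, is_derive f x (df x)) -> continuous f x.
Proof. intros H; apply (ex_derive_continuous f); eexists; apply H. Qed.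

Lemma continuous_cs (x : R) : continuous cs x.
Proof. apply (continuous_of_derive _ _ _ is_derive_cs). Qed.
Lemma continuous_sn (x : R) : continuous sn x.
Proof. apply (continuous_of_derive _ _ _ is_derive_sn). Qed.
Lemma continuous_kap (x : R) : continuous kap x.
Proof. apply (continuous_of_derive _ _ _ is_derive_kap). Qed.

Lemma continuous_Rplus {U : UniformSpace} (f g : U -> R) (x : U) :
  continuous f x -> continuous g x -> continuous (fun y => f y + g y) x.
Proof. apply (continuous_plus (V := R_NormedModule)). Qed.
Lemma continuous_Rminus {U : UniformSpace} (f g : U -> R) (x : U) :
  continuous f x -> continuous g x -> continuous (fun y => f y - g y) x.
Proof. apply (continuous_minus (V := R_NormedModule)). Qed.
Lemma continuous_Ropp {U : UniformSpace} (f : U -> R) (x : U) :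
  continuous f x -> continuous (fun y => - f y) x.
Proof. apply (continuous_opp (V := R_NormedModule)). Qed.
Lemma continuous_Rmult {U : UniformSpace} (f g : U -> R) (x : U) :
  continuous f x -> continuous g x -> continuous (fun y => f y * g y) x.
Proof. apply (continuous_mult (K := R_AbsRing)). Qed.
Lemma continuous_pow {U : UniformSpace} (f : U -> R) (n : nat) (x : U) :
  continuous f x -> continuous (fun y => f y ^ n) x.
Proof.
intros H; induction n as [| n IH]; [apply continuous_const |].
now apply continuous_Rmult.
Qed.

Ltac cont_step :=
  match goal with
  | H : ?G |- ?G => exact H
  | |- continuous (fun _ => ?c) _ => apply continuous_const
  | |- continuous (fun x => x) _ => apply continuous_id
  | |- continuous (fun x => cs x) _ => apply continuous_cs
  | |- continuous (fun x => sn x) _ => apply continuous_sn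
  | |- continuous (fun x => kap x) _ => apply continuous_kap
  | |- continuous (fun x => @?f x + @?g x) _ => apply (continuous_Rplus f g)
  | |- continuous (fun x => @?f x - @?g x) _ => apply (continuous_Rminus f g)
  | |- continuous (fun x => - @?f x) _ => apply (continuous_Ropp f)
  | |- continuous (fun x => @?f x * @?g x) _ => apply (continuous_Rmult f g)
  | |- continuous (fun x => @?f x ^ ?n) _ => apply (continuous_pow f n)
  end.

Lemma cont_A3s (k : coeffs) (e : coefs) (n : nat) : cont e n -> cont (A3s k e) n.
Proof.
intros He.
assert (H1 : cont (sc e) n).
{ intros i Hi a phi; unfold sc; apply continuous_Rmult;
    [apply continuous_const | now apply He]. }
assert (H2 := cont_conv _ _ _ H1 H1).
assert (H3 := cont_conv _ _ _ H1 H2).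
intros i Hi a phi; specialize (H1 i Hi a phi); specialize (H2 i Hi a phi);
  specialize (H3 i Hi a phi).
unfold A3s; destruct i; cbv beta iota delta [monom0]; repeat cont_step.
Qed.

Lemma cont_B2s (k : coeffs) (e : coefs) (n : nat) : cont e n -> cont (B2s k e) n.
Proof.
intros He.
assert (H1 : cont (sc e) n).
{ intros i Hi a phi; unfold sc; apply continuous_Rmult;
    [apply continuous_const | now apply He]. }
assert (H2 := cont_conv _ _ _ H1 H1).
intros i Hi a phi; specialize (H1 i Hi a phi); specialize (H2 i Hi a phi).
unfold B2s; destruct i; cbv beta iota delta [monom0]; repeat cont_step.
Qed.

Lemma ex_RInt_cont (f : R -> R) (x y : R) : (forall z, continuous f z) -> ex_RInt f x y.
Proof. intros H; apply (ex_RInt_continuous (V := R_CompleteNormedModule)); auto. Qed.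

Lemma is_derive_RInt_cont (f : R -> R) (x y : R) :
  (forall z, continuous f z) -> is_derive (fun s => RInt f x s) y (f y).
Proof.
intros H; apply (is_derive_RInt f (fun s => RInt f x s) x); [| apply H].
apply filter_forall; intros z; apply (RInt_correct (V := R_CompleteNormedModule)).
now apply ex_RInt_cont.
Qed.

Lemma cont_next_exp (sign : R) (e w : coefs) (n : nat) :
  cont e n -> cont w n -> cont (next_exp sign e w) (S n).
Proof.
intros He Hw [| i] Hi a phi; simpl; [apply continuous_const |].
assert (Hc := fun x => cont_conv _ _ _ He Hw i ltac:(lia) a x).
apply continuous_Rmult; [apply continuous_const |].
apply (ex_derive_continuous (fun s => RInt (fun t => conv e w i t a) 0 s)).
eexists; now apply is_derive_RInt_cont.
Qed.

Lemma cont_next_w (k : coeffs) (e w : coefs) (n : nat) :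
  cont e (S n) -> cont w n -> cont (next_w k e w) (S n).
Proof.
intros He Hw i Hi a phi.
assert (HA : cont (A3s k e) (S n)) by now apply cont_A3s.
assert (HB : cont (B2s k e) (S n)) by now apply cont_B2s.
assert (HQ : cont (Qs k e) n).
{ intros j Hj b x; assert (HA' := HA j ltac:(lia) b x);
    assert (HB' := HB j ltac:(lia) b x); unfold Qs; repeat cont_step. }
assert (HA' := HA i Hi a phi); assert (HB' := HB i Hi a phi).
unfold next_w, Ns; destruct i as [| i]; repeat cont_step.
apply (cont_conv w (Qs k e) n); auto; lia.
Qed.

Lemma cont_sol (k : coeffs) (n : nat) : cont (ce k) n /\ cont (cr k) n /\ cont (cw k) n.
Proof.
induction n as [| n (He & Hr & Hw)].
- repeat split; intros i Hi; lia.
- assert (He' : cont (ce k) (S n)).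
  { intros i Hi a phi; rewrite ce_fix; revert i Hi a phi; now apply cont_next_exp. }
  repeat split; auto; intros i Hi a phi.
  + rewrite cr_fix; revert i Hi a phi; now apply cont_next_exp.
  + rewrite cw_fix; revert i Hi a phi; now apply cont_next_w.
Qed.

(** * Summation *)

Lemma geom_term (a : nat -> R) (K r e : R) (n : nat) :
  0 < r -> Rabs e <= / (2 * r) -> (forall n, Rabs (a n) <= K * r ^ n) ->
  Rabs (a n * e ^ n) <= K * (/ 2) ^ n.
Proof.
intros Hr He Ha.
assert (HK : 0 <= K).
{ specialize (Ha O); simpl in Ha; generalize (Rabs_pos (a O)); lra. }
apply Rle_trans with (K * r ^ n * (/ (2 * r)) ^ n).
- apply Rabs_mult_le; [apply Ha |].
  rewrite <- RPow_abs; apply pow_incr; split; [apply Rabs_pos | assumption].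
- rewrite Rmult_assoc, <- Rpow_mult_distr.
  replace (r * / (2 * r)) with (/ 2) by (field; lra); lra.
Qed.

Lemma geom_half (K : R) : is_series (fun n => K * (/ 2) ^ n) (2 * K).
Proof.
evar_last.
- apply (is_series_scal (K := R_AbsRing) (V := R_NormedModule) K (fun n => (/ 2) ^ n)); apply is_series_geom; rewrite Rabs_pos_eq; lra.
- unfold scal; simpl; unfold mult; simpl; field.
Qed.

Lemma ex_pseries_geom (a : nat -> R) (K r e : R) :
  0 < r -> Rabs e <= / (2 * r) -> (forall n, Rabs (a n) <= K * r ^ n) ->
  ex_series (fun n => Rabs (a n * e ^ n)).
Proof.
intros Hr He Ha; apply (ex_series_le (K := R_AbsRing) (V := R_CompleteNormedModule) _ (fun n => K * (/ 2) ^ n)).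
- intros n; unfold norm; simpl; unfold abs; simpl; rewrite Rabs_Rabsolu.
  now apply geom_term with r.
- eexists; apply geom_half.
Qed.

Lemma PSeries_geom_bound (a : nat -> R) (K r e : R) :
  0 < r -> Rabs e <= / (2 * r) -> (forall n, Rabs (a n) <= K * r ^ n) ->
  Rabs (PSeries a e) <= 2 * K.
Proof.
intros Hr He Ha; unfold PSeries.
eapply Rle_trans; [apply Series_Rabs; now apply ex_pseries_geom with K r |].
rewrite <- (is_series_unique _ _ (geom_half K)).
apply Series_le; [| eexists; apply geom_half].
intros n; split; [apply Rabs_pos | now apply geom_term with r].
Qed.

Lemma CV_radius_geom (a : nat -> R) (K r e : R) :
  0 < r -> Rabs e <= / (2 * r) -> (forall n, Rabs (a n) <= K * r ^ n) ->
  Rbar_lt (Rabs e) (CV_radius a).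
Proof.
intros Hr He Ha; apply Rbar_lt_le_trans with (/ r).
- simpl; apply Rle_lt_trans with (1 := He), Rinv_lt_contravar; nra.
- apply CV_radius_bounded; exists K; intros n.
  assert (E : K * r ^ n * (/ r) ^ n = K)
    by (rewrite Rmult_assoc, <- Rpow_mult_distr, Rinv_r, pow1; lra).
  rewrite <- E; apply Rabs_mult_le; [apply Ha |].
  rewrite Rabs_pos_eq; [lra | apply pow_le, Rlt_le, Rinv_0_lt_compat, Hr].
Qed.

(** A quadratic error suffices for differentiability. It is the form in which Lipschitz bounds on
    the derivatives of the terms can be summed over a series. *)
Lemma is_derive_quadratic (f : R -> R) (x l K d : R) :
  0 < d ->
  (forall y, Rabs (y - x) < d -> Rabs (f y - f x - l * (y - x)) <= K * (y - x) ^ 2) ->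
  is_derive f x l.
Proof.
intros Hd H; apply is_derive_Reals; intros eps Heps.
assert (HK := Rabs_pos K).
assert (Hm : 0 < Rmin d (eps / (Rabs K + 1))).
{ apply Rmin_pos; [assumption | apply Rdiv_lt_0_compat; lra]. }
exists (mkposreal _ Hm); intros h Hh Hhd; simpl in Hhd.
assert (Hhp := Rabs_pos_lt h Hh).
specialize (H (x + h)); replace (x + h - x) with h in H by ring.
specialize (H ltac:(apply Rlt_le_trans with (1 := Hhd), Rmin_l)).
replace ((f (x + h) - f x) / h - l) with ((f (x + h) - f x - l * h) / h)
  by (field; assumption).
unfold Rdiv; rewrite Rabs_mult, Rabs_inv.
apply (Rmult_lt_reg_r (Rabs h)); [assumption |].
rewrite Rmult_assoc, Rinv_l, Rmult_1_r by lra.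
apply Rle_lt_trans with (Rabs K * Rabs h * Rabs h).
- eapply Rle_trans; [exact H |].
  replace (h ^ 2) with (Rabs h * Rabs h) by (rewrite <- (pow2_abs h); ring).
  rewrite <- Rmult_assoc; repeat apply Rmult_le_compat_r; try lra; apply Rle_abs.
- apply Rmult_lt_compat_r; [assumption |].
  assert (Rabs h < eps / (Rabs K + 1)) by (apply Rlt_le_trans with (1 := Hhd), Rmin_r).
  apply (Rmult_lt_compat_l (Rabs K + 1)) in H0; [| lra].
  replace ((Rabs K + 1) * (eps / (Rabs K + 1))) with eps in H0 by (field; lra).
  nra.
Qed.

Lemma wt_le_pow (r : R) (n : nat) : 0 < r -> wt r n <= r ^ n.
Proof.
intros Hr; unfold wt; assert (Hn := pos_INR n).
rewrite <- (Rmult_1_r (r ^ n)) at 2; apply Rmult_le_compat_l.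
- now apply pow_le, Rlt_le.
- rewrite <- Rinv_1; apply Rinv_le_contravar; nra.
Qed.

Definition ser (f : coefs) (phi a e : R) : R := PSeries (fun n => f n phi a) e.

Definition shift (f : coefs) : coefs := fun n => f (S n).

Definition gmaj (U r : R) (f : coefs) (K : R) : Prop :=
  forall n, bnd U (f n) (K * r ^ n).

Lemma gmaj_maj (U r : R) (f : coefs) (K : R) :
  0 < r -> 0 <= K -> (forall N, maj U r N f K) -> gmaj U r f K.
Proof.
intros Hr HK H n; eapply bnd_le; [apply (H (S n)); lia |].
apply Rmult_le_compat_l; [assumption | now apply wt_le_pow].
Qed.

Lemma gmaj_shift (U r : R) (f : coefs) (K : R) :
  gmaj U r f K -> gmaj U r (shift f) (K * r).
Proof. intros H n; rewrite Rmult_assoc; apply (H (S n)). Qed.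

Lemma gmaj_sup (U r : R) (f : coefs) (K phi a : R) :
  gmaj U r f K -> in_dom U phi a -> forall n, Rabs (f n phi a) <= K * r ^ n.
Proof. intros H D n; now apply bnd_sup with U. Qed.

Lemma ser_CV (U r : R) (f : coefs) (K phi a e : R) :
  0 < r -> Rabs e <= / (2 * r) -> gmaj U r f K -> in_dom U phi a ->
  Rbar_lt (Rabs e) (CV_radius (fun n => f n phi a)).
Proof. intros; apply CV_radius_geom with K r; auto; now apply gmaj_sup with U. Qed.

Lemma ser_sup (U r : R) (f : coefs) (K phi a e : R) :
  0 < r -> Rabs e <= / (2 * r) -> gmaj U r f K -> in_dom U phi a ->
  Rabs (ser f phi a e) <= 2 * K.
Proof. intros; apply PSeries_geom_bound with r; auto; now apply gmaj_sup with U. Qed.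

Lemma ser_lip (U r : R) (f : coefs) (K phi a phi' a' e : R) :
  0 < r -> Rabs e <= / (2 * r) -> gmaj U r f K -> in_dom U phi a -> in_dom U phi' a' ->
  Rabs (ser f phi a e - ser f phi' a' e) <=
    2 * K * (Rabs (phi - phi') + Rabs (a - a')).
Proof.
intros Hr He Hf D D'; unfold ser.
rewrite <- PSeries_minus; try (apply CV_radius_inside; now apply ser_CV with U r K).
rewrite Rmult_assoc; apply PSeries_geom_bound with r; auto; intros n.
unfold PS_minus, PS_plus, PS_opp, plus, opp; simpl.
replace (K * (Rabs (phi - phi') + Rabs (a - a')) * r ^ n) with
  (K * r ^ n * (Rabs (phi - phi') + Rabs (a - a'))) by ring.
now apply bnd_lip with U.
Qed.

Lemma ser_conv (U r : R) (f g : coefs) (K L phi a e : R) :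
  0 < r -> Rabs e <= / (2 * r) -> gmaj U r f K -> gmaj U r g L -> in_dom U phi a ->
  ser (conv f g) phi a e = ser f phi a e * ser g phi a e.
Proof.
intros; unfold ser, conv; apply PSeries_mult; eapply ser_CV; eassumption.
Qed.

Lemma ser_shift (U r : R) (f : coefs) (K phi a e : R) :
  0 < r -> Rabs e <= / (2 * r) -> gmaj U r f K -> in_dom U phi a ->
  ser f phi a e = f O phi a + e * ser (shift f) phi a e.
Proof.
intros; unfold ser; rewrite PSeries_decr_1.
- reflexivity.
- apply CV_radius_inside; eapply ser_CV; eassumption.
Qed.

(** In each degree the first order Taylor error is the integral of g(s) - g(phi) from phi to y. The
    Lipschitz bound makes it at most L r^n (y - phi)^2, and these bounds sum to a quadratic error of
    the series. *)
Lemma ser_derive (U r : R) (f g : coefs) (K L phi a e : R) :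
  0 < r -> Rabs e <= / (2 * r) -> gmaj U r f K -> gmaj U r g L ->
  Rabs phi < 9 -> Rabs a <= U ->
  (forall n x, continuous (fun s => g n s a) x) ->
  (forall n x, f n x a = f n 0 a + RInt (fun s => g n s a) 0 x) ->
  is_derive (fun x => ser f x a e) phi (ser g phi a e).
Proof.
intros Hr He Hf Hg Hphi Ha Hc Hint.
apply is_derive_quadratic with (2 * L) (9 - Rabs phi); [lra |].
intros y Hy.
assert (Dphi : in_dom U phi a) by (split; lra).
assert (Dy : in_dom U y a).
{ split; [| assumption]; replace y with (phi + (y - phi)) by ring.
  eapply Rle_trans; [apply Rabs_triang | lra]. }
unfold ser; rewrite (Rmult_comm _ (y - phi)), <- PSeries_scal.
assert (ex : forall h M x, gmaj U r h M -> in_dom U x a ->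
  ex_pseries (fun n => h n x a) e).
{ intros h M x Hh D; apply CV_radius_inside; eapply ser_CV; eassumption. }
rewrite <- PSeries_minus by eauto.
rewrite <- PSeries_minus;
  [| apply ex_pseries_minus; eauto | apply (ex_pseries_scal (y - phi));
     [apply Rmult_comm | eauto]].
rewrite Rmult_assoc; apply PSeries_geom_bound with r; auto; intros n.
unfold PS_minus, PS_plus, PS_opp, PS_scal, plus, opp, scal; simpl; unfold mult; simpl.
rewrite (Hint n y), (Hint n phi).
assert (Hi : forall u v, ex_RInt (fun s => g n s a) u v)
  by (intros; now apply ex_RInt_cont).
replace (f n 0 a + RInt (fun s => g n s a) 0 y + - (f n 0 a +
   RInt (fun s => g n s a) 0 phi) + - ((y - phi) * g n phi a)) with
  (RInt (fun s => g n s a - g n phi a) phi y).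
- apply Rle_trans with (L * r ^ n * Rabs (y - phi) * Rabs (y - phi)).
  + apply RInt_bound.
    { intros z; apply continuous_Rminus; [apply Hc | apply continuous_const]. }
    intros z Hz; eapply Rle_trans.
    { apply (bnd_lip U (g n) (L * r ^ n)); [apply Hg | | assumption].
      now apply in_dom_between with phi y. }
    apply Rmult_le_compat_l; [eapply bnd_nonneg; apply Hg |].
    rewrite Rminus_diag, Rabs_R0, Rplus_0_r.
    revert Hz; unfold Rmin, Rmax; destruct (Rle_dec phi y); intros Hz.
    * rewrite !Rabs_pos_eq; lra.
    * rewrite !Rabs_left1; lra.
  + apply Req_le; transitivity (L * r ^ n * (y - phi) ^ 2); [rewrite <- pow2_abs |]; ring.
- rewrite (RInt_minus (fun s => g n s a) (fun _ => g n phi a)) by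
    (auto; apply ex_RInt_const).
  rewrite RInt_const.
  rewrite <- (RInt_Chasles (fun s => g n s a) 0 phi y) by auto.
  unfold minus, plus, opp, scal; simpl; unfold mult; simpl; ring.
Qed.

Lemma ser_scal (c : R -> R -> R) (f : coefs) (phi a e : R) :
  ser (fun n phi a => c phi a * f n phi a) phi a e = c phi a * ser f phi a e.
Proof. unfold ser; now rewrite <- PSeries_scal. Qed.

Lemma ser_plus (U r : R) (f g : coefs) (K L phi a e : R) :
  0 < r -> Rabs e <= / (2 * r) -> gmaj U r f K -> gmaj U r g L -> in_dom U phi a ->
  ser (fun n phi a => f n phi a + g n phi a) phi a e = ser f phi a e + ser g phi a e.
Proof.
intros; unfold ser; rewrite <- PSeries_plus.
- reflexivity.
- apply CV_radius_inside; eapply (ser_CV U r f); eassumption.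
- apply CV_radius_inside; eapply (ser_CV U r g); eassumption.
Qed.

Lemma ser_monom0 (c : R -> R -> R) (phi a e : R) : ser (monom0 c) phi a e = c phi a.
Proof.
unfold ser; rewrite PSeries_decr_1.
- change (c phi a + e * PSeries (fun _ => 0) e = c phi a).
  rewrite PSeries_const_0; ring.
- apply CV_radius_inside; apply CV_radius_geom with (Rabs (c phi a)) (/ (2 * (Rabs e + 1))).
  + apply Rinv_0_lt_compat; generalize (Rabs_pos e); lra.
  + rewrite Rinv_mult, Rinv_inv; generalize (Rabs_pos e); lra.
  + assert (Hr : 0 < / (2 * (Rabs e + 1)))
      by (apply Rinv_0_lt_compat; generalize (Rabs_pos e); lra).
    intros [| n]; simpl; [lra |]; rewrite Rabs_R0.
    apply Rmult_le_pos; [apply Rabs_pos | apply (pow_le _ (S n)); lra].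
Qed.

(** * Operators on series together with the functions that they sum to *)

Definition bd (U : R) (f : R -> R -> R) : Prop := exists K, bnd U f K.

Lemma bd_const (U c : R) : bd U (fun _ _ => c).
Proof. eexists; apply bnd_const. Qed.
Lemma bd_plus (U : R) (f g : R -> R -> R) :
  bd U f -> bd U g -> bd U (fun phi a => f phi a + g phi a).
Proof. intros [K HK] [L HL]; eexists; apply bnd_plus; eassumption. Qed.
Lemma bd_minus (U : R) (f g : R -> R -> R) :
  bd U f -> bd U g -> bd U (fun phi a => f phi a - g phi a).
Proof. intros [K HK] [L HL]; eexists; apply bnd_minus; eassumption. Qed.
Lemma bd_mult (U : R) (f g : R -> R -> R) :
  bd U f -> bd U g -> bd U (fun phi a => f phi a * g phi a).
Proof. intros [K HK] [L HL]; eexists; apply bnd_mult; eassumption. Qed.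
Lemma bd_pow (U : R) (f : R -> R -> R) (n : nat) :
  bd U f -> bd U (fun phi a => f phi a ^ n).
Proof. intros H; induction n as [| n IH]; [apply (bd_const U 1) | now apply (bd_mult U f (fun phi a => f phi a ^ n))]. Qed.
Lemma bd_cs (U : R) : bd U (fun phi _ => cs phi).
Proof. eexists; apply (bnd_angle U cs 1 2); auto using cs_bound, cs_lipschitz; lra. Qed.
Lemma bd_sn (U : R) : bd U (fun phi _ => sn phi).
Proof. eexists; apply (bnd_angle U sn 1 2); auto using sn_bound, sn_lipschitz; lra. Qed.
Lemma bd_kap (U : R) : bd U (fun phi _ => kap phi).
Proof. eexists; apply (bnd_angle U kap 2 8); auto using kap_bound, kap_lipschitz; lra. Qed.

Ltac bd_tac := repeat first [ assumption | apply bd_cs | apply bd_sn | apply bd_kap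
  | apply bd_const | apply bd_pow | apply bd_minus | apply bd_plus | apply bd_mult ].

(* The series operator [T] has a majorant which depends on [e] only through the
   majorant [1] of [e], and the sum of [T e] is [F] applied to the sum of [e]. *)
Definition sums_to (U : R) (T : coefs -> coefs) (F : R -> R -> R -> R) : Prop :=
  exists K, 0 <= K /\
    (forall r N e, 0 < r -> maj U r N e 1 -> maj U r N (T e) K) /\
    (forall r e x, 0 < r -> (forall N, maj U r N e 1) -> Rabs x <= / (2 * r) ->
       forall phi a, in_dom U phi a -> ser (T e) phi a x = F phi a (ser e phi a x)).

Lemma sums_to_gmaj (U r K : R) (T : coefs -> coefs) (e : coefs) :
  0 < r -> 0 <= K -> (forall r N e, 0 < r -> maj U r N e 1 -> maj U r N (T e) K) ->
  (forall N, maj U r N e 1) -> gmaj U r (T e) K.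
Proof. intros; apply gmaj_maj; auto. Qed.

Lemma sums_to_plus (U : R) (T T' : coefs -> coefs) (F F' : R -> R -> R -> R) :
  sums_to U T F -> sums_to U T' F' ->
  sums_to U (fun e n phi a => T e n phi a + T' e n phi a)
    (fun phi a E => F phi a E + F' phi a E).
Proof.
intros (K & HK & H1 & H2) (L & HL & G1 & G2); exists (K + L); repeat split.
- lra.
- intros; apply maj_plus; auto.
- intros r e x Hr He Hx phi a D; rewrite <- (H2 r e x), <- (G2 r e x) by auto.
  apply (ser_plus U r _ _ K L); auto; now apply sums_to_gmaj.
Qed.

Lemma sums_to_scal (U : R) (c : R -> R -> R) (T : coefs -> coefs) (F : R -> R -> R -> R) :
  bd U c -> sums_to U T F ->
  sums_to U (fun e n phi a => c phi a * T e n phi a) (fun phi a E => c phi a * F phi a E).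
Proof.
intros [L Hc] (K & HK & H1 & H2); exists (L * K); repeat split.
- apply Rmult_le_pos; [eapply bnd_nonneg; eassumption | assumption].
- intros; apply maj_scal; auto.
- intros r e x Hr He Hx phi a D; rewrite <- (H2 r e x) by auto; apply ser_scal.
Qed.

Lemma sums_to_conv (U : R) (T T' : coefs -> coefs) (F F' : R -> R -> R -> R) :
  sums_to U T F -> sums_to U T' F' ->
  sums_to U (fun e => conv (T e) (T' e)) (fun phi a E => F phi a E * F' phi a E).
Proof.
intros (K & HK & H1 & H2) (L & HL & G1 & G2); exists (8 * K * L); repeat split.
- nra.
- intros; apply maj_conv; auto.
- intros r e x Hr He Hx phi a D; rewrite <- (H2 r e x), <- (G2 r e x) by auto.
  apply (ser_conv U r _ _ K L); auto; now apply sums_to_gmaj.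
Qed.

Lemma sums_to_monom0 (U : R) (c : R -> R -> R) :
  bd U c -> sums_to U (fun _ => monom0 c) (fun phi a _ => c phi a).
Proof.
intros [K Hc]; exists K; repeat split.
- eapply bnd_nonneg; eassumption.
- intros; now apply maj_monom0.
- intros; apply ser_monom0.
Qed.

Lemma sums_to_ext (U : R) (T T' : coefs -> coefs) (F F' : R -> R -> R -> R) :
  (forall e n phi a, T e n phi a = T' e n phi a) ->
  (forall phi a E, F phi a E = F' phi a E) -> sums_to U T F -> sums_to U T' F'.
Proof.
intros HT HF; replace T' with T.
{ intros (K & HK & H1 & H2); exists K; repeat split; auto.
  intros; rewrite <- HF; eauto. }
extensionality e; extensionality n; extensionality phi; extensionality a; apply HT.
Qed.

Lemma sums_to_sc (U : R) : 0 <= U -> sums_to U sc (fun _ a E => a * E).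
Proof.
intros HU; apply (sums_to_scal U (fun _ a => a) (fun e => e) (fun _ _ E => E)).
- eexists; now apply bnd_radius.
- exists 1; repeat split; auto; lra.
Qed.

Lemma sums_to_A3s (U : R) (k : coeffs) : 0 <= U ->
  sums_to U (A3s k) (fun phi a E => A3 k phi (a * E)).
Proof.
intros HU; assert (H := sums_to_sc U HU).
assert (H2 := sums_to_conv U _ _ _ _ H H).
assert (H3 := sums_to_conv U _ _ _ _ H H2).
eapply sums_to_ext; [reflexivity | |
  apply sums_to_plus; [apply sums_to_plus; [apply sums_to_plus |] |];
  [ apply (sums_to_scal U (fun _ _ => c0 k)); [bd_tac | exact H3]
  | apply (sums_to_scal U (fun phi _ => c1 k * cs phi)); [bd_tac | exact H2]
  | apply (sums_to_scal U (fun phi _ => c2 k * cs phi ^ 2 + c3 k * sn phi));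
    [bd_tac | exact H]
  | apply sums_to_monom0; bd_tac ]].
intros; unfold A3; simpl; ring.
Qed.

Lemma sums_to_B2s (U : R) (k : coeffs) : 0 <= U ->
  sums_to U (B2s k) (fun phi a E => B2 k phi (a * E)).
Proof.
intros HU; assert (H := sums_to_sc U HU).
assert (H2 := sums_to_conv U _ _ _ _ H H).
eapply sums_to_ext; [reflexivity | |
  apply sums_to_plus; [apply sums_to_plus |];
  [ apply (sums_to_scal U (fun _ _ => b0 k)); [bd_tac | exact H2]
  | apply (sums_to_scal U (fun phi _ => b1 k * cs phi)); [bd_tac | exact H]
  | apply sums_to_monom0; bd_tac ]].
intros; unfold B2; simpl; ring.
Qed.

Lemma sums_to_Qs (U : R) (k : coeffs) : 0 <= U ->
  sums_to U (Qs k) (fun phi a E => Qf k phi (a * E)).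
Proof.
intros HU; apply (sums_to_plus U (fun e n phi a => cs phi * A3s k e n phi a)
  (fun e n phi a => 2 * sn phi * B2s k e n phi a)
  (fun phi a E => cs phi * A3 k phi (a * E))
  (fun phi a E => 2 * sn phi * B2 k phi (a * E))).
- apply (sums_to_scal U (fun phi _ => cs phi)); [bd_tac | now apply sums_to_A3s].
- apply (sums_to_scal U (fun phi _ => 2 * sn phi)); [bd_tac | now apply sums_to_B2s].
Qed.

Lemma sums_to_Ns (U : R) (k : coeffs) : 0 <= U ->
  sums_to U (Ns k) (fun phi a E => Nf k phi (a * E)).
Proof.
intros HU; eapply sums_to_ext; [| |
  apply (sums_to_plus U (fun e n phi a => cs phi ^ 3 * B2s k e n phi a)
    (fun e n phi a => (- 1 * sn phi) * A3s k e n phi a)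
    (fun phi a E => cs phi ^ 3 * B2 k phi (a * E))
    (fun phi a E => (- 1 * sn phi) * A3 k phi (a * E)))].
- intros; unfold Ns; ring.
- intros; unfold Nf; ring.
- apply (sums_to_scal U (fun phi _ => cs phi ^ 3)); [bd_tac | now apply sums_to_B2s].
- apply (sums_to_scal U (fun phi _ => - 1 * sn phi)); [bd_tac | now apply sums_to_A3s].
Qed.

(** * The majorant estimate and the resulting polar solution *)

Lemma wt_0 (r : R) : wt r 0 = 1.
Proof. unfold wt; simpl; field. Qed.

(** The constant 320 is 8 * 10 * 4: 8 for the Cauchy product, 10 for the integral and 4 / r for the
    shift of the degree. *)
Lemma maj_next_exp (U r sign K : R) (N : nat) (e w : coefs) :
  0 < r -> Rabs sign = 1 -> 0 <= K -> 320 * K <= r ->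
  (forall n a phi, (n < N)%nat -> continuous (fun s => conv e w n s a) phi) ->
  maj U r N e 1 -> maj U r N w K -> maj U r (S N) (next_exp sign e w) 1.
Proof.
intros Hr Hs HK HKr Hc He Hw [| n] Hn; simpl.
- rewrite wt_0, Rmult_1_r; eapply bnd_le; [apply bnd_const | rewrite Rabs_R1; lra].
- eapply bnd_le.
  + apply bnd_mult; [apply bnd_const |].
    apply bnd_RInt; [intros; apply Hc; lia |].
    apply (maj_conv U r N e w 1 K Hr); auto; lra || lia.
  + rewrite Hs; generalize (wt_shift r n Hr); intros Hsh.
    assert (H := wt_pos r (S n) Hr).
    apply Rle_trans with (80 * K * (4 / r * wt r (S n))).
    * apply Rle_trans with (80 * K * wt r n); [apply Req_le; ring |].
      apply Rmult_le_compat_l; lra.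
    * replace (80 * K * (4 / r * wt r (S n))) with
        (320 * K / r * wt r (S n)) by (field; lra).
      apply Rmult_le_compat_r; [lra |]; apply Rle_div_l; lra.
Qed.

(** Every term that feeds back into the recursion is shifted by one degree and so carries a factor 1
    / r; a large r makes these terms harmless. *)
Lemma sol_maj (U : R) (k : coeffs) : 0 <= U -> exists r K, 0 < r /\ 0 <= K /\
  forall N, maj U r N (ce k) 1 /\ maj U r N (cr k) 1 /\ maj U r N (cw k) K.
Proof.
intros HU.
destruct (sums_to_Ns U k HU) as (KN & HKN & HN & _).
destruct (sums_to_Qs U k HU) as (KQ & HKQ & HQ & _).
destruct (bd_kap U) as [Kk Hk]; assert (HKk := bnd_nonneg _ _ _ Hk).
(* The term kap N uses half of K. The feedback term is at most 32 K KQ / r, which fits into the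
   other half since r >= 64 KQ; 320 K is the demand of [maj_next_exp]. *)
set (K := 2 * (Kk * KN)); set (r := 320 * K + 64 * KQ + 1).
assert (HK : 0 <= K) by (unfold K; nra).
assert (Hr : 0 < r) by (unfold r; nra).
exists r, K; do 2 (split; [assumption |]).
induction N as [| N (He & Hrr & Hw)].
{ repeat split; intros n Hn; lia. }
destruct (cont_sol k N) as (Ce & Cr & Cw).
assert (He' : maj U r (S N) (ce k) 1).
{ intros n Hn; rewrite ce_fix; revert n Hn.
  apply (maj_next_exp U r (-1) K); auto; try (unfold r; lra).
  - rewrite Rabs_left; lra.
  - intros n a phi Hn; now apply (cont_conv (ce k) (cw k) N). }
repeat split; [assumption | |].
- intros n Hn; rewrite cr_fix; revert n Hn.
  apply (maj_next_exp U r 1 K); auto; try (unfold r; lra).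
  + apply Rabs_R1.
  + intros n a phi Hn; now apply (cont_conv (cr k) (cw k) N).
- intros n Hn; rewrite cw_fix; unfold next_w.
  assert (H1 : bnd U (fun phi a => kap phi * Ns k (ce k) n phi a)
    (Kk * KN * wt r n)).
  { rewrite Rmult_assoc; apply (bnd_mult U (fun phi _ => kap phi)); [exact Hk |].
    now apply (HN r (S N)). }
  eapply bnd_le with (Kk * KN * wt r n + Kk * KN * wt r n);
    [| apply Req_le; unfold K; ring].
  apply bnd_minus; [exact H1 |].
  assert (Hwn := wt_pos r n Hr).
  destruct n as [| n].
  + eapply bnd_le; [apply bnd_const |]; rewrite Rabs_R0.
    apply Rmult_le_pos; [nra | lra].
  + eapply bnd_le.
    * apply (maj_conv U r N (cw k) (Qs k (ce k)) K KQ); auto; lia.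
    * generalize (wt_shift r n Hr); intros Hsh.
      apply Rle_trans with (8 * K * KQ * (4 / r * wt r (S n))).
      { apply Rmult_le_compat_l; [| assumption]; nra. }
      replace (8 * K * KQ * (4 / r * wt r (S n))) with
        (32 * K * KQ / r * wt r (S n)) by (field; lra).
      apply Rmult_le_compat_r; [lra |]; apply Rle_div_l; [lra |].
      unfold r; assert (Kk * KN = K / 2) by (unfold K; field); nra.
Qed.

Lemma ser_next_exp_derive (U r K sign : R) (f w : coefs) (phi a e : R) :
  0 < r -> 0 <= K -> Rabs e <= / (2 * r) ->
  (forall N, maj U r N f 1) -> (forall N, maj U r N w K) ->
  (forall n, cont f n) -> (forall n, cont w n) ->
  (forall n, f n = next_exp sign f w n) -> Rabs phi < 9 -> Rabs a <= U ->
  is_derive (fun x => ser f x a e) phi (sign * e * ser f phi a e * ser w phi a e).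
Proof.
intros Hr HK He Hf Hw Cf Cw Hfix Hphi Ha.
assert (D : in_dom U phi a) by (split; lra).
assert (Gf : gmaj U r f 1) by (apply gmaj_maj; auto; lra).
assert (Gw : gmaj U r w K) by (apply gmaj_maj; auto; lra).
assert (Gc : gmaj U r (conv f w) (8 * 1 * K)).
{ apply gmaj_maj; auto; [lra |]; intros; apply maj_conv; auto; lra. }
(* The right-hand side of the equation has a factor e, so its coefficients are those of the product
   moved up by one degree. *)
set (g := fun n => match n with O => fun _ _ => 0
  | S m => fun x b => sign * conv f w m x b end).
assert (Gg : gmaj U r g (Rabs sign * (8 * 1 * K) / r)).
{ intros [| n]; simpl g.
  - eapply bnd_le; [apply bnd_const |]; rewrite Rabs_R0; simpl.
    rewrite Rmult_1_r; apply Rdiv_le_0_compat; [| assumption].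
    generalize (Rabs_pos sign); nra.
  - replace (Rabs sign * (8 * 1 * K) / r * r ^ S n) with
      (Rabs sign * (8 * 1 * K * r ^ n)) by (simpl; field; lra).
    apply bnd_mult; [apply bnd_const | apply Gc]. }
replace (sign * e * ser f phi a e * ser w phi a e) with (ser g phi a e).
- apply (ser_derive U r f g 1 (Rabs sign * (8 * 1 * K) / r)); auto.
  + intros [| n] x; simpl g; [apply continuous_const |].
    apply (continuous_Rmult (fun _ => sign)); [apply continuous_const |].
    apply (cont_conv f w (S n)); auto.
  + intros [| n] x; simpl g.
    * rewrite Hfix; simpl; rewrite RInt_const; unfold scal; simpl.
      unfold mult; simpl; ring.
    * rewrite Hfix; simpl.
      assert (ex : ex_RInt (fun s => conv f w n s a) 0 x).
      { apply ex_RInt_cont; intros z; apply (cont_conv f w (S n)); auto. }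
      rewrite RInt_point; unfold zero; simpl.
      assert (E := RInt_scal (fun s => conv f w n s a) 0 x sign ex).
      unfold scal in E; simpl in E; unfold mult in E; simpl in E.
      rewrite E; ring.
- rewrite (ser_shift U r g (Rabs sign * (8 * 1 * K) / r)) by assumption.
  simpl g; change (shift g) with (fun n x b => sign * conv f w n x b).
  rewrite (ser_scal (fun _ _ => sign)).
  rewrite (ser_conv U r f w 1 K) by auto; ring.
Qed.

Lemma ser_next_exp_0 (sign : R) (f w : coefs) (a e : R) :
  (forall n, f n = next_exp sign f w n) -> ser f 0 a e = 1.
Proof.
intros H; transitivity (ser (monom0 (fun _ _ => 1)) 0 a e); [| apply ser_monom0].
apply PSeries_ext; intros [| n]; rewrite H; simpl; [reflexivity |].
rewrite RInt_point; unfold zero; simpl; ring.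
Qed.

Definition Eser (k : coeffs) : R -> R -> R -> R := ser (ce k).
Definition Rser (k : coeffs) : R -> R -> R -> R := ser (cr k).
Definition wser (k : coeffs) : R -> R -> R -> R := ser (cw k).

Lemma polar_series (U : R) (k : coeffs) : 0 <= U -> exists e0 L, 0 < e0 /\ 0 <= L /\
  gmaj U (/ (2 * e0)) (cr k) 1 /\
  forall e, Rabs e <= e0 ->
  (forall phi a, Rabs phi < 9 -> Rabs a <= U ->
     is_derive (fun x => Eser k x a e) phi (- e * Eser k phi a e * wser k phi a e) /\
     is_derive (fun x => Rser k x a e) phi (e * Rser k phi a e * wser k phi a e)) /\
  (forall phi a, in_dom U phi a ->
     wser k phi a e = kap phi * Nf k phi (a * Eser k phi a e) -
       e * wser k phi a e * Qf k phi (a * Eser k phi a e)) /\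
  (forall a, Rabs a <= U -> Eser k 0 a e = 1 /\ Rser k 0 a e = 1) /\
  (forall phi a, in_dom U phi a -> Rbar_lt (Rabs e) (CV_radius (fun n => cr k n phi a))) /\
  (forall phi a, in_dom U phi a -> Rabs (Eser k phi a e - 1) <= L * Rabs e /\
     Rabs (Rser k phi a e - 1) <= L * Rabs e) /\
  (forall phi a phi' a', in_dom U phi a -> in_dom U phi' a' ->
     Rabs (Eser k phi a e - Eser k phi' a' e) <=
       L * Rabs e * (Rabs (phi - phi') + Rabs (a - a'))).
Proof.
intros HU; destruct (sol_maj U k HU) as (r & K & Hr & HK & Hmaj).
assert (He := fun N => proj1 (Hmaj N)).
assert (Hrr := fun N => proj1 (proj2 (Hmaj N))).
assert (Hw := fun N => proj2 (proj2 (Hmaj N))); clear Hmaj.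
assert (Ce := fun n => proj1 (cont_sol k n)).
assert (Cr := fun n => proj1 (proj2 (cont_sol k n))).
assert (Cw := fun n => proj2 (proj2 (cont_sol k n))).
assert (Ge : gmaj U r (ce k) 1) by (apply gmaj_maj; auto; lra).
assert (Gr : gmaj U r (cr k) 1) by (apply gmaj_maj; auto; lra).
assert (Gw : gmaj U r (cw k) K) by (apply gmaj_maj; auto; lra).
destruct (sums_to_Ns U k HU) as (KN & HKN & MN & SN).
destruct (sums_to_Qs U k HU) as (KQ & HKQ & MQ & SQ).
(* For these e the geometric series has ratio at most 1/2. The constant 2 r bounds the sum of the
   shifted series, which is what remains of E - 1 and R - 1 after a factor e. *)
exists (/ (2 * r)), (2 * r); split; [apply Rinv_0_lt_compat; lra |].
split; [lra |].
split; [replace (/ (2 * / (2 * r))) with r by (field; lra); assumption |].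
intros e Hee.
assert (shift_bound : forall f, gmaj U r f 1 -> (forall phi a, f O phi a = 1) ->
  (forall phi a, in_dom U phi a -> Rabs (ser f phi a e - 1) <= 2 * r * Rabs e) /\
  (forall phi a phi' a', in_dom U phi a -> in_dom U phi' a' ->
     Rabs (ser f phi a e - ser f phi' a' e) <=
       2 * r * Rabs e * (Rabs (phi - phi') + Rabs (a - a')))).
{ intros f Gf H0; assert (Gs := gmaj_shift U r f 1 Gf); split.
  - intros phi a D; rewrite (ser_shift U r f 1), H0 by assumption.
    replace (1 + e * ser (shift f) phi a e - 1) with (ser (shift f) phi a e * e) by ring.
    apply Rabs_mult_le; [| lra].
    eapply Rle_trans; [now apply (ser_sup U r _ (1 * r)) | lra].
  - intros phi a phi' a' D D'.
    rewrite !(ser_shift U r f 1), !H0 by assumption.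
    replace (1 + e * ser (shift f) phi a e - (1 + e * ser (shift f) phi' a' e)) with
      (e * (ser (shift f) phi a e - ser (shift f) phi' a' e)) by ring.
    replace (2 * r * Rabs e * (Rabs (phi - phi') + Rabs (a - a'))) with
      (Rabs e * (2 * (1 * r) * (Rabs (phi - phi') + Rabs (a - a')))) by ring.
    apply Rabs_mult_le; [lra | now apply (ser_lip U r)]. }
assert (E0 : forall phi a, ce k O phi a = 1) by (intros; now rewrite ce_fix).
assert (R0 : forall phi a, cr k O phi a = 1) by (intros; now rewrite cr_fix).
destruct (shift_bound (ce k) Ge E0) as [BE LE].
destruct (shift_bound (cr k) Gr R0) as [BR _].
split; [intros phi a Hphi Ha; split |].
{ replace (- e * Eser k phi a e * wser k phi a e) with
    (-1 * e * Eser k phi a e * wser k phi a e) by ring.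
  apply (ser_next_exp_derive U r K); auto using ce_fix. }
{ replace (e * Rser k phi a e * wser k phi a e) with
    (1 * e * Rser k phi a e * wser k phi a e) by ring.
  apply (ser_next_exp_derive U r K); auto using cr_fix. }
split; [| split; [| split; [| split]]].
- intros phi a D; unfold wser, Eser.
  rewrite <- (SN r (ce k) e Hr He Hee phi a D), <- (SQ r (ce k) e Hr He Hee phi a D).
  assert (GN : gmaj U r (Ns k (ce k)) KN) by (apply gmaj_maj; auto).
  assert (GQ : gmaj U r (Qs k (ce k)) KQ) by (apply gmaj_maj; auto).
  assert (Gc : gmaj U r (conv (cw k) (Qs k (ce k))) (8 * K * KQ)).
  { apply gmaj_maj; auto; [nra |]; intros; apply maj_conv; auto. }
  set (g := fun n => match n with O => fun _ _ => 0
    | S m => conv (cw k) (Qs k (ce k)) m end).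
  assert (Gg : gmaj U r g (8 * K * KQ / r)).
  { intros [| n]; simpl g.
    - eapply bnd_le; [apply bnd_const |]; rewrite Rabs_R0; simpl.
      rewrite Rmult_1_r; apply Rdiv_le_0_compat; nra.
    - replace (8 * K * KQ / r * r ^ S n) with (8 * K * KQ * r ^ n)
        by (simpl; field; lra).
      apply Gc. }
  transitivity (ser (fun n phi a => kap phi * Ns k (ce k) n phi a + -1 * g n phi a)
    phi a e).
  { apply PSeries_ext; intros n; rewrite cw_fix; unfold next_w, g.
    destruct n; ring. }
  destruct (bd_kap U) as [Kk Hk].
  rewrite (ser_plus U r (fun n phi a => kap phi * Ns k (ce k) n phi a)
    (fun n phi a => -1 * g n phi a) (Kk * KN) (Rabs (-1) * (8 * K * KQ / r))); auto.
  + rewrite (ser_scal (fun phi _ => kap phi)), (ser_scal (fun _ _ => -1)).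
    rewrite (ser_shift U r g (8 * K * KQ / r)) by assumption.
    change (shift g) with (conv (cw k) (Qs k (ce k))); simpl g.
    rewrite (ser_conv U r _ _ K KQ) by assumption; ring.
  + intros n; rewrite Rmult_assoc; apply (bnd_mult U (fun phi _ => kap phi)); auto.
  + intros n; rewrite Rmult_assoc; apply (bnd_mult U (fun _ _ => -1));
      [apply bnd_const | apply Gg].
- intros a _; split; [apply (ser_next_exp_0 (-1) _ (cw k)), ce_fix |].
  apply (ser_next_exp_0 1 _ (cw k)), cr_fix.
- intros phi a D; now apply (ser_CV U r _ 1).
- intros phi a D; split; [now apply BE | now apply BR].
- intros; now apply LE.
Qed.

(** * Leaves in polar coordinates *)

Definition pt (phi u : R) : R * R := (cs phi / u, sn phi / u ^ 2).

Lemma kap_ge_half (phi : R) : / 2 <= kap phi.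
Proof.
assert (Hq := quart_ge_1 phi); assert (H4 := quart_4 phi).
assert (Hs := SIN_bound phi).
assert (Hs2 : sin phi ^ 2 <= 1) by nra.
assert (quart phi ^ 4 <= 2) by nra.
assert (quart phi ^ 3 <= 2).
{ apply Rle_trans with (quart phi ^ 4); [| assumption].
  assert (0 < quart phi ^ 3) by (apply pow_lt; lra).
  change (quart phi ^ 4) with (quart phi * quart phi ^ 3); nra. }
unfold kap; apply Rle_trans with (/ quart phi ^ 3).
- apply Rinv_le_contravar; [apply pow_lt |]; lra.
- assert (0 < / quart phi ^ 3) by apply inv_quart_bound.
  unfold Rdiv; nra.
Qed.

(** The passage from (A3, B2) to (N, Q) is linear with determinant of absolute value [cs]^4 + 2
    [sn]^2 = 1, so B2 here and A3 in the companion lemma are recovered from N and Q. *)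
Lemma omega_pt_dy (k : coeffs) (e phi u : R) : u <> 0 ->
  snd (omega k e (pt phi u)) =
    (sn phi * (1 + e * Qf k phi u) + e * cs phi * Nf k phi u) / u ^ 2.
Proof.
intros Hu; assert (H := cs4_sn2 phi).
unfold omega, omega1, dHam, pt; simpl fst; simpl snd.
replace (sn phi * (1 + e * Qf k phi u) + e * cs phi * Nf k phi u) with
  (sn phi + e * ((cs phi ^ 4 + 2 * sn phi ^ 2) * B2 k phi u))
  by (unfold Nf, Qf; ring).
rewrite H; unfold B2; field; assumption.
Qed.

Lemma omega_pt_dx (k : coeffs) (e phi u : R) : u <> 0 ->
  - fst (omega k e (pt phi u)) =
    - (cs phi ^ 3 * (1 + e * Qf k phi u) - 2 * e * sn phi * Nf k phi u) / u ^ 3.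
Proof.
intros Hu; assert (H := cs4_sn2 phi).
unfold omega, omega1, dHam, pt; simpl fst; simpl snd.
replace (cs phi ^ 3 * (1 + e * Qf k phi u) - 2 * e * sn phi * Nf k phi u) with
  (cs phi ^ 3 + e * ((cs phi ^ 4 + 2 * sn phi ^ 2) * A3 k phi u))
  by (unfold Nf, Qf; ring).
rewrite H; unfold A3; field; assumption.
Qed.

Lemma is_derive_pt (f u : R -> R) (t df du : R) : is_derive f t df -> is_derive u t du ->
  u t <> 0 ->
  is_derive (fun s => fst (pt (f s) (u s))) t
    ((kap (f t) * sn (f t) * df * u t - cs (f t) * du) / u t ^ 2) /\
  is_derive (fun s => snd (pt (f s) (u s))) t
    ((- kap (f t) * cs (f t) ^ 3 * df * u t - 2 * sn (f t) * du) / u t ^ 3).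
Proof.
intros Hf Hu Hu0; unfold pt; simpl fst; simpl snd; split.
- evar_last.
  + apply (is_derive_div (fun s => cs (f s)) u); [| exact Hu | exact Hu0].
    apply (is_derive_comp cs f); [apply is_derive_cs | exact Hf].
  + unfold scal; simpl; unfold mult; simpl; field; assumption.
- evar_last.
  + apply (is_derive_div (fun s => sn (f s)) (fun s => u s ^ 2)).
    * apply (is_derive_comp sn f); [apply is_derive_sn | exact Hf].
    * apply (is_derive_pow u 2); exact Hu.
    * now apply pow_nonzero.
  + unfold scal; simpl; unfold mult; simpl; field; assumption.
Qed.

Lemma integral_curve_pt (k : coeffs) (e : R) (f u : R -> R) (t : R) : u t <> 0 ->
  is_derive f t ((1 + e * Qf k (f t) (u t)) / (kap (f t) * u t)) ->
  is_derive u t (- e * Nf k (f t) (u t)) ->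
  integral_curve_at (omega k e) (fun s => pt (f s) (u s)) t.
Proof.
intros Hu0 Hf Hu; assert (Hk := kap_pos (f t)).
destruct (is_derive_pt f u t _ _ Hf Hu Hu0) as [H1 H2]; split.
- rewrite omega_pt_dy by assumption; evar_last; [exact H1 | field; lra].
- rewrite omega_pt_dx by assumption; evar_last; [exact H2 | field; lra].
Qed.

Lemma polar_of_integral_curve (k : coeffs) (e : R) (f u : R -> R) (t df du : R) :
  u t <> 0 -> is_derive f t df -> is_derive u t du ->
  integral_curve_at (omega k e) (fun s => pt (f s) (u s)) t ->
  df = (1 + e * Qf k (f t) (u t)) / (kap (f t) * u t) /\
  du = - e * Nf k (f t) (u t).
Proof.
intros Hu0 Hf Hu [G1 G2].
destruct (is_derive_pt f u t _ _ Hf Hu Hu0) as [H1 H2].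
assert (E1 := is_derive_unique _ _ _ H1); rewrite (is_derive_unique _ _ _ G1) in E1.
assert (E2 := is_derive_unique _ _ _ H2); rewrite (is_derive_unique _ _ _ G2) in E2.
rewrite omega_pt_dy in E1 by assumption; rewrite omega_pt_dx in E2 by assumption.
assert (Hc := cs4_sn2 (f t)); assert (Hk := kap_pos (f t)).
revert E1 E2 Hc Hk; generalize (Qf k (f t) (u t)) (Nf k (f t) (u t)).
generalize (cs (f t)) (sn (f t)) (kap (f t)).
revert Hu0; generalize (u t); intros v Hv c s kp Q N E1 E2 Hc Hk.
apply (f_equal (fun x => x * v ^ 2)) in E1.
apply (f_equal (fun x => x * v ^ 3)) in E2.
replace ((s * (1 + e * Q) + e * c * N) / v ^ 2 * v ^ 2) with
  (s * (1 + e * Q) + e * c * N) in E1 by (field; assumption).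
replace ((kp * s * df * v - c * du) / v ^ 2 * v ^ 2) with
  (kp * s * df * v - c * du) in E1 by (field; assumption).
replace (- (c ^ 3 * (1 + e * Q) - 2 * e * s * N) / v ^ 3 * v ^ 3) with
  (- (c ^ 3 * (1 + e * Q) - 2 * e * s * N)) in E2 by (field; assumption).
replace ((- kp * c ^ 3 * df * v - 2 * s * du) / v ^ 3 * v ^ 3) with
  (- kp * c ^ 3 * df * v - 2 * s * du) in E2 by (field; assumption).
(* Cramer's rule for the unknown angular and radial speeds; the determinant is again [cs]^4 + 2
   [sn]^2 = 1. *)
assert (D1 : (c ^ 4 + 2 * s ^ 2) * (kp * df * v - (1 + e * Q)) = 0).
{ transitivity (2 * s * (kp * s * df * v - c * du) -
    c * (- kp * c ^ 3 * df * v - 2 * s * du) - (c ^ 4 + 2 * s ^ 2) * (1 + e * Q));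
    [ring |]; rewrite <- E1, <- E2; ring. }
assert (D2 : (c ^ 4 + 2 * s ^ 2) * (du + e * N) = 0).
{ transitivity (- c ^ 3 * (kp * s * df * v - c * du) -
    s * (- kp * c ^ 3 * df * v - 2 * s * du) + (c ^ 4 + 2 * s ^ 2) * (e * N));
    [ring |]; rewrite <- E1, <- E2; ring. }
rewrite Hc, Rmult_1_l in D1, D2; split; [| lra].
apply (Rmult_eq_reg_r (kp * v)); [| apply Rmult_integral_contrapositive; lra].
replace ((1 + e * Q) / (kp * v) * (kp * v)) with (1 + e * Q)
  by (field; lra); lra.
Qed.

Lemma periodic_IZR {A : Type} (f : R -> A) : (forall x, f (x + 2 * PI) = f x) ->
  forall (n : Z) x, f (x + 2 * PI * IZR n) = f x.
Proof.
intros H.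
assert (Hn : forall (n : nat) x, f (x + 2 * PI * INR n) = f x).
{ induction n as [| n IH]; intros x.
  - simpl; f_equal; ring.
  - rewrite S_INR; replace (x + 2 * PI * (INR n + 1)) with (x + 2 * PI * INR n + 2 * PI)
      by ring; now rewrite H. }
intros n x; destruct (Z_le_gt_dec 0 n) as [Hz | Hz].
- rewrite <- (Z2Nat.id n) by assumption; rewrite <- INR_IZR_INZ; apply Hn.
- rewrite <- (Hn (Z.to_nat (- n)) (x + 2 * PI * IZR n)); f_equal.
  rewrite INR_IZR_INZ, Z2Nat.id, opp_IZR by lia; ring.
Qed.

Lemma angle_reduce (phi : R) :
  exists (n : Z) x, phi = x + 2 * PI * IZR n /\ 0 <= x < 2 * PI.
Proof.
assert (HP := PI_RGT_0).
exists (Int_part (phi / (2 * PI))), (phi - 2 * PI * IZR (Int_part (phi / (2 * PI)))).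
split; [ring |].
destruct (base_Int_part (phi / (2 * PI))) as [H1 H2].
assert (E : phi = 2 * PI * (phi / (2 * PI))) by (field; lra).
split; [| apply Rplus_lt_reg_r with (2 * PI * IZR (Int_part (phi / (2 * PI))) - 2 * PI)];
  rewrite E at 1; nra.
Qed.

(** The right-hand side of the scalar equation du/dphi, the quotient of the two speeds along a
    leaf. *)
Definition Fu (k : coeffs) (e phi u : R) : R :=
  - e * u * (kap phi * Nf k phi u / (1 + e * Qf k phi u)).

Lemma A3_periodic (k : coeffs) (phi u : R) : A3 k (phi + 2 * PI) u = A3 k phi u.
Proof. unfold A3; now rewrite cs_periodic, sn_periodic. Qed.
Lemma B2_periodic (k : coeffs) (phi u : R) : B2 k (phi + 2 * PI) u = B2 k phi u.
Proof. unfold B2; now rewrite cs_periodic, sn_periodic. Qed.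
Lemma Qf_periodic (k : coeffs) (phi u : R) : Qf k (phi + 2 * PI) u = Qf k phi u.
Proof. unfold Qf; now rewrite cs_periodic, sn_periodic, A3_periodic, B2_periodic. Qed.
Lemma Nf_periodic (k : coeffs) (phi u : R) : Nf k (phi + 2 * PI) u = Nf k phi u.
Proof. unfold Nf; now rewrite cs_periodic, sn_periodic, A3_periodic, B2_periodic. Qed.
Lemma Fu_periodic (k : coeffs) (e phi u : R) : Fu k e (phi + 2 * PI) u = Fu k e phi u.
Proof. unfold Fu; now rewrite Qf_periodic, Nf_periodic, kap_periodic. Qed.
Lemma pt_periodic (phi u : R) : pt (phi + 2 * PI) u = pt phi u.
Proof. unfold pt; now rewrite cs_periodic, sn_periodic. Qed.

Lemma bd_A3 (U : R) (k : coeffs) : 0 <= U -> bd U (A3 k).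
Proof. intros HU; unfold A3; bd_tac; eexists; now apply bnd_radius. Qed.
Lemma bd_B2 (U : R) (k : coeffs) : 0 <= U -> bd U (B2 k).
Proof. intros HU; unfold B2; bd_tac; eexists; now apply bnd_radius. Qed.
Lemma bd_Qf (U : R) (k : coeffs) : 0 <= U -> bd U (Qf k).
Proof. intros HU; assert (HA := bd_A3 U k HU); assert (HB := bd_B2 U k HU); unfold Qf; bd_tac. Qed.
Lemma bd_Nf (U : R) (k : coeffs) : 0 <= U -> bd U (Nf k).
Proof. intros HU; assert (HA := bd_A3 U k HU); assert (HB := bd_B2 U k HU); unfold Nf; bd_tac. Qed.

Lemma quotient_diff (e G1 G2 Q1 Q2 K KQ D : R) :
  / 2 <= 1 + e * Q1 -> / 2 <= 1 + e * Q2 -> Rabs e <= 1 ->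
  Rabs G2 <= K -> Rabs Q2 <= KQ -> Rabs (G1 - G2) <= K * D -> Rabs (Q1 - Q2) <= KQ * D ->
  Rabs (G1 / (1 + e * Q1) - G2 / (1 + e * Q2)) <= 4 * (K + 2 * K * KQ) * D.
Proof.
intros H1 H2 He BG BQ DG DQ.
replace (G1 / (1 + e * Q1) - G2 / (1 + e * Q2)) with
  (((G1 - G2) + e * ((G1 - G2) * Q2 - G2 * (Q1 - Q2))) *
   (/ (1 + e * Q1) * / (1 + e * Q2))) by (field; lra).
assert (I1 : Rabs (/ (1 + e * Q1)) <= 2).
{ rewrite Rabs_inv, Rabs_pos_eq by lra; rewrite <- (Rinv_inv 2).
  apply Rinv_le_contravar; lra. }
assert (I2 : Rabs (/ (1 + e * Q2)) <= 2).
{ rewrite Rabs_inv, Rabs_pos_eq by lra; rewrite <- (Rinv_inv 2).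
  apply Rinv_le_contravar; lra. }
replace (4 * (K + 2 * K * KQ) * D) with
  ((K * D + 1 * (K * D * KQ + K * (KQ * D))) * (2 * 2)) by ring.
apply Rabs_mult_le; [| now apply Rabs_mult_le].
eapply Rle_trans; [apply Rabs_triang |]; apply Rplus_le_compat; [assumption |].
apply Rabs_mult_le; [assumption |]; unfold Rminus at 1.
eapply Rle_trans; [apply Rabs_triang |]; rewrite Rabs_Ropp.
apply Rplus_le_compat; now apply Rabs_mult_le.
Qed.

Lemma Fu_regular (U : R) (k : coeffs) : 0 <= U -> exists e0 L, 0 < e0 /\ 0 <= L /\
  forall e, Rabs e <= e0 ->
  (forall phi u, Rabs u <= U -> / 2 <= 1 + e * Qf k phi u <= 2) /\
  (forall phi u u', Rabs u <= U -> Rabs u' <= U ->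
     Rabs (Fu k e phi u - Fu k e phi u') <= L * Rabs (u - u')).
Proof.
intros HU; destruct (bd_Qf U k HU) as [KQ HQ].
assert (HG : bd U (fun phi u => kap phi * Nf k phi u * u)).
{ assert (HN := bd_Nf U k HU); bd_tac; eexists; now apply bnd_radius. }
destruct HG as [K HG].
assert (HK := bnd_nonneg _ _ _ HG); assert (HKQ := bnd_nonneg _ _ _ HQ).
assert (He0 : 0 < / (2 * (KQ + 1))) by (apply Rinv_0_lt_compat; lra).
assert (He1 : (KQ + 1) * / (2 * (KQ + 1)) = / 2) by (field; lra).
exists (/ (2 * (KQ + 1))), (4 * (K + 2 * K * KQ)).
split; [assumption |]; split; [nra |]; intros e He.
assert (He2 : Rabs e <= 1) by nra.
assert (Hd : forall x u, 0 <= x < 2 * PI -> Rabs u <= U -> in_dom U x u).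
{ intros x u Hx Hu; split; [| assumption].
  generalize PI_4; intros; rewrite Rabs_pos_eq; lra. }
assert (B : forall phi u, Rabs u <= U -> / 2 <= 1 + e * Qf k phi u <= 2).
{ intros phi u Hu; destruct (angle_reduce phi) as (n & x & -> & Hx).
  rewrite (periodic_IZR (fun x => Qf k x u)) by (intros; apply Qf_periodic).
  assert (H : Rabs (e * Qf k x u) <= / (2 * (KQ + 1)) * KQ).
  { apply Rabs_mult_le; [assumption |]; apply (bnd_sup U); auto. }
  apply Rabs_le_between in H; nra. }
split; [exact B |].
intros phi u u' Hu Hu'.
assert (B1 := B phi u Hu); assert (B2 := B phi u' Hu'); revert B1 B2.
destruct (angle_reduce phi) as (n & x & -> & Hx).
rewrite (periodic_IZR (fun x => Fu k e x u)) by (intros; apply Fu_periodic).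
rewrite (periodic_IZR (fun x => Fu k e x u')) by (intros; apply Fu_periodic).
rewrite (periodic_IZR (fun x => Qf k x u)) by (intros; apply Qf_periodic).
rewrite (periodic_IZR (fun x => Qf k x u')) by (intros; apply Qf_periodic).
intros B1 B2; unfold Fu.
replace (- e * u * (kap x * Nf k x u / (1 + e * Qf k x u)) -
   - e * u' * (kap x * Nf k x u' / (1 + e * Qf k x u'))) with
  (- e * (kap x * Nf k x u * u / (1 + e * Qf k x u) -
   kap x * Nf k x u' * u' / (1 + e * Qf k x u'))) by (field; lra).
replace (4 * (K + 2 * K * KQ) * Rabs (u - u')) with
  (1 * (4 * (K + 2 * K * KQ) * Rabs (u - u'))) by ring.
apply Rabs_mult_le; [rewrite Rabs_Ropp; assumption |].
assert (D := Hd x u Hx Hu); assert (D' := Hd x u' Hx Hu').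
assert (E : Rabs (u - u') = Rabs (x - x) + Rabs (u - u'))
  by (rewrite Rminus_diag, Rabs_R0; ring).
apply quotient_diff; try lra.
- now apply (bnd_sup U _ _ x u' HG).
- now apply (bnd_sup U _ _ x u' HQ).
- rewrite E; now apply (bnd_lip U _ _ x u x u' HG).
- rewrite E; now apply (bnd_lip U _ _ x u x u' HQ).
Qed.

(** * Exchange of angle and time along a leaf *)

Lemma continuity_of_derive (f df : R -> R) :
  (forall x, is_derive f x (df x)) -> forall x, continuity_pt f x.
Proof.
intros H x; apply continuity_pt_filterlim; apply (continuous_of_derive f df x H).
Qed.

(** A slope bounded below by a positive constant makes f a bijection of the whole line. It is used
    in both directions: time as a function of the angle, and the angle of a given leaf as a function
    of time. *)
Lemma inverse_of_derive (f df : R -> R) (c : R) : 0 < c ->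
  (forall x, is_derive f x (df x)) -> (forall x, c <= df x) ->
  exists g, (forall t, f (g t) = t) /\ (forall x, g (f x) = x) /\
    (forall t, is_derive g t (/ df (g t))) /\
    (forall x y, x < y -> f x < f y).
Proof.
intros Hc Hf Hdf.
assert (grow : forall x y, x <= y -> c * (y - x) <= f y - f x).
{ intros x y Hxy; destruct (MVT_gen f x y df) as [z [_ Hz]]; auto.
  - intros z _; now apply continuity_of_derive with df.
  - rewrite Hz; apply Rmult_le_compat_r; [lra | apply Hdf]. }
assert (surj : forall t, exists x, f x = t).
{ intros t; set (d := Rabs (t - f 0) / c).
  assert (Hd : 0 <= d) by (apply Rdiv_le_0_compat; [apply Rabs_pos | lra]).
  assert (Ed : c * d = Rabs (t - f 0)) by (unfold d; field; lra).
  assert (G1 := grow (- d) 0 ltac:(lra)); assert (G2 := grow 0 d ltac:(lra)).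
  destruct (IVT_gen f (- d) d t) as (x & _ & Hx).
  - intros x; now apply continuity_of_derive with df.
  - assert (Ht : - Rabs (t - f 0) <= t - f 0 <= Rabs (t - f 0))
      by (apply Rabs_le_between; lra).
    split; [eapply Rle_trans; [apply Rmin_l |] | eapply Rle_trans; [| apply Rmax_r]];
      nra.
  - now exists x. }
set (g := fun t => proj1_sig (constructive_indefinite_description _ (surj t))).
assert (fg : forall t, f (g t) = t).
{ intros t; unfold g; apply proj2_sig. }
assert (inj : forall x y, f x = f y -> x = y).
{ intros x y E; destruct (Rtotal_order x y) as [H | [H | H]]; [| assumption |].
  - generalize (grow x y ltac:(lra)); nra.
  - generalize (grow y x ltac:(lra)); nra. }
exists g; split; [exact fg |]; split; [intros x; apply inj, fg |]; split.
- intros t; apply is_derive_Reals; intros eps Heps.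
  assert (Hl := Hdf (g t)); set (l := df (g t)) in *.
  (* The error of the inverse quotient is (h / s - l) (s / h) / l, and each of the last two factors
     is at most 1 / c in absolute value. *)
  destruct (proj1 (is_derive_Reals _ _ _) (Hf (g t)) (eps * c * c)) as [d Hd].
  { repeat apply Rmult_lt_0_compat; assumption. }
  assert (Hdc : 0 < d * c) by (apply Rmult_lt_0_compat; [apply cond_pos | assumption]).
  exists (mkposreal _ Hdc); simpl; intros h Hh Hhd.
  set (s := g (t + h) - g t).
  assert (Es : f (g t + s) - f (g t) = h).
  { unfold s; replace (g t + (g (t + h) - g t)) with (g (t + h)) by ring.
    rewrite !fg; ring. }
  assert (Hs0 : s <> 0) by (intros E; rewrite E, Rplus_0_r in Es; lra).
  assert (Hsh : c * Rabs s <= Rabs h).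
  { rewrite <- Es; destruct (Rle_dec 0 s) as [H | H].
    - generalize (grow (g t) (g t + s) ltac:(lra)); intros G.
      rewrite (Rabs_pos_eq s), Rabs_pos_eq; nra.
    - generalize (grow (g t + s) (g t) ltac:(lra)); intros G.
      rewrite (Rabs_left1 s), Rabs_left1; nra. }
  specialize (Hd s Hs0 ltac:(nra)); fold l in Hd.
  rewrite Es in Hd.
  assert (Hs' := Rabs_pos_lt s Hs0).
  replace (s / h - / l) with (- ((h / s - l) * (s / h) * / l))
    by (field; repeat split; lra).
  rewrite Rabs_Ropp, !Rabs_mult.
  assert (H1 : Rabs (s / h) <= / c).
  { unfold Rdiv; rewrite Rabs_mult, Rabs_inv.
    assert (0 < Rabs h) by now apply Rabs_pos_lt.
    apply (Rmult_le_reg_r (Rabs h * c)); [nra |].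
    replace (Rabs s * / Rabs h * (Rabs h * c)) with (c * Rabs s) by (field; lra).
    replace (/ c * (Rabs h * c)) with (Rabs h) by (field; lra); assumption. }
  assert (H2 : Rabs (/ l) <= / c).
  { rewrite Rabs_inv, Rabs_pos_eq by lra; apply Rinv_le_contravar; lra. }
  assert (Hic : 0 < / c) by now apply Rinv_0_lt_compat.
  apply Rle_lt_trans with (Rabs (h / s - l) * / c * / c).
  + repeat apply Rmult_le_compat; auto using Rabs_pos; try lra.
    apply Rmult_le_pos; apply Rabs_pos.
  + apply (Rmult_lt_reg_r (c * c)); [nra |].
    replace (Rabs (h / s - l) * / c * / c * (c * c)) with (Rabs (h / s - l))
      by (field; lra); lra.
- intros x y Hxy; generalize (grow x y ltac:(lra)); nra.
Qed.

Lemma continuous_Rinv {T : UniformSpace} (f : T -> R) (x : T) :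
  f x <> 0 -> continuous f x -> continuous (fun y => / f y) x.
Proof.
intros H0 H; apply (continuous_comp f Rinv); [assumption |].
apply continuity_pt_filterlim; apply continuity_pt_inv; [| assumption].
apply continuity_pt_id.
Qed.

Lemma continuous_A3 {T : UniformSpace} (k : coeffs) (f u : T -> R) (x : T) :
  continuous f x -> continuous u x -> continuous (fun y => A3 k (f y) (u y)) x.
Proof.
intros Hf Hu; unfold A3.
assert (Hc := continuous_comp f cs x Hf (continuous_cs _)).
assert (Hs := continuous_comp f sn x Hf (continuous_sn _)).
repeat cont_step.
Qed.

Lemma continuous_B2 {T : UniformSpace} (k : coeffs) (f u : T -> R) (x : T) :
  continuous f x -> continuous u x -> continuous (fun y => B2 k (f y) (u y)) x.
Proof.
intros Hf Hu; unfold B2.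
assert (Hc := continuous_comp f cs x Hf (continuous_cs _)).
assert (Hs := continuous_comp f sn x Hf (continuous_sn _)).
repeat cont_step.
Qed.

Lemma continuous_Qf {T : UniformSpace} (k : coeffs) (f u : T -> R) (x : T) :
  continuous f x -> continuous u x -> continuous (fun y => Qf k (f y) (u y)) x.
Proof.
intros Hf Hu; unfold Qf.
assert (Hc := continuous_comp f cs x Hf (continuous_cs _)).
assert (Hs := continuous_comp f sn x Hf (continuous_sn _)).
assert (HA := continuous_A3 k f u x Hf Hu).
assert (HB := continuous_B2 k f u x Hf Hu).
repeat cont_step.
Qed.

(** Time is the integral of kap u / (1 + e Q) over the angle. The differential equation for u is
    asked for only at the angle concerned, so that the lemma also serves a solution known on a
    single turn and prolonged arbitrarily. *)
Lemma time_of_angle (k : coeffs) (e m : R) (u : R -> R) : 0 < m ->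
  (forall phi, continuous u phi) -> (forall phi, m <= u phi) ->
  (forall phi, / 2 <= 1 + e * Qf k phi (u phi) <= 2) ->
  exists tau th : R -> R, tau 0 = 0 /\ (forall t, tau (th t) = t) /\
    (forall phi, th (tau phi) = phi) /\ (forall x y, x < y -> tau x < tau y) /\
    (forall t, continuous th t) /\
    (forall t, is_derive u (th t) (Fu k e (th t) (u (th t))) ->
       integral_curve_at (omega k e) (fun s => pt (th s) (u (th s))) t) /\
    ((forall phi, u (phi + 2 * PI) = u phi) ->
       forall phi, tau (phi + 2 * PI) = tau phi + tau (2 * PI)).
Proof.
intros Hm Hc Hmu HQ.
set (dt := fun phi => kap phi * u phi * / (1 + e * Qf k phi (u phi))).
assert (Hdc : forall phi, continuous dt phi).
{ intros phi; unfold dt; apply continuous_Rmult.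
  - assert (H := Hc phi); repeat cont_step.
  - apply continuous_Rinv; [generalize (HQ phi); lra |].
    apply (continuous_Rplus (fun _ => 1)); [apply continuous_const |].
    apply (continuous_Rmult (fun _ => e)); [apply continuous_const |].
    apply (continuous_Qf k (fun x => x) u); [apply continuous_id | apply Hc]. }
(* The integrand is at least m / 4: kap and 1 / (1 + e Q) are at least 1/2 each, and u is at least
   m. *)
destruct (inverse_of_derive (fun x => RInt dt 0 x) dt (m / 4)) as (th & H1 & H2 & H3 & H4).
- lra.
- intros x; now apply is_derive_RInt_cont.
- intros x; unfold dt; generalize (HQ x) (kap_ge_half x) (Hmu x); intros.
  assert (/ 2 <= / (1 + e * Qf k x (u x))) by (apply Rinv_le_contravar; lra).
  assert (m / 2 <= kap x * u x) by nra; nra.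
- exists (fun x => RInt dt 0 x), th; split; [apply (RInt_point (V := R_CompleteNormedModule)) |].
  split; [assumption |]; split; [assumption |]; split; [assumption |].
  split; [intros t; apply (continuous_of_derive _ _ _ H3) |].
  split; [intros t Hu | intros Hper phi].
  2: { assert (ex : forall x y, ex_RInt dt x y) by (intros; now apply ex_RInt_cont).
    assert (Hdt : forall x, dt (x + 2 * PI) = dt x)
      by (intros; unfold dt; now rewrite Hper, kap_periodic, Qf_periodic).
    rewrite <- (RInt_Chasles dt 0 (2 * PI) (phi + 2 * PI)) by auto.
    unfold plus; simpl; rewrite Rplus_comm; f_equal.
    transitivity (RInt dt (1 * 0 + 2 * PI) (1 * phi + 2 * PI)); [f_equal; ring |].
    rewrite <- (RInt_comp_lin dt 1 (2 * PI) 0 phi) by auto.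
    apply RInt_ext; intros x _; unfold scal; simpl; unfold mult; simpl.
    rewrite !Rmult_1_l; apply Hdt. }
  generalize (HQ (th t)) (kap_pos (th t)) (Hmu (th t)); intros.
  apply (integral_curve_pt k e th (fun s => u (th s))); [lra | |].
  + evar_last; [apply H3 |]; unfold dt; field; lra.
  + evar_last; [apply (is_derive_comp u th); [exact Hu | apply H3] |].
    unfold scal; simpl; unfold mult; simpl; unfold dt, Fu; field; lra.
Qed.

(** The series solution is controlled for angles below 9 only. Freezing the angle beyond 17/2 gives
    a function on the line that is unchanged near a full turn, since 2 PI <= 8. *)
Definition clamp (x : R) : R := Rmax (- (17 / 2)) (Rmin x (17 / 2)).

Lemma clamp_lip (x y : R) : Rabs (clamp x - clamp y) <= Rabs (x - y).
Proof.
unfold clamp, Rmax, Rmin; repeat destruct (Rle_dec _ _); unfold Rabs;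
  repeat destruct (Rcase_abs _); lra.
Qed.

Lemma clamp_range (x : R) : Rabs (clamp x) <= 17 / 2.
Proof.
apply Rabs_le; unfold clamp, Rmax, Rmin; repeat destruct (Rle_dec _ _); lra.
Qed.

Lemma clamp_id (x : R) : - (17 / 2) <= x <= 17 / 2 -> clamp x = x.
Proof. unfold clamp, Rmax, Rmin; repeat destruct (Rle_dec _ _); lra. Qed.

Lemma continuous_lipschitz (f : R -> R) (K : R) :
  (forall x y, Rabs (f x - f y) <= K * Rabs (x - y)) -> forall x, continuous f x.
Proof.
intros H x; apply filterlim_locally; intros eps.
assert (Hk := Rabs_pos K).
assert (Hd : 0 < eps / (Rabs K + 1))
  by (apply Rdiv_lt_0_compat; [apply cond_pos | lra]).
exists (mkposreal _ Hd); intros y Hy.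
change (Rabs (f y - f x) < eps); change (Rabs (y - x) < eps / (Rabs K + 1)) in Hy.
apply Rle_lt_trans with (Rabs K * Rabs (y - x)).
- eapply Rle_trans; [apply H |]; apply Rmult_le_compat_r; [apply Rabs_pos | apply Rle_abs].
- apply (Rmult_lt_compat_l (Rabs K + 1)) in Hy; [| lra].
  replace ((Rabs K + 1) * (eps / (Rabs K + 1))) with (pos eps) in Hy by (field; lra).
  generalize (Rabs_pos (y - x)); nra.
Qed.

(** All that later proofs use about one fixed small e. The range 2 U leaves room for u = a E, as a
    <= U and E <= 3/2; [reg_small'] is what keeps solutions with different initial values in
    order. *)
Record regular (U : R) (k : coeffs) (L e : R) : Prop := {
  reg_Q : forall phi u, Rabs u <= 2 * U -> / 2 <= 1 + e * Qf k phi u <= 2;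
  reg_Fu : forall phi u u', Rabs u <= 2 * U -> Rabs u' <= 2 * U ->
     Rabs (Fu k e phi u - Fu k e phi u') <= L * Rabs (u - u');
  reg_ode : forall phi a, Rabs phi < 9 -> Rabs a <= U ->
     is_derive (fun x => a * Eser k x a e) phi (Fu k e phi (a * Eser k phi a e));
  reg_init : forall a, Rabs a <= U -> Eser k 0 a e = 1 /\ Rser k 0 a e = 1;
  reg_CV : forall phi a, in_dom U phi a ->
     Rbar_lt (Rabs e) (CV_radius (fun n => cr k n phi a));
  reg_near_1 : forall phi a, in_dom U phi a -> Rabs (Eser k phi a e - 1) <= L * Rabs e /\
     Rabs (Rser k phi a e - 1) <= L * Rabs e;
  reg_lip : forall phi a phi' a', in_dom U phi a -> in_dom U phi' a' ->
     Rabs (Eser k phi a e - Eser k phi' a' e) <=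
       L * Rabs e * (Rabs (phi - phi') + Rabs (a - a'));
  reg_small : L * Rabs e <= / 2;
  reg_small' : L * Rabs e * U <= / 4;
  reg_inv : forall phi a, Rabs phi < 9 -> Rabs a <= U ->
     Eser k phi a e * Rser k phi a e = 1 }.

Lemma polar_flow (U : R) (k : coeffs) : 0 < U -> exists e0 L, 0 < e0 /\ 0 <= L /\
  gmaj U (/ (2 * e0)) (cr k) 1 /\ forall e, Rabs e <= e0 -> regular U k L e.
Proof.
intros HU.
destruct (polar_series U k ltac:(lra)) as (e1 & L1 & He1 & HL1 & G & H).
destruct (Fu_regular (2 * U) k ltac:(lra)) as (e2 & L2 & He2 & HL2 & HF).
set (L := L1 + L2).
(* One choice for both smallness conditions: (L + 1) (U + 1) e3 = 1/4 bounds L |e| and L |e| U at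
   the same time. *)
set (e3 := / (4 * (L + 1) * (U + 1))).
assert (HL : 0 <= L) by (unfold L; lra).
assert (He3 : 0 < e3).
{ apply Rinv_0_lt_compat; repeat apply Rmult_lt_0_compat; lra. }
assert (Ee3 : (L + 1) * (U + 1) * e3 = / 4) by (unfold e3; field; lra).
set (e0 := Rmin e1 (Rmin e2 e3)).
assert (He0 : 0 < e0) by (unfold e0; repeat apply Rmin_pos; assumption).
assert (Hle1 : e0 <= e1) by apply Rmin_l.
assert (Hle2 : e0 <= e2) by (eapply Rle_trans; [apply Rmin_r | apply Rmin_l]).
assert (Hle3 : e0 <= e3) by (eapply Rle_trans; [apply Rmin_r | apply Rmin_r]).
exists e0, L; split; [assumption |]; split; [assumption |]; split.
{ intros n; eapply bnd_le; [apply G |]; apply Rmult_le_compat_l; [lra |].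
  apply pow_incr; split; [apply Rlt_le, Rinv_0_lt_compat; lra |].
  apply Rinv_le_contravar; lra. }
intros e He.
destruct (H e ltac:(lra)) as (D & W & E0 & CV & B & Lip).
destruct (HF e ltac:(lra)) as (HQ & HLip); clear H HF.
assert (Hep := Rabs_pos e).
assert (HLe : L * Rabs e <= (L + 1) * e3) by nra.
assert (HLU : 0 <= (L + 1) * e3) by nra.
assert (Hs1 : L * Rabs e <= / 2) by nra.
assert (Hs2 : L * Rabs e * U <= / 4) by nra.
assert (B' : forall phi a, in_dom U phi a -> Rabs (Eser k phi a e - 1) <= L * Rabs e /\
     Rabs (Rser k phi a e - 1) <= L * Rabs e).
{ intros phi a Da; destruct (B phi a Da); unfold L; split; nra. }
assert (Bu : forall phi a, in_dom U phi a -> Rabs (a * Eser k phi a e) <= 2 * U).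
{ intros phi a Da; rewrite (Rmult_comm 2); apply Rabs_mult_le; [apply Da |].
  replace (Eser k phi a e) with (1 + (Eser k phi a e - 1)) by ring.
  eapply Rle_trans; [apply Rabs_triang |]; rewrite Rabs_R1.
  destruct (B' phi a Da); lra. }
assert (Dom : forall phi a, Rabs phi < 9 -> Rabs a <= U -> in_dom U phi a)
  by (split; lra).
constructor; auto.
{ intros; eapply Rle_trans; [now apply HLip |].
  apply Rmult_le_compat_r; [apply Rabs_pos | unfold L; lra]. }
{ intros phi a Hphi Ha; destruct (D phi a Hphi Ha) as [D1 _].
  evar_last; [apply (is_derive_scal (fun x => Eser k x a e)); exact D1 |].
  assert (Hw := W phi a (Dom _ _ Hphi Ha)).
  assert (HQa := HQ phi _ (Bu phi a (Dom _ _ Hphi Ha))).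
  unfold Fu; replace (kap phi * Nf k phi (a * Eser k phi a e) /
    (1 + e * Qf k phi (a * Eser k phi a e))) with (wser k phi a e); [ring |].
  apply (Rmult_eq_reg_r (1 + e * Qf k phi (a * Eser k phi a e))); [| lra].
  transitivity (kap phi * Nf k phi (a * Eser k phi a e)); [lra | field; lra]. }
{ intros; eapply Rle_trans; [now apply Lip |].
  apply Rmult_le_compat_r;
    [apply Rplus_le_le_0_compat; apply Rabs_pos | unfold L; nra]. }
intros phi a Hphi Ha.
(* E and R solve equations with opposite right-hand sides, so their product has derivative 0 and
   keeps its initial value 1. *)
assert (Hd : forall x, Rmin 0 phi <= x <= Rmax 0 phi ->
  is_derive (fun x => Eser k x a e * Rser k x a e) x 0).
{ intros x Hx.
  assert (Hx9 : Rabs x < 9).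
  { revert Hx; unfold Rmin, Rmax; apply Rabs_lt_between in Hphi.
    destruct (Rle_dec 0 phi); intros; apply Rabs_lt_between; lra. }
  destruct (D x a Hx9 Ha) as [D1 D2].
  evar_last.
  - apply (is_derive_mult (K := R_AbsRing) (fun x => Eser k x a e) (fun x => Rser k x a e));
      [exact D1 | exact D2 |].
    intros; apply Rmult_comm.
  - unfold plus, mult; simpl; ring. }
destruct (MVT_gen (fun x => Eser k x a e * Rser k x a e) 0 phi (fun _ => 0)) as [z [_ Hz]].
- intros x Hx; apply Hd; lra.
- intros x Hx; apply continuity_pt_filterlim.
  apply (ex_derive_continuous (fun x => Eser k x a e * Rser k x a e)); eexists; now apply Hd.
- destruct (E0 a Ha) as [E1 E2]; rewrite E1, E2 in Hz; lra.
Qed.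

(** * The first return map *)

Lemma cs_sn_axis (phi : R) : 0 < cs phi -> sn phi = 0 -> exists n : Z, phi = 2 * PI * IZR n.
Proof.
assert (Hq := quart_ge_1 phi).
intros Hc Hs.
assert (Hc' : 0 < cos phi).
{ replace (cos phi) with (cs phi * quart phi) by (unfold cs; field; lra); nra. }
assert (Hs' : sin phi = 0).
{ replace (sin phi) with (- sn phi * quart phi ^ 2) by (unfold sn; field; lra).
  rewrite Hs; ring. }
destruct (sin_eq_0_0 (phi / 2)) as [n Hn].
{ assert (E := cos_2a_sin (phi / 2)); replace (2 * (phi / 2)) with phi in E by field.
  assert (H := sin2_cos2' phi); rewrite Hs' in H.
  assert (cos phi = 1) by nra; nra. }
exists n; lra.
Qed.

Lemma pt_0 (a : R) : 0 < a -> pt 0 a = (/ a, 0).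
Proof. intros Ha; unfold pt; rewrite cs_0, sn_0; f_equal; field; lra. Qed.

Lemma pt_2PI (a : R) : 0 < a -> pt (2 * PI) a = (/ a, 0).
Proof.
intros Ha; rewrite <- (pt_0 a Ha), <- (pt_periodic 0); f_equal; ring.
Qed.

Lemma in_dom_2PI (U a : R) : Rabs a <= U -> in_dom U (2 * PI) a.
Proof.
intros Ha; split; [| assumption].
generalize PI_RGT_0 PI_4; intros; rewrite Rabs_pos_eq; lra.
Qed.

Lemma Eser_bounds (U L e : R) (k : coeffs) (phi a : R) : regular U k L e ->
  in_dom U phi a -> / 2 <= Eser k phi a e <= 3 / 2.
Proof.
intros Hr D; destruct (reg_near_1 _ _ _ _ Hr _ _ D) as [H _].
assert (Hs := reg_small _ _ _ _ Hr); apply Rabs_le_between in H; lra.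
Qed.

Lemma Rser_pos (U L e : R) (k : coeffs) (phi a : R) : regular U k L e ->
  in_dom U phi a -> 0 < Rser k phi a e.
Proof.
intros Hr D; destruct (reg_near_1 _ _ _ _ Hr _ _ D) as [_ H].
assert (Hs := reg_small _ _ _ _ Hr); apply Rabs_le_between in H; lra.
Qed.

(** On the positive half-axis x = 1 / u, so the leaf from 1 / a comes back at 1 / (a E) = R / a. It
    is the first return because the angle increases strictly from 0 to 2 PI. The reciprocal series R
    is carried for the sake of this formula. *)
Lemma first_return_Rser (U L e : R) (k : coeffs) (a : R) : regular U k L e ->
  0 <= L -> 0 < a <= U -> first_return (omega k e) (/ a) (/ a * Rser k (2 * PI) a e).
Proof.
intros Hr HL Ha.
assert (HP := PI_RGT_0); assert (HP4 := PI_4).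
assert (HaU : Rabs a <= U) by (rewrite Rabs_pos_eq; lra).
assert (D2 := in_dom_2PI U a HaU).
assert (HR := Rser_pos _ _ _ _ _ _ Hr D2).
assert (Hia : 0 < / a) by (apply Rinv_0_lt_compat; lra).
split; [assumption |]; split; [now apply Rmult_lt_0_compat |].
set (u := fun phi => a * Eser k (clamp phi) a e).
assert (Dc : forall phi, in_dom U (clamp phi) a).
{ intros phi; split; [generalize (clamp_range phi); lra | assumption]. }
assert (Bu : forall phi, a / 2 <= u phi <= 2 * U).
{ intros phi; unfold u; generalize (Eser_bounds _ _ _ _ _ _ Hr (Dc phi)); nra. }
destruct (time_of_angle k e (a / 2) u) as (tau & th & T0 & T1 & T2 & T3 & _ & T4 & _).
- lra.
- apply continuous_lipschitz with (a * (L * Rabs e)); intros x y; unfold u.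
  replace (a * Eser k (clamp x) a e - a * Eser k (clamp y) a e) with
    (a * (Eser k (clamp x) a e - Eser k (clamp y) a e)) by ring.
  rewrite Rmult_assoc; apply Rabs_mult_le; [rewrite Rabs_pos_eq; lra |].
  eapply Rle_trans; [now apply (reg_lip _ _ _ _ Hr) |].
  rewrite Rminus_diag, Rabs_R0, Rplus_0_r.
  apply Rmult_le_compat_l; [| apply clamp_lip].
  generalize (Rabs_pos e); nra.
- intros phi; apply Bu.
- intros phi; apply (reg_Q _ _ _ _ Hr); generalize (Bu phi); intros.
  rewrite Rabs_pos_eq; lra.
- exists (fun s => pt (th s) (u (th s))), (tau (2 * PI)).
  assert (T2' : th 0 = 0) by (rewrite <- T0 at 1; apply T2).
  assert (Hmono : forall x y, tau x <= tau y -> x <= y).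
  { intros x y H; apply Rnot_lt_le; intros Hlt; generalize (T3 _ _ Hlt); lra. }
  assert (Hmono' : forall x y, tau x < tau y -> x < y).
  { intros x y H; apply Rnot_le_lt; intros [Hlt | ->]; [generalize (T3 _ _ Hlt) |]; lra. }
  split; [rewrite <- T0; apply T3; lra |].
  split; [| split; [| split]].
  + intros t Ht; apply T4.
    assert (Hth : 0 <= th t <= 2 * PI).
    { split; apply Hmono; rewrite T1; lra. }
    assert (Ec : clamp (th t) = th t) by (apply clamp_id; lra).
    unfold u at 2; rewrite Ec.
    apply (is_derive_ext_loc (fun x => a * Eser k x a e)).
    * exists (mkposreal (/ 4) ltac:(lra)); intros y Hy.
      change (Rabs (y - th t) < / 4) in Hy; apply Rabs_lt_between in Hy.
      unfold u; rewrite clamp_id by lra; reflexivity.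
    * apply (reg_ode _ _ _ _ Hr); [rewrite Rabs_pos_eq; lra | assumption].
  + rewrite T2'; unfold u; rewrite clamp_id by lra.
    rewrite (proj1 (reg_init _ _ _ _ Hr a HaU)), Rmult_1_r; apply pt_0; lra.
  + rewrite T2; unfold u; rewrite clamp_id by lra.
    assert (HE := Eser_bounds _ _ _ _ _ _ Hr D2).
    assert (HI := reg_inv _ _ _ _ Hr (2 * PI) a ltac:(rewrite Rabs_pos_eq; lra) HaU).
    rewrite pt_2PI by nra; f_equal.
    rewrite Rinv_mult; f_equal.
    apply (Rmult_eq_reg_l (Eser k (2 * PI) a e)); [rewrite HI; field |]; lra.
  + intros t Ht [Hx Hy]; simpl in Hx, Hy.
    assert (Hu := Bu (th t)).
    assert (Hth : 0 < th t < 2 * PI).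
    { split; apply Hmono'; rewrite T1; lra. }
    destruct (cs_sn_axis (th t)) as [n Hn].
    * replace (cs (th t)) with (cs (th t) / u (th t) * u (th t)) by (field; lra).
      apply Rmult_lt_0_compat; lra.
    * apply (Rmult_eq_reg_r (/ u (th t) ^ 2)); [rewrite Rmult_0_l; exact Hy |].
      apply Rinv_neq_0_compat, pow_nonzero; lra.
    * rewrite Hn in Hth.
      assert (0 < IZR n) by nra; assert (IZR n < 1) by nra.
      apply (lt_IZR 0) in H; apply (lt_IZR n 1) in H0; lia.
Qed.

Definition melnikov_fun (k : coeffs) (i : nat) (h : R) : R := h * cr k i (2 * PI) (/ h).

Lemma melnikov_fun_correct (k : coeffs) : melnikov k (melnikov_fun k).
Proof.
split.
- intros h _; unfold melnikov_fun; rewrite cr_fix; simpl; ring.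
- intros a b Ha Hab.
  destruct (polar_flow (/ a) k) as (e0 & L & He0 & HL & _ & Hreg);
    [now apply Rinv_0_lt_compat |].
  exists e0; split; [assumption |]; intros h e Hh He.
  assert (Hr := Hreg e ltac:(lra)).
  assert (Hih : 0 < / h <= / a).
  { split; [apply Rinv_0_lt_compat | apply Rinv_le_contravar]; lra. }
  assert (HhU : Rabs (/ h) <= / a) by (rewrite Rabs_pos_eq; lra).
  exists (h * Rser k (2 * PI) (/ h) e); split.
  + rewrite <- (Rinv_inv h) at 1 2; now apply first_return_Rser with (/ a) L.
  + assert (D := in_dom_2PI _ _ HhU).
    apply (is_pseries_scal h (fun i => cr k i (2 * PI) (/ h))); [apply Rmult_comm |].
    apply PSeries_correct, CV_radius_inside, (reg_CV _ _ _ _ Hr _ _ D).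
Qed.

(** * Closed leaves and periodic solutions *)

(** Squaring avoids the sign of d: d^2 exp(- 2 K y) does not increase to the right of x0, and d^2
    exp(2 K y) does not increase to the left of it. *)
Lemma gronwall_zero (d dd : R -> R) (K x0 x : R) :
  (forall y, Rmin x0 x <= y <= Rmax x0 x ->
     is_derive d y (dd y) /\ Rabs (dd y) <= K * Rabs (d y)) ->
  d x0 = 0 -> d x = 0.
Proof.
intros H H0.
assert (Hd : forall s, forall y, Rmin x0 x <= y <= Rmax x0 x ->
  is_derive (fun y => d y ^ 2 * exp (s * y)) y
    ((2 * d y * dd y + s * d y ^ 2) * exp (s * y))).
{ intros s y Hy; destruct (H y Hy) as [D _]; evar_last.
  - apply (is_derive_mult (K := R_AbsRing) (fun y => d y ^ 2) (fun y => exp (s * y))).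
    + apply (is_derive_pow d 2); exact D.
    + auto_derive; [exact I | reflexivity].
    + intros; apply Rmult_comm.
  - unfold plus, mult; simpl; ring. }
assert (Hb : forall y, Rmin x0 x <= y <= Rmax x0 x -> Rabs (d y * dd y) <= K * d y ^ 2).
{ intros y Hy; destruct (H y Hy) as [_ B]; rewrite Rabs_mult.
  rewrite <- (pow2_abs (d y)); generalize (Rabs_pos (d y)); nra. }
assert (Hz : forall s, d x ^ 2 * exp (s * x) <= 0 -> d x = 0).
{ intros s Hs; generalize (exp_pos (s * x)) (pow2_ge_0 (d x)); intros.
  assert (d x ^ 2 = 0) by nra; nra. }
destruct (Rle_dec x0 x) as [Hx | Hx].
- apply (Hz (- 2 * K)).
  destruct (MVT_gen (fun y => d y ^ 2 * exp (- 2 * K * y)) x0 x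
    (fun y => (2 * d y * dd y + - 2 * K * d y ^ 2) * exp (- 2 * K * y))) as (c & Hc & E).
  + intros y Hy; apply Hd; lra.
  + intros y Hy; apply continuity_pt_filterlim.
    apply (ex_derive_continuous (fun y => d y ^ 2 * exp (- 2 * K * y))).
    eexists; now apply Hd.
  + rewrite H0 in E.
    assert (B := Hb c Hc); apply Rabs_le_between in B.
    assert (Hp := exp_pos (- 2 * K * c)).
    assert ((2 * d c * dd c + - 2 * K * d c ^ 2) * exp (- 2 * K * c) <= 0).
    { assert (0 <= - (2 * d c * dd c + - 2 * K * d c ^ 2)) by lra; nra. }
    assert (0 <= x - x0) by lra; nra.
- apply (Hz (2 * K)).
  destruct (MVT_gen (fun y => d y ^ 2 * exp (2 * K * y)) x0 x
    (fun y => (2 * d y * dd y + 2 * K * d y ^ 2) * exp (2 * K * y))) as (c & Hc & E).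
  + intros y Hy; apply Hd; lra.
  + intros y Hy; apply continuity_pt_filterlim.
    apply (ex_derive_continuous (fun y => d y ^ 2 * exp (2 * K * y))).
    eexists; now apply Hd.
  + rewrite H0 in E.
    assert (B := Hb c Hc); apply Rabs_le_between in B.
    assert (Hp := exp_pos (2 * K * c)).
    assert (0 <= (2 * d c * dd c + 2 * K * d c ^ 2) * exp (2 * K * c)).
    { apply Rmult_le_pos; lra. }
    assert (x - x0 <= 0) by lra; nra.
Qed.

Definition periodic_polar (k : coeffs) (e : R) (u : R -> R) : Prop :=
  (forall phi, is_derive u phi (Fu k e phi (u phi))) /\
  (forall phi, u (phi + 2 * PI) = u phi) /\ (forall phi, 0 < u phi).

Definition leaf (u : R -> R) (p : R * R) : Prop := exists phi, pt phi (u phi) = p.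

Lemma polar_eq_between (U L e : R) (k : coeffs) (u v : R -> R) (x0 x : R) :
  regular U k L e ->
  (forall y, Rmin x0 x <= y <= Rmax x0 x -> is_derive u y (Fu k e y (u y))) ->
  (forall y, Rmin x0 x <= y <= Rmax x0 x -> is_derive v y (Fu k e y (v y))) ->
  (forall y, Rmin x0 x <= y <= Rmax x0 x -> Rabs (u y) <= 2 * U /\ Rabs (v y) <= 2 * U) ->
  u x0 = v x0 -> u x = v x.
Proof.
intros Hr Hu Hv HB E.
apply Rminus_diag_uniq.
apply (gronwall_zero (fun y => u y - v y)
  (fun y => Fu k e y (u y) - Fu k e y (v y)) L x0 x); [| lra].
intros y Hy; split.
- apply (is_derive_minus (V := R_NormedModule) u v); auto.
- apply (reg_Fu _ _ _ _ Hr); now apply HB.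
Qed.

Lemma polar_eq (U L e : R) (k : coeffs) (u v : R -> R) (x0 : R) :
  regular U k L e ->
  (forall y, is_derive u y (Fu k e y (u y))) ->
  (forall y, is_derive v y (Fu k e y (v y))) ->
  (forall y, 0 < u y <= 2 * U) -> (forall y, 0 < v y <= 2 * U) ->
  u x0 = v x0 -> forall x, u x = v x.
Proof.
intros Hr Hu Hv Bu Bv E x; apply (polar_eq_between U L e k u v x0); auto.
intros y _; generalize (Bu y) (Bv y); intros; split; rewrite Rabs_pos_eq; lra.
Qed.

Lemma periodic_min (u : R -> R) : (forall x, continuous u x) ->
  (forall x, u (x + 2 * PI) = u x) -> (forall x, 0 < u x) ->
  exists m, 0 < m /\ forall x, m <= u x.
Proof.
intros Hc Hp H0; assert (HP := PI_RGT_0).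
destruct (continuity_ab_min u 0 (2 * PI)) as (x0 & Hm & _).
- lra.
- intros c _; apply continuity_pt_filterlim; apply Hc.
- exists (u x0); split; [apply H0 |]; intros x.
  destruct (angle_reduce x) as (n & y & -> & Hy).
  rewrite (periodic_IZR u Hp); apply Hm; lra.
Qed.

Lemma omega_pt_regular (k : coeffs) (e phi u : R) : u <> 0 ->
  1 + e * Qf k phi u <> 0 -> omega k e (pt phi u) <> (0, 0).
Proof.
intros Hu HQ E.
assert (E1 := omega_pt_dx k e phi u Hu); assert (E2 := omega_pt_dy k e phi u Hu).
rewrite E in E1, E2; simpl fst in E1; simpl snd in E2.
assert (H := cs4_sn2 phi); apply HQ.
transitivity ((cs phi ^ 4 + 2 * sn phi ^ 2) * (1 + e * Qf k phi u)); [rewrite H; ring |].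
transitivity (2 * sn phi * u ^ 2 *
   ((sn phi * (1 + e * Qf k phi u) + e * cs phi * Nf k phi u) / u ^ 2) -
  cs phi * u ^ 3 *
   (- (cs phi ^ 3 * (1 + e * Qf k phi u) - 2 * e * sn phi * Nf k phi u) / u ^ 3)).
- field; assumption.
- rewrite <- E1, <- E2; ring.
Qed.

Lemma closed_leaf_of_polar (U L e : R) (k : coeffs) (u : R -> R) :
  regular U k L e -> periodic_polar k e u -> (forall phi, u phi <= 2 * U) ->
  closed_leaf (omega k e) (leaf u).
Proof.
intros Hr (D & Hp & H0) HU; assert (HP := PI_RGT_0).
assert (Hc : forall x, continuous u x) by (intros; apply (continuous_of_derive u _ x D)).
destruct (periodic_min u Hc Hp H0) as (m & Hm & Hmu).
assert (HQ : forall phi, / 2 <= 1 + e * Qf k phi (u phi) <= 2).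
{ intros phi; apply (reg_Q _ _ _ _ Hr); generalize (H0 phi) (HU phi); intros.
  rewrite Rabs_pos_eq; lra. }
destruct (time_of_angle k e m u Hm Hc Hmu HQ) as
  (tau & th & T0 & T1 & T2 & T3 & _ & T4 & T5); specialize (T5 Hp).
exists (fun s => pt (th s) (u (th s))), (tau (2 * PI)).
split; [rewrite <- T0; apply T3; lra |].
split; [intros t; apply T4, D |].
split; [| split].
- intros t.
  assert (E : th (t + tau (2 * PI)) = th t + 2 * PI).
  { rewrite <- (T1 t) at 1; rewrite <- T5; apply T2. }
  now rewrite E, Hp, pt_periodic.
- apply omega_pt_regular.
  + generalize (H0 (th 0)); lra.
  + generalize (HQ (th 0)); lra.
- intros p; split; [intros [phi Hphi] | intros [t Ht]].
  + exists (tau phi); now rewrite T2.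
  + now exists (th t).
Qed.

(** * Lifting a closed leaf to a periodic solution in polar coordinates *)

Definition is_C1 (f : R -> R) : Prop :=
  exists df : R -> R, (forall t, is_derive f t (df t)) /\ (forall t, continuous df t).

Lemma is_C1_continuous (f : R -> R) : is_C1 f -> forall t, continuous f t.
Proof. intros (df & H & _) t; apply (continuous_of_derive f df t H). Qed.

Lemma is_C1_const (c : R) : is_C1 (fun _ => c).
Proof.
exists (fun _ => 0); split; intros; [apply (is_derive_const c) | apply continuous_const].
Qed.

Lemma is_C1_plus (f g : R -> R) : is_C1 f -> is_C1 g -> is_C1 (fun t => f t + g t).
Proof.
intros (df & Hf & Cf) (dg & Hg & Cg); exists (fun t => df t + dg t); split; intros.
- now apply (is_derive_plus (V := R_NormedModule)).
- now apply continuous_Rplus.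
Qed.

Lemma is_C1_mult (f g : R -> R) : is_C1 f -> is_C1 g -> is_C1 (fun t => f t * g t).
Proof.
intros Hf Hg; assert (Kf := is_C1_continuous f Hf); assert (Kg := is_C1_continuous g Hg).
destruct Hf as (df & Hf & Cf), Hg as (dg & Hg & Cg).
exists (fun t => df t * g t + f t * dg t); split; intros t.
- apply (is_derive_mult (K := R_AbsRing)); auto; intros; apply Rmult_comm.
- apply continuous_Rplus; apply continuous_Rmult; auto.
Qed.

Lemma is_C1_pow (f : R -> R) (n : nat) : is_C1 f -> is_C1 (fun t => f t ^ n).
Proof. intros H; induction n; [apply (is_C1_const 1) | now apply is_C1_mult]. Qed.

Lemma is_C1_inv (f : R -> R) : (forall t, f t <> 0) -> is_C1 f -> is_C1 (fun t => / f t).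
Proof.
intros H0 Hf; assert (Kf := is_C1_continuous f Hf); destruct Hf as (df & Hf & Cf).
exists (fun t => - df t / f t ^ 2); split; intros t.
- now apply is_derive_inv.
- apply continuous_Rmult; [apply continuous_Ropp; auto |].
  apply continuous_Rinv; [now apply pow_nonzero | now apply continuous_pow].
Qed.

Lemma is_C1_sqrt (f : R -> R) : (forall t, 0 < f t) -> is_C1 f -> is_C1 (fun t => sqrt (f t)).
Proof.
intros H0 Hf; assert (Kf := is_C1_continuous f Hf); destruct Hf as (df & Hf & Cf).
exists (fun t => df t / (2 * sqrt (f t))); split; intros t.
- now apply is_derive_sqrt.
- apply continuous_Rmult; [auto |].
  apply continuous_Rinv.
  + generalize (sqrt_lt_R0 _ (H0 t)); lra.
  + apply (continuous_Rmult (fun _ => 2)); [apply continuous_const |].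
    apply (continuous_comp f sqrt); [apply Kf |].
    apply continuity_pt_filterlim, continuity_pt_sqrt, Rlt_le, H0.
Qed.

Lemma angle_exists (p q : R) : p ^ 2 + q ^ 2 = 1 -> exists f, cos f = p /\ sin f = q.
Proof.
intros H; assert (Hp : -1 <= p <= 1) by (split; nra).
assert (Hs : Rsqr q = 1 - Rsqr p) by (unfold Rsqr; lra).
destruct (Rle_dec 0 q) as [Hq | Hq].
- exists (acos p); split; [now apply cos_acos |].
  rewrite sin_acos by assumption; rewrite <- Hs; now apply sqrt_Rsqr.
- exists (- acos p); split; [rewrite cos_neg; now apply cos_acos |].
  rewrite sin_neg, sin_acos by assumption; rewrite <- Hs, sqrt_Rsqr_abs.
  rewrite Rabs_left; lra.
Qed.

(** The angle is the integral of p q' - q p', starting from a suitable value. The scalar product of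
    (p, q) with (cos f, sin f) then has derivative 0 and equals 1 at time 0. *)
Lemma angle_lift (p q : R -> R) : is_C1 p -> is_C1 q -> (forall t, p t ^ 2 + q t ^ 2 = 1) ->
  exists f df : R -> R, (forall t, is_derive f t (df t)) /\
    (forall t, cos (f t) = p t /\ sin (f t) = q t).
Proof.
intros Hp Hq H1; assert (Kp := is_C1_continuous p Hp); assert (Kq := is_C1_continuous q Hq).
destruct Hp as (dp & Hp & Cp), Hq as (dq & Hq & Cq).
set (df := fun t => p t * dq t - q t * dp t).
assert (Cdf : forall t, continuous df t).
{ intros t; apply continuous_Rminus; apply continuous_Rmult; auto. }
destruct (angle_exists _ _ (H1 0)) as (f0 & Hc0 & Hs0).
set (f := fun t => f0 + RInt df 0 t).
assert (Hf : forall t, is_derive f t (df t)).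
{ intros t; unfold f; rewrite <- (Rplus_0_l (df t)).
  apply (is_derive_plus (V := R_NormedModule) (fun _ => f0) (fun t => RInt df 0 t));
    [apply (is_derive_const f0) | now apply is_derive_RInt_cont]. }
assert (Ht : forall t, p t * dp t + q t * dq t = 0).
{ intros t.
  assert (D : is_derive (fun t => p t ^ 2 + q t ^ 2) t (2 * dp t * p t + 2 * dq t * q t)).
  { evar_last.
    - apply (is_derive_plus (V := R_NormedModule) (fun t => p t ^ 2) (fun t => q t ^ 2)).
      + exact (is_derive_pow p 2 t _ (Hp t)).
      + exact (is_derive_pow q 2 t _ (Hq t)).
    - unfold plus; simpl; match goal with |- ?a = ?b => change (@eq R a b) end; ring. }
  apply (is_derive_ext _ (fun _ => 1)) in D; [| exact H1].
  assert (E := is_derive_unique _ _ _ D); rewrite Derive_const in E; lra. }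
set (F := fun t => p t * cos (f t) + q t * sin (f t)).
assert (HF : forall t, is_derive F t 0).
{ intros t.
  assert (D1 : is_derive (fun t => cos (f t)) t (df t * - sin (f t))).
  { apply (is_derive_comp cos f); [apply is_derive_cos | apply Hf]. }
  assert (D2 : is_derive (fun t => sin (f t)) t (df t * cos (f t))).
  { apply (is_derive_comp sin f); [apply is_derive_sin | apply Hf]. }
  evar_last.
  - apply (is_derive_plus (V := R_NormedModule) (fun t => p t * cos (f t))
      (fun t => q t * sin (f t))).
    + exact (is_derive_mult p (fun t => cos (f t)) t _ _ (Hp t) D1 Rmult_comm).
    + exact (is_derive_mult q (fun t => sin (f t)) t _ _ (Hq t) D2 Rmult_comm).
  - unfold plus, mult; simpl; match goal with |- ?a = ?b => change (@eq R a b) end.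
    assert (Edp : dp t = - q t * df t).
    { unfold df; transitivity (p t * (p t * dp t + q t * dq t) +
        (1 - (p t ^ 2 + q t ^ 2)) * dp t - q t * (p t * dq t - q t * dp t));
        [ring | rewrite Ht, H1; ring]. }
    assert (Edq : dq t = p t * df t).
    { unfold df; transitivity (q t * (p t * dp t + q t * dq t) +
        (1 - (p t ^ 2 + q t ^ 2)) * dq t + p t * (p t * dq t - q t * dp t));
        [ring | rewrite Ht, H1; ring]. }
    rewrite Edp, Edq; ring. }
assert (F1 : forall t, F t = 1).
{ intros t; destruct (MVT_gen F 0 t (fun _ => 0)) as [z [_ Hz]].
  - intros; apply HF.
  - intros; now apply continuity_of_derive with (fun _ => 0).
  - assert (F 0 = 1); [| lra].
    unfold F, f; rewrite RInt_point; unfold zero; simpl.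
    rewrite Rplus_0_r, Hc0, Hs0, <- (H1 0); ring. }
exists f, df; split; [exact Hf |]; intros t.
assert (E := F1 t); unfold F in E.
assert (Es := sin2_cos2' (f t)); assert (Ep := H1 t).
(* Two unit vectors with scalar product 1 coincide. *)
assert (Z : (p t - cos (f t)) ^ 2 + (q t - sin (f t)) ^ 2 = 0) by nra.
assert (Z1 := pow2_ge_0 (p t - cos (f t))); assert (Z2 := pow2_ge_0 (q t - sin (f t))).
split; nra.
Qed.

Lemma same_angle (x y : R) : cos x = cos y -> sin x = sin y ->
  exists n : Z, x = y + 2 * PI * IZR n.
Proof.
intros Hc Hs.
assert (E : cos (x - y) = 1).
{ rewrite cos_minus, Hc, Hs; generalize (sin2_cos2 y); unfold Rsqr; lra. }
destruct (sin_eq_0_0 ((x - y) / 2)) as [n Hn].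
{ assert (E' := cos_2a_sin ((x - y) / 2)).
  replace (2 * ((x - y) / 2)) with (x - y) in E' by field; nra. }
exists n; lra.
Qed.

Definition N4 (p : R * R) : R := fst p ^ 4 + 2 * snd p ^ 2.

Lemma N4_pt (phi u : R) : u <> 0 -> N4 (pt phi u) = / u ^ 4.
Proof.
intros Hu; unfold N4, pt; simpl fst; simpl snd.
transitivity ((cs phi ^ 4 + 2 * sn phi ^ 2) / u ^ 4); [field; assumption |].
rewrite cs4_sn2; field; assumption.
Qed.

Lemma pow4_le_reg (x y : R) : 0 <= y -> x ^ 4 <= y ^ 4 -> x <= y.
Proof.
intros Hy H; apply Rnot_lt_le; intros Hlt.
assert (y ^ 2 < x ^ 2) by nra; assert (0 <= y ^ 2) by nra; nra.
Qed.

Lemma pow4_inj (x y : R) : 0 <= x -> 0 <= y -> x ^ 4 = y ^ 4 -> x = y.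
Proof. intros; apply Rle_antisym; apply pow4_le_reg; lra. Qed.

(* [x = lam * p] and [y = - lam ^ 2 * q] with [p ^ 2 + q ^ 2 = 1] if and only if
   [lam ^ 4 - x ^ 2 * lam ^ 2 - y ^ 2 = 0]. *)
Definition lam2 (p : R * R) : R :=
  (fst p ^ 2 + sqrt ((fst p ^ 2) ^ 2 + 4 * snd p ^ 2)) / 2.

Lemma N4_pos_discr (p : R * R) : 0 < N4 p -> 0 < (fst p ^ 2) ^ 2 + 4 * snd p ^ 2.
Proof. unfold N4; generalize (pow2_ge_0 (snd p)); intros; nra. Qed.

Lemma lam2_pos (p : R * R) : 0 < N4 p -> 0 < lam2 p.
Proof.
intros H; unfold lam2.
generalize (sqrt_lt_R0 _ (N4_pos_discr p H)) (pow2_ge_0 (fst p)); lra.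
Qed.

Lemma lam2_eq (p : R * R) : lam2 p ^ 2 = fst p ^ 2 * lam2 p + snd p ^ 2.
Proof.
assert (H : 0 <= (fst p ^ 2) ^ 2 + 4 * snd p ^ 2)
  by (generalize (pow2_ge_0 (fst p ^ 2)) (pow2_ge_0 (snd p)); lra).
unfold lam2; generalize (pow2_sqrt _ H).
generalize (sqrt ((fst p ^ 2) ^ 2 + 4 * snd p ^ 2)); intros s Hs.
transitivity (((fst p ^ 2) ^ 2 + 2 * fst p ^ 2 * s + s ^ 2) / 4); [field |].
rewrite Hs; field.
Qed.

Lemma polar_coordinates (p : R * R) : 0 < N4 p ->
  (fst p / sqrt (lam2 p)) ^ 2 + (- snd p / lam2 p) ^ 2 = 1 /\
  forall phi, cos phi = fst p / sqrt (lam2 p) -> sin phi = - snd p / lam2 p ->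
    p = pt phi (/ (sqrt (lam2 p) * quart phi)).
Proof.
intros H; assert (HL := lam2_pos p H); assert (Hs := sqrt_lt_R0 _ HL).
assert (Es := pow2_sqrt (lam2 p) ltac:(lra)); split.
- transitivity ((fst p ^ 2 * lam2 p + snd p ^ 2) / lam2 p ^ 2).
  + unfold Rdiv; rewrite !Rpow_mult_distr, !pow_inv, Es; field; lra.
  + rewrite <- lam2_eq; field; lra.
- intros phi Hc Hsn; assert (Hq := quart_ge_1 phi).
  unfold pt, cs, sn; rewrite Hc, Hsn; rewrite surjective_pairing at 1; f_equal.
  + field; lra.
  + transitivity (snd p / lam2 p * sqrt (lam2 p) ^ 2); [rewrite Es; field; lra |].
    field; lra.
Qed.

Lemma is_C1_of_curve (k : coeffs) (e : R) (g : R -> R * R) :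
  (forall t, integral_curve_at (omega k e) g t) ->
  is_C1 (fun t => fst (g t)) /\ is_C1 (fun t => snd (g t)).
Proof.
intros H.
assert (Cx : forall t, continuous (fun t => fst (g t)) t)
  by (intros t; apply (ex_derive_continuous (fun t => fst (g t)));
      exact (ex_intro _ _ (proj1 (H t)))).
assert (Cy : forall t, continuous (fun t => snd (g t)) t)
  by (intros t; apply (ex_derive_continuous (fun t => snd (g t)));
      exact (ex_intro _ _ (proj2 (H t)))).
split; [exists (fun t => snd (omega k e (g t))) | exists (fun t => - fst (omega k e (g t)))];
  (split; [intros t; first [exact (proj1 (H t)) | exact (proj2 (H t))] |]); intros t;
  assert (Hx := Cx t); assert (Hy := Cy t);
  unfold omega, omega1, dHam; cbn [fst snd]; repeat cont_step.
Qed.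

Lemma pow4_continuous_inverse (u v : R) : 0 < u -> 0 < v -> / u ^ 4 = / v ^ 4 -> u = v.
Proof.
intros Hu Hv E; apply pow4_inj; try lra.
rewrite <- (Rinv_inv (u ^ 4)), E; apply Rinv_inv.
Qed.

(* The difference with the solution shifted by a turn has a constant sign if it
   does not vanish, so that the solution is monotone along successive turns. *)
Lemma periodic_of_multiply_periodic (U L e : R) (k : coeffs) (u : R -> R) (x0 : R) (n : nat) :
  regular U k L e -> (forall y, is_derive u y (Fu k e y (u y))) ->
  (forall y, 0 < u y <= 2 * U) -> u (x0 + 2 * PI * INR (S n)) = u x0 ->
  forall y, u (y + 2 * PI) = u y.
Proof.
intros Hr Hu B E.
set (v := fun y => u (y + 2 * PI)).
assert (Hv : forall y, is_derive v y (Fu k e y (v y))).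
{ intros y; unfold v; rewrite <- Fu_periodic.
  rewrite <- (Rmult_1_l (Fu k e (y + 2 * PI) (u (y + 2 * PI)))).
  apply (is_derive_comp u (fun y => y + 2 * PI)); [apply Hu |].
  auto_derive; [exact I | ring]. }
assert (Bv : forall y, 0 < v y <= 2 * U) by (intros; apply B).
intros y; apply (polar_eq U L e k v u x0); auto; apply NNPP; intros Hne.
assert (Hz : forall y, v y - u y <> 0).
{ intros z Hz; apply Hne; apply (polar_eq U L e k v u z); auto; lra. }
assert (Cd : forall y, continuity_pt (fun y => v y - u y) y).
{ intros z; apply continuity_pt_filterlim; apply (continuous_Rminus v u);
    [apply (continuous_of_derive v _ z Hv) | apply (continuous_of_derive u _ z Hu)]. }
assert (Hsign : forall x y, 0 < v x - u x -> v y - u y < 0 -> False).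
{ intros x z Hx Hz'; destruct (IVT_gen (fun y => v y - u y) x z 0) as (c & _ & Hc).
  - exact Cd.
  - split; [eapply Rle_trans; [apply Rmin_r | lra] | eapply Rle_trans; [| apply Rmax_l]; lra].
  - exact (Hz c Hc). }
assert (Hstep : forall m, u (x0 + 2 * PI * INR (S m)) = v (x0 + 2 * PI * INR m)).
{ intros m; unfold v; f_equal; rewrite S_INR; ring. }
destruct (Rtotal_order (v x0 - u x0) 0) as [H | [H | H]]; [| exact (Hz _ H) |].
- assert (Hm : forall m, u (x0 + 2 * PI * INR (S m)) < u x0).
  { induction m as [| m IH].
    - rewrite Hstep; simpl INR; replace (x0 + 2 * PI * 0) with x0 by ring; lra.
    - rewrite Hstep; apply Rlt_trans with (2 := IH), Rnot_le_lt; intros Hle.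
      apply (Hsign (x0 + 2 * PI * INR (S m)) x0); [| assumption].
      assert (Hn := Hz (x0 + 2 * PI * INR (S m))); lra. }
  generalize (Hm n); lra.
- assert (Hm : forall m, u x0 < u (x0 + 2 * PI * INR (S m))).
  { induction m as [| m IH].
    - rewrite Hstep; simpl INR; replace (x0 + 2 * PI * 0) with x0 by ring; lra.
    - rewrite Hstep; apply Rlt_trans with (1 := IH), Rnot_le_lt; intros Hle.
      apply (Hsign x0 (x0 + 2 * PI * INR (S m))); [assumption |].
      assert (Hn := Hz (x0 + 2 * PI * INR (S m))); lra. }
  generalize (Hm n); lra.
Qed.

(** The lower bound on [N4] keeps the leaf where u <= U. There the angle has a speed bounded below,
    so it parametrizes the leaf. A period of the leaf may be several turns;
    [periodic_of_multiply_periodic] reduces them to one. *)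
Lemma polar_of_closed_leaf (U L e : R) (k : coeffs) (Lf : R * R -> Prop) :
  0 < U -> regular U k L e -> closed_leaf (omega k e) Lf ->
  (forall p, Lf p -> / U ^ 4 <= N4 p) ->
  exists u, periodic_polar k e u /\ (forall phi, u phi <= U) /\ set_eq Lf (leaf u).
Proof.
intros HU Hr (g & T & HT & Hg & Hper & _ & HL) HN.
assert (HU4 : 0 < / U ^ 4) by (apply Rinv_0_lt_compat, pow_lt, HU).
assert (HgN : forall t, / U ^ 4 <= N4 (g t)) by (intros t; apply HN, HL; now exists t).
assert (HgN0 : forall t, 0 < N4 (g t)) by (intros t; generalize (HgN t); lra).
destruct (is_C1_of_curve k e g Hg) as [Cx Cy].
assert (HL2 : forall t, 0 < lam2 (g t)) by (intros; now apply lam2_pos).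
assert (Hs0 : forall t, 0 < sqrt (lam2 (g t))) by (intros; now apply sqrt_lt_R0).
assert (CL : is_C1 (fun t => lam2 (g t))).
{ unfold lam2, Rdiv; apply (is_C1_mult _ (fun _ => / 2)); [| apply is_C1_const].
  apply (is_C1_plus (fun t => fst (g t) ^ 2)
    (fun t => sqrt ((fst (g t) ^ 2) ^ 2 + 4 * snd (g t) ^ 2)));
    [now apply is_C1_pow |].
  apply is_C1_sqrt; [intros t; now apply N4_pos_discr |].
  apply is_C1_plus; [now apply (is_C1_pow (fun t => fst (g t) ^ 2)), is_C1_pow |].
  apply (is_C1_mult (fun _ => 4)); [apply is_C1_const | now apply is_C1_pow]. }
assert (CS : is_C1 (fun t => sqrt (lam2 (g t)))) by now apply is_C1_sqrt.
destruct (angle_lift (fun t => fst (g t) / sqrt (lam2 (g t)))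
  (fun t => - snd (g t) / lam2 (g t))) as (f & df & Hf & Hcs).
- apply is_C1_mult; [assumption |]; apply is_C1_inv; [| assumption].
  intros t; generalize (Hs0 t); lra.
- unfold Rdiv; apply is_C1_mult.
  + destruct Cy as (dy & D & K); exists (fun t => - dy t); split; intros t.
    * now apply (is_derive_opp (V := R_NormedModule) (fun t => snd (g t))).
    * now apply continuous_Ropp.
  + apply is_C1_inv; [| assumption]; intros t; generalize (HL2 t); lra.
- intros t; now apply polar_coordinates.
- set (u := fun t => / (sqrt (lam2 (g t)) * quart (f t))).
  assert (Hg' : forall t, g t = pt (f t) (u t)).
  { intros t; destruct (Hcs t) as [H1 H2].
    now apply (proj2 (polar_coordinates (g t) (HgN0 t))). }
  assert (Hu0 : forall t, 0 < u t).
  { intros t; apply Rinv_0_lt_compat, Rmult_lt_0_compat; [apply Hs0 |].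
    generalize (quart_ge_1 (f t)); lra. }
  assert (HuN : forall t, / u t ^ 4 = N4 (g t)).
  { intros t; rewrite Hg', N4_pt; [reflexivity | generalize (Hu0 t); lra]. }
  assert (HuU : forall t, u t <= U).
  { intros t; apply pow4_le_reg; [lra |].
    rewrite <- (Rinv_inv (u t ^ 4)), HuN, <- (Rinv_inv (U ^ 4)).
    now apply Rinv_le_contravar. }
  assert (Hdu : exists du, forall t, is_derive u t (du t)).
  { destruct CS as (ds & Ds & _).
    eexists; intros t; unfold u; apply is_derive_inv.
    - apply (is_derive_mult (K := R_AbsRing) (fun t => sqrt (lam2 (g t)))
        (fun t => quart (f t))); [apply Ds | | intros; apply Rmult_comm].
      apply (is_derive_comp quart f); [apply is_derive_quart | apply Hf].
    - generalize (Hs0 t) (quart_ge_1 (f t)); intros; apply Rgt_not_eq; nra. }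
  destruct Hdu as [du Hdu].
  assert (Hode : forall t, df t = (1 + e * Qf k (f t) (u t)) / (kap (f t) * u t) /\
    du t = - e * Nf k (f t) (u t)).
  { intros t; apply polar_of_integral_curve; auto.
    - generalize (Hu0 t); lra.
    - replace (fun s => pt (f s) (u s)) with g; [apply Hg |].
      extensionality s; apply Hg'. }
  assert (HQ : forall t, / 2 <= 1 + e * Qf k (f t) (u t) <= 2).
  { intros t; apply (reg_Q _ _ _ _ Hr); generalize (Hu0 t) (HuU t); intros.
    rewrite Rabs_pos_eq; lra. }
  (* The angular speed (1 + e Q) / (kap u) is at least (1/2) / (2 U). *)
  destruct (inverse_of_derive f df (/ (4 * U))) as (th & H1 & H2 & H3 & H4).
  + apply Rinv_0_lt_compat; lra.
  + exact Hf.
  + intros t; rewrite (proj1 (Hode t)).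
    generalize (Hu0 t) (HuU t) (HQ t) (kap_pos (f t)) (kap_bound (f t)); intros A1 A2 A3 A4 A5.
    rewrite Rabs_pos_eq in A5 by lra.
    apply Rle_trans with (/ 2 * / (2 * U)).
    * rewrite <- Rinv_mult; apply Rinv_le_contravar; lra.
    * apply Rmult_le_compat; try lra; [apply Rlt_le, Rinv_0_lt_compat; lra |].
      apply Rinv_le_contravar; nra.
  + set (v := fun phi => u (th phi)).
    assert (Hv : forall phi, is_derive v phi (Fu k e phi (v phi))).
    { intros phi; evar_last; [apply (is_derive_comp u th); [apply Hdu | apply H3] |].
      destruct (Hode (th phi)) as [E1 E2].
      unfold scal; simpl; unfold mult; simpl; rewrite E1, E2, H1; unfold Fu, v.
      generalize (Hu0 (th phi)) (HQ (th phi)) (kap_pos phi); rewrite H1; intros.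
      field; lra. }
    assert (Bv : forall phi, 0 < v phi <= 2 * U).
    { intros phi; unfold v; generalize (Hu0 (th phi)) (HuU (th phi)); lra. }
    assert (HgT : g T = g 0) by (rewrite <- (Rplus_0_l T); apply Hper).
    destruct (same_angle (f T) (f 0)) as [n Hn].
    { now rewrite (proj1 (Hcs T)), (proj1 (Hcs 0)), HgT. }
    { now rewrite (proj2 (Hcs T)), (proj2 (Hcs 0)), HgT. }
    (* The angle is strictly increasing, so a period of the leaf makes a positive number of
       turns. *)
    assert (Hn0 : (0 < n)%Z).
    { apply lt_IZR; generalize (H4 0 T HT) PI_RGT_0; intros; nra. }
    exists v; split; [split; [exact Hv |]; split; [| apply Bv] | split].
    * apply (periodic_of_multiply_periodic U L e k v (f 0) (Z.to_nat (n - 1))); auto.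
      replace (INR (S (Z.to_nat (n - 1)))) with (IZR n).
      -- rewrite <- Hn; unfold v; rewrite !H2.
         apply pow4_continuous_inverse; auto; rewrite !HuN.
         now rewrite HgT.
      -- rewrite INR_IZR_INZ; f_equal; lia.
    * intros phi; apply HuU.
    * intros p; rewrite HL; split.
      -- intros [t <-]; exists (f t); unfold v; rewrite H2; now rewrite <- Hg'.
      -- intros [phi <-]; exists (th phi); rewrite Hg', H1; reflexivity.
Qed.

Lemma periodic_polar_unique (U L e : R) (k : coeffs) (u v : R -> R) :
  regular U k L e -> periodic_polar k e u -> periodic_polar k e v ->
  (forall phi, u phi <= 2 * U) -> (forall phi, v phi <= 2 * U) ->
  u 0 = v 0 -> set_eq (leaf u) (leaf v).
Proof.
intros Hr (Du & _ & Hu) (Dv & _ & Hv) Bu Bv E.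
assert (H : forall x, u x = v x) by (apply (polar_eq U L e k u v 0); auto).
intros p; split; intros [phi <-]; exists phi; now rewrite H.
Qed.

Lemma polar_is_Eser (U L e : R) (k : coeffs) (u : R -> R) (phi : R) :
  0 < U -> regular U k L e -> (forall y, is_derive u y (Fu k e y (u y))) ->
  (forall y, 0 < u y <= 2 * U) -> u 0 <= U -> Rabs phi < 9 ->
  u phi = u 0 * Eser k phi (u 0) e.
Proof.
intros HU Hr Du Bu H0 Hphi.
assert (Ha : Rabs (u 0) <= U) by (rewrite Rabs_pos_eq; generalize (Bu 0); lra).
assert (H9 : forall y, Rmin 0 phi <= y <= Rmax 0 phi -> Rabs y < 9).
{ intros y; apply Rabs_lt_between in Hphi; unfold Rmin, Rmax.
  destruct (Rle_dec 0 phi); intros; apply Rabs_lt_between; lra. }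
apply (polar_eq_between U L e k u (fun x => u 0 * Eser k x (u 0) e) 0 phi); auto.
- intros y Hy; apply (reg_ode _ _ _ _ Hr); auto.
- intros y Hy; generalize (Bu y) (Bu 0); intros; split; [rewrite Rabs_pos_eq; lra |].
  assert (D : in_dom U y (u 0)) by (split; [generalize (H9 y Hy); lra | assumption]).
  generalize (Eser_bounds _ _ _ _ _ _ Hr D); intros.
  rewrite Rabs_pos_eq; nra.
- rewrite (proj1 (reg_init _ _ _ _ Hr (u 0) Ha)); ring.
Qed.

Lemma Rser_of_periodic (U L e : R) (k : coeffs) (u : R -> R) :
  0 < U -> regular U k L e -> periodic_polar k e u -> (forall phi, u phi <= 2 * U) ->
  u 0 <= U -> Rser k (2 * PI) (u 0) e = 1.
Proof.
intros HU Hr (Du & Pu & Hu) Bu H0.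
assert (HP : Rabs (2 * PI) < 9)
  by (generalize PI_RGT_0 PI_4; intros; rewrite Rabs_pos_eq; lra).
assert (Ha : Rabs (u 0) <= U) by (rewrite Rabs_pos_eq; generalize (Hu 0); lra).
assert (E := polar_is_Eser U L e k u (2 * PI) HU Hr Du ltac:(auto) H0 HP).
rewrite <- (Rplus_0_l (2 * PI)) in E at 1; rewrite Pu in E.
assert (HI := reg_inv _ _ _ _ Hr (2 * PI) (u 0) HP Ha).
assert (E1 : Eser k (2 * PI) (u 0) e = 1).
{ apply (Rmult_eq_reg_l (u 0)); generalize (Hu 0); lra. }
rewrite E1 in HI; lra.
Qed.

(** * An integrating factor *)

(** The tube lemma. It turns local statements at e = 0, or at one initial value, into statements
    that are uniform over a whole turn. *)
Lemma tube (x0 a b : R) (P : R -> R -> Prop) :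
  (forall y, a <= y <= b -> locally (x0, y) (fun p => P (fst p) (snd p))) ->
  exists d : posreal, forall x y, Rabs (x - x0) < d -> a <= y <= b -> P x y.
Proof.
intros H.
assert (H' : forall y, exists d : posreal, a <= y <= b ->
  forall x z, Rabs (x - x0) < d -> Rabs (z - y) < d -> P x z).
{ intros y; destruct (classic (a <= y <= b)) as [Hy | Hy].
  - destruct (H y Hy) as [d Hd]; exists d; intros _ x z Hx Hz.
    apply (Hd (x, z)); now split.
  - exists (mkposreal 1 Rlt_0_1); tauto. }
set (delta := fun y => proj1_sig (constructive_indefinite_description _ (H' y))).
destruct (compactness_value_1d a b delta) as [d Hd].
exists d; intros x y Hx Hy; apply NNPP; intros HP.
apply (Hd y Hy); intros (t & Ht & Hyt & Hdt); apply HP.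
unfold delta in Hyt, Hdt.
destruct (constructive_indefinite_description _ (H' t)) as [dt Hdt']; simpl in *.
apply (Hdt' Ht x y); [lra | assumption].
Qed.

Lemma continuous_Rlt {T : UniformSpace} (f : T -> R) (x : T) (c : R) :
  continuous f x -> c < f x -> locally x (fun y => c < f y).
Proof.
intros H Hc; apply (H (fun z => c < z)); apply (open_gt c); assumption.
Qed.

Lemma tube_uniform (f : R * R -> R) (x0 a b : R) :
  (forall y, a <= y <= b -> continuous f (x0, y)) -> forall eta, 0 < eta ->
  exists d : posreal, forall x y, Rabs (x - x0) < d -> a <= y <= b ->
    Rabs (f (x, y) - f (x0, y)) < eta.
Proof.
intros H eta Heta.
destruct (tube x0 a b (fun x y => Rabs (f (x, y) - f (x0, y)) < eta)) as [d Hd].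
- intros y Hy; assert (He : 0 < eta / 2) by lra.
  destruct (proj1 (filterlim_locally _ _) (H y Hy) (mkposreal _ He)) as [d Hd].
  exists d; intros [x z] [Hx Hz]; simpl in Hx, Hz |- *.
  assert (B1 := Hd (x, z) (conj Hx Hz)).
  assert (B2 := Hd (x0, z) (conj (ball_center x0 d) Hz)).
  change (Rabs (f (x, z) - f (x0, y)) < eta / 2) in B1.
  change (Rabs (f (x0, z) - f (x0, y)) < eta / 2) in B2.
  change (Rabs (f (x, z) - f (x0, z)) < eta).
  apply Rabs_def2 in B1; apply Rabs_def2 in B2; apply Rabs_def1; lra.
- exists d; intros x y Hx Hy; now apply Hd.
Qed.

Lemma continuous_sqrt_comp {T : UniformSpace} (f : T -> R) (x : T) :
  0 < f x -> continuous f x -> continuous (fun y => sqrt (f y)) x.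
Proof.
intros H0 H; apply (continuous_comp f sqrt); [assumption |].
apply continuity_pt_filterlim, continuity_pt_sqrt; lra.
Qed.

Lemma continuous_atan_comp {T : UniformSpace} (f : T -> R) (x : T) :
  continuous f x -> continuous (fun y => atan (f y)) x.
Proof.
intros H; apply (continuous_comp f atan); [assumption |].
apply (ex_derive_continuous atan); eexists; apply is_derive_atan.
Qed.

Lemma continuous_exp_comp {T : UniformSpace} (f : T -> R) (x : T) :
  continuous f x -> continuous (fun y => exp (f y)) x.
Proof.
intros H; apply (continuous_comp f exp); [assumption |].
apply (ex_derive_continuous exp); eexists; apply is_derive_exp.
Qed.

(* The argument of the point (nu sigma, z + mu sigma / 2), which lies off the
   negative half-axis. *)
Definition larg (mu nu sg z : R) : R :=
  2 * atan ((z + mu * sg / 2) /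
    (sqrt ((z + mu * sg / 2) ^ 2 + (nu * sg) ^ 2) + nu * sg)).

Definition lfac (mu nu sg z : R) : R := exp (- (mu / nu) * larg mu nu sg z).

(* A first integral of the linear system sigma' = z,
   z' = - (nu ^ 2 + mu ^ 2 / 4) sigma - mu z. *)
Definition lint (mu nu sg z : R) : R :=
  ((z + mu * sg / 2) ^ 2 + (nu * sg) ^ 2) * lfac mu nu sg z.

(** The tangent of the half-angle is p / (|(X, p)| + X), a formula that is smooth off the negative
    half-axis; its derivative is the usual angular form. *)
Lemma is_derive_arg (X p : R -> R) (t dX dp : R) :
  is_derive X t dX -> is_derive p t dp -> 0 < sqrt (p t ^ 2 + X t ^ 2) + X t ->
  0 < p t ^ 2 + X t ^ 2 ->
  is_derive (fun s => 2 * atan (p s / (sqrt (p s ^ 2 + X s ^ 2) + X s))) t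
    ((X t * dp - p t * dX) / (p t ^ 2 + X t ^ 2)).
Proof.
intros HX Hp H H2; assert (Hs := sqrt_lt_R0 _ H2).
assert (Es := pow2_sqrt _ (Rlt_le _ _ H2)).
assert (Ds : is_derive (fun s => sqrt (p s ^ 2 + X s ^ 2)) t
  ((2 * dp * p t + 2 * dX * X t) / (2 * sqrt (p t ^ 2 + X t ^ 2)))).
{ apply (is_derive_sqrt (fun s => p s ^ 2 + X s ^ 2)); [| assumption].
  evar_last.
  - apply (is_derive_plus (V := R_NormedModule) (fun s => p s ^ 2) (fun s => X s ^ 2)).
    + exact (is_derive_pow p 2 t _ Hp).
    + exact (is_derive_pow X 2 t _ HX).
  - unfold plus; simpl; match goal with |- ?a = ?b => change (@eq R a b) end; ring. }
assert (Dq : is_derive (fun s => sqrt (p s ^ 2 + X s ^ 2) + X s) t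
  ((2 * dp * p t + 2 * dX * X t) / (2 * sqrt (p t ^ 2 + X t ^ 2)) + dX)).
{ exact (is_derive_plus (V := R_NormedModule) _ _ t _ _ Ds HX). }
assert (Dr := is_derive_div p _ t _ _ Hp Dq (Rgt_not_eq _ _ H)).
assert (Da := is_derive_comp atan _ t _ _ (is_derive_atan _) Dr).
assert (D2 := is_derive_scal _ t 2 _ Da).
evar_last; [exact D2 |].
unfold scal; simpl; unfold mult; simpl; unfold Rsqr.
match goal with |- ?a = ?b => change (@eq R a b) end.
change (p t * (p t * 1)) with (p t ^ 2); change (X t * (X t * 1)) with (X t ^ 2).
set (s := sqrt (p t ^ 2 + X t ^ 2)) in *.
(* This identity, valid because s^2 = p^2 + X^2, cancels the denominator produced by the
   arctangent. *)
assert (K : (s + X t) ^ 2 + p t ^ 2 = 2 * s * (s + X t)).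
{ replace (p t ^ 2) with (s ^ 2 - X t ^ 2) by lra; ring. }
rewrite <- Es.
transitivity (2 * ((dp * (s + X t) - p t * ((2 * dp * p t + 2 * dX * X t) / (2 * s) + dX)) /
  ((s + X t) ^ 2 + p t ^ 2))).
- field; repeat split; try lra; rewrite K; apply Rgt_not_eq; nra.
- rewrite K.
  transitivity ((dp * (s * (s + X t) - p t ^ 2) - p t * dX * (X t + s)) /
    (s ^ 2 * (s + X t))); [field; lra |].
  replace (p t ^ 2) with (s ^ 2 - X t ^ 2) by lra; field; lra.
Qed.

(** The bracket is the one-form that vanishes along sigma' = z, z' = - (nu^2 + mu^2 / 4) sigma - mu
    z, and 2 [lfac] is an integrating factor for it. Arbitrary curves are allowed because the leaves
    follow the linear system only up to the terms in [gg0] and [gg2]. *)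
Lemma is_derive_lint (mu nu : R) (sg z : R -> R) (t dsg dz : R) :
  is_derive sg t dsg -> is_derive z t dz -> 0 < nu ->
  0 < (z t + mu * sg t / 2) ^ 2 + (nu * sg t) ^ 2 ->
  0 < sqrt ((z t + mu * sg t / 2) ^ 2 + (nu * sg t) ^ 2) + nu * sg t ->
  is_derive (fun s => lint mu nu (sg s) (z s)) t
    (2 * lfac mu nu (sg t) (z t) *
      (z t * dz + ((nu ^ 2 + mu ^ 2 / 4) * sg t + mu * z t) * dsg)).
Proof.
intros Hsg Hz Hnu Hq Hsq.
assert (DX : is_derive (fun s => nu * sg s) t (nu * dsg)).
{ exact (is_derive_scal sg t nu _ Hsg). }
assert (Dp : is_derive (fun s => z s + mu * sg s / 2) t (dz + mu * dsg / 2)).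
{ apply (is_derive_ext (fun s => z s + (mu / 2) * sg s)).
  - intros; match goal with |- ?a = ?b => change (@eq R a b) end; field.
  - evar_last.
    + exact (is_derive_plus (V := R_NormedModule) _ _ t _ _ Hz
        (is_derive_scal sg t (mu / 2) _ Hsg)).
    + unfold plus; simpl; match goal with |- ?a = ?b => change (@eq R a b) end; field. }
assert (Da := is_derive_arg _ _ t _ _ DX Dp Hsq Hq).
assert (Dl : is_derive (fun s => lfac mu nu (sg s) (z s)) t
  (- (mu / nu) * ((nu * sg t * (dz + mu * dsg / 2) - (z t + mu * sg t / 2) * (nu * dsg)) /
    ((z t + mu * sg t / 2) ^ 2 + (nu * sg t) ^ 2)) * lfac mu nu (sg t) (z t))).
{ unfold lfac at 1.
  exact (is_derive_comp exp _ t _ _ (is_derive_exp _)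
    (is_derive_scal _ t (- (mu / nu)) _ Da)). }
assert (Dq : is_derive (fun s => (z s + mu * sg s / 2) ^ 2 + (nu * sg s) ^ 2) t
  (2 * (dz + mu * dsg / 2) * (z t + mu * sg t / 2) + 2 * (nu * dsg) * (nu * sg t))).
{ evar_last.
  - apply (is_derive_plus (V := R_NormedModule)
      (fun s => (z s + mu * sg s / 2) ^ 2) (fun s => (nu * sg s) ^ 2)).
    + exact (is_derive_pow _ 2 t _ Dp).
    + exact (is_derive_pow _ 2 t _ DX).
  - unfold plus; simpl; match goal with |- ?a = ?b => change (@eq R a b) end; ring. }
unfold lint at 1; evar_last; [exact (is_derive_mult _ _ t _ _ Dq Dl Rmult_comm) |].
unfold plus, mult; simpl; match goal with |- ?a = ?b => change (@eq R a b) end.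
change ((z t + mu * sg t / 2) * ((z t + mu * sg t / 2) * 1)) with
  ((z t + mu * sg t / 2) ^ 2).
change (nu * sg t * (nu * sg t * 1)) with ((nu * sg t) ^ 2).
field; split; [| lra].
intros E; apply (Rgt_not_eq _ _ Hq); rewrite <- (Rmult_0_l (/ 4)), <- E; field.
Qed.

(** Makes it possible to split off the factor s from 1 - exp(- s) exactly, and hence to divide by
    powers of e without a remainder term. *)
Definition psi (s : R) : R := if Req_EM_T s 0 then 1 else (1 - exp (- s)) / s.

Lemma psi_eq (s : R) : 1 - exp (- s) = s * psi s.
Proof.
unfold psi; destruct (Req_EM_T s 0) as [-> | H]; [| field; assumption].
rewrite Ropp_0, exp_0; ring.
Qed.

Lemma psi_0 : psi 0 = 1.
Proof. unfold psi; destruct (Req_EM_T 0 0); lra. Qed.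

Lemma continuous_psi_0 : continuous psi 0.
Proof.
apply filterlim_locally; intros eps; rewrite psi_0.
assert (D : derivable_pt_lim (fun s => - exp (- s)) 0 1).
{ apply is_derive_Reals; auto_derive; [exact I |]; rewrite Ropp_0, exp_0; ring. }
destruct (D eps (cond_pos eps)) as [d Hd].
exists d; intros s Hs; change (Rabs (s - 0) < d) in Hs; rewrite Rminus_0_r in Hs.
change (Rabs (psi s - 1) < eps); unfold psi; destruct (Req_EM_T s 0) as [-> | H].
- rewrite Rminus_diag, Rabs_R0; apply cond_pos.
- replace ((1 - exp (- s)) / s - 1) with ((- exp (- (0 + s)) - - exp (- 0)) / s - 1).
  + now apply Hd.
  + rewrite Rplus_0_l, Ropp_0, exp_0; field; assumption.
Qed.

(** * The Lienard form *)

(* With z = y + e (b0 + b1 x + b2 x^2 + b3 y) the leaves are the orbits of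
   x' = z, z' = - (gg0 + gg1 x + gg2 x^2 + gg3 x^3) - e (c3 - b1) z - lmu x z. *)
Definition gg0 (k : coeffs) (e : R) : R := e * (1 + e * b3 k) * c0 k - e ^ 2 * (c3 k * b0 k).
Definition gg1 (k : coeffs) (e : R) : R :=
  e * (1 + e * b3 k) * c1 k - e ^ 2 * (c3 k * b1 k + c5 k * b0 k).
Definition gg2 (k : coeffs) (e : R) : R :=
  e * (1 + e * b3 k) * c2 k - e ^ 2 * (c3 k * b2 k + c5 k * b1 k).
Definition gg3 (k : coeffs) (e : R) : R :=
  (1 + e * b3 k) * (1 + e * c4 k) - e ^ 2 * (c5 k * b2 k).
Definition lmu (k : coeffs) (e : R) : R := e * (c5 k - 2 * b2 k).
(** The shift in [lsg] is such that g1 + g3 x^2 = 2 g3 sigma. When g0 = g2 = 0, dividing the vector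
    field by x gives sigma' = z, z' = - 2 g3 sigma - mu z, and [lnu] is the frequency of this damped
    oscillator. *)
Definition lnu (k : coeffs) (e : R) : R := sqrt (2 * gg3 k e - lmu k e ^ 2 / 4).
Definition lsg (k : coeffs) (e x : R) : R := x ^ 2 / 2 + gg1 k e / (2 * gg3 k e).
Definition lz (k : coeffs) (e x y : R) : R :=
  y + e * (b0 k + b1 k * x + b2 k * x ^ 2 + b3 k * y).

(** The added polynomial makes this twice the Lienard energy, up to a constant, when mu = 0. It is
    thus a first integral in each of the two integrable cases mu = 0 and g0 = g2 = 0. *)
Definition jhat (k : coeffs) (e x y : R) : R :=
  lint (lmu k e) (lnu k e) (lsg k e x) (lz k e x y) +
  2 * (gg0 k e * x + gg2 k e * x ^ 3 / 3).

Definition lradius (k : coeffs) (e x y : R) : R :=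
  sqrt ((lz k e x y + lmu k e * lsg k e x / 2) ^ 2 + (lnu k e * lsg k e x) ^ 2) +
  lnu k e * lsg k e x.

Definition admissible (k : coeffs) (e x y : R) : Prop :=
  0 < gg3 k e /\ 0 < 2 * gg3 k e - lmu k e ^ 2 / 4 /\ 0 < lradius k e x y.

Definition lf (k : coeffs) (e x y : R) : R :=
  lfac (lmu k e) (lnu k e) (lsg k e x) (lz k e x y).

Lemma sum_squares_pos (p X : R) : 0 < sqrt (p ^ 2 + X ^ 2) + X -> 0 < p ^ 2 + X ^ 2.
Proof.
intros H; destruct (Rle_lt_or_eq_dec 0 (p ^ 2 + X ^ 2)) as [Hlt | Heq]; [nra | assumption |].
rewrite <- Heq, sqrt_0 in H; nra.
Qed.

Lemma lnu_spec (k : coeffs) (e : R) : 0 < 2 * gg3 k e - lmu k e ^ 2 / 4 ->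
  0 < lnu k e /\ lnu k e ^ 2 + lmu k e ^ 2 / 4 = 2 * gg3 k e.
Proof.
intros H; unfold lnu; split; [now apply sqrt_lt_R0 |].
rewrite pow2_sqrt; lra.
Qed.

Lemma is_derive_jhat (k : coeffs) (e : R) (x y : R -> R) (t dx dy : R) :
  is_derive x t dx -> is_derive y t dy -> admissible k e (x t) (y t) ->
  is_derive (fun s => jhat k e (x s) (y s)) t
    (2 * lf k e (x t) (y t) * (lz k e (x t) (y t) *
       ((1 + e * b3 k) * dy + e * (b1 k + 2 * b2 k * x t) * dx) +
       (gg3 k e * x t ^ 2 + gg1 k e + lmu k e * lz k e (x t) (y t)) * (x t * dx)) +
     2 * (gg0 k e + gg2 k e * x t ^ 2) * dx).
Proof.
intros Hx Hy (H3 & Hn & Hr).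
destruct (lnu_spec k e Hn) as [Hnu Enu].
assert (Dx2 : is_derive (fun s => x s ^ 2) t (2 * dx * x t)).
{ evar_last; [exact (is_derive_pow x 2 t _ Hx) |]; simpl; ring. }
assert (Dx3 : is_derive (fun s => x s ^ 3) t (3 * dx * x t ^ 2)).
{ evar_last; [exact (is_derive_pow x 3 t _ Hx) |]; simpl; ring. }
assert (Dsg : is_derive (fun s => lsg k e (x s)) t (x t * dx)).
{ unfold lsg; apply (is_derive_ext (fun s => / 2 * x s ^ 2 + gg1 k e / (2 * gg3 k e))).
  - intros; match goal with |- ?a = ?b => change (@eq R a b) end; field; lra.
  - evar_last.
    + exact (is_derive_plus (V := R_NormedModule) _ _ t _ _
        (is_derive_scal _ t (/ 2) _ Dx2) (is_derive_const _ t)).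
    + unfold plus, zero; simpl; match goal with |- ?a = ?b => change (@eq R a b) end; field. }
assert (Dz : is_derive (fun s => lz k e (x s) (y s)) t
  ((1 + e * b3 k) * dy + e * (b1 k + 2 * b2 k * x t) * dx)).
{ unfold lz; apply (is_derive_ext (fun s => (1 + e * b3 k) * y s +
    ((e * b1 k) * x s + ((e * b2 k) * x s ^ 2 + e * b0 k)))).
  - intros; match goal with |- ?a = ?b => change (@eq R a b) end; ring.
  - evar_last.
    + exact (is_derive_plus (V := R_NormedModule) _ _ t _ _
        (is_derive_scal y t (1 + e * b3 k) _ Hy)
        (is_derive_plus (V := R_NormedModule) _ _ t _ _
          (is_derive_scal x t (e * b1 k) _ Hx)
          (is_derive_plus (V := R_NormedModule) _ _ t _ _
            (is_derive_scal _ t (e * b2 k) _ Dx2) (is_derive_const (e * b0 k) t)))).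
    + unfold plus, zero; simpl; match goal with |- ?a = ?b => change (@eq R a b) end; ring. }
assert (Dg : is_derive (fun s => 2 * (gg0 k e * x s + gg2 k e * x s ^ 3 / 3)) t
  (2 * (gg0 k e + gg2 k e * x t ^ 2) * dx)).
{ apply (is_derive_ext (fun s => (2 * gg0 k e) * x s + (2 * gg2 k e / 3) * x s ^ 3)).
  - intros; match goal with |- ?a = ?b => change (@eq R a b) end; field.
  - evar_last.
    + exact (is_derive_plus (V := R_NormedModule) _ _ t _ _
        (is_derive_scal x t (2 * gg0 k e) _ Hx)
        (is_derive_scal _ t (2 * gg2 k e / 3) _ Dx3)).
    + unfold plus; simpl; match goal with |- ?a = ?b => change (@eq R a b) end; field. }
assert (DJ := is_derive_lint (lmu k e) (lnu k e) _ _ t _ _ Dsg Dz Hnu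
  (sum_squares_pos _ _ Hr) Hr).
evar_last; [exact (is_derive_plus (V := R_NormedModule) _ _ t _ _ DJ Dg) |].
unfold plus; simpl; match goal with |- ?a = ?b => change (@eq R a b) end.
change (lmu k e * (lmu k e * 1)) with (lmu k e ^ 2).
change (lnu k e * (lnu k e * 1)) with (lnu k e ^ 2).
rewrite Enu; unfold lf.
replace (2 * gg3 k e * lsg k e (x t)) with (gg3 k e * x t ^ 2 + gg1 k e)
  by (unfold lsg; field; lra).
ring.
Qed.

(** The equality of b1 and c3 removes the damping term e (c3 - b1) z. The linear part is annihilated
    by the integrating factor; g0 and g2 enter once with the factor [lf] and once, through the added
    polynomial, without it. *)
Lemma is_derive_jhat_leaf (k : coeffs) (e : R) (x y : R -> R) (t dt : R) :
  b1 k = c3 k ->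
  is_derive x t (snd (omega k e (x t, y t)) * dt) ->
  is_derive y t (- fst (omega k e (x t, y t)) * dt) ->
  admissible k e (x t) (y t) ->
  is_derive (fun s => jhat k e (x s) (y s)) t
    (2 * (gg0 k e + gg2 k e * x t ^ 2) * (1 - lf k e (x t) (y t)) *
      lz k e (x t) (y t) * dt).
Proof.
intros Hb Hx Hy Ha; evar_last; [exact (is_derive_jhat k e x y t _ _ Hx Hy Ha) |].
unfold omega, omega1, dHam; cbn [fst snd].
change (y t + e * (b0 k + b1 k * x t + b2 k * x t ^ 2 + b3 k * y t)) with
  (lz k e (x t) (y t)).
transitivity (2 * lf k e (x t) (y t) * lz k e (x t) (y t) * dt *
  ((1 + e * b3 k) * - (x t ^ 3 + e * (c0 k + c1 k * x t + c2 k * x t ^ 2 + c3 k * y t +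
     c4 k * x t ^ 3 + c5 k * x t * y t)) + e * (b1 k + 2 * b2 k * x t) * lz k e (x t) (y t) +
   (gg3 k e * x t ^ 2 + gg1 k e + lmu k e * lz k e (x t) (y t)) * x t) +
   2 * (gg0 k e + gg2 k e * x t ^ 2) * (lz k e (x t) (y t) * dt)); [ring |].
replace ((1 + e * b3 k) * - (x t ^ 3 + e * (c0 k + c1 k * x t + c2 k * x t ^ 2 + c3 k * y t +
     c4 k * x t ^ 3 + c5 k * x t * y t)) + e * (b1 k + 2 * b2 k * x t) * lz k e (x t) (y t) +
   (gg3 k e * x t ^ 2 + gg1 k e + lmu k e * lz k e (x t) (y t)) * x t) with
  (- (gg0 k e + gg2 k e * x t ^ 2)); [ring |].
unfold lz, gg0, gg1, gg2, gg3, lmu; rewrite Hb; ring.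
Qed.

(** * Asymptotics of the first return map *)

(** The value of [larg] on the unperturbed ovals; by quasi-homogeneity it does not depend on h. *)
Definition alpha0 (phi : R) : R := 2 * atan (sqrt 2 * sn phi / (1 + cs phi ^ 2)).

Lemma continuous_fst_R (p : R * R) : continuous (fun q : R * R => fst q) p.
Proof. destruct p; apply continuous_fst. Qed.
Lemma continuous_snd_R (p : R * R) : continuous (fun q : R * R => snd q) p.
Proof. destruct p; apply continuous_snd. Qed.

Ltac cont2 :=
  repeat first [ cont_step | apply continuous_fst_R | apply continuous_snd_R ].

(** The argument is the pair (e, phi), so that continuity at e = 0 can be stated jointly and made
    uniform over a turn. *)
Definition along (k : coeffs) (a : R) (p : R * R) : R := a * Eser k (snd p) a (fst p).
Definition alx (k : coeffs) (a : R) (p : R * R) : R := cs (snd p) / along k a p.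
Definition aly (k : coeffs) (a : R) (p : R * R) : R := sn (snd p) / along k a p ^ 2.

Lemma Eser_at_0 (k : coeffs) (phi a : R) : 0 < a -> Rabs phi <= 9 -> Eser k phi a 0 = 1.
Proof.
intros Ha Hphi.
destruct (polar_flow a k Ha) as (e0 & L & He0 & HL & _ & Hreg).
assert (Hr := Hreg 0 ltac:(rewrite Rabs_R0; lra)).
destruct (reg_near_1 _ _ _ _ Hr phi a) as [H _].
{ split; [assumption | rewrite Rabs_pos_eq; lra]. }
rewrite Rabs_R0, Rmult_0_r in H.
generalize (Rabs_pos (Eser k phi a 0 - 1)); intros.
assert (Z : Rabs (Eser k phi a 0 - 1) = 0) by lra.
destruct (Req_dec (Eser k phi a 0 - 1) 0) as [H1 | H1]; [lra |].
apply Rabs_pos_lt in H1; lra.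
Qed.

Lemma continuous_along (k : coeffs) (a phi : R) : 0 < a -> Rabs phi < 9 ->
  continuous (along k a) (0, phi).
Proof.
intros Ha Hphi; unfold along.
apply (continuous_Rmult (fun _ : R * R => a)); [apply continuous_const |].
destruct (polar_flow a k Ha) as (e0 & L & He0 & HL & _ & Hreg).
apply filterlim_locally; intros eps.
assert (Hd : 0 < Rmin (Rmin e0 (9 - Rabs phi)) (eps / (L + 1))).
{ repeat apply Rmin_pos; try lra; apply Rdiv_lt_0_compat; [apply cond_pos | lra]. }
exists (mkposreal _ Hd); intros [e x] [He Hx]; simpl in He, Hx.
change (Rabs (e - 0) < Rmin (Rmin e0 (9 - Rabs phi)) (eps / (L + 1))) in He.
change (Rabs (x - phi) < Rmin (Rmin e0 (9 - Rabs phi)) (eps / (L + 1))) in Hx.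
rewrite Rminus_0_r in He.
assert (M1 := Rmin_l (Rmin e0 (9 - Rabs phi)) (eps / (L + 1))).
assert (M2 := Rmin_r (Rmin e0 (9 - Rabs phi)) (eps / (L + 1))).
assert (M3 := Rmin_l e0 (9 - Rabs phi)); assert (M4 := Rmin_r e0 (9 - Rabs phi)).
assert (Hx9 : Rabs x <= 9).
{ replace x with (phi + (x - phi)) by ring.
  eapply Rle_trans; [apply Rabs_triang | lra]. }
change (Rabs (Eser k x a e - Eser k phi a 0) < eps).
rewrite Eser_at_0 by lra.
destruct (reg_near_1 _ _ _ _ (Hreg e ltac:(lra)) x a) as [H _].
{ split; [assumption | rewrite Rabs_pos_eq; lra]. }
apply Rle_lt_trans with (1 := H).
assert (He' : Rabs e < eps / (L + 1)) by lra.
apply (Rmult_lt_compat_l (L + 1)) in He'; [| lra].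
replace ((L + 1) * (eps / (L + 1))) with (pos eps) in He' by (field; lra).
generalize (Rabs_pos e); nra.
Qed.

Lemma along_at_0 (k : coeffs) (a phi : R) : 0 < a -> Rabs phi < 9 -> along k a (0, phi) = a.
Proof. intros; unfold along; cbn [fst snd]; rewrite Eser_at_0; lra. Qed.

Lemma continuous_al (k : coeffs) (a phi : R) : 0 < a -> Rabs phi < 9 ->
  continuous (alx k a) (0, phi) /\ continuous (aly k a) (0, phi).
Proof.
intros Ha Hphi; assert (H := continuous_along k a phi Ha Hphi).
assert (E := along_at_0 k a phi Ha Hphi).
assert (Hc : continuous (fun p : R * R => cs (snd p)) (0, phi)).
{ apply (continuous_comp (fun p : R * R => snd p) cs);
    [apply continuous_snd_R | apply continuous_cs]. }
assert (Hs : continuous (fun p : R * R => sn (snd p)) (0, phi)).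
{ apply (continuous_comp (fun p : R * R => snd p) sn);
    [apply continuous_snd_R | apply continuous_sn]. }
split; unfold alx, aly, Rdiv; apply continuous_Rmult; try assumption;
  apply continuous_Rinv.
- rewrite E; lra.
- assumption.
- rewrite E; apply pow_nonzero; lra.
- now apply continuous_pow.
Qed.

Lemma gg3_at_0 (k : coeffs) : gg3 k 0 = 1.
Proof. unfold gg3; ring. Qed.
Lemma gg1_at_0 (k : coeffs) : gg1 k 0 = 0.
Proof. unfold gg1; ring. Qed.
Lemma lmu_at_0 (k : coeffs) : lmu k 0 = 0.
Proof. unfold lmu; ring. Qed.
Lemma lnu_at_0 (k : coeffs) : lnu k 0 = sqrt 2.
Proof. unfold lnu; rewrite gg3_at_0, lmu_at_0; f_equal; field. Qed.
Lemma lsg_at_0 (k : coeffs) (x : R) : lsg k 0 x = x ^ 2 / 2.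
Proof. unfold lsg; rewrite gg3_at_0, gg1_at_0; field. Qed.
Lemma lz_at_0 (k : coeffs) (x y : R) : lz k 0 x y = y.
Proof. unfold lz; ring. Qed.

(** Continuity of all ingredients of [jhat] at a point with e = 0. The functions x and y are kept
    general because two cases occur: points along a leaf and points on the positive half-axis. *)
Record lcont (k : coeffs) (p0 : R * R) (x y : R * R -> R) : Prop := {
  lc_mu : continuous (fun p : R * R => lmu k (fst p)) p0;
  lc_nu : continuous (fun p : R * R => lnu k (fst p)) p0;
  lc_g1 : continuous (fun p : R * R => gg1 k (fst p)) p0;
  lc_g3 : continuous (fun p : R * R => gg3 k (fst p)) p0;
  lc_sg : continuous (fun p : R * R => lsg k (fst p) (x p)) p0;
  lc_z : continuous (fun p : R * R => lz k (fst p) (x p) (y p)) p0;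
  lc_radius : continuous (fun p : R * R => lradius k (fst p) (x p) (y p)) p0;
  lc_arg : continuous (fun p : R * R => larg (lmu k (fst p)) (lnu k (fst p))
    (lsg k (fst p) (x p)) (lz k (fst p) (x p) (y p))) p0;
  lc_adm : locally p0 (fun p => admissible k (fst p) (x p) (y p)) }.

Lemma lcont_at_0 (k : coeffs) (p0 : R * R) (x y : R * R -> R) :
  fst p0 = 0 -> continuous x p0 -> continuous y p0 ->
  0 < y p0 ^ 2 + (sqrt 2 * (x p0 ^ 2 / 2)) ^ 2 ->
  0 < sqrt (y p0 ^ 2 + (sqrt 2 * (x p0 ^ 2 / 2)) ^ 2) + sqrt 2 * (x p0 ^ 2 / 2) ->
  lcont k p0 x y.
Proof.
intros E Hx Hy Hq Hr.
assert (Cmu : continuous (fun p : R * R => lmu k (fst p)) p0)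
  by (unfold lmu; cont2).
assert (Cg1 : continuous (fun p : R * R => gg1 k (fst p)) p0)
  by (unfold gg1; cont2).
assert (Cg3 : continuous (fun p : R * R => gg3 k (fst p)) p0)
  by (unfold gg3; cont2).
assert (Cd : continuous (fun p : R * R => 2 * gg3 k (fst p) - lmu k (fst p) ^ 2 / 4) p0)
  by (unfold Rdiv; cont2).
assert (Hd0 : 2 * gg3 k (fst p0) - lmu k (fst p0) ^ 2 / 4 = 2)
  by (rewrite E, gg3_at_0, lmu_at_0; field).
assert (Cnu : continuous (fun p : R * R => lnu k (fst p)) p0).
{ unfold lnu; apply continuous_sqrt_comp; [rewrite Hd0; lra | exact Cd]. }
assert (Csg : continuous (fun p : R * R => lsg k (fst p) (x p)) p0).
{ unfold lsg, Rdiv.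
  apply (continuous_Rplus (fun p : R * R => x p ^ 2 * / 2)); [cont2 |].
  apply continuous_Rmult; [exact Cg1 |]; apply continuous_Rinv; [| cont2].
  rewrite E, gg3_at_0; lra. }
assert (Cz : continuous (fun p : R * R => lz k (fst p) (x p) (y p)) p0).
{ unfold lz; cont2. }
assert (Cp : continuous (fun p : R * R => lz k (fst p) (x p) (y p) +
  lmu k (fst p) * lsg k (fst p) (x p) / 2) p0) by (unfold Rdiv; cont2).
assert (Eq : (lz k (fst p0) (x p0) (y p0) + lmu k (fst p0) * lsg k (fst p0) (x p0) / 2) ^ 2
   + (lnu k (fst p0) * lsg k (fst p0) (x p0)) ^ 2 =
   y p0 ^ 2 + (sqrt 2 * (x p0 ^ 2 / 2)) ^ 2).
{ rewrite E, lz_at_0, lmu_at_0, lnu_at_0, lsg_at_0; field. }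
assert (Crad : continuous (fun p : R * R => lradius k (fst p) (x p) (y p)) p0).
{ unfold lradius; apply continuous_Rplus; [| cont2].
  apply (continuous_sqrt_comp (fun p : R * R =>
    (lz k (fst p) (x p) (y p) + lmu k (fst p) * lsg k (fst p) (x p) / 2) ^ 2 +
    (lnu k (fst p) * lsg k (fst p) (x p)) ^ 2)); [rewrite Eq; assumption | cont2]. }
assert (Erad : 0 < lradius k (fst p0) (x p0) (y p0)).
{ unfold lradius; rewrite Eq, E, lnu_at_0, lsg_at_0; assumption. }
constructor; auto.
- unfold larg; apply (continuous_Rmult (fun _ : R * R => 2)); [apply continuous_const |].
  apply continuous_atan_comp; apply continuous_Rmult; [exact Cp |].
  apply (continuous_Rinv (fun p : R * R => lradius k (fst p) (x p) (y p)));
    [lra | exact Crad].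
- unfold admissible; repeat apply filter_and.
  + apply (continuous_Rlt _ _ _ Cg3); rewrite E, gg3_at_0; lra.
  + apply (continuous_Rlt _ _ _ Cd); rewrite Hd0; lra.
  + now apply (continuous_Rlt _ _ _ Crad).
Qed.

Lemma sqrt2_sq : sqrt 2 ^ 2 = 2.
Proof. apply pow2_sqrt; lra. Qed.

Lemma sqrt2_pos : 0 < sqrt 2.
Proof. apply sqrt_lt_R0; lra. Qed.

Lemma alx_at_0 (k : coeffs) (h phi : R) : 0 < h -> Rabs phi < 9 ->
  alx k (/ h) (0, phi) = h * cs phi /\ aly k (/ h) (0, phi) = h ^ 2 * sn phi.
Proof.
intros Hh Hphi; assert (0 < / h) by now apply Rinv_0_lt_compat.
unfold alx, aly; rewrite along_at_0 by assumption; cbn [fst snd]; split; field; lra.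
Qed.

(** At e = 0 the point (nu sigma, z) runs on a circle of radius h^2 / sqrt 2, in the half-plane
    sigma >= 0. *)
Lemma oval_energy (h phi : R) :
  (h ^ 2 * sn phi) ^ 2 + (sqrt 2 * ((h * cs phi) ^ 2 / 2)) ^ 2 = (h ^ 2 / sqrt 2) ^ 2.
Proof.
assert (H := cs4_sn2 phi); assert (H2 := sqrt2_sq); assert (Hp := sqrt2_pos).
transitivity (h ^ 4 * (sn phi ^ 2 + sqrt 2 ^ 2 * cs phi ^ 4 / 4)); [field |].
transitivity (h ^ 4 / sqrt 2 ^ 2); [rewrite H2 | field; lra].
replace (sn phi ^ 2) with ((1 - cs phi ^ 4) / 2) by lra; field.
Qed.

Lemma oval_radius (h phi : R) : 0 < h ->
  sqrt ((h ^ 2 * sn phi) ^ 2 + (sqrt 2 * ((h * cs phi) ^ 2 / 2)) ^ 2) +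
    sqrt 2 * ((h * cs phi) ^ 2 / 2) = h ^ 2 / sqrt 2 * (1 + cs phi ^ 2).
Proof.
intros Hh; assert (H2 := sqrt2_sq); assert (Hp := sqrt2_pos).
assert (Hh2 : 0 < h ^ 2) by now apply pow_lt.
rewrite oval_energy, sqrt_pow2 by (apply Rdiv_le_0_compat; lra).
replace (sqrt 2 * ((h * cs phi) ^ 2 / 2)) with
  (h ^ 2 * cs phi ^ 2 * (sqrt 2 ^ 2 / 2) / sqrt 2) by (field; lra).
rewrite H2; field; lra.
Qed.

Lemma lcont_al (k : coeffs) (h phi : R) : 0 < h -> Rabs phi < 9 ->
  lcont k (0, phi) (alx k (/ h)) (aly k (/ h)).
Proof.
intros Hh Hphi; assert (Hi : 0 < / h) by now apply Rinv_0_lt_compat.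
destruct (continuous_al k (/ h) phi Hi Hphi) as [Cx Cy].
destruct (alx_at_0 k h phi Hh Hphi) as [Ex Ey].
assert (Hp := sqrt2_pos); assert (Hh2 : 0 < h ^ 2) by now apply pow_lt.
assert (Hd : 0 < h ^ 2 / sqrt 2) by now apply Rdiv_lt_0_compat.
apply lcont_at_0; auto; rewrite Ex, Ey.
- rewrite oval_energy; now apply pow_lt.
- rewrite oval_radius by assumption; generalize (pow2_ge_0 (cs phi)); nra.
Qed.

Lemma larg_at_0 (k : coeffs) (h phi : R) : 0 < h ->
  larg (lmu k 0) (lnu k 0) (lsg k 0 (h * cs phi)) (lz k 0 (h * cs phi) (h ^ 2 * sn phi)) =
  alpha0 phi.
Proof.
intros Hh; unfold larg, alpha0.
rewrite lmu_at_0, lnu_at_0, lsg_at_0, lz_at_0.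
replace (h ^ 2 * sn phi + 0 * ((h * cs phi) ^ 2 / 2) / 2) with (h ^ 2 * sn phi) by field.
rewrite oval_radius by assumption; do 2 f_equal.
generalize (pow2_ge_0 (cs phi)) sqrt2_pos; intros; field; lra.
Qed.

Definition aldt (k : coeffs) (a : R) (p : R * R) : R :=
  kap (snd p) * along k a p * / (1 + fst p * Qf k (snd p) (along k a p)).

(** The derivative of [jhat] with respect to the angle, divided by e^(j+1). One factor e comes from
    mu = e (c5 - 2 b2), split off from 1 - [lf] by [psi]; the others come from writing (c5 - 2 b2)
    [gg0] and (c5 - 2 b2) [gg2] as e^j [G0] and e^j [G2]. What is left is continuous at e = 0. *)
Definition jrate (k : coeffs) (G0 G2 : R -> R) (a : R) (p : R * R) : R :=
  let x := alx k a p in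
  let y := aly k a p in
  let e := fst p in
  let al := larg (lmu k e) (lnu k e) (lsg k e x) (lz k e x y) in
  2 * (G0 e + G2 e * x ^ 2) * (al * / lnu k e) * psi (lmu k e * / lnu k e * al) *
    lz k e x y * aldt k a p.

Lemma continuous_jrate (k : coeffs) (G0 G2 : R -> R) (h phi : R) :
  0 < h -> Rabs phi < 9 -> continuous G0 0 -> continuous G2 0 ->
  continuous (jrate k G0 G2 (/ h)) (0, phi).
Proof.
intros Hh Hphi H0 H2; assert (Hi : 0 < / h) by now apply Rinv_0_lt_compat.
destruct (continuous_al k (/ h) phi Hi Hphi) as [Cx Cy].
assert (Cu := continuous_along k (/ h) phi Hi Hphi).
assert (LC := lcont_al k h phi Hh Hphi).
assert (Eu := along_at_0 k (/ h) phi Hi Hphi).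
assert (Hnu : lnu k (fst (0, phi)) <> 0)
  by (simpl; rewrite lnu_at_0; generalize sqrt2_pos; lra).
assert (Cn : continuous (fun p : R * R => / lnu k (fst p)) (0, phi))
  by (apply continuous_Rinv; [exact Hnu | apply (lc_nu _ _ _ _ LC)]).
assert (Cm := lc_mu _ _ _ _ LC); assert (Ca := lc_arg _ _ _ _ LC).
unfold jrate; apply continuous_Rmult; [apply continuous_Rmult; [apply continuous_Rmult;
  [apply continuous_Rmult |] |] |].
- apply (continuous_Rmult (fun _ : R * R => 2)); [apply continuous_const |].
  apply continuous_Rplus.
  + now apply (continuous_comp (fun p : R * R => fst p) G0); [apply continuous_fst_R |].
  + apply continuous_Rmult; [| now apply continuous_pow].
    now apply (continuous_comp (fun p : R * R => fst p) G2); [apply continuous_fst_R |].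
- now apply continuous_Rmult.
- apply (continuous_comp (fun p : R * R => lmu k (fst p) * / lnu k (fst p) *
    larg (lmu k (fst p)) (lnu k (fst p)) (lsg k (fst p) (alx k (/ h) p))
      (lz k (fst p) (alx k (/ h) p) (aly k (/ h) p))) psi).
  + apply continuous_Rmult; [now apply continuous_Rmult | exact Ca].
  + simpl fst; rewrite lmu_at_0, !Rmult_0_l; apply continuous_psi_0.
- apply (lc_z _ _ _ _ LC).
- unfold aldt; apply continuous_Rmult.
  + apply continuous_Rmult; [| exact Cu].
    apply (continuous_comp (fun p : R * R => snd p) kap);
      [apply continuous_snd_R | apply continuous_kap].
  + apply continuous_Rinv; [simpl; lra |].
    apply (continuous_Rplus (fun _ : R * R => 1)); [apply continuous_const |].
    apply continuous_Rmult; [apply continuous_fst_R |].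
    apply continuous_Qf; [apply continuous_snd_R | exact Cu].
Qed.

Lemma jrate_at_0 (k : coeffs) (G0 G2 : R -> R) (h phi : R) : 0 < h -> Rabs phi < 9 ->
  jrate k G0 G2 (/ h) (0, phi) =
    sqrt 2 * h * (G0 0 * (kap phi * sn phi * alpha0 phi) +
      h ^ 2 * G2 0 * (cs phi ^ 2 * (kap phi * sn phi * alpha0 phi))).
Proof.
intros Hh Hphi; assert (Hi : 0 < / h) by now apply Rinv_0_lt_compat.
destruct (alx_at_0 k h phi Hh Hphi) as [Ex Ey].
assert (H2 := sqrt2_sq); assert (Hp := sqrt2_pos).
unfold jrate, aldt; rewrite Ex, Ey, along_at_0 by assumption; cbn [fst snd].
rewrite larg_at_0 by assumption.
rewrite lmu_at_0, lnu_at_0, lz_at_0, !Rmult_0_l, psi_0, Rplus_0_r, Rinv_1.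
replace (2 * (G0 0 + G2 0 * (h * cs phi) ^ 2)) with
  (sqrt 2 ^ 2 * (G0 0 + G2 0 * (h * cs phi) ^ 2)) by (rewrite H2; ring).
field; lra.
Qed.

Lemma is_derive_al (U L e : R) (k : coeffs) (a phi : R) : regular U k L e ->
  0 < a <= U -> Rabs phi < 9 ->
  is_derive (fun s => alx k a (e, s)) phi
    (snd (omega k e (alx k a (e, phi), aly k a (e, phi))) * aldt k a (e, phi)) /\
  is_derive (fun s => aly k a (e, s)) phi
    (- fst (omega k e (alx k a (e, phi), aly k a (e, phi))) * aldt k a (e, phi)).
Proof.
intros Hr Ha Hphi.
assert (HaU : Rabs a <= U) by (rewrite Rabs_pos_eq; lra).
assert (D : in_dom U phi a) by (split; lra).
assert (HE := Eser_bounds _ _ _ _ _ _ Hr D).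
assert (Hu : 0 < a * Eser k phi a e) by nra.
assert (HQ := reg_Q _ _ _ _ Hr phi (a * Eser k phi a e)
  ltac:(rewrite Rabs_pos_eq; nra)).
assert (Hk := kap_pos phi).
destruct (is_derive_pt (fun s => s) (fun s => a * Eser k s a e) phi 1
  (Fu k e phi (a * Eser k phi a e))) as [H1 H2].
- exact (is_derive_id (K := R_AbsRing) phi).
- now apply (reg_ode _ _ _ _ Hr).
- lra.
- change (alx k a (e, phi), aly k a (e, phi)) with (pt phi (a * Eser k phi a e)).
  rewrite omega_pt_dy, omega_pt_dx by lra.
  unfold aldt, along; cbn [fst snd]; split.
  + evar_last; [exact H1 |]; unfold Fu; field; lra.
  + evar_last; [exact H2 |]; unfold Fu; field; lra.
Qed.

Lemma is_derive_jhat_al (U L e : R) (k : coeffs) (G0 G2 : R -> R) (j : nat) (a phi : R) :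
  regular U k L e -> 0 < a <= U -> Rabs phi < 9 -> b1 k = c3 k ->
  (c5 k - 2 * b2 k) * gg0 k e = e ^ j * G0 e ->
  (c5 k - 2 * b2 k) * gg2 k e = e ^ j * G2 e ->
  admissible k e (alx k a (e, phi)) (aly k a (e, phi)) ->
  is_derive (fun s => jhat k e (alx k a (e, s)) (aly k a (e, s))) phi
    (e ^ S j * jrate k G0 G2 a (e, phi)).
Proof.
intros Hr Ha Hphi Hb H0 H2 Hadm.
destruct (is_derive_al _ _ _ _ _ _ Hr Ha Hphi) as [Dx Dy].
evar_last; [exact (is_derive_jhat_leaf k e (fun s => alx k a (e, s))
  (fun s => aly k a (e, s)) phi _ Hb Dx Dy Hadm) |].
unfold lf, lfac; cbv zeta.
match goal with |- context [exp (- ?m * ?al)] =>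
  replace (- m * al) with (- (m * al)) by ring end.
rewrite psi_eq; unfold jrate; cbn [fst snd]; unfold Rdiv.
set (al := larg _ _ _ _); set (x := alx k a (e, phi)).
set (z := lz _ _ _ _); set (dt := aldt _ _ _); set (ps := psi _).
unfold lmu at 1.
transitivity (2 * ((c5 k - 2 * b2 k) * gg0 k e + (c5 k - 2 * b2 k) * gg2 k e * x ^ 2) *
  e * (al * / lnu k e) * ps * z * dt); [ring |].
rewrite H0, H2; simpl; ring.
Qed.

Definition I0 : R := RInt (fun phi => kap phi * sn phi * alpha0 phi) 0 (2 * PI).
Definition I2 : R :=
  RInt (fun phi => cs phi ^ 2 * (kap phi * sn phi * alpha0 phi)) 0 (2 * PI).

Lemma continuous_alpha0 (phi : R) : continuous alpha0 phi.
Proof.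
unfold alpha0; apply (continuous_Rmult (fun _ => 2)); [apply continuous_const |].
apply continuous_atan_comp; apply continuous_Rmult; [repeat cont_step |].
apply continuous_Rinv; [| repeat cont_step].
generalize (pow2_ge_0 (cs phi)); lra.
Qed.

Lemma continuous_integrand (phi : R) :
  continuous (fun phi => kap phi * sn phi * alpha0 phi) phi.
Proof. assert (H := continuous_alpha0 phi); repeat cont_step. Qed.

(** The rate of [jhat] converges uniformly over the turn as e tends to 0, by the tube lemma, so its
    integral is e^(j+1) times the integral of the limit, up to a small multiple of e^(j+1). *)
Lemma jhat_variation (k : coeffs) (G0 G2 : R -> R) (j : nat) (h : R) :
  0 < h -> b1 k = c3 k -> continuous G0 0 -> continuous G2 0 ->
  (forall e, (c5 k - 2 * b2 k) * gg0 k e = e ^ j * G0 e) ->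
  (forall e, (c5 k - 2 * b2 k) * gg2 k e = e ^ j * G2 e) ->
  forall eta, 0 < eta -> exists d, 0 < d /\ forall e, Rabs e < d ->
    Rabs (jhat k e (h * Rser k (2 * PI) (/ h) e) 0 - jhat k e h 0 -
      e ^ S j * (sqrt 2 * h * (G0 0 * I0 + h ^ 2 * G2 0 * I2))) <= eta * Rabs e ^ S j.
Proof.
intros Hh Hb C0 C2 HG0 HG2 eta Heta.
assert (Hi : 0 < / h) by now apply Rinv_0_lt_compat.
assert (HP := PI_RGT_0); assert (HP4 := PI_4).
destruct (polar_flow (/ h) k Hi) as (e0 & L & He0 & HL & _ & Hreg).
assert (H9 : forall phi, 0 <= phi <= 2 * PI -> Rabs phi < 9)
  by (intros; rewrite Rabs_pos_eq; lra).
assert (Heta' : 0 < eta / (2 * PI)) by (apply Rdiv_lt_0_compat; lra).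
destruct (tube_uniform (jrate k G0 G2 (/ h)) 0 0 (2 * PI)) with (eta / (2 * PI)) as [d1 Hd1].
{ intros phi Hphi; apply continuous_jrate; auto. }
{ assumption. }
destruct (tube 0 0 (2 * PI) (fun e phi =>
  admissible k e (alx k (/ h) (e, phi)) (aly k (/ h) (e, phi)))) as [d2 Hd2].
{ intros phi Hphi; generalize (lc_adm _ _ _ _ (lcont_al k h phi Hh (H9 phi Hphi))).
  apply filter_imp; intros [e x] H; exact H. }
exists (Rmin e0 (Rmin d1 d2)); split.
{ repeat apply Rmin_pos; auto using cond_pos. }
intros e He.
assert (He0' : Rabs e < e0) by (eapply Rlt_le_trans; [exact He | apply Rmin_l]).
assert (He1 : Rabs e < d1).
{ eapply Rlt_le_trans; [exact He |]; eapply Rle_trans; [apply Rmin_r | apply Rmin_l]. }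
assert (He2 : Rabs e < d2).
{ eapply Rlt_le_trans; [exact He |]; eapply Rle_trans; [apply Rmin_r | apply Rmin_r]. }
assert (Hr := Hreg e ltac:(lra)).
set (q := fun phi => sqrt 2 * h * (G0 0 * (kap phi * sn phi * alpha0 phi) +
      h ^ 2 * G2 0 * (cs phi ^ 2 * (kap phi * sn phi * alpha0 phi)))).
assert (Cq : forall phi, continuous q phi).
{ intros phi; assert (H := continuous_alpha0 phi); unfold q; repeat cont_step. }
assert (Eq : RInt q 0 (2 * PI) = sqrt 2 * h * (G0 0 * I0 + h ^ 2 * G2 0 * I2)).
{ apply is_RInt_unique; unfold q, I0, I2.
  assert (X0 : is_RInt (fun phi => kap phi * sn phi * alpha0 phi) 0 (2 * PI)
    (RInt (fun phi => kap phi * sn phi * alpha0 phi) 0 (2 * PI))).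
  { apply (RInt_correct (V := R_CompleteNormedModule)), ex_RInt_cont.
    apply continuous_integrand. }
  assert (X2 : is_RInt (fun phi => cs phi ^ 2 * (kap phi * sn phi * alpha0 phi)) 0 (2 * PI)
    (RInt (fun phi => cs phi ^ 2 * (kap phi * sn phi * alpha0 phi)) 0 (2 * PI))).
  { apply (RInt_correct (V := R_CompleteNormedModule)), ex_RInt_cont.
    intros z; assert (H := continuous_integrand z); repeat cont_step. }
  exact (is_RInt_scal _ _ _ (sqrt 2 * h) _ (is_RInt_plus _ _ _ _ _ _
    (is_RInt_scal _ _ _ (G0 0) _ X0) (is_RInt_scal _ _ _ (h ^ 2 * G2 0) _ X2))). }
rewrite <- Eq.
(* With the limit integral subtracted, the mean value theorem expresses the error through the rate
   at a single angle, and no integral depending on e has to be considered. *)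
set (Y := fun phi => jhat k e (alx k (/ h) (e, phi)) (aly k (/ h) (e, phi)) -
  e ^ S j * RInt q 0 phi).
assert (DY : forall phi, 0 <= phi <= 2 * PI ->
  is_derive Y phi (e ^ S j * (jrate k G0 G2 (/ h) (e, phi) - q phi))).
{ intros phi Hphi; unfold Y; evar_last.
  - apply (is_derive_minus (V := R_NormedModule)
      (fun phi => jhat k e (alx k (/ h) (e, phi)) (aly k (/ h) (e, phi)))
      (fun phi => e ^ S j * RInt q 0 phi)).
    + apply (is_derive_jhat_al (/ h) L e k G0 G2 j); auto; [lra |].
      apply Hd2; [now rewrite Rminus_0_r | assumption].
    + apply (is_derive_scal (fun phi => RInt q 0 phi)); now apply is_derive_RInt_cont.
  - unfold minus, plus, opp; simpl.
    match goal with |- ?a = ?b => change (@eq R a b) end; ring. }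
destruct (MVT_gen Y 0 (2 * PI) (fun phi => e ^ S j * (jrate k G0 G2 (/ h) (e, phi) - q phi)))
  as (c & Hc & EY).
{ intros x; rewrite Rmin_left, Rmax_right by lra; intros; apply DY; lra. }
{ intros x; rewrite Rmin_left, Rmax_right by lra; intros.
  apply continuity_pt_filterlim, (ex_derive_continuous Y); eexists; now apply DY. }
rewrite Rmin_left, Rmax_right in Hc by lra.
assert (Hih : Rabs (/ h) <= / h) by (rewrite Rabs_pos_eq; lra).
assert (Y0 : Y 0 = jhat k e h 0).
{ unfold Y; rewrite RInt_point; unfold zero; simpl.
  unfold alx, aly, along; cbn [fst snd].
  rewrite (proj1 (reg_init _ _ _ _ Hr _ Hih)), cs_0, sn_0.
  replace (1 / (/ h * 1)) with h by (field; lra).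
  replace (0 / (/ h * 1) ^ 2) with 0 by (field; lra); ring. }
assert (Y1 : Y (2 * PI) = jhat k e (h * Rser k (2 * PI) (/ h) e) 0 -
   e ^ S j * RInt q 0 (2 * PI)).
{ unfold Y; f_equal; unfold alx, aly, along; cbn [fst snd].
  rewrite <- (Rplus_0_l (2 * PI)), cs_periodic, sn_periodic, Rplus_0_l, cs_0, sn_0.
  assert (HI := reg_inv _ _ _ _ Hr (2 * PI) (/ h) ltac:(apply H9; lra) Hih).
  assert (HE := Eser_bounds _ _ _ _ _ _ Hr (in_dom_2PI _ _ Hih)).
  f_equal.
  - apply (Rmult_eq_reg_r (Eser k (2 * PI) (/ h) e)); [| lra].
    rewrite Rmult_assoc, (Rmult_comm (Rser _ _ _ _)), HI; field; lra.
  - field; lra. }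
rewrite Y0, Y1 in EY.
replace (jhat k e (h * Rser k (2 * PI) (/ h) e) 0 - jhat k e h 0 -
  e ^ S j * RInt q 0 (2 * PI)) with
  (e ^ S j * (jrate k G0 G2 (/ h) (e, c) - q c) * (2 * PI - 0)) by lra.
replace (eta * Rabs e ^ S j) with (Rabs e ^ S j * (eta / (2 * PI)) * (2 * PI))
  by (field; lra).
apply Rabs_mult_le; [| rewrite Rabs_pos_eq; lra].
apply Rabs_mult_le; [rewrite RPow_abs; lra |].
unfold q; rewrite <- (jrate_at_0 k G0 G2 h c) by auto.
apply Rlt_le, Hd1; [now rewrite Rminus_0_r | assumption].
Qed.

(** * From the variation of the integral to the displacement on the half-axis *)

Definition jslope (k : coeffs) (p : R * R) : R :=
  let e := fst p in
  let x := snd p in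
  2 * lf k e x 0 * (lz k e x 0 * (e * (b1 k + 2 * b2 k * x)) +
    (gg3 k e * x ^ 2 + gg1 k e + lmu k e * lz k e x 0) * x) +
  2 * (gg0 k e + gg2 k e * x ^ 2).

Lemma lcont_axis (k : coeffs) (h : R) : 0 < h ->
  lcont k (0, h) (fun p => snd p) (fun _ => 0).
Proof.
intros Hh; assert (Hp := sqrt2_pos); assert (Hh2 : 0 < h ^ 2) by now apply pow_lt.
assert (Hx : 0 < sqrt 2 * (h ^ 2 / 2)) by (apply Rmult_lt_0_compat; lra).
apply lcont_at_0; cbn [fst snd]; auto.
- apply continuous_snd_R.
- apply continuous_const.
- generalize (pow_lt _ 2 Hx); lra.
- generalize (sqrt_pos (0 ^ 2 + (sqrt 2 * (h ^ 2 / 2)) ^ 2)); lra.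
Qed.

Lemma is_derive_jslope (k : coeffs) (e x : R) : admissible k e x 0 ->
  is_derive (fun s => jhat k e s 0) x (jslope k (e, x)).
Proof.
intros Ha; evar_last.
- exact (is_derive_jhat k e (fun s => s) (fun _ => 0) x 1 0
    (is_derive_id (K := R_AbsRing) x) (is_derive_const 0 x) Ha).
- unfold jslope; cbn [fst snd]; ring.
Qed.

Lemma continuous_jslope (k : coeffs) (h : R) : 0 < h -> continuous (jslope k) (0, h).
Proof.
intros Hh; assert (LC := lcont_axis k h Hh).
assert (Cz := lc_z _ _ _ _ LC); assert (Cm := lc_mu _ _ _ _ LC).
assert (C1 := lc_g1 _ _ _ _ LC); assert (C3 := lc_g3 _ _ _ _ LC).
assert (Cl : continuous (fun p : R * R => lf k (fst p) (snd p) 0) (0, h)).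
{ unfold lf, lfac; apply continuous_exp_comp.
  apply continuous_Rmult; [| exact (lc_arg _ _ _ _ LC)].
  apply continuous_Ropp, continuous_Rmult; [exact Cm |].
  apply continuous_Rinv; [| exact (lc_nu _ _ _ _ LC)].
  simpl; rewrite lnu_at_0; generalize sqrt2_pos; lra. }
assert (C0 : continuous (fun p : R * R => gg0 k (fst p)) (0, h)) by (unfold gg0; cont2).
assert (C2 : continuous (fun p : R * R => gg2 k (fst p)) (0, h)) by (unfold gg2; cont2).
unfold jslope; cbv zeta.
apply continuous_Rplus; [apply continuous_Rmult; [| apply continuous_Rplus] |]; cont2.
Qed.

Lemma jslope_at_0 (k : coeffs) (h : R) : jslope k (0, h) = 2 * h ^ 3.
Proof.
unfold jslope, lf, lfac; cbn [fst snd].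
rewrite lmu_at_0, gg3_at_0, gg1_at_0, lz_at_0.
replace (- (0 / lnu k 0) * _) with 0 by (unfold Rdiv; ring).
rewrite exp_0; unfold gg0, gg2; ring.
Qed.

Lemma is_lim_eps (f : R -> R) (l : R) :
  (forall eta, 0 < eta -> exists d, 0 < d /\
     forall e, Rabs e < d -> e <> 0 -> Rabs (f e - l) < eta) -> is_lim f 0 l.
Proof.
intros H; apply is_lim_spec; intros eta.
destruct (H eta (cond_pos eta)) as (d & Hd & Hf).
exists (mkposreal d Hd); intros e He Hne; apply Hf; [| assumption].
change (Rabs (e - 0) < d) in He; now rewrite Rminus_0_r in He.
Qed.

Lemma Rser_lim (k : coeffs) (h : R) : 0 < h -> forall eta, 0 < eta -> exists d, 0 < d /\
  forall e, Rabs e < d -> Rabs (h * Rser k (2 * PI) (/ h) e - h) < eta.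
Proof.
intros Hh eta Heta; assert (Hi : 0 < / h) by now apply Rinv_0_lt_compat.
destruct (polar_flow (/ h) k Hi) as (e0 & L & He0 & HL & _ & Hreg).
assert (HhL : 0 < h * (L + 1)) by nra.
exists (Rmin e0 (eta / (h * (L + 1)))); split.
{ apply Rmin_pos; [assumption | now apply Rdiv_lt_0_compat]. }
intros e He.
assert (He1 : Rabs e < e0) by (eapply Rlt_le_trans; [exact He | apply Rmin_l]).
assert (He2 : Rabs e < eta / (h * (L + 1)))
  by (eapply Rlt_le_trans; [exact He | apply Rmin_r]).
assert (Hih : Rabs (/ h) <= / h) by (rewrite Rabs_pos_eq; lra).
destruct (reg_near_1 _ _ _ _ (Hreg e ltac:(lra)) _ _ (in_dom_2PI _ _ Hih)) as [_ HR].
apply (Rmult_lt_compat_l (h * (L + 1))) in He2; [| assumption].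
replace (h * (L + 1) * (eta / (h * (L + 1)))) with eta in He2 by (field; lra).
replace (h * Rser k (2 * PI) (/ h) e - h) with (h * (Rser k (2 * PI) (/ h) e - 1)) by ring.
rewrite Rabs_mult, (Rabs_pos_eq h) by lra.
apply Rle_lt_trans with (h * (L * Rabs e)); [apply Rmult_le_compat_l; lra |].
generalize (Rabs_pos e); nra.
Qed.

(** By the mean value theorem the variation of [jhat] is its slope at a point between h and the
    return point, times the displacement; this slope tends to 2 h^3. *)
Lemma displacement_lim (k : coeffs) (G0 G2 : R -> R) (j : nat) (h : R) :
  0 < h -> b1 k = c3 k -> continuous G0 0 -> continuous G2 0 ->
  (forall e, (c5 k - 2 * b2 k) * gg0 k e = e ^ j * G0 e) ->
  (forall e, (c5 k - 2 * b2 k) * gg2 k e = e ^ j * G2 e) ->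
  is_lim (fun e => (h * Rser k (2 * PI) (/ h) e - h) / e ^ S j) 0
    (sqrt 2 * h * (G0 0 * I0 + h ^ 2 * G2 0 * I2) / (2 * h ^ 3)).
Proof.
intros Hh Hb C0 C2 HG0 HG2.
assert (Hh3 : 0 < h ^ 3) by now apply pow_lt.
set (h' := fun e => h * Rser k (2 * PI) (/ h) e).
set (l := sqrt 2 * h * (G0 0 * I0 + h ^ 2 * G2 0 * I2)).
assert (Hadm := lc_adm _ _ _ _ (lcont_axis k h Hh)); cbn [fst snd] in Hadm.
destruct Hadm as [d1 Hd1].
destruct (Rser_lim k h Hh d1 (cond_pos d1)) as (d2 & Hd2 & Hh').
(* An intermediate point is chosen for each e, so that its slope becomes a function of e whose limit
   can be taken. For e outside the small range the value 0 is a mere default. *)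
assert (Hxi : forall e, exists xi, Rabs e < d1 -> Rabs e < d2 ->
  Rabs (xi - h) <= Rabs (h' e - h) /\
  jhat k e (h' e) 0 - jhat k e h 0 = jslope k (e, xi) * (h' e - h)).
{ intros e; destruct (classic (Rabs e < d1 /\ Rabs e < d2)) as [[He1 He2] | He];
    [| exists 0; tauto].
  assert (Hhe := Hh' e He2); fold (h' e) in Hhe.
  assert (Hin : forall x, Rmin h (h' e) <= x <= Rmax h (h' e) ->
    Rabs (x - h) <= Rabs (h' e - h)).
  { intros x; unfold Rmin, Rmax; destruct (Rle_dec h (h' e)); intros Hx.
    - rewrite !Rabs_pos_eq; lra.
    - rewrite !Rabs_left1; lra. }
  assert (HD : forall x, Rmin h (h' e) <= x <= Rmax h (h' e) ->
    is_derive (fun s => jhat k e s 0) x (jslope k (e, x))).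
  { intros x Hx; apply is_derive_jslope; apply (Hd1 (e, x)); split; simpl.
    - change (Rabs (e - 0) < d1); now rewrite Rminus_0_r.
    - change (Rabs (x - h) < d1); generalize (Hin x Hx); lra. }
  destruct (MVT_gen (fun s => jhat k e s 0) h (h' e) (fun x => jslope k (e, x)))
    as (c & Hc & E).
  - intros; apply HD; lra.
  - intros x Hx; apply continuity_pt_filterlim.
    apply (ex_derive_continuous (fun s => jhat k e s 0)); eexists; now apply HD.
  - exists c; intros _ _; split; [now apply Hin | exact E]. }
set (xi := fun e => proj1_sig (constructive_indefinite_description _ (Hxi e))).
assert (Pxi : forall e, Rabs e < d1 -> Rabs e < d2 ->
  Rabs (xi e - h) <= Rabs (h' e - h) /\
  jhat k e (h' e) 0 - jhat k e h 0 = jslope k (e, xi e) * (h' e - h)).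
{ intros e; unfold xi; destruct (constructive_indefinite_description _ (Hxi e)); auto. }
assert (LimD : is_lim (fun e => (jhat k e (h' e) 0 - jhat k e h 0) / e ^ S j) 0 l).
{ apply is_lim_eps; intros eta Heta.
  destruct (jhat_variation k G0 G2 j h Hh Hb C0 C2 HG0 HG2 (eta / 2) ltac:(lra))
    as (d & Hd & H); exists d; split; [assumption |]; intros e He Hne.
  specialize (H e He); fold (h' e) l in H.
  assert (Hej : e ^ S j <> 0) by now apply pow_nonzero.
  replace ((jhat k e (h' e) 0 - jhat k e h 0) / e ^ S j - l) with
    ((jhat k e (h' e) 0 - jhat k e h 0 - e ^ S j * l) / e ^ S j)
    by (field; assumption).
  rewrite RPow_abs in H; assert (Hpj := Rabs_pos_lt _ Hej).
  unfold Rdiv at 1; rewrite Rabs_mult, Rabs_inv.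
  apply (Rmult_lt_reg_r (Rabs (e ^ S j))); [assumption |].
  rewrite Rmult_assoc, Rinv_l, Rmult_1_r by lra; nra. }
assert (LimS : is_lim (fun e => jslope k (e, xi e)) 0 (2 * h ^ 3)).
{ apply is_lim_eps; intros eta Heta.
  destruct (proj1 (filterlim_locally _ _) (continuous_jslope k h Hh) (mkposreal _ Heta))
    as [d Hd].
  destruct (Rser_lim k h Hh d (cond_pos d)) as (d3 & Hd3 & Hh3').
  exists (Rmin d (Rmin d3 (Rmin d1 d2))); split.
  { repeat apply Rmin_pos; auto using cond_pos. }
  intros e He _.
  assert (M1 := Rmin_l d (Rmin d3 (Rmin d1 d2))).
  assert (M2 := Rmin_r d (Rmin d3 (Rmin d1 d2))).
  assert (M3 := Rmin_l d3 (Rmin d1 d2)); assert (M4 := Rmin_r d3 (Rmin d1 d2)).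
  assert (M5 := Rmin_l d1 d2); assert (M6 := Rmin_r d1 d2).
  rewrite <- (jslope_at_0 k h).
  apply (Hd (e, xi e)); split; simpl.
  - change (Rabs (e - 0) < d); rewrite Rminus_0_r; lra.
  - change (Rabs (xi e - h) < d).
    destruct (Pxi e ltac:(lra) ltac:(lra)) as [H _].
    apply Rle_lt_trans with (1 := H); apply Hh3'; lra. }
apply (is_lim_ext_loc (fun e => (jhat k e (h' e) 0 - jhat k e h 0) / e ^ S j /
  jslope k (e, xi e))).
- destruct (proj2 (is_lim_spec _ _ _) LimS (mkposreal _ Hh3)) as [d4 Hd4]; simpl in Hd4.
  assert (Hm : 0 < Rmin d4 (Rmin d1 d2))
    by (repeat apply Rmin_pos; auto using cond_pos).
  exists (mkposreal _ Hm); intros e He Hne.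
  change (Rabs (e - 0) < Rmin d4 (Rmin d1 d2)) in He.
  assert (M1 := Rmin_l d4 (Rmin d1 d2)); assert (M2 := Rmin_r d4 (Rmin d1 d2)).
  assert (M5 := Rmin_l d1 d2); assert (M6 := Rmin_r d1 d2).
  assert (B := Hd4 e ltac:(change (Rabs (e - 0) < d4); lra) Hne).
  apply Rabs_lt_between in B.
  rewrite Rminus_0_r in He.
  destruct (Pxi e ltac:(lra) ltac:(lra)) as [_ H].
  rewrite H; fold (h' e); field; split; [now apply pow_nonzero | lra].
- apply (is_lim_div _ _ 0 l (2 * h ^ 3)); auto; [| exact I].
  intros E; apply Rbar_finite_eq in E; lra.
Qed.

(** A finite limit after division by e^(n+1) forces the coefficients of degrees 1 to n to vanish.
    This is how Melnikov functions are computed without expanding the recursion. *)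
Lemma PSeries_leading (n : nat) : forall (a : nat -> R) (l : R),
  Rbar_lt 0 (CV_radius a) -> is_lim (fun e => (PSeries a e - a O) / e ^ S n) 0 l ->
  (forall i, (1 <= i <= n)%nat -> a i = 0) /\ a (S n) = l.
Proof.
assert (Hdiff : forall a e n, Rbar_lt (Rabs e) (CV_radius a) -> e <> 0 ->
  (PSeries a e - a O) / e ^ S n = PSeries (PS_decr_1 a) e / e ^ n).
{ intros a e m Hcv He; rewrite PSeries_decr_1 by now apply CV_radius_inside.
  simpl; field; split; [now apply pow_nonzero | assumption]. }
assert (Hnear : forall a, Rbar_lt 0 (CV_radius a) ->
  Rbar_locally' 0 (fun e => Rbar_lt (Rabs e) (CV_radius a) /\ e <> 0)).
{ intros a Ha; destruct (CV_radius a) as [r | |]; simpl in Ha |- *; try easy.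
  - exists (mkposreal r Ha); intros e He Hne; split; [| assumption].
    change (Rabs (e - 0) < r) in He; now rewrite Rminus_0_r in He.
  - exists (mkposreal 1 Rlt_0_1); tauto. }
assert (Hlim0 : forall a, Rbar_lt 0 (CV_radius a) -> is_lim (PSeries a) 0 (a O)).
{ intros a Ha; rewrite <- (PSeries_0 a); apply is_lim_continuity.
  apply PSeries_continuity; now rewrite Rabs_R0. }
induction n as [| n IH]; intros a l Ha Hl.
- split; [intros; lia |].
  assert (Hb : Rbar_lt 0 (CV_radius (PS_decr_1 a))) by now rewrite CV_radius_decr_1.
  assert (H1 := Hlim0 _ Hb).
  assert (H2 : is_lim (PSeries (PS_decr_1 a)) 0 l).
  { apply (is_lim_ext_loc (fun e => (PSeries a e - a O) / e ^ 1)); [| assumption].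
    generalize (Hnear a Ha); apply filter_imp; intros e [He Hne].
    rewrite Hdiff by assumption; simpl; field. }
  apply is_lim_unique in H1; apply is_lim_unique in H2; rewrite H1 in H2.
  now injection H2.
- assert (Hb : Rbar_lt 0 (CV_radius (PS_decr_1 a))) by now rewrite CV_radius_decr_1.
  assert (H2 : is_lim (fun e => PSeries (PS_decr_1 a) e / e ^ S n) 0 l).
  { apply (is_lim_ext_loc (fun e => (PSeries a e - a O) / e ^ S (S n))); [| assumption].
    generalize (Hnear a Ha); apply filter_imp; intros e [He Hne]; now apply Hdiff. }
  assert (b0 : PS_decr_1 a O = 0).
  { assert (H1 := Hlim0 _ Hb).
    assert (H3 : is_lim (PSeries (PS_decr_1 a)) 0 (l * 0)).
    { apply (is_lim_ext_loc (fun e => PSeries (PS_decr_1 a) e / e ^ S n * e ^ S n)).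
      - generalize (Hnear a Ha); apply filter_imp; intros e [He Hne].
        field; now apply pow_nonzero.
      - apply (is_lim_mult _ _ 0 l 0); [assumption | | exact I].
        assert (X : is_lim (fun e => e ^ S n) 0 (0 ^ S n)).
        { apply (is_lim_continuity (fun e => e ^ S n)), derivable_continuous_pt.
          apply derivable_pt_pow. }
        rewrite pow_i in X by lia; exact X. }
    apply is_lim_unique in H1; apply is_lim_unique in H3; rewrite H1 in H3.
    apply (f_equal real) in H3; simpl in H3 |- *; lra. }
  destruct (IH (PS_decr_1 a) l Hb) as [Hz Hn].
  { apply (is_lim_ext (fun e => PSeries (PS_decr_1 a) e / e ^ S n)); [| assumption].
    intros e; now rewrite b0, Rminus_0_r. }
  split; [| exact Hn].
  intros [| [| i]] Hi; [lia | exact b0 |]; apply (Hz (S i)); lia.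
Qed.

Lemma melnikov_leading (k : coeffs) (G0 G2 : R -> R) (j : nat) (h : R) :
  0 < h -> b1 k = c3 k -> continuous G0 0 -> continuous G2 0 ->
  (forall e, (c5 k - 2 * b2 k) * gg0 k e = e ^ j * G0 e) ->
  (forall e, (c5 k - 2 * b2 k) * gg2 k e = e ^ j * G2 e) ->
  (forall i, (1 <= i <= j)%nat -> melnikov_fun k i h = 0) /\
  melnikov_fun k (S j) h =
    sqrt 2 * h * (G0 0 * I0 + h ^ 2 * G2 0 * I2) / (2 * h ^ 3).
Proof.
intros Hh Hb C0 C2 HG0 HG2; assert (Hi : 0 < / h) by now apply Rinv_0_lt_compat.
apply (PSeries_leading j (fun i => melnikov_fun k i h)).
- change (Rbar_lt 0 (CV_radius (PS_scal h (fun i => cr k i (2 * PI) (/ h))))).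
  rewrite CV_radius_scal by lra.
  destruct (polar_flow (/ h) k Hi) as (e0 & L & He0 & HL & _ & Hreg).
  rewrite <- Rabs_R0.
  apply (reg_CV _ _ _ _ (Hreg 0 ltac:(rewrite Rabs_R0; lra))).
  apply in_dom_2PI; rewrite Rabs_pos_eq; lra.
- apply (is_lim_ext (fun e => (h * Rser k (2 * PI) (/ h) e - h) / e ^ S j)).
  + intros e; f_equal; f_equal.
    * unfold melnikov_fun, Rser, ser; now rewrite <- PSeries_scal.
    * unfold melnikov_fun; rewrite cr_fix; simpl; ring.
  + now apply displacement_lim.
Qed.

(** * The Melnikov functions *)

Lemma cs_sn_quadrant (phi : R) : 0 < phi < PI / 2 -> 0 < cs phi /\ sn phi < 0.
Proof.
intros H; assert (Hq := quart_ge_1 phi); assert (HP := PI_RGT_0).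
assert (Hc : 0 < cos phi) by (apply cos_gt_0; lra).
assert (Hs : 0 < sin phi) by (apply sin_gt_0; lra).
unfold cs, sn; split.
- apply Rdiv_lt_0_compat; lra.
- assert (0 < sin phi / quart phi ^ 2) by (apply Rdiv_lt_0_compat; [| apply pow_lt]; lra).
  unfold Rdiv in *; lra.
Qed.

(** The arctangent is increasing and vanishes at 0, so [alpha0] has the sign of [sn]; hence the
    integrands of [I0] and [I2] never become negative. *)
Lemma sn_alpha0 (phi : R) :
  0 <= sn phi * alpha0 phi /\ (sn phi < 0 -> 0 < sn phi * alpha0 phi).
Proof.
unfold alpha0; assert (Hd : 0 < 1 + cs phi ^ 2) by (generalize (pow2_ge_0 (cs phi)); lra).
assert (Hp := sqrt2_pos).
set (c := sqrt 2 / (1 + cs phi ^ 2)).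
assert (Hc : 0 < c) by now apply Rdiv_lt_0_compat.
replace (sqrt 2 * sn phi / (1 + cs phi ^ 2)) with (c * sn phi) by (unfold c; field; lra).
assert (Hneg : sn phi < 0 -> 0 < sn phi * (2 * atan (c * sn phi))).
{ intros H; assert (atan (c * sn phi) < atan 0) by (apply atan_increasing; nra).
  rewrite atan_0 in *; nra. }
split; [| exact Hneg].
destruct (Rtotal_order (sn phi) 0) as [H | [H | H]].
- apply Rlt_le; auto.
- rewrite H; lra.
- assert (atan 0 < atan (c * sn phi)) by (apply atan_increasing; nra).
  rewrite atan_0 in *; nra.
Qed.

Lemma RInt_turn_pos (f : R -> R) : (forall x, continuous f x) -> (forall x, 0 <= f x) ->
  (forall x, 0 < x < PI / 2 -> 0 < f x) -> 0 < RInt f 0 (2 * PI).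
Proof.
intros Hc H0 Hp; assert (HP := PI_RGT_0).
assert (ex : forall x y, ex_RInt f x y) by (intros; now apply ex_RInt_cont).
rewrite <- (RInt_Chasles f 0 (PI / 2) (2 * PI)) by auto.
assert (0 < RInt f 0 (PI / 2)) by (apply RInt_gt_0; auto; lra).
assert (0 <= RInt f (PI / 2) (2 * PI)) by (apply RInt_ge_0; auto; lra).
unfold plus; simpl; lra.
Qed.

Lemma I0_pos : 0 < I0.
Proof.
apply RInt_turn_pos.
- apply continuous_integrand.
- intros x; rewrite Rmult_assoc; apply Rmult_le_pos; [apply Rlt_le, kap_pos | apply sn_alpha0].
- intros x Hx; rewrite Rmult_assoc; apply Rmult_lt_0_compat; [apply kap_pos |].
  now apply sn_alpha0, cs_sn_quadrant.
Qed.

Lemma I2_pos : 0 < I2.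
Proof.
apply RInt_turn_pos.
- intros x; assert (H := continuous_integrand x); repeat cont_step.
- intros x; apply Rmult_le_pos; [apply pow2_ge_0 |].
  rewrite Rmult_assoc; apply Rmult_le_pos; [apply Rlt_le, kap_pos | apply sn_alpha0].
- intros x Hx; destruct (cs_sn_quadrant x Hx) as [Hc Hs].
  apply Rmult_lt_0_compat; [now apply pow_lt |].
  rewrite Rmult_assoc; apply Rmult_lt_0_compat; [apply kap_pos | now apply sn_alpha0].
Qed.

Definition I1 : R := RInt (fun phi => kap phi * sn phi ^ 2) 0 (2 * PI).

Lemma I1_pos : 0 < I1.
Proof.
apply RInt_turn_pos.
- intros x; repeat cont_step.
- intros x; apply Rmult_le_pos; [apply Rlt_le, kap_pos | apply pow2_ge_0].
- intros x Hx; destruct (cs_sn_quadrant x Hx) as [_ Hs].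
  apply Rmult_lt_0_compat; [apply kap_pos | nra].
Qed.

Lemma RInt_antiperiodic (f : R -> R) : (forall x, continuous f x) ->
  (forall x, f (x + PI) = - f x) -> RInt f 0 (2 * PI) = 0.
Proof.
intros Hc Hf.
assert (ex : forall x y, ex_RInt f x y) by (intros; now apply ex_RInt_cont).
rewrite <- (RInt_Chasles f 0 PI (2 * PI)) by auto.
assert (X : is_RInt f 0 PI (RInt f 0 PI))
  by now apply (RInt_correct (V := R_CompleteNormedModule)).
assert (Y : is_RInt f (1 * 0 + PI) (1 * PI + PI) (RInt f PI (2 * PI))).
{ replace (1 * 0 + PI) with PI by ring; replace (1 * PI + PI) with (2 * PI) by ring.
  now apply (RInt_correct (V := R_CompleteNormedModule)). }
apply is_RInt_comp_lin in Y.
apply (is_RInt_ext _ (fun x => opp (f x))) in Y.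
- assert (E := is_RInt_unique _ _ _ _ Y).
  assert (E' := is_RInt_unique _ _ _ _ (is_RInt_opp f 0 PI _ X)).
  rewrite (eq_trans (eq_sym E) E'); unfold plus, opp; simpl; ring.
- intros x _; unfold scal, opp; simpl; unfold mult; simpl; rewrite !Rmult_1_l.
  apply Hf.
Qed.

(** A primitive of kap N at constant u, except for two terms: the one with b1 - c3, which gives the
    first Melnikov function, and an antiperiodic one whose integral over a turn is 0. *)
Definition primitive (k : coeffs) (u phi : R) : R :=
  - (b0 k * u ^ 2 * sn phi + b1 k * u * (cs phi * sn phi) + b2 k * (cs phi ^ 2 * sn phi) +
     b3 k / 2 * sn phi ^ 2 + c0 k * u ^ 3 * cs phi + c1 k * u ^ 2 / 2 * cs phi ^ 2 +
     c2 k * u / 3 * cs phi ^ 3 + c4 k / 4 * cs phi ^ 4).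

Lemma is_derive_primitive (k : coeffs) (u phi : R) :
  is_derive (primitive k u) phi (kap phi * Nf k phi u -
    u * (b1 k - c3 k) * (kap phi * sn phi ^ 2) -
    (2 * b2 k - c5 k) * (kap phi * sn phi ^ 2 * cs phi)).
Proof.
assert (Dc := is_derive_cs phi); assert (Ds := is_derive_sn phi).
assert (H := cs4_sn2 phi).
unfold primitive; evar_last.
{ auto_derive.
  - assert (Ec : ex_derive cs phi) by (eexists; apply Dc).
    assert (Es : ex_derive sn phi) by (eexists; apply Ds); tauto.
  - reflexivity. }
replace (Derive (fun x => cs x) phi) with (kap phi * sn phi)
  by (symmetry; now apply is_derive_unique).
replace (Derive (fun x => sn x) phi) with (- kap phi * cs phi ^ 3)
  by (symmetry; now apply is_derive_unique).
unfold Nf, A3, B2.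
field_simplify_eq; ring.
Qed.

(** In lowest degree the solution has constant u = 1 / h, so the coefficient is h times the integral
    of kap N at u = 1 / h. The surviving term carries a factor 1 / h, and the result does not depend
    on h. *)
Lemma melnikov_1 (k : coeffs) (h : R) : 0 < h ->
  melnikov_fun k 1 h = (b1 k - c3 k) * I1.
Proof.
intros Hh; unfold melnikov_fun; rewrite cr_fix; simpl.
assert (Cp : forall s, continuous (fun s => kap s * Nf k s (/ h) -
    / h * (b1 k - c3 k) * (kap s * sn s ^ 2) -
    (2 * b2 k - c5 k) * (kap s * sn s ^ 2 * cs s)) s).
{ intros s; unfold Nf, A3, B2; repeat cont_step. }
assert (X1 : is_RInt (fun s => kap s * sn s ^ 2) 0 (2 * PI) I1).
{ apply (RInt_correct (V := R_CompleteNormedModule)), ex_RInt_cont; intros; repeat cont_step. }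
assert (X2 : is_RInt (fun s => kap s * sn s ^ 2 * cs s) 0 (2 * PI) 0).
{ evar_last.
  - apply (RInt_correct (V := R_CompleteNormedModule)), ex_RInt_cont; intros; repeat cont_step.
  - apply RInt_antiperiodic; [intros; repeat cont_step |].
    intros; rewrite kap_antiperiodic, sn_antiperiodic, cs_antiperiodic; ring. }
assert (X0 := is_RInt_derive (primitive k (/ h)) _ 0 (2 * PI)
  (fun x _ => is_derive_primitive k (/ h) x) (fun x _ => Cp x)).
assert (X := is_RInt_plus _ _ _ _ _ _ X0 (is_RInt_plus _ _ _ _ _ _
  (is_RInt_scal _ _ _ (/ h * (b1 k - c3 k)) _ X1)
  (is_RInt_scal _ _ _ (2 * b2 k - c5 k) _ X2))).
apply (is_RInt_ext _ (fun s => conv (cr k) (cw k) O s (/ h))) in X.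
2: { intros s _; unfold conv, PS_mult; simpl.
  rewrite cr_fix, cw_fix; unfold next_w; simpl.
  unfold Ns, A3s, B2s, sc, conv, PS_mult; simpl; rewrite !ce_fix; simpl.
  unfold plus, scal; simpl; unfold mult; simpl; unfold Nf, A3, B2.
  match goal with |- ?a = ?b => change (@eq R a b) end; ring. }
assert (EX := is_RInt_unique _ _ _ _ X).
transitivity (h * (1 * RInt (fun s => conv (cr k) (cw k) O s (/ h)) 0 (2 * PI)));
  [reflexivity |].
rewrite EX.
unfold plus, scal, minus, opp; simpl; unfold plus, mult, opp; simpl.
assert (E : primitive k (/ h) (2 * PI) = primitive k (/ h) 0).
{ unfold primitive; rewrite <- (Rplus_0_l (2 * PI)), cs_periodic, sn_periodic; reflexivity. }
rewrite E; field; lra.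
Qed.

Lemma melnikov_1_vanishes (k : coeffs) : vanishes (melnikov_fun k 1) <-> b1 k = c3 k.
Proof.
split.
- intros H; specialize (H 1 Rlt_0_1); rewrite melnikov_1 in H by lra.
  generalize I1_pos; nra.
- intros H h Hh; rewrite melnikov_1, H by assumption; ring.
Qed.

(** The coefficient of the Lienard friction: [lmu] is e times it. *)
Definition dd (k : coeffs) : R := c5 k - 2 * b2 k.

Lemma melnikov_2 (k : coeffs) (h : R) : b1 k = c3 k -> 0 < h ->
  melnikov_fun k 2 h =
    sqrt 2 / (2 * h ^ 2) * dd k * (c0 k * I0 + h ^ 2 * c2 k * I2).
Proof.
intros Hb Hh.
destruct (melnikov_leading k
  (fun e => dd k * (c0 k + e * (b3 k * c0 k - c3 k * b0 k)))
  (fun e => dd k * (c2 k + e * (b3 k * c2 k - c3 k * b2 k - c5 k * b1 k))) 1 h)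
  as [_ ->]; auto.
- cont2.
- cont2.
- intros e; unfold gg0, dd; ring.
- intros e; unfold gg2, dd; ring.
- field; lra.
Qed.

(** The hypotheses remove the parts of [dd] [gg0] and [dd] [gg2] that come from c0 and c2; what
    remains is exactly a constant times e^2, so [G0] and [G2] are constants. *)
Lemma melnikov_3 (k : coeffs) (h : R) : b1 k = c3 k -> 0 < h ->
  dd k * c0 k = 0 -> dd k * c2 k = 0 ->
  melnikov_fun k 3 h =
    - sqrt 2 / (2 * h ^ 2) * dd k * c3 k * (b0 k * I0 + h ^ 2 * (b2 k + c5 k) * I2).
Proof.
intros Hb Hh H0 H2.
destruct (melnikov_leading k (fun _ => - dd k * (c3 k * b0 k))
  (fun _ => - dd k * (c3 k * (b2 k + c5 k))) 2 h) as [_ ->]; auto.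
- apply continuous_const.
- apply continuous_const.
- intros e; unfold gg0; fold (dd k).
  replace (dd k * (e * (1 + e * b3 k) * c0 k - e ^ 2 * (c3 k * b0 k))) with
    (e * (1 + e * b3 k) * (dd k * c0 k) - dd k * (e ^ 2 * (c3 k * b0 k))) by ring.
  rewrite H0; ring.
- intros e; unfold gg2; fold (dd k); rewrite Hb.
  replace (dd k * (e * (1 + e * b3 k) * c2 k - e ^ 2 * (c3 k * b2 k + c5 k * c3 k))) with
    (e * (1 + e * b3 k) * (dd k * c2 k) - dd k * (e ^ 2 * (c3 k * b2 k + c5 k * c3 k))) by ring.
  rewrite H2; ring.
- field; lra.
Qed.

(** The hypotheses make [dd] [gg0] and [dd] [gg2] vanish identically in e. They are then divisible
    by any power of e, with quotient 0, and all orders are treated at once. *)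
Lemma melnikov_center (k : coeffs) (i : nat) : b1 k = c3 k -> (1 <= i)%nat ->
  dd k * c0 k = 0 -> dd k * c2 k = 0 -> dd k * (c3 k * b0 k) = 0 ->
  dd k * (c3 k * (b2 k + c5 k)) = 0 -> vanishes (melnikov_fun k i).
Proof.
intros Hb Hi H0 H2 H3 H4 h Hh.
destruct (melnikov_leading k (fun _ => 0) (fun _ => 0) i h) as [H _]; auto.
- apply continuous_const.
- apply continuous_const.
- intros e; unfold gg0; fold (dd k).
  transitivity (e * (1 + e * b3 k) * (dd k * c0 k) - e ^ 2 * (dd k * (c3 k * b0 k)));
    [ring | rewrite H0, H3; ring].
- intros e; unfold gg2; fold (dd k); rewrite Hb.
  transitivity (e * (1 + e * b3 k) * (dd k * c2 k) -
    e ^ 2 * (dd k * (c3 k * (b2 k + c5 k)))); [ring | rewrite H2, H4; ring].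
Qed.

Lemma even_quadratic_vanishes (a b : R) :
  (forall h, 0 < h -> a * I0 + h ^ 2 * b * I2 = 0) -> a = 0 /\ b = 0.
Proof.
intros H; assert (H1 := H 1 Rlt_0_1); assert (H2 := H 2 Rlt_0_2).
assert (P0 := I0_pos); assert (P2 := I2_pos).
assert (b = 0) by nra; split; [nra | assumption].
Qed.

Lemma even_quadratic_root (a b h h' : R) : 0 < h -> 0 < h' -> ~ (a = 0 /\ b = 0) ->
  a * I0 + h ^ 2 * b * I2 = 0 -> a * I0 + h' ^ 2 * b * I2 = 0 -> h = h'.
Proof.
intros Hh Hh' Hn E E'; assert (P0 := I0_pos); assert (P2 := I2_pos).
assert (Hb : b <> 0).
{ intros ->; apply Hn; split; [nra | reflexivity]. }
assert (H : (h - h') * ((h + h') * (b * I2)) = 0).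
{ transitivity ((a * I0 + h ^ 2 * b * I2) - (a * I0 + h' ^ 2 * b * I2)); [ring | lra]. }
apply Rmult_integral in H; destruct H as [H | H]; [lra |].
exfalso; revert H; repeat apply Rmult_integral_contrapositive_currified; lra.
Qed.

Lemma factor_pos (h : R) : 0 < h -> 0 < sqrt 2 / (2 * h ^ 2).
Proof.
intros Hh; apply Rdiv_lt_0_compat; [apply sqrt2_pos |].
generalize (pow_lt h 2 Hh); lra.
Qed.

Lemma melnikov_2_vanishes (k : coeffs) : b1 k = c3 k ->
  (vanishes (melnikov_fun k 2) <-> dd k * c0 k = 0 /\ dd k * c2 k = 0).
Proof.
intros Hb; split.
- intros H; apply even_quadratic_vanishes; intros h Hh.
  specialize (H h Hh); rewrite melnikov_2 in H by assumption.
  apply (Rmult_eq_reg_l (sqrt 2 / (2 * h ^ 2))); [| generalize (factor_pos h Hh); lra].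
  rewrite Rmult_0_r, <- H; ring.
- intros [H0 H2] h Hh; rewrite melnikov_2 by assumption.
  transitivity (sqrt 2 / (2 * h ^ 2) * (dd k * c0 k * I0 + h ^ 2 * (dd k * c2 k) * I2));
    [ring | rewrite H0, H2; ring].
Qed.

Lemma melnikov_3_vanishes (k : coeffs) : b1 k = c3 k ->
  dd k * c0 k = 0 -> dd k * c2 k = 0 ->
  (vanishes (melnikov_fun k 3) <->
   dd k * (c3 k * b0 k) = 0 /\ dd k * (c3 k * (b2 k + c5 k)) = 0).
Proof.
intros Hb H0 H2; split.
- intros H; apply even_quadratic_vanishes; intros h Hh.
  specialize (H h Hh); rewrite melnikov_3 in H by assumption.
  apply (Rmult_eq_reg_l (- (sqrt 2 / (2 * h ^ 2)))); [| generalize (factor_pos h Hh); lra].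
  rewrite Rmult_0_r, <- H; unfold Rdiv; ring.
- intros [H3 H4] h Hh; rewrite melnikov_3 by assumption.
  transitivity (- sqrt 2 / (2 * h ^ 2) * (dd k * (c3 k * b0 k) * I0 +
    h ^ 2 * (dd k * (c3 k * (b2 k + c5 k))) * I2)); [ring | rewrite H3, H4; ring].
Qed.

(** The vanishing of the first three Melnikov functions as polynomial equations, each equation after
    the first keeping the common factor [dd]. *)
Definition center (k : coeffs) : Prop :=
  b1 k = c3 k /\ dd k * c0 k = 0 /\ dd k * c2 k = 0 /\ dd k * (c3 k * b0 k) = 0 /\
  dd k * (c3 k * (b2 k + c5 k)) = 0.

Lemma melnikov_123_vanish (k : coeffs) :
  vanishes (melnikov_fun k 1) /\ vanishes (melnikov_fun k 2) /\
  vanishes (melnikov_fun k 3) <-> center k.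
Proof.
split.
- intros (H1 & H2 & H3); apply melnikov_1_vanishes in H1.
  apply melnikov_2_vanishes in H2; [| assumption]; destruct H2 as [H20 H22].
  apply melnikov_3_vanishes in H3; auto; now repeat split.
- intros (Hb & H0 & H2 & H3 & H4); repeat split;
    apply melnikov_center; auto.
Qed.

Lemma center_components (k : coeffs) : center k <-> comp1 k \/ comp2 k \/ comp3 k.
Proof.
unfold center, comp1, comp2, comp3, dd; split.
- intros (Hb & H0 & H2 & H3 & H4).
  destruct (Req_dec (c5 k - 2 * b2 k) 0) as [Hd | Hd]; [left; lra | right].
  assert (Hz : forall x, (c5 k - 2 * b2 k) * x = 0 -> x = 0).
  { intros x Hx; apply Rmult_integral in Hx; tauto. }
  apply Hz in H0; apply Hz in H2; apply Hz in H3; apply Hz in H4.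
  destruct (Req_dec (c3 k) 0) as [Hc | Hc]; [left; lra | right].
  apply Rmult_integral in H3; apply Rmult_integral in H4.
  destruct H3, H4; try tauto; lra.
- intros [(H1 & H2) | [(H0 & H2 & H3 & H1) | (H1 & H0 & H2 & H3 & H4)]].
  + rewrite H2; repeat split; ring || lra.
  + rewrite H0, H2, H3, H1; repeat split; ring.
  + replace (b2 k + c5 k) with 0 by lra; rewrite H0, H2, H3; repeat split; ring || lra.
Qed.

(** * Fixed points of the first return map *)

(** Serves to join consecutive turns of a periodic continuation: as both branches have the same
    value and slope at x, it does not matter which of them f follows nearby. *)
Lemma is_derive_glue (f f1 f2 : R -> R) (x l : R) :
  is_derive f1 x l -> is_derive f2 x l -> f x = f1 x -> f x = f2 x ->
  locally x (fun y => f y = f1 y \/ f y = f2 y) -> is_derive f x l.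
Proof.
intros D1 D2 E1 E2 [d Hd]; apply is_derive_Reals; intros eps Heps.
destruct (proj1 (is_derive_Reals _ _ _) D1 eps Heps) as [d1 H1].
destruct (proj1 (is_derive_Reals _ _ _) D2 eps Heps) as [d2 H2].
assert (Hm : 0 < Rmin d (Rmin d1 d2)) by (repeat apply Rmin_pos; apply cond_pos).
exists (mkposreal _ Hm); simpl; intros h Hh Hhd.
assert (M1 := Rmin_l d (Rmin d1 d2)); assert (M2 := Rmin_r d (Rmin d1 d2)).
assert (M3 := Rmin_l d1 d2); assert (M4 := Rmin_r d1 d2).
destruct (Hd (x + h)) as [E | E].
- change (Rabs (x + h - x) < d); replace (x + h - x) with h by ring; lra.
- rewrite E, E1; apply H1; auto; lra.
- rewrite E, E2; apply H2; auto; lra.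
Qed.

Lemma Int_part_turn (y : R) (n : Z) : 0 <= y - 2 * PI * IZR n < 2 * PI ->
  Int_part (y / (2 * PI)) = n.
Proof.
intros H; assert (HP := PI_RGT_0); symmetry; apply Int_part_spec.
assert (E : y = 2 * PI * (y / (2 * PI))) by (field; lra).
split; [apply (Rmult_lt_reg_l (2 * PI)) | apply (Rmult_le_reg_l (2 * PI))]; lra.
Qed.

(** R = 1 after a turn means E = 1 after a turn, so the solution on [0, 2 PI] closes up; it is
    continued by reducing the angle modulo 2 PI. *)
Lemma periodic_of_Rser (U L e a : R) (k : coeffs) : regular U k L e -> 0 < a <= U ->
  Rser k (2 * PI) a e = 1 ->
  exists u, periodic_polar k e u /\ u 0 = a /\
    (forall phi, 0 <= phi <= 2 * PI -> u phi = a * Eser k phi a e) /\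
    (forall phi, u phi <= 2 * U).
Proof.
intros Hr Ha HR.
assert (HP := PI_RGT_0); assert (HP4 := PI_4).
assert (HaU : Rabs a <= U) by (rewrite Rabs_pos_eq; lra).
assert (H9 : forall x, 0 <= x <= 2 * PI -> Rabs x < 9)
  by (intros; rewrite Rabs_pos_eq; lra).
set (w := fun x => a * Eser k x a e).
assert (HE2 : Eser k (2 * PI) a e = 1).
{ assert (HI := reg_inv _ _ _ _ Hr (2 * PI) a ltac:(apply H9; lra) HaU).
  rewrite HR in HI; lra. }
assert (W2 : w (2 * PI) = a) by (unfold w; rewrite HE2; ring).
assert (W0 : w 0 = a).
{ unfold w; rewrite (proj1 (reg_init _ _ _ _ Hr a HaU)); ring. }
assert (Dw : forall x (n : Z), 0 <= x - 2 * PI * IZR n <= 2 * PI ->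
  is_derive (fun y => w (y - 2 * PI * IZR n)) x (Fu k e x (w (x - 2 * PI * IZR n)))).
{ intros x n Hx.
  assert (EF : Fu k e x (w (x - 2 * PI * IZR n)) =
    Fu k e (x - 2 * PI * IZR n) (w (x - 2 * PI * IZR n))).
  { rewrite <- (periodic_IZR (fun y => Fu k e y (w (x - 2 * PI * IZR n)))
      (fun y => Fu_periodic k e y _) n (x - 2 * PI * IZR n)); f_equal; ring. }
  rewrite EF, <- (Rmult_1_l (Fu k e _ _)).
  apply (is_derive_comp w (fun y => y - 2 * PI * IZR n)).
  - apply (reg_ode _ _ _ _ Hr); [apply H9; lra | assumption].
  - auto_derive; [exact I | ring]. }
assert (Bw : forall x, 0 <= x <= 2 * PI -> 0 < w x <= 2 * U).
{ intros x Hx; assert (D : in_dom U x a) by (split; [generalize (H9 x Hx) |]; lra).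
  generalize (Eser_bounds _ _ _ _ _ _ Hr D); intros; unfold w; split; nra. }
set (u := fun y => w (y - 2 * PI * IZR (Int_part (y / (2 * PI))))).
assert (Hu : forall y n, 0 <= y - 2 * PI * IZR n < 2 * PI -> u y = w (y - 2 * PI * IZR n)).
{ intros y n Hy; unfold u; now rewrite (Int_part_turn y n Hy). }
exists u; split; [split; [| split] | split; [| split]].
- intros x; destruct (angle_reduce x) as (n & x0 & Ex & Hx0).
  assert (Exn : x - 2 * PI * IZR n = x0) by (rewrite Ex; ring).
  assert (Eu : u x = w (x - 2 * PI * IZR n)) by (apply Hu; lra).
  rewrite Eu; destruct (Req_dec x0 0) as [H0 | H0].
  (* At a multiple of 2 PI the angles to the left belong to the previous turn, those to the right to
     the next one. The slopes agree because the solution has the same value at both ends of a turn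
     and the equation is periodic. *)
  + assert (En : x - 2 * PI * IZR (n - 1) = 2 * PI).
    { rewrite minus_IZR; lra. }
    apply (is_derive_glue u (fun y => w (y - 2 * PI * IZR n))
      (fun y => w (y - 2 * PI * IZR (n - 1)))).
    * apply Dw; lra.
    * assert (D := Dw x (n - 1)%Z ltac:(rewrite En; lra)).
      rewrite En, W2 in D; rewrite Exn, H0, W0; exact D.
    * exact Eu.
    * rewrite Eu, Exn, H0, En, W0, W2; reflexivity.
    * assert (H2P : 0 < 2 * PI) by lra.
      exists (mkposreal _ H2P); intros y Hy; change (Rabs (y - x) < 2 * PI) in Hy.
      apply Rabs_lt_between in Hy.
      destruct (Rle_dec x y) as [Hxy | Hxy]; [left | right]; apply Hu; lra.
  + assert (Hm : 0 < Rmin x0 (2 * PI - x0)) by (apply Rmin_pos; lra).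
    apply (is_derive_ext_loc (fun y => w (y - 2 * PI * IZR n))); [| apply Dw; lra].
    exists (mkposreal _ Hm); intros y Hy.
    change (Rabs (y - x) < Rmin x0 (2 * PI - x0)) in Hy.
    assert (M1 := Rmin_l x0 (2 * PI - x0)); assert (M2 := Rmin_r x0 (2 * PI - x0)).
    apply Rabs_lt_between in Hy; symmetry; apply Hu; lra.
- intros x; destruct (angle_reduce x) as (n & x0 & Ex & Hx0).
  rewrite (Hu x n) by lra.
  rewrite (Hu (x + 2 * PI) (n + 1)%Z) by (rewrite plus_IZR; lra).
  f_equal; rewrite plus_IZR; ring.
- intros x; destruct (angle_reduce x) as (n & x0 & Ex & Hx0).
  rewrite (Hu x n) by lra; apply Bw; lra.
- rewrite (Hu 0 0%Z) by lra; replace (0 - 2 * PI * 0) with 0 by ring; exact W0.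
- intros x Hx; destruct (Req_dec x (2 * PI)) as [-> | Hne].
  + rewrite (Hu (2 * PI) 1%Z) by lra.
    replace (2 * PI - 2 * PI * 1) with 0 by ring; fold (w (2 * PI)); lra.
  + rewrite (Hu x 0%Z) by lra; unfold w; do 2 f_equal; ring.
- intros x; destruct (angle_reduce x) as (n & x0 & Ex & Hx0).
  rewrite (Hu x n) by lra; apply Bw; lra.
Qed.

Lemma leaf_axis (k : coeffs) (e a : R) (u : R -> R) : periodic_polar k e u -> 0 < a ->
  leaf u (pt 0 a) -> u 0 = a.
Proof.
intros (_ & Hp & H0) Ha [phi E]; rewrite (pt_0 a Ha) in E; unfold pt in E.
assert (Hu := H0 phi); injection E; intros E2 E1.
assert (Hia : 0 < / a) by now apply Rinv_0_lt_compat.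
destruct (cs_sn_axis phi) as [n Hn].
- replace (cs phi) with (cs phi / u phi * u phi) by (field; lra).
  rewrite E1; now apply Rmult_lt_0_compat.
- apply (Rmult_eq_reg_r (/ u phi ^ 2)); [rewrite Rmult_0_l; exact E2 |].
  apply Rinv_neq_0_compat, pow_nonzero; lra.
- assert (Hc : cs phi = 1 /\ u phi = u 0).
  { rewrite Hn, <- (Rplus_0_l (2 * PI * IZR n)).
    rewrite (periodic_IZR cs cs_periodic), (periodic_IZR u Hp), cs_0; auto. }
  destruct Hc as [Hc Hu']; rewrite Hc, Hu' in E1; rewrite Hu' in Hu.
  rewrite <- (Rinv_inv (u 0)), <- (Rinv_inv a), <- E1; f_equal; field; lra.
Qed.

(** * The leading coefficient of the displacement and its remainder *)

Definition shiftn (n : nat) (f : coefs) : coefs := fun i => f (n + i)%nat.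

Lemma gmaj_shiftn (U r : R) (f : coefs) (K : R) (n : nat) :
  gmaj U r f K -> gmaj U r (shiftn n f) (K * r ^ n).
Proof.
intros H i; rewrite Rmult_assoc, <- pow_add; apply (H (n + i)%nat).
Qed.

Lemma ser_shiftn (U r : R) (f : coefs) (K phi a e : R) (n : nat) :
  0 < r -> Rabs e <= / (2 * r) -> gmaj U r f K -> in_dom U phi a ->
  (forall i, (i < n)%nat -> f i phi a = 0) ->
  ser f phi a e = e ^ n * ser (shiftn n f) phi a e.
Proof.
intros Hr He Hf D; induction n as [| n IH]; intros Hz.
- simpl; rewrite Rmult_1_l; reflexivity.
- rewrite IH by (intros; apply Hz; lia).
  rewrite (ser_shift U r (shiftn n f) (K * r ^ n)); auto using gmaj_shiftn.
  replace (shiftn n f O phi a) with 0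
    by (symmetry; unfold shiftn; rewrite Nat.add_0_r; apply Hz; lia).
  replace (shift (shiftn n f)) with (shiftn (S n) f); [simpl; ring |].
  extensionality i; unfold shift, shiftn; f_equal; lia.
Qed.

Lemma Rser_expansion (U e0 e a : R) (k : coeffs) (n : nat) : 0 < e0 ->
  gmaj U (/ (2 * e0)) (cr k) 1 -> Rabs e <= e0 -> Rabs a <= U ->
  (forall i, (i < n)%nat -> cr k (S i) (2 * PI) a = 0) ->
  Rser k (2 * PI) a e = 1 + e ^ S n * (cr k (S n) (2 * PI) a +
    e * ser (shiftn (S (S n)) (cr k)) (2 * PI) a e).
Proof.
intros He0 G He Ha Hz.
assert (D := in_dom_2PI U a Ha).
assert (Hr : 0 < / (2 * e0)) by (apply Rinv_0_lt_compat; lra).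
assert (He' : Rabs e <= / (2 * / (2 * e0))).
{ replace (/ (2 * / (2 * e0))) with e0 by (field; lra); assumption. }
unfold Rser; rewrite (ser_shift U (/ (2 * e0)) (cr k) 1) by assumption.
assert (G' := gmaj_shift U _ _ _ G).
rewrite (ser_shiftn U _ (shift (cr k)) _ _ _ _ n Hr He' G' D Hz).
rewrite (ser_shift U (/ (2 * e0)) (shiftn n (shift (cr k))) (1 * / (2 * e0) * (/ (2 * e0)) ^ n));
  auto using gmaj_shiftn.
replace (cr k O (2 * PI) a) with 1 by (now rewrite cr_fix).
replace (shiftn n (shift (cr k)) O (2 * PI) a) with (cr k (S n) (2 * PI) a)
  by (unfold shiftn, shift; now rewrite Nat.add_0_r).
replace (shift (shiftn n (shift (cr k)))) with (shiftn (S (S n)) (cr k)); [simpl; ring |].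
extensionality i; unfold shift, shiftn; f_equal; lia.
Qed.

Lemma cr_melnikov (k : coeffs) (i : nat) (a : R) : 0 < a ->
  cr k i (2 * PI) a = a * melnikov_fun k i (/ a).
Proof. intros Ha; unfold melnikov_fun; rewrite Rinv_inv; field; lra. Qed.

(** In terms of a = 1 / h the first nonzero Melnikov function, of order n + 1 at most 3, always
    gives an odd cubic a (al a^2 + be). The three orders can then be treated together. *)
Lemma noncenter_expansion (k : coeffs) : ~ center k ->
  exists n al be, ~ (al = 0 /\ be = 0) /\ forall a, 0 < a ->
    (forall i, (i < n)%nat -> cr k (S i) (2 * PI) a = 0) /\
    cr k (S n) (2 * PI) a = a * (al * a ^ 2 + be).
Proof.
intros Hn; assert (P1 := I1_pos); assert (P0 := I0_pos); assert (P2 := I2_pos).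
assert (Hs := sqrt2_pos).
destruct (Req_dec (b1 k) (c3 k)) as [Hb | Hb].
2: { exists O, 0, ((b1 k - c3 k) * I1); split.
  - intros [_ E]; apply Rmult_integral in E; lra.
  - intros a Ha; split; [intros; lia |].
    rewrite cr_melnikov, melnikov_1 by (auto using Rinv_0_lt_compat); ring. }
assert (V1 := proj2 (melnikov_1_vanishes k) Hb).
destruct (classic (dd k * c0 k = 0 /\ dd k * c2 k = 0)) as [[H0 H2] | H02].
2: { exists 1%nat, (sqrt 2 / 2 * (dd k * c0 k) * I0), (sqrt 2 / 2 * (dd k * c2 k) * I2); split.
  - intros [E0 E2]; apply H02; split.
    + apply Rmult_integral in E0; destruct E0 as [E0 | E0]; [| lra].
      apply Rmult_integral in E0; destruct E0; lra.
    + apply Rmult_integral in E2; destruct E2 as [E2 | E2]; [| lra].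
      apply Rmult_integral in E2; destruct E2; lra.
  - intros a Ha; assert (Hi := Rinv_0_lt_compat a Ha); split.
    + intros [| i] Hi'; [| lia]; rewrite cr_melnikov, V1 by assumption; ring.
    + rewrite cr_melnikov, melnikov_2 by assumption; field; lra. }
assert (V2 := proj2 (melnikov_2_vanishes k Hb) (conj H0 H2)).
assert (H34 : ~ (dd k * (c3 k * b0 k) = 0 /\ dd k * (c3 k * (b2 k + c5 k)) = 0)).
{ intros [H3 H4]; apply Hn; now repeat split. }
exists 2%nat, (- (sqrt 2 / 2) * (dd k * (c3 k * b0 k)) * I0),
  (- (sqrt 2 / 2) * (dd k * (c3 k * (b2 k + c5 k))) * I2); split.
- intros [E0 E2]; apply H34; split.
  + apply Rmult_integral in E0; destruct E0 as [E0 | E0]; [| lra].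
    apply Rmult_integral in E0; destruct E0; lra.
  + apply Rmult_integral in E2; destruct E2 as [E2 | E2]; [| lra].
    apply Rmult_integral in E2; destruct E2; lra.
- intros a Ha; assert (Hi := Rinv_0_lt_compat a Ha); split.
  + intros [| [| i]] Hi'; [| | lia]; rewrite cr_melnikov, ?V1, ?V2 by assumption; ring.
  + rewrite cr_melnikov, melnikov_3 by assumption; field; lra.
Qed.

(** The odd cubic p has at most one positive zero and crosses it transversally. Two points where p
    is small and whose values differ by a small multiple of their distance must coincide; if al = 0,
    p is not even small on [A, U]. *)
Lemma odd_cubic_zeros (al be A U : R) : 0 < A -> A <= U -> ~ (al = 0 /\ be = 0) ->
  forall B, 0 <= B -> exists d, 0 < d /\ forall eta a b, 0 <= eta < d ->
    A <= a <= U -> A <= b <= U ->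
    Rabs (a * (al * a ^ 2 + be)) <= eta * B -> Rabs (b * (al * b ^ 2 + be)) <= eta * B ->
    Rabs (a * (al * a ^ 2 + be) - b * (al * b ^ 2 + be)) <= eta * B * Rabs (a - b) ->
    a = b.
Proof.
intros HA HU Hn B HB.
destruct (Req_dec al 0) as [-> | Hal].
- assert (Hbe : 0 < Rabs be) by (apply Rabs_pos_lt; intros ->; tauto).
  exists (A * Rabs be / (B + 1)); split.
  { apply Rdiv_lt_0_compat; nra. }
  intros eta a b [He1 He2] Ha Hb H1 _ _; exfalso.
  replace (a * (0 * a ^ 2 + be)) with (a * be) in H1 by ring.
  rewrite Rabs_mult, (Rabs_pos_eq a) in H1 by lra.
  apply (Rmult_lt_compat_r (B + 1)) in He2; [| lra].
  replace (A * Rabs be / (B + 1) * (B + 1)) with (A * Rabs be) in He2 by (field; lra).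
  nra.
- assert (Hal' : 0 < Rabs al) by now apply Rabs_pos_lt.
  assert (HA2 : 0 < A ^ 2) by now apply pow_lt.
  (* Below this threshold eta B (U + 1) is less than 2 A^3 |al|, the lower bound for |al| a b (a +
     b). *)
  exists (2 * A ^ 3 * Rabs al / ((B + 1) * (U + 1))); split.
  { apply Rdiv_lt_0_compat; [| nra].
    repeat apply Rmult_lt_0_compat; auto using pow_lt; lra. }
  intros eta a b [He1 He2] Ha Hb H1 H2 H3.
  apply NNPP; intros Hab.
  assert (Hd : 0 < Rabs (a - b)) by (apply Rabs_pos_lt; lra).
  apply (Rmult_lt_compat_r ((B + 1) * (U + 1))) in He2; [| nra].
  replace (2 * A ^ 3 * Rabs al / ((B + 1) * (U + 1)) * ((B + 1) * (U + 1))) with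
    (2 * A ^ 3 * Rabs al) in He2 by (field; lra).
  set (p := a * (al * a ^ 2 + be)) in *; set (q := b * (al * b ^ 2 + be)) in *.
  (* Elimination of be from the two values. The left side is at least |a - b| times 2 A^3 |al|,
     while the right side is at most |a - b| times eta B (U + 1). *)
  assert (E : al * (a - b) * (a * b * (a + b)) = (p - q) * b - q * (a - b)).
  { unfold p, q; ring. }
  apply (f_equal Rabs) in E; rewrite !Rabs_mult in E.
  rewrite (Rabs_pos_eq a), (Rabs_pos_eq b), (Rabs_pos_eq (a + b)) in E by lra.
  assert (T : Rabs ((p - q) * b - q * (a - b)) <=
    eta * B * Rabs (a - b) * U + eta * B * Rabs (a - b)).
  { unfold Rminus at 1; eapply Rle_trans; [apply Rabs_triang |].
    rewrite Rabs_Ropp; apply Rplus_le_compat.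
    - apply Rabs_mult_le; [assumption | rewrite Rabs_pos_eq; lra].
    - apply Rabs_mult_le; [assumption | lra]. }
  rewrite <- E in T.
  assert (G : 2 * A ^ 3 <= a * b * (a + b)).
  { replace (2 * A ^ 3) with (A * A * (A + A)) by ring.
    apply Rmult_le_compat; try nra. }
  assert (G2 : Rabs al * Rabs (a - b) * (2 * A ^ 3) <=
    Rabs al * Rabs (a - b) * (a * b * (a + b))).
  { apply Rmult_le_compat_l; [nra | assumption]. }
  assert (F : Rabs (a - b) * (2 * A ^ 3 * Rabs al) <= Rabs (a - b) * (eta * B * (U + 1)))
    by lra.
  apply Rmult_le_reg_l in F; [| assumption].
  assert (eta * B * (U + 1) <= eta * ((B + 1) * (U + 1))); [| lra].
  rewrite <- Rmult_assoc; apply Rmult_le_compat_r; nra.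
Qed.

(** After division by e^(n+1) a fixed point satisfies p(a) = - e T(a), where p is the odd cubic and
    the remainder T is bounded and Lipschitz in a, both with constants independent of e. *)
Lemma unique_fixed_point (k : coeffs) (A U : R) : ~ center k -> 0 < A -> A <= U ->
  exists d, 0 < d /\ forall e a b, 0 < Rabs e < d -> A <= a <= U -> A <= b <= U ->
    Rser k (2 * PI) a e = 1 -> Rser k (2 * PI) b e = 1 -> a = b.
Proof.
intros Hn HA HU.
destruct (noncenter_expansion k Hn) as (n & al & be & Hnz & Hexp).
destruct (polar_flow U k ltac:(lra)) as (e0 & L & He0 & HL & G & Hreg).
set (K := 1 * (/ (2 * e0)) ^ S (S n)).
assert (Hr : 0 < / (2 * e0)) by (apply Rinv_0_lt_compat; lra).
assert (GK : gmaj U (/ (2 * e0)) (shiftn (S (S n)) (cr k)) K) by now apply gmaj_shiftn.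
assert (HK : 0 <= K).
{ unfold K; rewrite Rmult_1_l; apply pow_le; lra. }
destruct (odd_cubic_zeros al be A U HA HU Hnz (2 * K) ltac:(lra)) as (d & Hd & Hz).
exists (Rmin e0 d); split; [now apply Rmin_pos |].
intros e a b [He1 He2] Ha Hb Ra Rb.
assert (He3 : Rabs e < e0) by (eapply Rlt_le_trans; [exact He2 | apply Rmin_l]).
assert (He4 : Rabs e < d) by (eapply Rlt_le_trans; [exact He2 | apply Rmin_r]).
assert (Hne : e <> 0) by (intros ->; rewrite Rabs_R0 in He1; lra).
assert (He' : Rabs e <= / (2 * / (2 * e0))).
{ replace (/ (2 * / (2 * e0))) with e0 by (field; lra); lra. }
set (T := fun a => ser (shiftn (S (S n)) (cr k)) (2 * PI) a e).
assert (Hfix : forall a, A <= a <= U -> Rser k (2 * PI) a e = 1 ->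
  a * (al * a ^ 2 + be) = - (e * T a)).
{ intros x Hx HR; destruct (Hexp x ltac:(lra)) as [Hzero Hlead].
  rewrite (Rser_expansion U e0 e x k n) in HR; auto; try lra;
    [| rewrite Rabs_pos_eq; lra].
  rewrite <- Hlead; apply (Rmult_eq_reg_l (e ^ S n)); [| now apply pow_nonzero].
  unfold T; lra. }
assert (D : forall x, A <= x <= U -> in_dom U (2 * PI) x).
{ intros x Hx; apply in_dom_2PI; rewrite Rabs_pos_eq; lra. }
apply (Hz (Rabs e) a b); auto; try lra; rewrite ?(Hfix a Ha Ra), ?(Hfix b Hb Rb).
- rewrite Rabs_Ropp; apply Rabs_mult_le; [lra |].
  apply (ser_sup U _ _ K _ _ _ Hr He' GK (D a Ha)).
- rewrite Rabs_Ropp; apply Rabs_mult_le; [lra |].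
  apply (ser_sup U _ _ K _ _ _ Hr He' GK (D b Hb)).
- replace (- (e * T a) - - (e * T b)) with (- (e * (T a - T b))) by ring.
  rewrite Rabs_Ropp, Rmult_assoc; apply Rabs_mult_le; [lra |].
  eapply Rle_trans; [apply (ser_lip U _ _ K _ _ _ _ _ Hr He' GK (D a Ha) (D b Hb)) |].
  rewrite Rminus_diag, Rabs_R0, Rplus_0_l; lra.
Qed.

Lemma center_fixed (U L e a : R) (k : coeffs) : regular U k L e -> center k -> 0 < a <= U ->
  Rser k (2 * PI) a e = 1.
Proof.
intros Hr (Hb & H0 & H2 & H3 & H4) Ha; unfold Rser.
transitivity (ser (monom0 (fun _ _ => 1)) (2 * PI) a e); [| apply ser_monom0].
apply PSeries_ext; intros [| i]; [now rewrite cr_fix |].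
rewrite cr_melnikov, (melnikov_center k (S i)) by
  (auto using Rinv_0_lt_compat with arith || (try apply Rinv_0_lt_compat; lra)).
simpl; ring.
Qed.

(** * Limit cycles *)

(** The ring A < u < U: u is an inverse radius and [N4] is u^-4, which reverses the bounds. *)
Definition band (A U : R) (p : R * R) : Prop := / U ^ 4 < N4 p < / A ^ 4.

Lemma continuous_N4 (p : R * R) : continuous N4 p.
Proof. unfold N4; cont2. Qed.

Lemma open_band (A U : R) : open (band A U).
Proof.
intros p [H1 H2]; apply filter_and.
- apply (continuous_Rlt N4 p); auto using continuous_N4.
- generalize (continuous_Rlt (fun q => - N4 q) p (- / A ^ 4)
    (continuous_Ropp _ _ (continuous_N4 p)) ltac:(lra)).
  apply filter_imp; intros q Hq; lra.
Qed.

Lemma inv_pow4_lt (u v : R) : 0 < u -> 0 < v -> / u ^ 4 < / v ^ 4 -> v < u.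
Proof.
intros Hu Hv H; apply Rnot_le_lt; intros Hle.
assert (u ^ 4 <= v ^ 4) by (apply pow_incr; lra).
assert (/ v ^ 4 <= / u ^ 4) by (apply Rinv_le_contravar; [apply pow_lt |]; assumption).
lra.
Qed.

Lemma polar_of_closed_leaf_in_band (A U L e : R) (k : coeffs) (Lf : R * R -> Prop) :
  0 < A -> 0 < U -> regular U k L e -> closed_leaf (omega k e) Lf -> subset Lf (band A U) ->
  exists u, periodic_polar k e u /\ (forall phi, A < u phi < U) /\ set_eq Lf (leaf u) /\
    Rser k (2 * PI) (u 0) e = 1.
Proof.
intros HA HU Hr HL Hsub.
destruct (polar_of_closed_leaf U L e k Lf HU Hr HL) as (u & Pu & Bu & Eu).
{ intros p Hp; apply Rlt_le, (Hsub p Hp). }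
assert (Hu := proj2 (proj2 Pu)).
assert (HAu : forall phi, A < u phi < U).
{ intros phi; assert (Hp : Lf (pt phi (u phi))) by (apply Eu; now exists phi).
  destruct (Hsub _ Hp) as [H1 H2]; specialize (Hu phi).
  rewrite N4_pt in H1, H2 by lra; split; now apply inv_pow4_lt. }
exists u; split; [assumption |]; split; [assumption |]; split; [assumption |].
apply (Rser_of_periodic U L); auto.
- intros phi; generalize (Bu phi); lra.
Qed.

Lemma closed_leaves_equal (A U L e : R) (k : coeffs) (L1 L2 : R * R -> Prop) :
  0 < A -> A <= U -> regular U k L e ->
  (forall a b, A <= a <= U -> A <= b <= U ->
    Rser k (2 * PI) a e = 1 -> Rser k (2 * PI) b e = 1 -> a = b) ->
  closed_leaf (omega k e) L1 -> closed_leaf (omega k e) L2 ->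
  subset L1 (band A U) -> subset L2 (band A U) -> set_eq L1 L2.
Proof.
intros HA HU Hr Huniq H1 H2 S1 S2.
destruct (polar_of_closed_leaf_in_band A U L e k L1) as (u & Pu & Bu & Eu & Ru); auto; try lra.
destruct (polar_of_closed_leaf_in_band A U L e k L2) as (v & Pv & Bv & Ev & Rv); auto; try lra.
assert (E : set_eq (leaf u) (leaf v)).
{ apply (periodic_polar_unique U L e k); auto.
  - intros phi; generalize (Bu phi); lra.
  - intros phi; generalize (Bv phi); lra.
  - apply Huniq; auto; [generalize (Bu 0) | generalize (Bv 0)]; lra. }
intros p; now rewrite (Eu p), (E p), (Ev p).
Qed.

Lemma continuous_pt_pair (a phi : R) : a <> 0 ->
  continuous (fun p : R * R => pt (snd p) (fst p)) (a, phi).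
Proof.
intros Ha; unfold pt.
assert (Hc : continuous (fun p : R * R => cs (snd p)) (a, phi))
  by (apply (continuous_comp (fun p : R * R => snd p) cs);
      [apply continuous_snd_R | apply continuous_cs]).
assert (Hs : continuous (fun p : R * R => sn (snd p)) (a, phi))
  by (apply (continuous_comp (fun p : R * R => snd p) sn);
      [apply continuous_snd_R | apply continuous_sn]).
assert (C1 : continuous (fun p : R * R => cs (snd p) / fst p) (a, phi)).
{ apply continuous_Rmult; [exact Hc |]; apply continuous_Rinv; [exact Ha | cont2]. }
assert (C2 : continuous (fun p : R * R => sn (snd p) / fst p ^ 2) (a, phi)).
{ apply continuous_Rmult; [exact Hs |]; apply continuous_Rinv; [| cont2].
  now apply pow_nonzero. }
intros P [d Hd].
apply filterlim_locally with (eps := d) in C1.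
apply filterlim_locally with (eps := d) in C2.
unfold filtermap; generalize (filter_and _ _ C1 C2); apply filter_imp.
intros q [H1 H2]; apply Hd; now split.
Qed.

(** In the center case every initial value gives a closed leaf. A slightly smaller initial value
    gives one inside the isolating neighbourhood, and it meets the half-axis at a different
    point. *)
Lemma center_no_limit_cycle (A U L e : R) (k : coeffs) (Lf : R * R -> Prop) :
  0 < A -> 0 < U -> regular U k L e -> 0 <= L -> center k -> limit_cycle (omega k e) Lf ->
  subset Lf (band A U) -> False.
Proof.
intros HA HU Hr HL Hc [Hcl (V & HV & HLV & Hiso)] Hsub.
assert (HP := PI_RGT_0); assert (HP4 := PI_4).
destruct (polar_of_closed_leaf_in_band A U L e k Lf) as (u & Pu & Bu & Eu & Ru); auto.
set (a0 := u 0); assert (Ha0 : A < a0 < U) by apply Bu.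
assert (Eph : forall phi, 0 <= phi <= 2 * PI -> u phi = a0 * Eser k phi a0 e).
{ intros phi Hphi; apply (polar_is_Eser U L e k u phi); auto.
  - apply Pu.
  - intros y; generalize (Bu y); lra.
  - generalize (Bu 0); lra.
  - rewrite Rabs_pos_eq; lra. }
(* The radial coordinate is just a E(phi, a), expanded around the initial value a0 of the given
   leaf. *)
destruct (tube a0 0 (2 * PI) (fun a phi => V (pt phi (a * Eser k phi a0 e +
  a * (Eser k phi a e - Eser k phi a0 e))))) as [d Hd].
{ intros phi Hphi.
  assert (HVp : V (pt phi (u phi))) by (apply HLV, Eu; now exists phi).
  assert (Hu0 : u phi <> 0) by (generalize (Bu phi); lra).
  assert (Cc := continuous_pt_pair (u phi) phi Hu0).
  specialize (HV _ HVp).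
  apply Cc in HV; destruct HV as [d1 Hd1]; cbn [fst snd] in Hd1.
  assert (Cv : continuous (fun p : R * R => fst p * Eser k (snd p) (fst p) e) (a0, phi)).
  { apply continuous_Rmult; [apply continuous_fst_R |].
    apply filterlim_locally; intros eps.
    set (K := L * Rabs e + 1).
    assert (HK : 0 < K) by (unfold K; generalize (Rabs_pos e); nra).
    assert (Hm : 0 < Rmin (U - a0) (Rmin a0 (Rmin 1 (eps / (2 * K))))).
    { repeat apply Rmin_pos; try lra; apply Rdiv_lt_0_compat; [apply cond_pos | lra]. }
    exists (mkposreal _ Hm); intros [a x] [Hba Hbx]; simpl in Hba, Hbx.
    set (m := Rmin (U - a0) (Rmin a0 (Rmin 1 (eps / (2 * K))))) in *.
    change (Rabs (a - a0) < m) in Hba; change (Rabs (x - phi) < m) in Hbx.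
    assert (M1 : m <= U - a0) by apply Rmin_l.
    assert (M2 : m <= a0) by (eapply Rle_trans; [apply Rmin_r | apply Rmin_l]).
    assert (M3 : m <= Rmin 1 (eps / (2 * K))).
    { eapply Rle_trans; [apply Rmin_r | apply Rmin_r]. }
    assert (M4 := Rmin_l 1 (eps / (2 * K))); assert (M5 := Rmin_r 1 (eps / (2 * K))).
    change (Rabs (Eser k x a e - Eser k phi a0 e) < eps).
    eapply Rle_lt_trans; [apply (reg_lip _ _ _ _ Hr) |].
    - apply Rabs_lt_between in Hba; apply Rabs_lt_between in Hbx.
      split; apply Rabs_le; lra.
    - split; rewrite Rabs_pos_eq; lra.
    - assert (Hs : Rabs (x - phi) + Rabs (a - a0) < 2 * (eps / (2 * K))) by lra.
      apply Rle_lt_trans with (K * (Rabs (x - phi) + Rabs (a - a0))).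
      + apply Rmult_le_compat_r; [| unfold K; lra].
        apply Rplus_le_le_0_compat; apply Rabs_pos.
      + apply (Rmult_lt_compat_l K) in Hs; [| assumption].
        replace (K * (2 * (eps / (2 * K)))) with (pos eps) in Hs by (field; lra).
        exact Hs. }
  apply filterlim_locally with (eps := d1) in Cv.
  assert (Cs : locally (a0, phi) (fun p : R * R => ball phi d1 (snd p))).
  { exists d1; intros q [_ Hq]; exact Hq. }
  generalize (filter_and _ _ Cv Cs); apply filter_imp; intros q [H1 H2].
  replace (fst q * Eser k (snd q) a0 e + fst q *
    (Eser k (snd q) (fst q) e - Eser k (snd q) a0 e)) with
    (fst q * Eser k (snd q) (fst q) e) by ring.
  apply (Hd1 (fst q * Eser k (snd q) (fst q) e, snd q)); split; [| exact H2].
  simpl; rewrite (Eph phi Hphi); exact H1. }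
(* The two bounds keep the new leaf inside the tube and its initial value positive; decreasing the
   value also keeps it below U. *)
set (a := a0 - Rmin (d / 2) (a0 / 2)).
assert (Hm : 0 < Rmin (d / 2) (a0 / 2))
  by (apply Rmin_pos; [generalize (cond_pos d) |]; lra).
assert (M1 := Rmin_l (d / 2) (a0 / 2)); assert (M2 := Rmin_r (d / 2) (a0 / 2)).
assert (Ha : 0 < a <= U) by (unfold a; lra).
destruct (periodic_of_Rser U L e a k Hr Ha (center_fixed _ _ _ _ _ Hr Hc Ha))
  as (v & Pv & v0 & Ev & Bv).
assert (Hcv := closed_leaf_of_polar U L e k v Hr Pv Bv).
assert (E : set_eq (leaf v) Lf).
{ apply Hiso; [exact Hcv |]; intros p [phi <-].
  destruct (angle_reduce phi) as (n & x & -> & Hx).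
  rewrite (periodic_IZR v (proj1 (proj2 Pv))).
  rewrite (periodic_IZR (fun y => pt y (v x)) (fun y => pt_periodic y (v x))).
  rewrite Ev by lra.
  replace (a * Eser k x a e) with
    (a * Eser k x a0 e + a * (Eser k x a e - Eser k x a0 e)) by ring.
  apply Hd; [| lra]; unfold a; rewrite Rabs_left1; generalize (cond_pos d); lra. }
assert (Hin : leaf u (pt 0 a)).
{ apply Eu, E; exists 0; now rewrite v0. }
apply (leaf_axis k e a u Pu) in Hin; [| lra].
fold a0 in Hin; unfold a in Hin; lra.
Qed.

(** The rings 1 / (n + 2) < u < n + 2 form an increasing open cover of the punctured plane; the
    summand 2 keeps each ring nonempty and makes n + 2 at most its fourth power. *)
Lemma compact_in_band (K : R * R -> Prop) : compact_set K -> ~ K (0, 0) ->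
  exists A U, 0 < A /\ A < U /\ subset K (band A U).
Proof.
intros HK H0.
destruct (HK nat (fun n => band (/ (INR n + 2)) (INR n + 2))) as [l Hl].
- intros n; apply open_band.
- intros p Hp.
  assert (Hpos : 0 < N4 p).
  { destruct p as [x y]; unfold N4; simpl fst; simpl snd.
    assert (x <> 0 \/ y <> 0).
    { apply NNPP; intros H; apply not_or_and in H; destruct H as [Hx Hy].
      apply NNPP in Hx; apply NNPP in Hy; subst; tauto. }
    destruct H as [H | H].
    - assert (0 < x ^ 2) by (apply pow2_gt_0; assumption).
      generalize (pow2_ge_0 y); nra.
    - assert (0 < y ^ 2) by (apply pow2_gt_0; assumption).
      generalize (pow2_ge_0 (x ^ 2)); nra. }
  destruct (nfloor_ex (N4 p + / N4 p)) as [n Hn].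
  { generalize (Rinv_0_lt_compat _ Hpos); lra. }
  assert (Hip := Rinv_0_lt_compat _ Hpos).
  exists n; unfold band.
  assert (Hn0 := pos_INR n).
  assert (H4 : INR n + 2 <= (INR n + 2) ^ 4).
  { rewrite <- (pow_1 (INR n + 2)) at 1; apply Rle_pow; [lra | lia]. }
  split.
  + rewrite <- (Rinv_inv (N4 p)); apply Rinv_lt_contravar; [| lra].
    apply Rmult_lt_0_compat; lra.
  + rewrite pow_inv, Rinv_inv; lra.
- set (N := fold_right Nat.max O l).
  assert (HN : forall n, In n l -> (n <= N)%nat).
  { unfold N; clear; induction l as [| m l IH]; intros n Hn; [easy |].
    simpl; destruct Hn as [-> | Hn]; [lia |]; generalize (IH n Hn); lia. }
  exists (/ (INR N + 2)), (INR N + 2); assert (HN0 := pos_INR N).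
  split; [apply Rinv_0_lt_compat; lra |]; split.
  { apply Rlt_le_trans with 1; [| lra].
    rewrite <- Rinv_1; apply Rinv_lt_contravar; lra. }
  intros p Hp; destruct (Hl p Hp) as (n & Hn & H1 & H2).
  assert (Hle := le_INR _ _ (HN n Hn)); assert (Hn0 := pos_INR n).
  assert (H4 : (INR n + 2) ^ 4 <= (INR N + 2) ^ 4) by (apply pow_incr; lra).
  rewrite pow_inv, Rinv_inv in H2; unfold band; rewrite pow_inv, Rinv_inv.
  split; [| lra]; apply Rle_lt_trans with (2 := H1).
  apply Rinv_le_contravar; [apply pow_lt; lra | assumption].
Qed.

(** The whole band serves as neighbourhood: a center has no limit cycle in it, and otherwise two of
    them would start from the same fixed point. *)
Lemma cyclicity_le_1 (k : coeffs) (K : R * R -> Prop) :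
  compact_set K -> ~ K (0, 0) -> cyclicity_le k K 1.
Proof.
intros HK H0; destruct (compact_in_band K HK H0) as (A & U & HA & HU & Hsub).
exists (band A U).
destruct (polar_flow U k ltac:(lra)) as (e0 & L & He0 & HL & _ & Hreg).
destruct (classic (center k)) as [Hc | Hc].
- exists e0; split; [apply open_band |]; split; [assumption |]; split; [assumption |].
  intros e He Lf HLf; exfalso; destruct (HLf O ltac:(lia)) as [H1 H2].
  apply (center_no_limit_cycle A U L e k (Lf O)); auto; [lra |].
  apply Hreg; rewrite Rabs_pos_eq; lra.
- destruct (unique_fixed_point k A U Hc HA ltac:(lra)) as (d & Hd & Huniq).
  exists (Rmin e0 d); split; [apply open_band |]; split; [assumption |].
  split; [now apply Rmin_pos |]; intros e [He1 He2] Lf HLf.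
  assert (He3 : e < e0) by (eapply Rlt_le_trans; [exact He2 | apply Rmin_l]).
  assert (He4 : e < d) by (eapply Rlt_le_trans; [exact He2 | apply Rmin_r]).
  exists O, 1%nat; split; [lia |].
  destruct (HLf O ltac:(lia)) as [[C0 _] S0]; destruct (HLf 1%nat ltac:(lia)) as [[C1 _] S1].
  apply (closed_leaves_equal A U L e k); auto; [lra | |].
  + apply Hreg; rewrite Rabs_pos_eq; lra.
  + intros a b Ha Hb; apply Huniq; auto; rewrite Rabs_pos_eq; lra.
Qed.

(** * A perturbation for which one limit cycle occurs *)

Lemma compact_oval (a : R) : 0 < a -> compact_set (fun p => exists phi, pt phi a = p).
Proof.
intros Ha J W HW Hcov; assert (HP := PI_RGT_0).
assert (H : forall phi, exists i, W i (pt phi a)) by (intros; apply Hcov; eauto).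
set (idx := fun phi => proj1_sig (constructive_indefinite_description _ (H phi))).
assert (Hidx : forall phi, W (idx phi) (pt phi a)) by (intros; unfold idx; apply proj2_sig).
assert (Hd : forall phi, exists d : posreal, forall x, Rabs (x - phi) < d ->
  W (idx phi) (pt x a)).
{ intros phi; assert (L := HW _ _ (Hidx phi)).
  apply (continuous_pt_pair a phi ltac:(lra)) in L; destruct L as [d Hd].
  exists d; intros x Hx; apply (Hd (a, x)); split; [apply ball_center | exact Hx]. }
set (delta := fun phi => proj1_sig (constructive_indefinite_description _ (Hd phi))).
assert (Hdelta : forall phi x, Rabs (x - phi) < delta phi -> W (idx phi) (pt x a))
  by exact (fun phi => proj2_sig (constructive_indefinite_description _ (Hd phi))).
(* The cover is pulled back to the interval of angles. Points of a box are encoded as nested pairs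
   ending in [tt], and the finite list is delivered under a double negation. *)
assert (X := compactness_list 1 (0, tt) (2 * PI, tt) (fun t => delta (fst t))).
apply NNPP; intros Hn; apply X; intros (l & Hl); apply Hn.
exists (List.map (fun t => idx (fst t)) l); intros p [phi <-].
destruct (angle_reduce phi) as (n & x & -> & Hx).
rewrite (periodic_IZR (fun y => pt y a) (fun y => pt_periodic y a)).
destruct (Hl (x, tt)) as ([t []] & Hin & _ & Hclose); [simpl; split; [lra | exact I] |].
exists (idx t); split.
- apply in_map_iff; now exists (t, tt).
- apply Hdelta; apply Hclose.
Qed.

(** The bounds on the series hold only on the interval, whereas [IVT_gen] asks for continuity
    everywhere; composing with the projection onto [p, q] settles this. *)
Lemma IVT_lipschitz (f : R -> R) (p q c K : R) : p <= q -> 0 <= K ->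
  (forall x y, p <= x <= q -> p <= y <= q -> Rabs (f x - f y) <= K * Rabs (x - y)) ->
  Rmin (f p) (f q) <= c <= Rmax (f p) (f q) -> exists x, p <= x <= q /\ f x = c.
Proof.
intros Hpq HK Hf Hc.
set (cl := fun x => Rmax p (Rmin x q)).
assert (Hcl : forall x, p <= cl x <= q).
{ intros x; unfold cl, Rmax, Rmin; repeat destruct (Rle_dec _ _); lra. }
assert (Hlip : forall x y, Rabs (cl x - cl y) <= Rabs (x - y)).
{ intros x y; unfold cl, Rmax, Rmin; repeat destruct (Rle_dec _ _); unfold Rabs;
    repeat destruct (Rcase_abs _); lra. }
assert (Hid : forall x, p <= x <= q -> cl x = x).
{ intros x Hx; unfold cl, Rmax, Rmin; repeat destruct (Rle_dec _ _); lra. }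
destruct (IVT_gen (fun x => f (cl x)) p q c) as (x & Hx & E).
- intros x; apply continuity_pt_filterlim.
  apply (continuous_lipschitz (fun x => f (cl x)) K); intros y z.
  eapply Rle_trans; [apply Hf; apply Hcl |]; now apply Rmult_le_compat_l.
- now rewrite !Hid by lra.
- exists (cl x); auto.
Qed.

(** Here b1 = c3 = 0, [dd] = 1, c0 = 1 and c2 = -1, so the second Melnikov function is a positive
    multiple of I0 - h^2 I2, which has a simple positive zero. *)
Definition one_cycle : coeffs := Coeffs 1 0 (-1) 0 0 1 0 0 0 0.

Lemma one_cycle_cr (a : R) : 0 < a ->
  cr one_cycle 1%nat (2 * PI) a = 0 /\
  cr one_cycle 2%nat (2 * PI) a = sqrt 2 / 2 * a * (a ^ 2 * I0 - I2).
Proof.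
intros Ha; assert (Hi := Rinv_0_lt_compat a Ha).
assert (V1 : vanishes (melnikov_fun one_cycle 1)) by now apply melnikov_1_vanishes.
split; rewrite cr_melnikov by assumption.
- rewrite V1 by assumption; ring.
- rewrite melnikov_2 by (reflexivity || assumption).
  unfold dd; simpl; field; lra.
Qed.

Lemma one_cycle_not_center : ~ center one_cycle.
Proof. intros (_ & H & _); unfold dd in H; simpl in H; lra. Qed.

(** The leading coefficient changes sign at a, so for small e the return map has a fixed point near
    a, hence a closed leaf in any given neighbourhood of the oval. Uniqueness of the fixed point in
    a band isolates this leaf. *)
Lemma one_cycle_cyclicity (a : R) : 0 < a -> a ^ 2 * I0 = I2 ->
  ~ cyclicity_le one_cycle (fun p => exists phi, pt phi a = p) 0.
Proof.
intros Ha Ea (V & e1 & HV & HKV & He1 & Hmost).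
assert (HP := PI_RGT_0); assert (HP4 := PI_4).
assert (P0 := I0_pos); assert (Hs := sqrt2_pos).
destruct (tube a 0 (2 * PI) (fun v phi => V (pt phi v))) as [d Hd].
{ intros phi Hphi; assert (L := HV _ (HKV _ (ex_intro _ phi eq_refl))).
  exact (continuous_pt_pair a phi (Rgt_not_eq _ _ Ha) _ L). }
set (r := Rmin (d / 3) (a / 2)).
assert (Hr : 0 < r) by (apply Rmin_pos; [generalize (cond_pos d) |]; lra).
assert (Hr1 : r <= d / 3) by apply Rmin_l; assert (Hr2 : r <= a / 2) by apply Rmin_r.
(* The initial value found below lies in [a / 2, 3 a / 2] and E in [1/2, 3/2], so u ranges over
   [a / 4, 9 a / 4], well inside the band. *)
set (U := 4 * a); set (A := a / 8).
destruct (polar_flow U one_cycle ltac:(unfold U; lra)) as (e0 & L & He0 & HL & G & Hreg).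
destruct (unique_fixed_point one_cycle A U one_cycle_not_center
  ltac:(unfold A; lra) ltac:(unfold A, U; lra)) as (e2 & He2 & Huniq).
set (K := 1 * (/ (2 * e0)) ^ 3).
assert (Hrr : 0 < / (2 * e0)) by (apply Rinv_0_lt_compat; lra).
assert (GK : gmaj U (/ (2 * e0)) (shiftn 3 (cr one_cycle)) K) by now apply gmaj_shiftn.
assert (HK : 0 <= K).
{ unfold K; rewrite Rmult_1_l; apply pow_le; lra. }
set (lead := fun b => sqrt 2 / 2 * b * (b ^ 2 * I0 - I2)).
assert (Hp : 0 < lead (a + r)).
{ unfold lead; rewrite <- Ea; repeat apply Rmult_lt_0_compat; try lra.
  replace ((a + r) ^ 2 * I0 - a ^ 2 * I0) with ((2 * a * r + r * r) * I0) by ring.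
  apply Rmult_lt_0_compat; nra. }
assert (Hn : lead (a - r) < 0).
{ unfold lead; rewrite <- Ea.
  replace ((a - r) ^ 2 * I0 - a ^ 2 * I0) with (- ((2 * a - r) * r * I0)) by ring.
  assert (0 < (2 * a - r) * r * I0) by (repeat apply Rmult_lt_0_compat; lra).
  assert (0 < sqrt 2 / 2 * (a - r)) by (apply Rmult_lt_0_compat; lra).
  nra. }
set (m := Rmin (lead (a + r)) (- lead (a - r))).
assert (Hm : 0 < m) by (apply Rmin_pos; lra).
assert (Hm1 : m <= lead (a + r)) by apply Rmin_l.
assert (Hm2 : m <= - lead (a - r)) by apply Rmin_r.
(* The bound m / (2 K + 1) prevents the remainder from changing the sign of the leading term at the
   two ends; r / (2 a (L + 1)) keeps u within 2 r of a, hence inside the tube. *)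
set (e := / 2 * Rmin (Rmin e0 e1) (Rmin e2 (Rmin (m / (2 * K + 1)) (r / (2 * a * (L + 1)))))).
assert (Hmin : 0 < Rmin (Rmin e0 e1) (Rmin e2 (Rmin (m / (2 * K + 1)) (r / (2 * a * (L + 1)))))).
{ repeat apply Rmin_pos; try assumption; apply Rdiv_lt_0_compat; try lra.
  repeat apply Rmult_lt_0_compat; lra. }
assert (He : 0 < e) by (unfold e; lra).
assert (B0 : e < e0).
{ apply Rlt_le_trans with (2 := Rmin_l e0 e1).
  apply Rlt_le_trans with (2 := Rmin_l _ (Rmin e2 (Rmin (m / (2 * K + 1)) (r / (2 * a * (L + 1)))))).
  unfold e; lra. }
assert (B1 : e < e1).
{ apply Rlt_le_trans with (2 := Rmin_r e0 e1).
  apply Rlt_le_trans with (2 := Rmin_l _ (Rmin e2 (Rmin (m / (2 * K + 1)) (r / (2 * a * (L + 1)))))).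
  unfold e; lra. }
assert (B2' : e < Rmin e2 (Rmin (m / (2 * K + 1)) (r / (2 * a * (L + 1))))).
{ apply Rlt_le_trans with (2 := Rmin_r (Rmin e0 e1) _); unfold e; lra. }
assert (B2 : e < e2) by (eapply Rlt_le_trans; [exact B2' | apply Rmin_l]).
assert (B3' : e < Rmin (m / (2 * K + 1)) (r / (2 * a * (L + 1))))
  by (eapply Rlt_le_trans; [exact B2' | apply Rmin_r]).
assert (B3 : e * (2 * K + 1) < m).
{ apply (Rmult_lt_reg_r (/ (2 * K + 1))); [apply Rinv_0_lt_compat; lra |].
  rewrite Rmult_assoc, Rinv_r, Rmult_1_r by lra.
  eapply Rlt_le_trans; [exact B3' | apply Rmin_l]. }
assert (B4 : e * (2 * a * (L + 1)) < r).
{ assert (0 < 2 * a * (L + 1)) by (repeat apply Rmult_lt_0_compat; lra).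
  apply (Rmult_lt_reg_r (/ (2 * a * (L + 1)))); [now apply Rinv_0_lt_compat |].
  rewrite Rmult_assoc, Rinv_r, Rmult_1_r by lra.
  eapply Rlt_le_trans; [exact B3' | apply Rmin_r]. }
clear B2' B3' Hmin; clearbody e.
assert (Eabs : Rabs e = e) by (apply Rabs_pos_eq; lra).
assert (Hreg' := Hreg e ltac:(lra)).
assert (He' : Rabs e <= / (2 * / (2 * e0))).
{ replace (/ (2 * / (2 * e0))) with e0 by (field; lra); lra. }
assert (Habs : forall b, a - r <= b <= a + r -> Rabs b <= U).
{ intros b Hb; unfold U; rewrite Rabs_pos_eq; lra. }
assert (HR : forall b, a - r <= b <= a + r -> exists T, Rabs T <= 2 * K /\
  Rser one_cycle (2 * PI) b e = 1 + e ^ 2 * (lead b + e * T)).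
{ intros b Hb; exists (ser (shiftn 3 (cr one_cycle)) (2 * PI) b e); split.
  - apply (ser_sup U _ _ K _ _ _ Hrr He' GK); apply in_dom_2PI; auto.
  - destruct (one_cycle_cr b ltac:(lra)) as [Z1 Z2].
    rewrite (Rser_expansion U e0 e b one_cycle 1); auto; try lra.
    + rewrite Z2; reflexivity.
    + intros [| i] Hi; [exact Z1 | lia]. }
assert (HER : forall b, a - r <= b <= a + r ->
  / 2 <= Eser one_cycle (2 * PI) b e /\
  Eser one_cycle (2 * PI) b e * Rser one_cycle (2 * PI) b e = 1).
{ intros b Hb; split.
  - apply (Eser_bounds U L e); auto; apply in_dom_2PI; auto.
  - apply (reg_inv _ _ _ _ Hreg'); auto; rewrite Rabs_pos_eq; lra. }
assert (He2' : 0 < e ^ 2) by now apply pow_lt.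
assert (Hend : Rmin (Eser one_cycle (2 * PI) (a - r) e) (Eser one_cycle (2 * PI) (a + r) e)
  <= 1 <= Rmax (Eser one_cycle (2 * PI) (a - r) e) (Eser one_cycle (2 * PI) (a + r) e)).
{ destruct (HR (a - r) ltac:(lra)) as (T1 & HT1 & E1).
  destruct (HR (a + r) ltac:(lra)) as (T2 & HT2 & E2).
  destruct (HER (a - r) ltac:(lra)) as [F1 G1].
  destruct (HER (a + r) ltac:(lra)) as [F2 G2].
  apply Rabs_le_between in HT1; apply Rabs_le_between in HT2.
  assert (X1 : lead (a - r) + e * T1 < 0) by nra.
  assert (X2 : 0 < lead (a + r) + e * T2) by nra.
  assert (Y1 : Rser one_cycle (2 * PI) (a - r) e < 1) by nra.
  assert (Y2 : 1 < Rser one_cycle (2 * PI) (a + r) e) by nra.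
  split; [eapply Rle_trans; [apply Rmin_r |] | eapply Rle_trans; [| apply Rmax_l]]; nra. }
destruct (IVT_lipschitz (fun b => Eser one_cycle (2 * PI) b e) (a - r) (a + r) 1
  (L * Rabs e)) as (b & Hb & Eb).
{ lra. }
{ apply Rmult_le_pos; [assumption | apply Rabs_pos]. }
{ intros x y Hx Hy; eapply Rle_trans;
    [apply (reg_lip _ _ _ _ Hreg'); apply in_dom_2PI; auto |].
  rewrite Rminus_diag, Rabs_R0, Rplus_0_l; lra. }
{ exact Hend. }
assert (HRb : Rser one_cycle (2 * PI) b e = 1).
{ destruct (HER b Hb) as [_ HI]; rewrite Eb in HI; lra. }
destruct (periodic_of_Rser U L e b one_cycle Hreg' ltac:(unfold U; lra) HRb)
  as (u & Pu & u0 & Eu & Bu).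
assert (Hcl := closed_leaf_of_polar U L e one_cycle u Hreg' Pu Bu).
assert (Hpts : forall p, leaf u p -> exists phi, 0 <= phi <= 2 * PI /\
  p = pt phi (u phi) /\ Rabs (u phi - a) < d /\ A < u phi < U).
{ intros p [phi <-]; destruct (angle_reduce phi) as (n & x & -> & Hx).
  exists x; split; [lra |]; rewrite (periodic_IZR u (proj1 (proj2 Pu))).
  rewrite (periodic_IZR (fun y => pt y (u x)) (fun y => pt_periodic y (u x))).
  split; [reflexivity |]; rewrite Eu by lra.
  assert (D : in_dom U x b).
  { split; [rewrite Rabs_pos_eq; lra | auto]. }
  destruct (reg_near_1 _ _ _ _ Hreg' _ _ D) as [H1 _].
  assert (H2 := Eser_bounds _ _ _ _ _ _ Hreg' D).
  apply Rabs_le_between in H1; rewrite Eabs in H1.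
  split; [apply Rabs_def1 | split; unfold A, U]; nra. }
assert (Hband : subset (leaf u) (band A U)).
{ intros p Hpp; destruct (Hpts p Hpp) as (phi & _ & -> & _ & Hu).
  assert (HA : 0 < A) by (unfold A; lra).
  unfold band; rewrite N4_pt by lra.
  assert (Hq : forall s t, 0 < s < t -> / t ^ 4 < / s ^ 4).
  { intros s t Hst; assert (0 < s ^ 4) by (apply pow_lt; lra).
    assert (s ^ 4 < t ^ 4).
    { assert (s ^ 2 < t ^ 2) by nra; assert (0 < s ^ 2) by nra; nra. }
    apply Rinv_lt_contravar; nra. }
  split; apply Hq; lra. }
(* With the bound 0 a family of cycles has one member, and the coincidence i < j <= 0 is impossible:
   a single limit cycle is a contradiction. *)
destruct (Hmost e ltac:(lra) (fun _ => leaf u)) as (i & j & Hij & _); [| lia].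
intros i _; split.
- split; [exact Hcl |]; exists (band A U); split; [apply open_band |].
  split; [exact Hband |]; intros L' HL' HB.
  apply (closed_leaves_equal A U L e one_cycle); auto; try (unfold A, U; lra).
  intros s t Hs' Ht; apply Huniq; auto; lra.
- intros p Hpp; destruct (Hpts p Hpp) as (phi & Hphi & -> & Hu & _); now apply Hd.
Qed.

Lemma bifurcating_limit_cycles_1 : bifurcating_limit_cycles 1.
Proof.
split.
- intros k K HK H0; assert (H1 := cyclicity_le_1 k K HK H0).
  destruct (classic (cyclicity_le k K 0)) as [Hz | Hz].
  + exists O; split; [| lia]; split; [assumption | lia].
  + exists 1%nat; split; [| lia]; split; [assumption |].
    intros [| m] Hm; [tauto | lia].
- assert (P0 := I0_pos); assert (P2 := I2_pos).
  assert (Hq : 0 < I2 / I0) by now apply Rdiv_lt_0_compat.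
  set (a := sqrt (I2 / I0)); assert (Ha : 0 < a) by now apply sqrt_lt_R0.
  assert (Ea : a ^ 2 * I0 = I2) by (unfold a; rewrite pow2_sqrt by lra; field; lra).
  assert (HK := compact_oval a Ha).
  assert (H0 : ~ exists phi, pt phi a = (0, 0)).
  { intros [phi E]; assert (HN := N4_pt phi a ltac:(lra)); rewrite E in HN.
    unfold N4 in HN; simpl fst in HN; simpl snd in HN.
    assert (0 < / a ^ 4) by (apply Rinv_0_lt_compat, pow_lt, Ha); lra. }
  exists one_cycle, (fun p => exists phi, pt phi a = p); split; [exact HK |].
  split; [exact H0 |]; split; [now apply cyclicity_le_1 |].
  intros [| m] Hm; [exfalso; now apply (one_cycle_cyclicity a Ha Ea) | lia].
Qed.

(** * The period annulus *)

Lemma N4_pos (p : R * R) : p <> (0, 0) -> 0 < N4 p.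
Proof.
destruct p as [x y]; intros H; unfold N4; cbn [fst snd].
destruct (Req_dec x 0) as [-> | Hx].
- assert (y <> 0) by (intros ->; tauto).
  assert (0 < y ^ 2) by (apply pow2_gt_0; assumption); simpl in *; lra.
- assert (0 < x ^ 2) by (apply pow2_gt_0; assumption).
  generalize (pow2_ge_0 y); nra.
Qed.

Lemma continuous_pair_R {T : UniformSpace} (f g : T -> R) (x : T) :
  continuous f x -> continuous g x -> continuous (fun t => (f t, g t)) x.
Proof.
intros Hf Hg P [d Hd].
apply filterlim_locally with (eps := d) in Hf.
apply filterlim_locally with (eps := d) in Hg.
unfold filtermap; generalize (filter_and _ _ Hf Hg); apply filter_imp.
intros t [H1 H2]; apply Hd; now split.
Qed.

Definition ucos (p : R * R) : R := fst p / sqrt (lam2 p).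
Definition usin (p : R * R) : R := - snd p / lam2 p.
(** Some angle with the given cosine and sine. The choice need not be continuous, since it is used
    only through 2 PI-periodic functions. *)
Definition ang (c s : R) : R := epsilon (inhabits 0) (fun phi => cos phi = c /\ sin phi = s).
Definition dirv (v : R -> R) (p : R * R) : R := v (ang (ucos p) (usin p)).
Definition radu (p : R * R) : R := / sqrt (sqrt (N4 p)).
Definition dil (s : R) (p : R * R) : R * R := (s * fst p, s ^ 2 * snd p).

Lemma ang_spec (p : R * R) : 0 < N4 p ->
  cos (ang (ucos p) (usin p)) = ucos p /\ sin (ang (ucos p) (usin p)) = usin p.
Proof.
intros H; unfold ang.
apply (epsilon_spec (inhabits 0) (fun phi => cos phi = ucos p /\ sin phi = usin p)).
apply angle_exists; now apply polar_coordinates.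
Qed.

Lemma dirv_angle (v : R -> R) (p : R * R) (phi : R) :
  (forall x, v (x + 2 * PI) = v x) -> 0 < N4 p ->
  cos phi = ucos p -> sin phi = usin p -> dirv v p = v phi.
Proof.
intros Hv Hp Hc Hs; destruct (ang_spec p Hp) as [Hc' Hs'].
destruct (same_angle (ang (ucos p) (usin p)) phi) as [n Hn];
  [now rewrite Hc' | now rewrite Hs' |].
unfold dirv; rewrite Hn; apply (periodic_IZR v Hv).
Qed.

Lemma lam2_pt (phi u : R) : 0 < u -> lam2 (pt phi u) = / (quart phi * u) ^ 2.
Proof.
intros Hu; assert (Hq := quart_ge_1 phi).
unfold lam2, pt, cs, sn; cbn [fst snd].
assert (E : ((cos phi / quart phi / u) ^ 2) ^ 2 + 4 * (- sin phi / quart phi ^ 2 / u ^ 2) ^ 2 =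
  ((1 + sin phi ^ 2) / (quart phi * u) ^ 2) ^ 2).
{ transitivity (((cos phi ^ 2) ^ 2 + 4 * sin phi ^ 2) / (quart phi * u) ^ 4);
    [field; lra |].
  rewrite sin2_cos2'; field; lra. }
rewrite E, sqrt_pow2.
- transitivity ((cos phi ^ 2 + (1 + sin phi ^ 2)) / 2 / (quart phi * u) ^ 2);
    [field; lra |].
  rewrite sin2_cos2'; field; lra.
- apply Rdiv_le_0_compat; [generalize (pow2_ge_0 (sin phi)); lra |].
  apply pow_lt; nra.
Qed.

Lemma unit_pt (phi u : R) : 0 < u ->
  cos phi = ucos (pt phi u) /\ sin phi = usin (pt phi u).
Proof.
intros Hu; assert (Hq := quart_ge_1 phi); assert (Hqu : 0 < quart phi * u) by nra.
unfold ucos, usin; rewrite lam2_pt, <- pow_inv by assumption.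
rewrite sqrt_pow2 by (apply Rlt_le, Rinv_0_lt_compat; assumption).
unfold pt, cs, sn; cbn [fst snd]; split; field; lra.
Qed.

Lemma radu_pos (p : R * R) : 0 < N4 p -> 0 < radu p.
Proof. intros; apply Rinv_0_lt_compat; now do 2 apply sqrt_lt_R0. Qed.

Lemma radu_4 (p : R * R) : 0 < N4 p -> / radu p ^ 4 = N4 p.
Proof.
intros H; unfold radu; rewrite pow_inv, Rinv_inv.
assert (H2 := sqrt_lt_R0 _ H).
replace (sqrt (sqrt (N4 p)) ^ 4) with ((sqrt (sqrt (N4 p)) ^ 2) ^ 2) by ring.
rewrite pow2_sqrt by lra; apply pow2_sqrt; lra.
Qed.

Lemma radu_unique (p : R * R) (u : R) : 0 < u -> / u ^ 4 = N4 p -> radu p = u.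
Proof.
intros Hu E; assert (HN : 0 < N4 p)
  by (rewrite <- E; apply Rinv_0_lt_compat, pow_lt, Hu).
apply pow4_continuous_inverse; auto using radu_pos; now rewrite radu_4.
Qed.

Lemma N4_dil (s : R) (p : R * R) : N4 (dil s p) = s ^ 4 * N4 p.
Proof. unfold N4, dil; cbn [fst snd]; ring. Qed.

Lemma radu_dil (s : R) (p : R * R) : 0 < s -> 0 < N4 p -> radu (dil s p) = radu p / s.
Proof.
intros Hs Hp; assert (Hr := radu_pos p Hp); apply radu_unique.
- now apply Rdiv_lt_0_compat.
- rewrite N4_dil, <- radu_4 by assumption; field; lra.
Qed.

Lemma unit_dil (s : R) (p : R * R) : 0 < s -> 0 < N4 p ->
  ucos (dil s p) = ucos p /\ usin (dil s p) = usin p.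
Proof.
intros Hs Hp; assert (HL := lam2_pos p Hp); assert (Hq := sqrt_lt_R0 _ HL).
assert (E : lam2 (dil s p) = s ^ 2 * lam2 p).
{ unfold lam2, dil; cbn [fst snd].
  replace (((s * fst p) ^ 2) ^ 2 + 4 * (s ^ 2 * snd p) ^ 2) with
    ((s ^ 2) ^ 2 * ((fst p ^ 2) ^ 2 + 4 * snd p ^ 2)) by ring.
  rewrite sqrt_mult_alt by apply pow2_ge_0.
  rewrite sqrt_pow2 by apply pow2_ge_0; field. }
unfold ucos, usin; rewrite E; unfold dil; cbn [fst snd].
rewrite sqrt_mult_alt by apply pow2_ge_0; rewrite sqrt_pow2 by lra.
split; field; lra.
Qed.

Lemma continuous_lam2 (p : R * R) : 0 < N4 p -> continuous lam2 p.
Proof.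
intros H; unfold lam2, Rdiv; apply continuous_Rmult; [| apply continuous_const].
apply continuous_Rplus; [cont2 |].
apply (continuous_sqrt_comp (fun p : R * R => (fst p ^ 2) ^ 2 + 4 * snd p ^ 2)).
- now apply N4_pos_discr.
- cont2.
Qed.

Lemma continuous_ucos (p : R * R) : 0 < N4 p -> continuous ucos p.
Proof.
intros H; unfold ucos, Rdiv; apply continuous_Rmult; [cont2 |].
assert (HL := lam2_pos p H).
apply continuous_Rinv; [generalize (sqrt_lt_R0 _ HL); lra |].
apply continuous_sqrt_comp; auto using continuous_lam2.
Qed.

Lemma continuous_usin (p : R * R) : 0 < N4 p -> continuous usin p.
Proof.
intros H; unfold usin, Rdiv; apply continuous_Rmult; [cont2 |].
apply continuous_Rinv; [generalize (lam2_pos p H); lra | now apply continuous_lam2].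
Qed.

Lemma continuous_radu (p : R * R) : 0 < N4 p -> continuous radu p.
Proof.
intros H; assert (H2 := sqrt_lt_R0 _ H); assert (H4 := sqrt_lt_R0 _ H2).
unfold radu; apply continuous_Rinv; [lra |].
apply (continuous_sqrt_comp (fun p => sqrt (N4 p))); [assumption |].
apply continuous_sqrt_comp; auto using continuous_N4.
Qed.

(* Near a point of argument [phi0] the argument is [phi0 + asin s], where [s] is
   the sine of the difference. *)
Lemma continuous_dirv (v : R -> R) (p : R * R) : (forall x, continuous v x) ->
  (forall x, v (x + 2 * PI) = v x) -> 0 < N4 p -> continuous (dirv v) p.
Proof.
intros Cv Hv Hp; destruct (ang_spec p Hp) as [Hc0 Hs0].
set (phi0 := ang (ucos p) (usin p)) in *.
set (cd := fun q => ucos q * cos phi0 + usin q * sin phi0).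
set (sd := fun q => usin q * cos phi0 - ucos q * sin phi0).
assert (Cu := continuous_ucos p Hp); assert (Cs := continuous_usin p Hp).
assert (Ccd : continuous cd p).
{ unfold cd; apply continuous_Rplus; apply continuous_Rmult; auto using continuous_const. }
assert (Csd : continuous sd p).
{ unfold sd; apply continuous_Rminus; apply continuous_Rmult; auto using continuous_const. }
assert (Hunit := proj1 (polar_coordinates p Hp)); fold (ucos p) (usin p) in Hunit.
assert (E1 : cd p = 1) by (unfold cd; rewrite Hc0, Hs0, <- Hunit; ring).
assert (E2 : sd p = 0) by (unfold sd; rewrite Hc0, Hs0; ring).
apply (continuous_ext_loc _ (fun q => v (phi0 + asin (sd q)))).
- assert (L1 := continuous_Rlt cd p 0 Ccd ltac:(lra)).
  assert (L2 := continuous_Rlt N4 p 0 (continuous_N4 p) Hp).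
  generalize (filter_and _ _ L1 L2); apply filter_imp; intros q [Hcd Hq].
  assert (Hqu := proj1 (polar_coordinates q Hq)); fold (ucos q) (usin q) in Hqu.
  assert (H0 := sin2_cos2' phi0).
  assert (Esq : cd q ^ 2 + sd q ^ 2 = 1).
  { unfold cd, sd.
    transitivity ((ucos q ^ 2 + usin q ^ 2) * (cos phi0 ^ 2 + sin phi0 ^ 2)); [ring |].
    rewrite Hqu, H0; ring. }
  assert (Hsd : -1 <= sd q <= 1) by (split; nra).
  assert (Ecos : cos (asin (sd q)) = cd q).
  { rewrite cos_asin by assumption.
    replace (1 - Rsqr (sd q)) with (cd q ^ 2) by (unfold Rsqr; lra).
    apply sqrt_pow2; lra. }
  assert (Esin : sin (asin (sd q)) = sd q) by now apply sin_asin.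
  symmetry; apply dirv_angle; auto.
  + rewrite cos_plus, Ecos, Esin; unfold cd, sd.
    transitivity (ucos q * (cos phi0 ^ 2 + sin phi0 ^ 2)); [ring | rewrite H0; ring].
  + rewrite sin_plus, Ecos, Esin; unfold cd, sd.
    transitivity (usin q * (cos phi0 ^ 2 + sin phi0 ^ 2)); [ring | rewrite H0; ring].
- apply (continuous_comp (fun q => phi0 + asin (sd q)) v); [| apply Cv].
  apply (continuous_Rplus (fun _ => phi0)); [apply continuous_const |].
  apply (continuous_comp sd asin); [exact Csd |]; rewrite E2.
  apply continuity_pt_filterlim, derivable_continuous_pt, derivable_pt_asin; lra.
Qed.

(** The exterior of the closed curve u = v(phi): u is an inverse radius, so smaller u means farther
    from the origin. *)
Definition outside (v : R -> R) (p : R * R) : Prop := 0 < N4 p /\ radu p < dirv v p.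

Lemma outside_annulus (v : R -> R) : (forall x, continuous v x) ->
  (forall x, v (x + 2 * PI) = v x) -> (forall x, 0 < v x) -> open_annulus (outside v).
Proof.
intros Cv Hv H0.
assert (Hd0 : forall p, 0 < dirv v p) by (intros; apply H0).
assert (Cd := fun p => continuous_dirv v p Cv Hv).
assert (Hdil : forall s p, 0 < s -> 0 < N4 p -> dirv v (dil s p) = dirv v p).
{ intros s p Hs Hp; unfold dirv; destruct (unit_dil s p Hs Hp) as [-> ->]; reflexivity. }
assert (HNdil : forall s p, 0 < s -> 0 < N4 p -> 0 < N4 (dil s p)).
{ intros s p Hs Hp; rewrite N4_dil; apply Rmult_lt_0_compat; [now apply pow_lt | assumption]. }
assert (Hdd : forall s t p, s * t = 1 -> dil s (dil t p) = p).
{ intros s t [x y] Hst; unfold dil; cbn [fst snd]; f_equal.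
  - transitivity (s * t * x); [ring | rewrite Hst; ring].
  - transitivity ((s * t) ^ 2 * y); [ring | rewrite Hst; ring]. }
assert (Cdil : forall (s : R * R -> R) p, continuous s p ->
  continuous (fun q => dil (s q) q) p).
{ intros s p Cs; unfold dil; apply continuous_pair_R; cont2. }
split.
- intros p [H1 H2]; unfold outside; apply filter_and.
  + now apply (continuous_Rlt N4 p 0 (continuous_N4 p)).
  + generalize (continuous_Rlt (fun q => dirv v q - radu q) p 0
      (continuous_Rminus _ _ _ (Cd p H1) (continuous_radu p H1)) ltac:(lra)).
    apply filter_imp; intros q Hq; lra.
(* A dilation by s divides u by s and keeps the angle. With t = u / v these maps are t -> t / (1 +
   t) and t -> t / (1 - t), inverse bijections between (0, oo) and (0, 1). *)
- exists (fun p => dil (1 + radu p / dirv v p) p), (fun p => dil (1 - radu p / dirv v p) p).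
  split.
  + intros p Hp; apply N4_pos in Hp; assert (Hr := radu_pos p Hp); assert (Hd := Hd0 p).
    assert (Hs : 0 < 1 + radu p / dirv v p).
    { assert (0 < radu p / dirv v p) by now apply Rdiv_lt_0_compat. lra. }
    assert (Er : radu (dil (1 + radu p / dirv v p) p) / dirv v p =
      radu p / (dirv v p + radu p)).
    { rewrite radu_dil by assumption; field; lra. }
    split; [| split].
    * split; [now apply HNdil |]; rewrite Hdil by assumption.
      apply (Rmult_lt_reg_r (/ dirv v p)); [now apply Rinv_0_lt_compat |].
      rewrite Rinv_r by lra; unfold Rdiv in Er at 1; rewrite Er.
      apply Rlt_div_l; lra.
    * rewrite Hdil, Er by assumption; apply Hdd; field; lra.
    * apply (Cdil (fun q => 1 + radu q / dirv v q)).
      apply (continuous_Rplus (fun _ => 1)); [apply continuous_const |].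
      apply continuous_Rmult; [now apply continuous_radu |].
      apply continuous_Rinv; [lra | now apply Cd].
  + intros p [Hp Hlt]; assert (Hr := radu_pos p Hp); assert (Hd := Hd0 p).
    assert (Hs : 0 < 1 - radu p / dirv v p).
    { assert (radu p / dirv v p < 1) by (apply Rlt_div_l; lra). lra. }
    assert (Er : radu (dil (1 - radu p / dirv v p) p) / dirv v p =
      radu p / (dirv v p - radu p)).
    { rewrite radu_dil by assumption; field; lra. }
    split; [| split].
    * intros E; assert (HN := HNdil _ _ Hs Hp); rewrite E in HN.
      unfold N4 in HN; cbn [fst snd] in HN; lra.
    * rewrite Hdil, Er by assumption; apply Hdd; field; lra.
    * apply (Cdil (fun q => 1 - radu q / dirv v q)).
      apply (continuous_Rminus (fun _ => 1)); [apply continuous_const |].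
      apply continuous_Rmult; [now apply continuous_radu |].
      apply continuous_Rinv; [lra | now apply Cd].
Qed.

Lemma outside_pt (v : R -> R) (phi u : R) : (forall x, v (x + 2 * PI) = v x) -> 0 < u ->
  (outside v (pt phi u) <-> u < v phi).
Proof.
intros Hv Hu; unfold outside.
assert (HN : N4 (pt phi u) = / u ^ 4) by (apply N4_pt; lra).
assert (HN0 : 0 < N4 (pt phi u))
  by (rewrite HN; apply Rinv_0_lt_compat, pow_lt, Hu).
destruct (unit_pt phi u Hu) as [Hc Hs].
rewrite (radu_unique _ u) by (congruence || assumption).
rewrite (dirv_angle v _ phi) by assumption; tauto.
Qed.

(** The boundary is the closed leaf with initial value U. Every point beyond it lies on a closed
    leaf with an initial value a < U, and that leaf stays beyond the boundary. *)
Lemma outside_period_annulus (U L e : R) (k : coeffs) : 0 < U -> 0 <= L -> regular U k L e ->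
  center k -> exists v, (forall x, U / 2 <= v x <= 2 * U) /\
    period_annulus (omega k e) (outside v).
Proof.
intros HU HL Hr Hc; assert (HP := PI_RGT_0); assert (HP4 := PI_4).
destruct (periodic_of_Rser U L e U k Hr ltac:(lra) (center_fixed U L e U k Hr Hc ltac:(lra)))
  as (v & Pv & v0 & Ev & Bv).
assert (HvU : forall x, U / 2 <= v x <= 2 * U).
{ intros x; split; [| apply Bv]; destruct (angle_reduce x) as (n & y & -> & Hy).
  rewrite (periodic_IZR v (proj1 (proj2 Pv))), Ev by lra.
  assert (D : in_dom U y U) by (split; rewrite Rabs_pos_eq; lra).
  generalize (Eser_bounds _ _ _ _ _ _ Hr D); nra. }
exists v; split; [exact HvU |].
assert (Cv : forall x, continuous v x)
  by (intros x; apply (continuous_of_derive v _ x (proj1 Pv))).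
destruct Pv as (Dv & Hv & Hv0).
split; [now apply outside_annulus |]; intros p [Hp Hlt].
destruct (polar_coordinates p Hp) as [_ Hpol].
destruct (ang_spec p Hp) as [Hca Hsa].
assert (Ep := Hpol _ Hca Hsa).
set (phi1 := ang (ucos p) (usin p)) in *.
set (u1 := / (sqrt (lam2 p) * quart phi1)) in *.
assert (Hu1 : 0 < u1).
{ apply Rinv_0_lt_compat, Rmult_lt_0_compat.
  - apply sqrt_lt_R0; now apply lam2_pos.
  - generalize (quart_ge_1 phi1); lra. }
assert (Hu1v : u1 < v phi1).
{ apply (outside_pt v); [assumption | assumption | rewrite <- Ep; now split]. }
destruct (angle_reduce phi1) as (n & x & Ex & Hx).
rewrite Ex in Ep, Hu1v.
rewrite (periodic_IZR (fun y => pt y u1) (fun y => pt_periodic y u1)) in Ep.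
rewrite (periodic_IZR v Hv), Ev in Hu1v by lra.
assert (Dx : forall y a, 0 <= y <= 2 * PI -> 0 <= a <= U -> in_dom U y a).
{ intros y a Hy Ha; split; rewrite Rabs_pos_eq; lra. }
(* At the angle of the point, a E sweeps from 0, that is from infinity, up to the boundary as a runs
   from 0 to U. *)
destruct (IVT_lipschitz (fun a => a * Eser k x a e) 0 U u1 (3 / 2 + U * (L * Rabs e)))
  as (a & Ha & Ea).
{ lra. }
{ apply Rplus_le_le_0_compat; [lra |]; repeat apply Rmult_le_pos; try lra; apply Rabs_pos. }
{ intros s t Hs Ht.
  replace (s * Eser k x s e - t * Eser k x t e) with
    (Eser k x s e * (s - t) + t * (Eser k x s e - Eser k x t e)) by ring.
  eapply Rle_trans; [apply Rabs_triang |]; rewrite Rmult_plus_distr_r.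
  apply Rplus_le_compat.
  - rewrite Rabs_mult; apply Rmult_le_compat_r; [apply Rabs_pos |].
    generalize (Eser_bounds _ _ _ _ _ _ Hr (Dx x s ltac:(lra) Hs)); intros.
    rewrite Rabs_pos_eq; lra.
  - rewrite Rmult_assoc; apply Rabs_mult_le; [rewrite Rabs_pos_eq; lra |].
    eapply Rle_trans; [apply (reg_lip _ _ _ _ Hr); apply Dx; lra |].
    rewrite Rminus_diag, Rabs_R0, Rplus_0_l; lra. }
{ split; [eapply Rle_trans; [apply Rmin_l |] | eapply Rle_trans; [| apply Rmax_r]]; lra. }
assert (Ha0 : 0 < a).
{ destruct Ha as [[Ha | <-] _]; [assumption |]; exfalso; lra. }
assert (HaU : a < U).
{ destruct Ha as [_ [Ha | ->]]; [assumption |]; exfalso; lra. }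
destruct (periodic_of_Rser U L e a k Hr ltac:(lra) (center_fixed U L e a k Hr Hc ltac:(lra)))
  as (w & Pw & w0 & Ew & Bw).
exists (leaf w); split; [now apply (closed_leaf_of_polar U L e) |]; split.
- exists x; rewrite Ew, Ea by lra; now symmetry.
- intros q [phi <-]; apply outside_pt; [assumption | apply Pw |].
  destruct (angle_reduce phi) as (m & y & -> & Hy).
  rewrite (periodic_IZR w (proj1 (proj2 Pw))), (periodic_IZR v Hv), Ew, Ev by lra.
  assert (H1 := Eser_bounds _ _ _ _ _ _ Hr (Dx y U ltac:(lra) ltac:(lra))).
  assert (H2 := reg_lip _ _ _ _ Hr y U y a (Dx y U ltac:(lra) ltac:(lra))
    (Dx y a ltac:(lra) ltac:(lra))).
  rewrite Rminus_diag, Rabs_R0, Rplus_0_l, (Rabs_pos_eq (U - a)) in H2 by lra.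
  apply Rabs_le_between in H2.
  assert (H3 := reg_small' _ _ _ _ Hr).
  assert (H4 : a * (L * Rabs e * (U - a)) <= / 4 * (U - a)).
  { assert (0 <= L * Rabs e) by (apply Rmult_le_pos; [| apply Rabs_pos]; assumption). nra. }
  assert (0 < U - a) by lra.
  (* The leaves keep their order: a E(a) <= a E(U) + (U - a) / 4, which is less than U E(U) because
     E(U) >= 1/2. *)
  assert (H5 : a * Eser k y a e <= a * Eser k y U e + a * (L * Rabs e * (U - a))) by nra.
  nra.
Qed.

Lemma period_annulus_ext (w : one_form) (A B : R * R -> Prop) : (forall p, A p <-> B p) ->
  period_annulus w A -> period_annulus w B.
Proof.
intros E [[HO (f & g & Hf & Hg)] HL]; split; [split |].
- intros p Hp; apply E, HO in Hp; revert Hp; apply filter_imp; intros q; apply E.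
- exists f, g; split.
  + intros p Hp; destruct (Hf p Hp) as (H1 & H2 & H3); repeat split; auto; now apply E.
  + intros p Hp; apply Hg; now apply E.
- intros p Hp; apply E in Hp; destruct (HL p Hp) as (Lf & H1 & H2 & H3).
  exists Lf; repeat split; auto; intros q Hq; apply E; auto.
Qed.

Lemma center_period_annulus (k : coeffs) (W : R * R -> Prop) : center k ->
  locally (0, 0) W -> exists e0, 0 < e0 /\ forall e, 0 < e < e0 ->
    exists Z : R * R -> Prop, locally (0, 0) Z /\ subset Z W /\
      period_annulus (omega k e) (fun p => ~ Z p).
Proof.
intros Hc [d Hd].
set (m := Rmin d 1); assert (Hm : 0 < m) by (apply Rmin_pos; [apply cond_pos | lra]).
assert (Hm1 : m <= 1) by apply Rmin_r; assert (Hmd : m <= d) by apply Rmin_l.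
(* The boundary leaf satisfies u >= U / 2 = 2 / m, so the excluded region is contained in [N4] <= (m
   / 2)^4, hence in the given neighbourhood since m <= 1. *)
set (U := 4 / m); assert (HU : 0 < U) by (apply Rdiv_lt_0_compat; lra).
destruct (polar_flow U k HU) as (e0 & L & He0 & HL & _ & Hreg).
exists e0; split; [assumption |]; intros e He.
assert (Hr := Hreg e ltac:(rewrite Rabs_pos_eq; lra)).
destruct (outside_period_annulus U L e k HU HL Hr Hc) as (v & Hv & Hann).
exists (fun p => ~ outside v p); split; [| split].
- assert (H4 : 0 < / (2 * U) ^ 4) by (apply Rinv_0_lt_compat, pow_lt; lra).
  assert (HN0 : N4 (0, 0) = 0) by (unfold N4; simpl; ring).
  generalize (continuous_Rlt (fun q => - N4 q) (0, 0) (- / (2 * U) ^ 4)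
    (continuous_Ropp _ _ (continuous_N4 (0, 0))) ltac:(change (- / (2 * U) ^ 4 < - N4 (0, 0)); rewrite HN0; lra)).
  apply filter_imp; intros q Hq [HNq Hlt].
  assert (Hrq := radu_pos q HNq).
  assert (Hdq := Hv (ang (ucos q) (usin q))); fold (dirv v q) in Hdq.
  rewrite <- (radu_4 q HNq) in Hq.
  assert (2 * U < radu q) by (apply inv_pow4_lt; lra); lra.
- intros [x y] Hq; apply Hd.
  assert (HN : N4 (x, y) <= (m / 2) ^ 4).
  { apply Rnot_lt_le; intros Hlt; apply Hq.
    assert (Hm4 : 0 < (m / 2) ^ 4) by (apply pow_lt; lra).
    split; [lra |].
    assert (Hdq := Hv (ang (ucos (x, y)) (usin (x, y)))); fold (dirv v (x, y)) in Hdq.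
    apply Rlt_le_trans with (U / 2); [| lra].
    apply inv_pow4_lt; [lra | apply radu_pos; lra |].
    rewrite radu_4 by lra.
    replace (/ (U / 2) ^ 4) with ((m / 2) ^ 4); [assumption |].
    unfold U; field; lra. }
  unfold N4 in HN; cbn [fst snd] in HN.
  assert (Hx4 : 0 <= x ^ 4)
    by (replace (x ^ 4) with ((x ^ 2) ^ 2) by ring; apply pow2_ge_0).
  assert (Hx : Rabs x <= m / 2).
  { apply pow4_le_reg; [lra |]; rewrite RPow_abs, Rabs_pos_eq by assumption.
    generalize (pow2_ge_0 y); lra. }
  assert (Hy : Rabs y <= m / 2).
  { assert (H2 : y ^ 2 <= (m / 2) ^ 2).
    { assert (0 <= (m / 2) ^ 2 <= 1) by (split; nra).
      assert ((m / 2) ^ 4 <= (m / 2) ^ 2).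
      { replace ((m / 2) ^ 4) with ((m / 2) ^ 2 * (m / 2) ^ 2) by ring; nra. }
      generalize (pow2_ge_0 y); lra. }
    apply Rabs_le; split; nra. }
  split; simpl.
  + change (Rabs (x - 0) < d); rewrite Rminus_0_r; lra.
  + change (Rabs (y - 0) < d); rewrite Rminus_0_r; lra.
- apply (period_annulus_ext _ (outside v)); [| assumption].
  intros p; split; [tauto | apply NNPP].
Qed.

(** * The algebraic set of centers *)

Fixpoint ev (l : list R) (t : R) : R :=
  match l with nil => 0 | c :: l => c + t * ev l t end.

Lemma ev_plus (l m : list R) : exists s, forall t, ev s t = ev l t + ev m t.
Proof.
revert m; induction l as [| c l IH]; intros m; [exists m; intros; simpl; ring |].
destruct m as [| d m]; [exists (c :: l); intros; simpl; ring |].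
destruct (IH m) as [s Hs]; exists (c + d :: s); intros t; simpl; rewrite Hs; ring.
Qed.

Lemma ev_scal (c : R) (l : list R) : exists s, forall t, ev s t = c * ev l t.
Proof.
induction l as [| d l [s Hs]]; [exists nil; intros; simpl; ring |].
exists (c * d :: s); intros t; simpl; rewrite Hs; ring.
Qed.

Lemma ev_mult (l m : list R) : exists s, forall t, ev s t = ev l t * ev m t.
Proof.
induction l as [| c l [s Hs]]; [exists nil; intros; simpl; ring |].
destruct (ev_scal c m) as [s1 H1]; destruct (ev_plus s1 (0 :: s)) as [s2 H2].
exists s2; intros t; rewrite H2, H1; simpl; rewrite Hs; ring.
Qed.

(** A polynomial either vanishes identically or stays away from 0 for large arguments. This yields
    the absence of zero divisors without degrees or leading coefficients. *)
Lemma ev_eventually (l : list R) : (forall t, ev l t = 0) \/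
  exists T c, 0 < c /\ forall t, T <= t -> c <= Rabs (ev l t).
Proof.
induction l as [| d l [Hz | (T & c & Hc & H)]]; [left; reflexivity | |].
- destruct (Req_dec d 0) as [-> | Hd]; [left | right; exists 0, (Rabs d)].
  + intros t; simpl; rewrite Hz; ring.
  + split; [now apply Rabs_pos_lt |]; intros t _; simpl; rewrite Hz.
    rewrite Rmult_0_r, Rplus_0_r; lra.
(* Beyond this argument the term t * [ev l t] is at least |d| + 1 in absolute value, so adding d
   leaves at least 1. *)
- right; exists (Rmax T ((Rabs d + 1) / c)), 1; split; [lra |]; intros t Ht.
  assert (H1 : T <= t) by (eapply Rle_trans; [apply Rmax_l | exact Ht]).
  assert (H2 : (Rabs d + 1) / c <= t) by (eapply Rle_trans; [apply Rmax_r | exact Ht]).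
  assert (Hd := Rabs_pos d).
  assert (H3 : Rabs d + 1 <= t * c) by (apply Rle_div_l; lra).
  assert (Ht0 : 0 <= t).
  { apply Rle_trans with (2 := H2); apply Rdiv_le_0_compat; lra. }
  specialize (H t H1); simpl.
  assert (H4 : Rabs d + 1 <= Rabs (t * ev l t)).
  { rewrite Rabs_mult, (Rabs_pos_eq t) by lra; nra. }
  replace (t * ev l t) with (d + t * ev l t + - d) in H4 by ring.
  generalize (Rabs_triang (d + t * ev l t) (- d)); rewrite Rabs_Ropp; lra.
Qed.

Lemma ev_domain (l m : list R) : (forall t, ev l t * ev m t = 0) ->
  (forall t, ev l t = 0) \/ (forall t, ev m t = 0).
Proof.
intros H.
destruct (ev_eventually l) as [Hl | (T & c & Hc & Hl)]; [now left | right].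
destruct (ev_eventually m) as [Hm | (T' & c' & Hc' & Hm)]; [assumption | exfalso].
specialize (H (Rmax T T')); specialize (Hl _ (Rmax_l T T')); specialize (Hm _ (Rmax_r T T')).
apply Rmult_integral in H; destruct H as [H | H]; rewrite H, Rabs_R0 in *; lra.
Qed.

Definition line (p q : coeffs) (t : R) : coeffs :=
  Coeffs (c0 p + t * (c0 q - c0 p)) (c1 p + t * (c1 q - c1 p))
    (c2 p + t * (c2 q - c2 p)) (c3 p + t * (c3 q - c3 p))
    (c4 p + t * (c4 q - c4 p)) (c5 p + t * (c5 q - c5 p))
    (b0 p + t * (b0 q - b0 p)) (b1 p + t * (b1 q - b1 p))
    (b2 p + t * (b2 q - b2 p)) (b3 p + t * (b3 q - b3 p)).

Lemma line_0 (p q : coeffs) : line p q 0 = p.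
Proof. destruct p; unfold line; simpl; f_equal; ring. Qed.

Lemma line_1 (p q : coeffs) : line p q 1 = q.
Proof. destruct p, q; unfold line; simpl; f_equal; ring. Qed.

Lemma polynomial_line (f : coeffs -> R) (p q : coeffs) : polynomial coeff_coords f ->
  exists l, forall t, f (line p q t) = ev l t.
Proof.
induction 1 as [a | f Hf | f g _ [l Hl] _ [m Hm] | f g _ [l Hl] _ [m Hm]].
- exists (a :: nil); intros; simpl; ring.
- exists (f p :: f q - f p :: nil); intros t; simpl.
  unfold coeff_coords in Hf; simpl in Hf.
  repeat destruct Hf as [<- | Hf]; try (simpl; ring); easy.
- destruct (ev_plus l m) as [s Hs]; exists s; intros t; now rewrite Hl, Hm, Hs.
- destruct (ev_mult l m) as [s Hs]; exists s; intros t; now rewrite Hl, Hm, Hs.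
Qed.

Lemma not_in_algebraic_set {E : Type} (X : list (E -> R)) (Z : E -> Prop)
  (S : (E -> R) -> Prop) (p : E) : (forall p, Z p <-> forall f, S f -> f p = 0) -> ~ Z p ->
  exists f, S f /\ f p <> 0.
Proof.
intros HZ Hp; apply NNPP; intros Hn; apply Hp, HZ; intros f Hf.
apply NNPP; intros Hf0; apply Hn; now exists f.
Qed.

(* If neither algebraic set contains the subspace, some polynomial of each is
   nonzero at a point of it, and the product of the two does not vanish
   identically on the line through these points. *)
Lemma irreducible_subspace (Z : coeffs -> Prop) : algebraic_set coeff_coords Z ->
  (exists p, Z p) -> (forall p q t, Z p -> Z q -> Z (line p q t)) ->
  irreducible coeff_coords Z.
Proof.
intros HZ Hne Hline; split; [assumption |]; split; [assumption |].
intros Z1 Z2 (S1 & P1 & E1) (S2 & P2 & E2) HU.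
destruct (classic (forall p, Z p -> Z1 p)) as [H1 | H1].
{ left; intros p; split; [apply H1 | intros H; apply HU; now left]. }
destruct (classic (forall p, Z p -> Z2 p)) as [H2 | H2].
{ right; intros p; split; [apply H2 | intros H; apply HU; now right]. }
exfalso.
apply not_all_ex_not in H1; destruct H1 as [p Hp].
apply not_all_ex_not in H2; destruct H2 as [q Hq].
apply imply_to_and in Hp; destruct Hp as [Zp Np].
apply imply_to_and in Hq; destruct Hq as [Zq Nq].
destruct (not_in_algebraic_set coeff_coords Z1 S1 p E1 Np) as (f & Sf & Hf).
destruct (not_in_algebraic_set coeff_coords Z2 S2 q E2 Nq) as (g & Sg & Hg).
destruct (polynomial_line f p q (P1 f Sf)) as [l Hl].
destruct (polynomial_line g p q (P2 g Sg)) as [m Hm].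
destruct (ev_domain l m) as [H | H].
- intros t; rewrite <- Hl, <- Hm.
  destruct (proj1 (HU _) (Hline p q t Zp Zq)) as [H | H].
  + rewrite (proj1 (E1 _) H f Sf); ring.
  + rewrite (proj1 (E2 _) H g Sg); ring.
- apply Hf; rewrite <- (line_0 p q), Hl; apply H.
- apply Hg; rewrite <- (line_1 p q), Hm; apply H.
Qed.

(** * The three linear subspaces as irreducible components *)

Lemma algebraic_set_inter {E : Type} (X : list (E -> R)) (Z1 Z2 : E -> Prop) :
  algebraic_set X Z1 -> algebraic_set X Z2 -> algebraic_set X (fun p => Z1 p /\ Z2 p).
Proof.
intros (S1 & P1 & E1) (S2 & P2 & E2); exists (fun f => S1 f \/ S2 f); split.
- intros f [H | H]; auto.
- intros p; rewrite E1, E2; split; [intros [H1 H2] f [H | H]; auto | auto].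
Qed.

Lemma algebraic_set_zero {E : Type} (X : list (E -> R)) (f : E -> R) :
  polynomial X f -> algebraic_set X (fun p => f p = 0).
Proof.
intros Hf; exists (fun g => g = f); split; [intros g ->; assumption |].
intros p; split; [intros H g ->; assumption | auto].
Qed.

Lemma algebraic_set_ext {E : Type} (X : list (E -> R)) (Z Z' : E -> Prop) :
  set_eq Z Z' -> algebraic_set X Z -> algebraic_set X Z'.
Proof. intros H (S & P & HS); exists S; split; [assumption |]; intros p; now rewrite <- (H p). Qed.

Ltac poly_tac :=
  repeat match goal with
  | |- polynomial _ (fun k => @?f k + @?g k) => apply (poly_add _ f g)
  | |- polynomial _ (fun k => @?f k * @?g k) => apply (poly_mul _ f g)
  | |- polynomial _ (fun k => ?c) => apply poly_const
  | |- polynomial _ _ => apply poly_coord; simpl; tauto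
  end.

Lemma algebraic_comp1 : algebraic_set coeff_coords comp1.
Proof.
eapply algebraic_set_ext; [| apply algebraic_set_inter; apply algebraic_set_zero].
2: apply (poly_add _ c3 (fun k => -1 * b1 k)); poly_tac.
2: apply (poly_add _ c5 (fun k => -2 * b2 k)); poly_tac.
intros k; unfold comp1; simpl; split; intros [H1 H2]; split; lra.
Qed.

Lemma algebraic_comp2 : algebraic_set coeff_coords comp2.
Proof.
repeat apply algebraic_set_inter; apply algebraic_set_zero; apply poly_coord; simpl; tauto.
Qed.

Lemma algebraic_comp3 : algebraic_set coeff_coords comp3.
Proof.
eapply algebraic_set_ext; [| apply algebraic_set_inter;
  [apply algebraic_set_zero | apply algebraic_set_inter; [apply algebraic_set_zero |
   apply algebraic_set_inter; [apply algebraic_set_zero | apply algebraic_set_inter;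
   apply algebraic_set_zero]]]].
2: apply (poly_add _ b1 (fun k => -1 * c3 k)); poly_tac.
2: apply (poly_coord _ c0); simpl; tauto.
2: apply (poly_coord _ c2); simpl; tauto.
2: apply (poly_coord _ b0); simpl; tauto.
2: apply (poly_add _ c5 b2); poly_tac.
intros k; unfold comp3; simpl; split; intros (H1 & H2 & H3 & H4 & H5); repeat split; lra.
Qed.

Lemma algebraic_center : algebraic_set coeff_coords center.
Proof.
eapply algebraic_set_ext; [| apply algebraic_set_inter;
  [apply algebraic_set_zero | apply algebraic_set_inter; [apply algebraic_set_zero |
   apply algebraic_set_inter; [apply algebraic_set_zero | apply algebraic_set_inter;
   apply algebraic_set_zero]]]].
2: apply (poly_add _ b1 (fun k => -1 * c3 k)); poly_tac.
2: apply (poly_mul _ (fun k => c5 k + -2 * b2 k) c0); poly_tac.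
2: apply (poly_mul _ (fun k => c5 k + -2 * b2 k) c2); poly_tac.
2: apply (poly_mul _ (fun k => c5 k + -2 * b2 k) (fun k => c3 k * b0 k)); poly_tac.
2: apply (poly_mul _ (fun k => c5 k + -2 * b2 k) (fun k => c3 k * (b2 k + c5 k))); poly_tac.
intros k; unfold center, dd; simpl.
replace (c5 k + -2 * b2 k) with (c5 k - 2 * b2 k) by ring.
split; intros (H1 & H2 & H3 & H4 & H5); repeat split; auto; lra.
Qed.

Lemma irreducible_comp1 : irreducible coeff_coords comp1.
Proof.
apply irreducible_subspace.
- exact algebraic_comp1.
- exists (Coeffs 0 0 0 0 0 0 0 0 0 0); unfold comp1; simpl; split; ring.
- unfold comp1; intros p q t (H1 & H2) (G1 & G2); simpl; split; nra.
Qed.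

Lemma irreducible_comp2 : irreducible coeff_coords comp2.
Proof.
apply irreducible_subspace.
- exact algebraic_comp2.
- exists (Coeffs 0 0 0 0 0 0 0 0 0 0); unfold comp2; simpl; auto.
- unfold comp2; intros p q t (H1 & H2 & H3 & H4) (G1 & G2 & G3 & G4); simpl.
  rewrite H1, H2, H3, H4, G1, G2, G3, G4; repeat split; ring.
Qed.

Lemma irreducible_comp3 : irreducible coeff_coords comp3.
Proof.
apply irreducible_subspace.
- exact algebraic_comp3.
- exists (Coeffs 0 0 0 0 0 0 0 0 0 0); unfold comp3; simpl; repeat split; ring.
- unfold comp3; intros p q t (H1 & H2 & H3 & H4 & H5) (G1 & G2 & G3 & G4 & G5); simpl.
  rewrite H2, H3, H4, G2, G3, G4; repeat split; nra.
Qed.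

Lemma irreducible_union {E : Type} (X : list (E -> R)) (Z A B : E -> Prop) :
  irreducible X Z -> algebraic_set X A -> algebraic_set X B ->
  (forall p, Z p -> A p \/ B p) -> subset Z A \/ subset Z B.
Proof.
intros (HZ & _ & Hirr) HA HB H.
destruct (Hirr (fun p => Z p /\ A p) (fun p => Z p /\ B p)) as [H1 | H1].
- now apply algebraic_set_inter.
- now apply algebraic_set_inter.
- intros p; split; [intros Hp; destruct (H p Hp); auto | intros [[Hp _] | [Hp _]]; auto].
- left; intros p Hp; now apply H1.
- right; intros p Hp; now apply H1.
Qed.

Lemma algebraic_set_union {E : Type} (X : list (E -> R)) (Z1 Z2 : E -> Prop) :
  algebraic_set X Z1 -> algebraic_set X Z2 -> algebraic_set X (fun p => Z1 p \/ Z2 p).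
Proof.
intros (S1 & P1 & E1) (S2 & P2 & E2).
exists (fun h => exists f g, S1 f /\ S2 g /\ h = (fun p => f p * g p)); split.
- intros h (f & g & Hf & Hg & ->); apply poly_mul; auto.
- intros p; split.
  + intros [H | H] h (f & g & Hf & Hg & ->).
    * rewrite (proj1 (E1 p) H f Hf); ring.
    * rewrite (proj1 (E2 p) H g Hg); ring.
  + intros H; apply NNPP; intros Hn; apply not_or_and in Hn; destruct Hn as [N1 N2].
    destruct (not_in_algebraic_set X Z1 S1 p E1 N1) as (f & Sf & Hf).
    destruct (not_in_algebraic_set X Z2 S2 p E2 N2) as (g & Sg & Hg).
    assert (Hfg := H _ (ex_intro _ f (ex_intro _ g (conj Sf (conj Sg eq_refl))))).
    apply Rmult_integral in Hfg; tauto.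
Qed.

Lemma irreducible_in_center (Z : coeffs -> Prop) : irreducible coeff_coords Z ->
  subset Z center -> subset Z comp1 \/ subset Z comp2 \/ subset Z comp3.
Proof.
intros HZ HV.
destruct (irreducible_union coeff_coords Z comp1 (fun k => comp2 k \/ comp3 k)) as [H | H];
  auto using algebraic_comp1, algebraic_comp2, algebraic_comp3, algebraic_set_union.
- intros k Hk; now apply center_components, HV.
- right; apply (irreducible_union coeff_coords);
    auto using algebraic_comp2, algebraic_comp3.
Qed.

Lemma comp_not_subset :
  ~ subset comp1 comp2 /\ ~ subset comp1 comp3 /\ ~ subset comp2 comp1 /\
  ~ subset comp2 comp3 /\ ~ subset comp3 comp1 /\ ~ subset comp3 comp2.
Proof.
repeat split; intros H.
- specialize (H (Coeffs 1 0 0 0 0 0 0 0 0 0)); unfold comp1, comp2 in H; simpl in H; lra.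
- specialize (H (Coeffs 1 0 0 0 0 0 0 0 0 0)); unfold comp1, comp3 in H; simpl in H; lra.
- specialize (H (Coeffs 0 0 0 0 0 1 0 0 0 0)); unfold comp1, comp2 in H; simpl in H; lra.
- specialize (H (Coeffs 0 0 0 0 0 0 1 0 0 0)); unfold comp2, comp3 in H; simpl in H; lra.
- specialize (H (Coeffs 0 0 0 0 0 1 0 0 (-1) 0)); unfold comp1, comp3 in H; simpl in H; lra.
- specialize (H (Coeffs 0 0 0 1 0 0 0 1 0 0)); unfold comp2, comp3 in H; simpl in H; lra.
Qed.

(** An irreducible subset of the center set lies in one of the three subspaces. As none of these
    contains another, each of them is maximal and there are no others. *)
Lemma irreducible_components (V Z : coeffs -> Prop) : set_eq V center ->
  (irreducible_component coeff_coords V Z <->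
   set_eq Z comp1 \/ set_eq Z comp2 \/ set_eq Z comp3).
Proof.
intros HV; destruct comp_not_subset as (N12 & N13 & N21 & N23 & N31 & N32).
assert (Hsub : forall k, comp1 k \/ comp2 k \/ comp3 k -> V k)
  by (intros k Hk; now apply HV, center_components).
assert (Hin : forall Z', irreducible coeff_coords Z' -> subset Z' V ->
  subset Z' comp1 \/ subset Z' comp2 \/ subset Z' comp3).
{ intros Z' Hi Hs; apply irreducible_in_center; [assumption |].
  intros k Hk; now apply HV, Hs. }
split.
- intros (Hi & Hs & Hmax).
  destruct (Hin Z Hi Hs) as [H | [H | H]]; [left | right; left | right; right];
    intros k; (split; [apply H | intros Hk]).
  + apply (Hmax comp1 irreducible_comp1 H); [intros k' Hk'; auto | assumption].
  + apply (Hmax comp2 irreducible_comp2 H); [intros k' Hk'; auto | assumption].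
  + apply (Hmax comp3 irreducible_comp3 H); [intros k' Hk'; auto | assumption].
- assert (Hcomp : forall C, irreducible coeff_coords C -> subset C V -> set_eq Z C ->
    (forall Z', irreducible coeff_coords Z' -> subset C Z' -> subset Z' V ->
       subset Z' C) -> irreducible_component coeff_coords V Z).
  { intros C (HC1 & [p Hp] & HC3) HCV HZ Hmax; split; [split; [| split] | split].
    - apply (algebraic_set_ext _ C); [| assumption]; intros k; now rewrite (HZ k).
    - exists p; now apply HZ.
    - intros Z1 Z2 A1 A2 HU; destruct (HC3 Z1 Z2 A1 A2) as [H | H].
      + intros k; rewrite <- (HZ k); apply HU.
      + left; intros k; now rewrite (HZ k).
      + right; intros k; now rewrite (HZ k).
    - intros k Hk; now apply HCV, HZ.
    - intros Z' Hi' HZZ' HZ'V k; split; [intros Hk; apply HZ | apply HZZ'].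
      apply (Hmax Z'); auto; intros k' Hk'; now apply HZZ', HZ. }
  assert (Htr : forall C Z' C' : coeffs -> Prop, subset C Z' -> subset Z' C' -> subset C C')
    by (intros C Z' C' H1 H2 k Hk; auto).
  intros [H | [H | H]].
  + apply (Hcomp comp1 irreducible_comp1); auto; [intros k Hk; auto |].
    intros Z' Hi' H1 H2; destruct (Hin Z' Hi' H2) as [G | [G | G]]; auto; exfalso; eauto.
  + apply (Hcomp comp2 irreducible_comp2); auto; [intros k Hk; auto |].
    intros Z' Hi' H1 H2; destruct (Hin Z' Hi' H2) as [G | [G | G]]; auto; exfalso; eauto.
  + apply (Hcomp comp3 irreducible_comp3); auto; [intros k Hk; auto |].
    intros Z' Hi' H1 H2; destruct (Hin Z' Hi' H2) as [G | [G | G]]; auto; exfalso; eauto.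
Qed.

(** * The foliation on the components *)

Lemma comp1_exact (k : coeffs) (e : R) : comp1 k -> exact (omega k e).
Proof.
intros [H1 H2].
exists (fun x y => / 4 * x ^ 4 + / 2 * y ^ 2 + e * (c0 k * x + c1 k / 2 * x ^ 2 +
  c2 k / 3 * x ^ 3 + c4 k / 4 * x ^ 4 + c3 k * x * y + b2 k * x ^ 2 * y +
  b0 k * y + b3 k / 2 * y ^ 2)).
intros [x y]; apply filterdiff_differentiable_pt_lim.
apply (filterdiff_ext_lin _ (fun u : R * R =>
  plus (scal (fst u) (fst (omega k e (x, y)))) (scal (snd u) (snd (omega k e (x, y))))));
  [| reflexivity].
apply (is_derive_filterdiff (fun x y => / 4 * x ^ 4 + / 2 * y ^ 2 + e * (c0 k * x +
  c1 k / 2 * x ^ 2 + c2 k / 3 * x ^ 3 + c4 k / 4 * x ^ 4 + c3 k * x * y +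
  b2 k * x ^ 2 * y + b0 k * y + b3 k / 2 * y ^ 2)) x y (fun x y => fst (omega k e (x, y)))).
- apply filter_forall; intros [s t]; cbn [fst snd]; auto_derive; [exact I |].
  unfold omega, omega1, dHam; cbn [fst snd].
  replace (c5 k) with (2 * b2 k) by lra; field.
- auto_derive; [exact I |]; unfold omega, omega1, dHam; cbn [fst snd].
  replace (b1 k) with (c3 k) by lra; field.
- unfold omega, omega1, dHam; cbn [fst snd]; cont2.
Qed.

(** The Lienard variable [lz] as a function on the plane, with the square written as a product so
    that it matches the constructors of [polynomial]. *)
Definition zchart (k : coeffs) (e : R) (p : R * R) : R :=
  (1 + e * b3 k) * snd p + e * (b0 k + b1 k * fst p + b2 k * (fst p * fst p)).

Lemma dz_dx_zchart (k : coeffs) (e : R) (p : R * R) :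
  dz_dx (zchart k e) p = e * (b1 k + 2 * b2 k * fst p).
Proof.
unfold dz_dx, zchart; cbn [fst snd]; apply is_derive_unique; auto_derive; [exact I | ring].
Qed.

Lemma dz_dy_zchart (k : coeffs) (e : R) (p : R * R) :
  dz_dy (zchart k e) p = 1 + e * b3 k.
Proof.
unfold dz_dy, zchart; cbn [fst snd]; apply is_derive_unique; auto_derive; [exact I | ring].
Qed.

(** In the coordinates (x, z) the form is, up to the factor 1 + e b3, equal to z dz + (g1 x + g3 x^3
    + mu x z) dx. The coefficient of dx is odd in x, so the form is invariant under the
    reflection. *)
Lemma pairing_zchart (k : coeffs) (e : R) (p v : R * R) : b1 k = c3 k ->
  gg0 k e = 0 -> gg2 k e = 0 ->
  (1 + e * b3 k) * pairing (omega k e p) v =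
    zchart k e p * snd (dchart (zchart k e) p v) +
    (gg1 k e * fst p + gg3 k e * fst p ^ 3 + lmu k e * fst p * zchart k e p) * fst v.
Proof.
intros Hb H0 H2; unfold dchart; rewrite dz_dx_zchart, dz_dy_zchart; cbn [fst snd].
transitivity (zchart k e p * (e * (b1 k + 2 * b2 k * fst p) * fst v + (1 + e * b3 k) * snd v) +
    (gg0 k e + gg1 k e * fst p + gg2 k e * fst p ^ 2 + gg3 k e * fst p ^ 3 +
     lmu k e * fst p * zchart k e p) * fst v); [| rewrite H0, H2; ring].
unfold pairing, omega, omega1, dHam, zchart, gg0, gg1, gg2, gg3, lmu; cbn [fst snd].
rewrite Hb; ring.
Qed.

Lemma comp23_pulled_back (k : coeffs) : comp2 k \/ comp3 k ->
  exists e0, 0 < e0 /\ forall e, 0 < e < e0 -> pulled_back_to_symmetric (omega k e).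
Proof.
intros Hk; assert (Hb3 := Rabs_pos (b3 k)).
(* Below this bound 1 + e b3 is positive, so the chart is invertible. *)
exists (/ (Rabs (b3 k) + 1)); split; [apply Rinv_0_lt_compat; lra |]; intros e [He1 He2].
assert (He3 : e * (Rabs (b3 k) + 1) < 1).
{ apply (Rmult_lt_reg_r (/ (Rabs (b3 k) + 1))); [apply Rinv_0_lt_compat; lra |].
  rewrite Rmult_assoc, Rinv_r by lra; lra. }
assert (Hpos : 0 < 1 + e * b3 k).
{ assert (B : - Rabs (b3 k) <= b3 k <= Rabs (b3 k)) by (apply Rabs_le_between; lra). nra. }
assert (Hg : b1 k = c3 k /\ gg0 k e = 0 /\ gg2 k e = 0).
{ unfold gg0, gg2; destruct Hk as [(H0 & H2 & H3 & H1) | (H1 & H0 & H2 & H3 & H5)].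
  - rewrite H0, H1, H2, H3; repeat split; ring.
  - replace (b1 k) with (c3 k) by lra; rewrite H0, H2, H3.
    replace (c5 k) with (- b2 k) by lra; repeat split; ring. }
destruct Hg as (Hb & H0 & H2).
exists (zchart k e); split; [| split; [split |]].
- unfold zchart.
  apply (poly_add _ (fun p : R * R => (1 + e * b3 k) * snd p)
    (fun p : R * R => e * (b0 k + b1 k * fst p + b2 k * (fst p * fst p)))).
  + apply (poly_mul _ (fun _ : R * R => 1 + e * b3 k) snd); [apply poly_const |].
    apply poly_coord; simpl; auto.
  + apply (poly_mul _ (fun _ : R * R => e)); [apply poly_const |].
    apply (poly_add _ (fun p : R * R => b0 k + b1 k * fst p)
      (fun p : R * R => b2 k * (fst p * fst p))).
    * apply (poly_add _ (fun _ : R * R => b0 k) (fun p : R * R => b1 k * fst p));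
        [apply poly_const |].
      apply (poly_mul _ (fun _ : R * R => b1 k) fst); [apply poly_const |].
      apply poly_coord; simpl; auto.
    * apply (poly_mul _ (fun _ : R * R => b2 k)); [apply poly_const |].
      apply (poly_mul _ fst fst); apply poly_coord; simpl; auto.
- intros [x z].
  exists (x, (z - e * (b0 k + b1 k * x + b2 k * (x * x))) / (1 + e * b3 k)); split.
  + unfold chart, zchart; cbn [fst snd]; f_equal; field; lra.
  + intros [x' y'] E; unfold chart, zchart in E; cbn [fst snd] in E.
    injection E; intros Ez Ex; subst x'; f_equal; rewrite <- Ez; field; lra.
- intros p; rewrite dz_dy_zchart; lra.
- intros p q v u Eq Eu.
  assert (Ex : fst q = - fst p) by exact (f_equal fst Eq).
  assert (Ez : zchart k e q = zchart k e p) by exact (f_equal snd Eq).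
  assert (Ev : fst u = - fst v) by exact (f_equal fst Eu).
  assert (Ed : snd (dchart (zchart k e) q u) = snd (dchart (zchart k e) p v))
    by exact (f_equal snd Eu).
  assert (E : (1 + e * b3 k) * pairing (omega k e q) u =
    (1 + e * b3 k) * pairing (omega k e p) v).
  { rewrite !pairing_zchart by assumption; rewrite Ex, Ez, Ev, Ed; ring. }
  apply Rmult_eq_reg_l in E; [| lra]; rewrite E; tauto.
Qed.

Theorem theorem5p1 :
  bifurcating_limit_cycles 1 /\
  exists M : coeffs -> nat -> R -> R,
    (forall k : coeffs, melnikov k (M k)) /\
    (* 1 *)
    (forall k : coeffs,
       ~ vanishes (M k 1%nat) -> forall h, 0 < h -> M k 1%nat h <> 0) /\
    (* 2: at most one positive zero, and the zero does occur *)
    (forall k : coeffs,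
       vanishes (M k 1%nat) -> ~ vanishes (M k 2%nat) ->
       forall h h', 0 < h -> 0 < h' ->
         M k 2%nat h = 0 -> M k 2%nat h' = 0 -> h = h') /\
    (exists k : coeffs,
       vanishes (M k 1%nat) /\ ~ vanishes (M k 2%nat) /\
       exists h, 0 < h /\ M k 2%nat h = 0) /\
    (* 3: at most one positive zero, and the zero does occur *)
    (forall k : coeffs,
       vanishes (M k 1%nat) -> vanishes (M k 2%nat) -> ~ vanishes (M k 3%nat) ->
       forall h h', 0 < h -> 0 < h' ->
         M k 3%nat h = 0 -> M k 3%nat h' = 0 -> h = h') /\
    (exists k : coeffs,
       vanishes (M k 1%nat) /\ vanishes (M k 2%nat) /\ ~ vanishes (M k 3%nat) /\
       exists h, 0 < h /\ M k 3%nat h = 0) /\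
    (* 4 *)
    (forall k : coeffs,
       vanishes (M k 1%nat) -> vanishes (M k 2%nat) -> vanishes (M k 3%nat) ->
       forall i : nat, (4 <= i)%nat -> vanishes (M k i)) /\
    (* period annulus outside a small neighbourhood of the origin *)
    (forall k : coeffs,
       vanishes (M k 1%nat) -> vanishes (M k 2%nat) -> vanishes (M k 3%nat) ->
       forall W : R * R -> Prop, locally (0, 0) W ->
       exists e0, 0 < e0 /\
         forall e, 0 < e < e0 ->
         exists U : R * R -> Prop,
           locally (0, 0) U /\ subset U W /\
           period_annulus (omega k e) (fun p => ~ U p)) /\
    (* irreducible components *)
    (let V := fun k : coeffs =>
       vanishes (M k 1%nat) /\ vanishes (M k 2%nat) /\ vanishes (M k 3%nat) in
     algebraic_set coeff_coords V /\
     (forall Z : coeffs -> Prop,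
        irreducible_component coeff_coords V Z <->
        set_eq Z comp1 \/ set_eq Z comp2 \/ set_eq Z comp3) /\
     ~ set_eq comp1 comp2 /\ ~ set_eq comp1 comp3 /\ ~ set_eq comp2 comp3) /\
    (forall k : coeffs, comp1 k -> forall e, exact (omega k e)) /\
    (forall k : coeffs, comp2 k \/ comp3 k ->
       exists e0, 0 < e0 /\
         forall e, 0 < e < e0 -> pulled_back_to_symmetric (omega k e)).
Proof.
split; [exact bifurcating_limit_cycles_1 |].
assert (Hcenter : forall k, vanishes (melnikov_fun k 1) -> vanishes (melnikov_fun k 2) ->
  vanishes (melnikov_fun k 3) -> center k)
  by (intros; apply melnikov_123_vanish; auto).
exists melnikov_fun; split; [exact melnikov_fun_correct |].
split; [| split; [| split; [| split; [| split; [| split; [| split; [| split; [| split]]]]]]]].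
- intros k Hk h Hh; rewrite melnikov_1 by assumption.
  apply Rmult_integral_contrapositive; split; [| generalize I1_pos; lra].
  intros E; apply Hk, melnikov_1_vanishes; lra.
- intros k H1 H2 h h' Hh Hh' E E'; apply melnikov_1_vanishes in H1.
  rewrite melnikov_2 in E, E' by assumption.
  assert (F := factor_pos h Hh); assert (F' := factor_pos h' Hh').
  apply (even_quadratic_root (dd k * c0 k) (dd k * c2 k)); auto.
  + intros H; now apply H2, melnikov_2_vanishes.
  + apply (Rmult_eq_reg_l (sqrt 2 / (2 * h ^ 2))); [| lra].
    rewrite Rmult_0_r, <- E; ring.
  + apply (Rmult_eq_reg_l (sqrt 2 / (2 * h' ^ 2))); [| lra].
    rewrite Rmult_0_r, <- E'; ring.
- exists one_cycle.
  assert (H1 : b1 one_cycle = c3 one_cycle) by reflexivity.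
  split; [now apply melnikov_1_vanishes |]; split.
  + rewrite melnikov_2_vanishes by assumption; unfold dd; simpl; lra.
  + assert (P0 := I0_pos); assert (P2 := I2_pos).
    assert (Hq : 0 < I0 / I2) by now apply Rdiv_lt_0_compat.
    assert (Hh : 0 < sqrt (I0 / I2)) by now apply sqrt_lt_R0.
    exists (sqrt (I0 / I2)); split; [assumption |].
    rewrite melnikov_2, pow2_sqrt by (assumption || lra).
    unfold dd; simpl; field; lra.
- intros k H1 H2 H3 h h' Hh Hh' E E'; apply melnikov_1_vanishes in H1.
  apply melnikov_2_vanishes in H2; [| assumption]; destruct H2 as [H20 H22].
  rewrite melnikov_3 in E, E' by assumption.
  assert (F := factor_pos h Hh); assert (F' := factor_pos h' Hh').
  apply (even_quadratic_root (dd k * (c3 k * b0 k)) (dd k * (c3 k * (b2 k + c5 k)))); auto.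
  + intros H; now apply H3, melnikov_3_vanishes.
  + apply (Rmult_eq_reg_l (- (sqrt 2 / (2 * h ^ 2)))); [| lra].
    rewrite Rmult_0_r, <- E; unfold Rdiv; ring.
  + apply (Rmult_eq_reg_l (- (sqrt 2 / (2 * h' ^ 2)))); [| lra].
    rewrite Rmult_0_r, <- E'; unfold Rdiv; ring.
(* With b1 = c3 = 1, c5 = 1 and b0 = -1 one has [dd] = 1 and c0 = c2 = 0, and the third Melnikov
   function is a positive multiple of I0 - h^2 I2. *)
- set (k := Coeffs 0 0 0 1 0 1 (-1) 1 0 0); exists k.
  assert (H1 : b1 k = c3 k) by reflexivity.
  assert (H0 : dd k * c0 k = 0) by (unfold dd; simpl; ring).
  assert (H2 : dd k * c2 k = 0) by (unfold dd; simpl; ring).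
  split; [now apply melnikov_1_vanishes |].
  split; [now apply melnikov_2_vanishes |]; split.
  + rewrite melnikov_3_vanishes by assumption; unfold dd; simpl; lra.
  + assert (P0 := I0_pos); assert (P2 := I2_pos).
    assert (Hq : 0 < I0 / I2) by now apply Rdiv_lt_0_compat.
    assert (Hh : 0 < sqrt (I0 / I2)) by now apply sqrt_lt_R0.
    exists (sqrt (I0 / I2)); split; [assumption |].
    rewrite melnikov_3, pow2_sqrt by (assumption || lra).
    unfold dd; simpl; field; lra.
- intros k H1 H2 H3 i Hi.
  destruct (Hcenter k H1 H2 H3) as (C1 & C2 & C3 & C4 & C5).
  apply melnikov_center; auto; lia.
- intros k H1 H2 H3 W HW; now apply center_period_annulus; [apply Hcenter |].
- intros V.
  assert (HV : set_eq V center) by exact melnikov_123_vanish.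
  destruct comp_not_subset as (N12 & N13 & N21 & N23 & N31 & N32).
  split; [| split; [| split; [| split]]].
  + apply (algebraic_set_ext _ center); [| exact algebraic_center].
    intros k; now rewrite (HV k).
  + intros Z; now apply irreducible_components.
  + intros E; apply N12; intros k; apply E.
  + intros E; apply N13; intros k; apply E.
  + intros E; apply N23; intros k; apply E.
- intros k Hk e; now apply comp1_exact.
- exact comp23_pulled_back.
Qed.
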